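(* Let $\nu\in\mathbb{C}\setminus\mathbb{Z}$ with $\Re(\nu)\ge0$, let $\chi$ be a non-principal even primitive Dirichlet character modulo $q$, and let $N$ be an integer with $N\ge\lfloor\frac{\Re(\nu)+1}{2}\rfloor$. Then for every $x>0$ with $qx\notin\mathbb{Z}_{>0}$, \begin{align*} &8\pi x^{\nu/2} \sum_{n=1}^{\infty} \sigma_{-\nu, \bar{\chi}}(n) n^{\nu/2}K_{\nu}(4\pi\sqrt{nx}) =-\frac{ \Gamma(\nu) L(\nu, \bar{\chi})}{(2\pi)^{\nu-1} } + \frac{2\Gamma(1+\nu) L(1+\nu, \bar{\chi})}{(2\pi)^{\nu+1} }x^{ -1} \\ & \quad + \frac{2q^{1-\nu} }{\tau(\chi) \sin \left(\frac{\pi \nu}{2}\right)} \left\{\sum_{j=1}^{N} \zeta(2j)\, L(2j-\nu, \chi)(qx)^{2j-1} + (qx)^{2N+1}\sum_{n=1}^{\infty}\bar{\sigma}_{-\nu, \chi}(n) \left(\frac{ n^{\nu-2N}-(qx)^{\nu-2N} }{ n^2-(qx)^2} \right) \right\}. \end{align*}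
   Context: For a Dirichlet character $\chi$ and $z\in\mathbb{C}$: $\sigma_{z,\chi}(n)=\sum_{d\mid n}d^z\chi(d)$ and $\bar{\sigma}_{z,\chi}(n)=\sum_{d\mid n}d^z\chi(n/d)$. $\tau(\chi)=\sum_{h=1}^q\chi(h)e^{2\pi i h/q}$ is the Gauss sum, $L(s,\chi)$ the Dirichlet $L$-function, $\zeta$ the Riemann zeta function, and $K_\nu$ the modified Bessel function of the second kind. *)

(* Defs.v *)
From Stdlib Require Import Reals ZArith Arith List.
From Coquelicot Require Import Coquelicot.
Import ListNotations.

Local Open Scope R_scope.

Definition Cexp (z : C) : C :=
  (exp (Re z) * cos (Im z), exp (Re z) * sin (Im z)).

Definition cpow (a : R) (z : C) : C := Cexp (z * RtoC (ln a))%C.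

Definition Ci : C := (0, 1).

Definition Csin (z : C) : C :=
  ((Cexp (Ci * z) - Cexp (- (Ci * z))) / (2 * Ci))%C.

Definition Ccosh (z : C) : C := ((Cexp z + Cexp (- z)) / 2)%C.

Definition GammaInt (s : C) : C :=
  RInt_gen (V := C_R_CompleteNormedModule)
    (fun t => (cpow t (s - 1) * RtoC (exp (- t)))%C)
    (at_right 0) (Rbar_locally p_infty).

(* Complex Gamma function on Re s > -1, s <> 0, via Gamma(s) = Gamma(s+1)/s
   (only used at nu and 1+nu with Re nu >= 0, nu not an integer). *)
Definition CGamma (s : C) : C := (GammaInt (s + 1) / s)%C.

Definition BesselK (nu : C) (y : R) : C :=
  RInt_gen (V := C_R_CompleteNormedModule)
    (fun t => (RtoC (exp (- y * cosh t)) * Ccosh (nu * RtoC t))%C)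
    (at_point 0) (Rbar_locally p_infty).

Definition zetaR (s : R) : R := Series (fun n => / Rpower (INR (S n)) s).

Definition Csum (l : list nat) (f : nat -> C) : C :=
  fold_right (fun n acc => (f n + acc)%C) (RtoC 0) l.

Definition divsum (n : nat) (f : nat -> C) : C :=
  Csum (seq 1 n) (fun d => if Nat.eqb (n mod d) 0 then f d else RtoC 0).

Definition sigma_chi (z : C) (chi : nat -> C) (n : nat) : C :=
  divsum n (fun d => (cpow (INR d) z * chi d)%C).

Definition sigmabar_chi (z : C) (chi : nat -> C) (n : nat) : C :=
  divsum n (fun d => (cpow (INR d) z * chi (n / d)%nat)%C).

Definition is_dirichlet_char (q : nat) (chi : nat -> C) : Prop :=
  (1 <= q)%nat /\
  (forall m n, chi (m * n)%nat = (chi m * chi n)%C) /\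
  (forall n, chi (n + q)%nat = chi n) /\
  (forall n, chi n <> RtoC 0 <-> Nat.gcd n q = 1%nat).

Definition is_principal (q : nat) (chi : nat -> C) : Prop :=
  forall n, Nat.gcd n q = 1%nat -> chi n = RtoC 1.

(* chi is primitive: not induced by a character of any modulus d | q, d < q,
   i.e. for no such d is chi(n) = 1 for all n coprime to q with n = 1 mod d. *)
Definition is_primitive (q : nat) (chi : nat -> C) : Prop :=
  forall d, Nat.divide d q -> (d < q)%nat ->
    ~ (forall n, Nat.gcd n q = 1%nat -> n mod d = 1 mod d -> chi n = RtoC 1).

(* even: chi(-1) = 1, with -1 represented by q - 1 *)
Definition is_even_char (q : nat) (chi : nat -> C) : Prop :=
  chi (q - 1)%nat = RtoC 1.

Definition conj_char (chi : nat -> C) : nat -> C := fun n => Cconj (chi n).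

Definition gauss_sum (q : nat) (chi : nat -> C) : C :=
  Csum (seq 1 q) (fun h => (chi h * Cexp (Ci * RtoC (2 * PI * INR h / INR q)))%C).

(* L is (the analytic continuation of) L(s, chi): an entire function agreeing
   with the Dirichlet series sum_{n>=1} chi(n) n^{-s} on Re s > 1. *)
Definition is_L_function (chi : nat -> C) (L : C -> C) : Prop :=
  (forall s, ex_derive (K := C_AbsRing) (V := C_NormedModule) L s) /\
  (forall s, 1 < Re s ->
     is_series (K := C_AbsRing) (V := C_NormedModule)
       (fun n => (chi (S n) * cpow (INR (S n)) (- s))%C) (L s)).

(* Main.v *)
Require Import Defs.
From Stdlib Require Import Reals ZArith Arith List Lra Lia ClassicalEpsilon Permutation.
From Coquelicot Require Import Coquelicot.
Import ListNotations.

Local Open Scope R_scope.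

(** The integral representation of [K_nu] turns the left-hand side into
    [4 pi * int_0^oo F(u) u^(nu-1) / (exp(2 pi x / u) - 1) du] with
    [F(u) = sum_d conj(chi d) exp(-2 pi d u)].  Expanding [1 / (exp(2 pi y) - 1)] in partial
    fractions at [y = x / u], the terms [1 / (2 pi y)] and [-1/2] give Mellin transforms of [F],
    that is the two Gamma-L terms, and leave a sum over [m] of integrals of
    [F(u) u^nu / (u^2 + (x/m)^2)].  Since [chi] is even and primitive, Gauss sums give
    [F(u) = (tau(conj chi) / pi) * sum_k chi(k) q u / (k^2 + q^2 u^2)].  Expanding
    [1 / (u^2 + (x/m)^2)] to order [N] yields Mellin transforms of [F] again, which are the terms
    [zeta(2j) L(2j - nu, chi)], and the product of two Lorentzians in the remainder integrates to
    the quotients in the last series, with [n = k m].  This works for one value of [N]; passing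
    from [N] to [N + 1] is telescoping.  The values of [L] outside [Re s > 1] are identified by
    unique continuation, which rests on Goursat's theorem and a maximum principle. *)

(** * Complex exponentials and powers *)

(** The substitution u = e^t turns every Mellin integral into an integral over the whole line of a
    function bounded by K exp(-c|t|). With a common rate c, exchanging a sum and an integral only
    asks that the constants K be summable. The Lorentzian expansion gives F(u) = O(u) at 0, so the
    Mellin transform of F is holomorphic for Re s > -1. There it is computed in two ways: from the
    exponential series for Re s > 1 and from the Lorentzian series for -1 < Re s < 0. Continuing
    both identities to the half-plane expresses it through the two given entire functions, so the
    functional equation is derived rather than assumed. The order reached by integrals is the N with
    2N - 1 <= Re nu < 2N + 1. Then n = nu - 2N lies in the strip -1 <= Re n < 1, where the remainder
    can be both integrated and summed, and all Mellin transforms of the expansion stay in Re s > -1.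
    The identities are kept multiplied by sin(pi nu / 2), which is divided out only at the end,
    where nu is known not to be an integer. *)

Lemma exp_ge_0 (a : R) : 0 <= exp a.
Proof. apply Rlt_le, exp_pos. Qed.

Lemma Rpower_pos (a p : R) : 0 < Rpower a p.
Proof. apply exp_pos. Qed.

Lemma exp_mono (a b : R) : a <= b -> exp a <= exp b.
Proof. intros [h | ->]; [left; now apply exp_increasing | apply Rle_refl]. Qed.

Lemma C_ext (z w : C) : Re z = Re w -> Im z = Im w -> z = w.
Proof. destruct z, w; simpl; congruence. Qed.

Lemma Cexp_plus (z w : C) : Cexp (z + w) = (Cexp z * Cexp w)%C.
Proof.
  destruct z as [a b], w as [c d]. unfold Cexp.
  apply C_ext; cbn; rewrite exp_plus, ?cos_plus, ?sin_plus; ring.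
Qed.

Lemma Cexp_0 : Cexp 0 = RtoC 1.
Proof. unfold Cexp; simpl. rewrite exp_0, cos_0, sin_0. apply C_ext; simpl; ring. Qed.

Lemma Cexp_RtoC (r : R) : Cexp (RtoC r) = RtoC (exp r).
Proof. unfold Cexp; simpl. rewrite cos_0, sin_0. apply C_ext; simpl; ring. Qed.

Lemma Cmod_Cexp (z : C) : Cmod (Cexp z) = exp (Re z).
Proof.
  unfold Cmod, Cexp; cbn [fst snd].
  replace ((exp (Re z) * cos (Im z)) ^ 2 + (exp (Re z) * sin (Im z)) ^ 2)
    with (exp (Re z) ^ 2 * (Rsqr (sin (Im z)) + Rsqr (cos (Im z)))) by (unfold Rsqr; ring).
  rewrite sin2_cos2, Rmult_1_r. apply sqrt_pow2, Rlt_le, exp_pos.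
Qed.

Lemma Cexp_neq_0 (z : C) : Cexp z <> RtoC 0.
Proof. apply Cmod_gt_0. rewrite Cmod_Cexp. apply exp_pos. Qed.

Lemma Cexp_opp (z : C) : Cexp (- z) = (/ Cexp z)%C.
Proof.
  assert (h : (Cexp (- z) * Cexp z)%C = RtoC 1).
  { rewrite <- Cexp_plus. replace (- z + z)%C with (RtoC 0) by ring. apply Cexp_0. }
  replace (Cexp (- z)) with ((Cexp (- z) * Cexp z) * / Cexp z)%C.
  - rewrite h. ring.
  - field. apply Cexp_neq_0.
Qed.

Lemma RtoC_neq_0 (r : R) : r <> 0 -> RtoC r <> RtoC 0.
Proof. intros h e; apply h. now injection e. Qed.

Lemma C2_neq_0 : RtoC 2 <> RtoC 0.
Proof. apply RtoC_neq_0; lra. Qed.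

Lemma Cmod_RtoC_pos (r : R) : 0 <= r -> Cmod (RtoC r) = r.
Proof. intros h. rewrite Cmod_R. now apply Rabs_pos_eq. Qed.

Lemma Cmod_cpow (a : R) (z : C) : 0 < a -> Cmod (cpow a z) = Rpower a (Re z).
Proof.
  intros ha. unfold cpow. rewrite Cmod_Cexp. unfold Rpower. f_equal.
  destruct z; simpl; ring.
Qed.

Lemma cpow_neq_0 (a : R) (z : C) : cpow a z <> RtoC 0.
Proof. apply Cexp_neq_0. Qed.

Lemma cpow_plus (a : R) (z w : C) : cpow a (z + w) = (cpow a z * cpow a w)%C.
Proof. unfold cpow. rewrite <- Cexp_plus. f_equal. ring. Qed.

Lemma cpow_opp (a : R) (z : C) : cpow a (- z) = (/ cpow a z)%C.
Proof. unfold cpow. rewrite <- Cexp_opp. f_equal. ring. Qed.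

Lemma cpow_minus (a : R) (z w : C) : cpow a (z - w) = (cpow a z / cpow a w)%C.
Proof. unfold Cminus. now rewrite cpow_plus, cpow_opp. Qed.

Lemma cpow_mult_base (a b : R) (z : C) :
  0 < a -> 0 < b -> cpow (a * b) z = (cpow a z * cpow b z)%C.
Proof.
  intros ha hb. unfold cpow. rewrite <- Cexp_plus, ln_mult by assumption.
  rewrite RtoC_plus. f_equal. ring.
Qed.

Lemma cpow_inv_base (a : R) (z : C) : 0 < a -> cpow (/ a) z = (/ cpow a z)%C.
Proof.
  intros ha. rewrite <- cpow_opp. unfold cpow.
  rewrite ln_Rinv, RtoC_opp by assumption. f_equal. ring.
Qed.

Lemma cpow_exp (t : R) (z : C) : cpow (exp t) z = Cexp (z * RtoC t).
Proof. unfold cpow. now rewrite ln_exp. Qed.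

Lemma cpow_RtoC (a r : R) : cpow a (RtoC r) = RtoC (Rpower a r).
Proof. unfold cpow. now rewrite <- RtoC_mult, Cexp_RtoC. Qed.

Lemma cpow_INR (a : R) (n : nat) : 0 < a -> cpow a (RtoC (INR n)) = RtoC (a ^ n).
Proof. intros ha. now rewrite cpow_RtoC, Rpower_pow. Qed.

Lemma cpow_1 (a : R) : 0 < a -> cpow a 1 = RtoC a.
Proof. intros ha. now rewrite cpow_RtoC, Rpower_1. Qed.

Lemma cpow_Rinv_pow (a : R) (n : nat) : 0 < a -> cpow a (- RtoC (INR n)) = RtoC (/ a ^ n).
Proof.
  intros ha. rewrite cpow_opp, cpow_INR, RtoC_inv; auto.
  now apply pow_nonzero, Rgt_not_eq.
Qed.

(** * Continuity, differentiability and integration of complex-valued functions *)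

Definition ccont (f : R -> C) (t : R) : Prop :=
  @continuous R_UniformSpace C_UniformSpace f t.

Lemma ccont_pair (f : R -> C) (t : R) :
  continuous (fun u => Re (f u)) t -> continuous (fun u => Im (f u)) t -> ccont f t.
Proof.
  intros h1 h2. unfold ccont.
  apply (@continuous_ext R_UniformSpace C_UniformSpace
           (fun u => (Re (f u), Im (f u)))).
  - intros u; now destruct (f u).
  - intros P [eps hP]. unfold filtermap.
    apply (filter_imp (fun u => ball (Re (f t)) eps (Re (f u)) /\ ball (Im (f t)) eps (Im (f u)))).
    + intros u [h h']. apply hP. now split.
    + apply filter_and; [apply h1 | apply h2]; apply locally_ball.
Qed.

Lemma ccont_Re (f : R -> C) (t : R) : ccont f t -> continuous (fun u => Re (f u)) t.
Proof.
  intros h. apply (@continuous_comp R_UniformSpace C_UniformSpace R_UniformSpace f (fun z => fst z)).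
  - exact h.
  - apply continuous_fst.
Qed.

Lemma ccont_Im (f : R -> C) (t : R) : ccont f t -> continuous (fun u => Im (f u)) t.
Proof.
  intros h. apply (@continuous_comp R_UniformSpace C_UniformSpace R_UniformSpace f (fun z => snd z)).
  - exact h.
  - apply continuous_snd.
Qed.

Lemma ccont_const (c : C) (t : R) : ccont (fun _ => c) t.
Proof. apply continuous_const. Qed.

Lemma ccont_RtoC (f : R -> R) (t : R) : continuous f t -> ccont (fun u => RtoC (f u)) t.
Proof. intros h; apply ccont_pair; simpl; [exact h | apply continuous_const]. Qed.

Lemma continuous_ex_derive (f : R -> R) (t : R) : ex_derive f t -> continuous f t.
Proof. apply (ex_derive_continuous (K := R_AbsRing) (V := R_NormedModule)). Qed.

Lemma ccont_ex_derive (f : R -> R) (t : R) : ex_derive f t -> ccont (fun u => RtoC (f u)) t.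
Proof. intros h. now apply ccont_RtoC, continuous_ex_derive. Qed.

Lemma ccont_plus (f g : R -> C) (t : R) :
  ccont f t -> ccont g t -> ccont (fun u => f u + g u)%C t.
Proof.
  intros hf hg; apply ccont_pair; simpl.
  - apply (continuous_plus (fun u => Re (f u)) (fun u => Re (g u)));
      now apply ccont_Re.
  - apply (continuous_plus (fun u => Im (f u)) (fun u => Im (g u)));
      now apply ccont_Im.
Qed.

Lemma ccont_opp (f : R -> C) (t : R) : ccont f t -> ccont (fun u => - f u)%C t.
Proof.
  intros hf; apply ccont_pair; simpl.
  - apply (continuous_opp (fun u => Re (f u))); now apply ccont_Re.
  - apply (continuous_opp (fun u => Im (f u))); now apply ccont_Im.
Qed.

Lemma ccont_minus (f g : R -> C) (t : R) :
  ccont f t -> ccont g t -> ccont (fun u => f u - g u)%C t.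
Proof. intros hf hg. apply ccont_plus; [exact hf | now apply ccont_opp]. Qed.

Lemma ccont_mult (f g : R -> C) (t : R) :
  ccont f t -> ccont g t -> ccont (fun u => f u * g u)%C t.
Proof.
  intros hf hg.
  pose proof (ccont_Re _ _ hf); pose proof (ccont_Im _ _ hf).
  pose proof (ccont_Re _ _ hg); pose proof (ccont_Im _ _ hg).
  apply ccont_pair; simpl.
  - apply (continuous_minus (fun u => Re (f u) * Re (g u)) (fun u => Im (f u) * Im (g u)));
      now apply (continuous_mult (K := R_AbsRing)).
  - apply (continuous_plus (fun u => Re (f u) * Im (g u)) (fun u => Im (f u) * Re (g u)));
      now apply (continuous_mult (K := R_AbsRing)).
Qed.

Lemma ccont_Cexp (f : R -> C) (t : R) : ccont f t -> ccont (fun u => Cexp (f u)) t.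
Proof.
  intros hf.
  pose proof (ccont_Re _ _ hf); pose proof (ccont_Im _ _ hf).
  apply ccont_pair; simpl; apply (continuous_mult (K := R_AbsRing)).
  1, 3: apply continuous_exp_comp; assumption.
  - now apply continuous_cos_comp.
  - now apply continuous_sin_comp.
Qed.

Lemma Cmod_eq_norm (z : C) : norm (V := C_R_NormedModule) z = Cmod z.
Proof. symmetry. apply Cmod_norm. Qed.

Definition ccont_on (f : R -> C) (a b : R) : Prop :=
  forall t, Rmin a b <= t <= Rmax a b -> ccont f t.

Lemma ccont_on_swap (f : R -> C) (a b : R) : ccont_on f a b -> ccont_on f b a.
Proof. intros h t. rewrite Rmin_comm, Rmax_comm. apply h. Qed.

Lemma ccont_on_all (f : R -> C) (a b : R) : (forall t, ccont f t) -> ccont_on f a b.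
Proof. intros h t _; apply h. Qed.

Definition CInt (f : R -> C) (a b : R) : C := RInt (V := C_R_CompleteNormedModule) f a b.

Lemma ex_CInt (f : R -> C) (a b : R) :
  ccont_on f a b -> ex_RInt (V := C_R_NormedModule) f a b.
Proof. intros h. apply (ex_RInt_continuous (V := C_R_CompleteNormedModule)). exact h. Qed.

Lemma is_CInt (f : R -> C) (a b : R) :
  ccont_on f a b -> is_RInt (V := C_R_NormedModule) f a b (CInt f a b).
Proof. intros h. apply (RInt_correct (V := C_R_CompleteNormedModule)). now apply ex_CInt. Qed.

Lemma CInt_ext (f g : R -> C) (a b : R) :
  (forall t, Rmin a b <= t <= Rmax a b -> f t = g t) -> CInt f a b = CInt g a b.
Proof. intros h. apply (RInt_ext (V := C_R_CompleteNormedModule)). intros t ht. apply h. lra. Qed.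

Lemma Re_CInt (f : R -> C) (a b : R) :
  ccont_on f a b -> Re (CInt f a b) = RInt (fun t => Re (f t)) a b.
Proof.
  intros h. symmetry. apply is_RInt_unique.
  apply (is_RInt_fct_extend_fst (U := R_NormedModule) (V := R_NormedModule) f).
  now apply is_CInt.
Qed.

Lemma Im_CInt (f : R -> C) (a b : R) :
  ccont_on f a b -> Im (CInt f a b) = RInt (fun t => Im (f t)) a b.
Proof.
  intros h. symmetry. apply is_RInt_unique.
  apply (is_RInt_fct_extend_snd (U := R_NormedModule) (V := R_NormedModule) f).
  now apply is_CInt.
Qed.

Lemma CInt_plus (f g : R -> C) (a b : R) :
  ccont_on f a b -> ccont_on g a b ->
  CInt (fun t => f t + g t)%C a b = (CInt f a b + CInt g a b)%C.
Proof.
  intros hf hg. apply (RInt_plus (V := C_R_CompleteNormedModule)); now apply ex_CInt.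
Qed.

Lemma CInt_minus (f g : R -> C) (a b : R) :
  ccont_on f a b -> ccont_on g a b ->
  CInt (fun t => f t - g t)%C a b = (CInt f a b - CInt g a b)%C.
Proof.
  intros hf hg. apply (RInt_minus (V := C_R_CompleteNormedModule)); now apply ex_CInt.
Qed.

Lemma CInt_mult_l (c : C) (f : R -> C) (a b : R) :
  ccont_on f a b -> CInt (fun t => c * f t)%C a b = (c * CInt f a b)%C.
Proof.
  intros hf.
  assert (hcf : ccont_on (fun t => c * f t)%C a b).
  { intros t ht. apply ccont_mult; [apply ccont_const | now apply hf]. }
  assert (hre : ex_RInt (fun t => Re (f t)) a b).
  { apply (ex_RInt_continuous (V := R_CompleteNormedModule)). intros; now apply ccont_Re, hf. }
  assert (him : ex_RInt (fun t => Im (f t)) a b).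
  { apply (ex_RInt_continuous (V := R_CompleteNormedModule)). intros; now apply ccont_Im, hf. }
  assert (hs : forall k g, ex_RInt (V := R_NormedModule) g a b ->
             ex_RInt (V := R_NormedModule) (fun t => k * g t) a b).
  { intros k g hg. now apply (ex_RInt_scal (V := R_NormedModule)). }
  assert (hs' : forall k g, ex_RInt (V := R_NormedModule) g a b ->
             RInt (fun t => k * g t) a b = k * RInt g a b).
  { intros k g hg. now apply (RInt_scal (V := R_CompleteNormedModule)). }
  apply C_ext.
  - rewrite Re_CInt by assumption. simpl. fold (Re c) (Im c).
    rewrite (RInt_minus (V := R_CompleteNormedModule)
               (fun t => fst c * fst (f t)) (fun t => snd c * snd (f t))).
    + rewrite !hs' by assumption. rewrite <- Re_CInt, <- Im_CInt by assumption. reflexivity.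
    + now apply (hs (fst c) (fun t => fst (f t))).
    + now apply (hs (snd c) (fun t => snd (f t))).
  - rewrite Im_CInt by assumption. simpl. fold (Re c) (Im c).
    rewrite (RInt_plus (V := R_CompleteNormedModule)
               (fun t => fst c * snd (f t)) (fun t => snd c * fst (f t))).
    + rewrite !hs' by assumption. rewrite <- Re_CInt, <- Im_CInt by assumption. reflexivity.
    + now apply (hs (fst c) (fun t => snd (f t))).
    + now apply (hs (snd c) (fun t => fst (f t))).
Qed.

Lemma CInt_Chasles (f : R -> C) (a b c : R) :
  ccont_on f a b -> ccont_on f b c -> (CInt f a b + CInt f b c)%C = CInt f a c.
Proof.
  intros h1 h2. apply (RInt_Chasles (V := C_R_CompleteNormedModule)); now apply ex_CInt.
Qed.

Lemma CInt_swap (f : R -> C) (a b : R) : ccont_on f a b -> CInt f b a = (- CInt f a b)%C.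
Proof.
  intros h. symmetry. apply (opp_RInt_swap (V := C_R_CompleteNormedModule)). now apply ex_CInt.
Qed.

Lemma CInt_point (f : R -> C) (a : R) : CInt f a a = RtoC 0.
Proof. apply (RInt_point (V := C_R_CompleteNormedModule)). Qed.

Lemma Cmod_CInt_le (f : R -> C) (g : R -> R) (a b lg : R) :
  a <= b -> ccont_on f a b -> (forall t, a <= t <= b -> Cmod (f t) <= g t) ->
  is_RInt g a b lg -> Cmod (CInt f a b) <= lg.
Proof.
  intros hab hf hg hl. rewrite <- Cmod_eq_norm.
  eapply (norm_RInt_le (V := C_R_NormedModule) f g); eauto.
  - intros t ht. rewrite Cmod_eq_norm. now apply hg.
  - now apply is_CInt.
Qed.

Lemma Cmod_CInt_le_const (f : R -> C) (B a b : R) :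
  ccont_on f a b -> (forall t, Rmin a b <= t <= Rmax a b -> Cmod (f t) <= B) ->
  Cmod (CInt f a b) <= B * Rabs (b - a).
Proof.
  assert (main : forall a b, a <= b -> ccont_on f a b ->
     (forall t, Rmin a b <= t <= Rmax a b -> Cmod (f t) <= B) ->
     Cmod (CInt f a b) <= B * Rabs (b - a)).
  { clear a b. intros a b hab hf hB. rewrite Rabs_pos_eq by lra.
    apply (Cmod_CInt_le f (fun _ => B) a b); auto.
    - intros t ht. apply hB. rewrite Rmin_left, Rmax_right; auto.
    - rewrite Rmult_comm. apply (is_RInt_const (V := R_NormedModule)). }
  intros hf hB. destruct (Rle_dec a b) as [h|h].
  - now apply main.
  - rewrite CInt_swap by now apply ccont_on_swap.
    rewrite Cmod_opp, Rabs_minus_sym. apply main; try lra.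
    + now apply ccont_on_swap.
    + intros t ht. apply hB. now rewrite Rmin_comm, Rmax_comm.
Qed.

Lemma CInt_shift (f : R -> C) (a b v : R) :
  ccont_on f (a + v) (b + v) -> CInt (fun t => f (t + v)) a b = CInt f (a + v) (b + v).
Proof.
  intros hf. pose proof (RInt_comp_lin (V := C_R_CompleteNormedModule) f 1 v a b) as h.
  rewrite !Rmult_1_l in h. specialize (h (ex_CInt _ _ _ hf)).
  unfold CInt. rewrite <- h. apply (RInt_ext (V := C_R_CompleteNormedModule)). intros t _.
  rewrite Rmult_1_l. symmetry. apply (scal_one (V := C_R_ModuleSpace)).
Qed.

Lemma CInt_reflect (f : R -> C) (a b : R) :
  ccont_on f (- a) (- b) -> CInt (fun t => f (- t)) a b = (- CInt f (- a) (- b))%C.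
Proof.
  intros hf. pose proof (RInt_comp_lin (V := C_R_CompleteNormedModule) f (-1) 0 a b) as h.
  replace (-1 * a + 0) with (- a) in h by ring.
  replace (-1 * b + 0) with (- b) in h by ring.
  specialize (h (ex_CInt _ _ _ hf)).
  unfold CInt. rewrite <- h.
  assert (hg : ccont_on (fun t => f (-1 * t + 0)) a b).
  { intros t ht. apply (@continuous_comp R_UniformSpace R_UniformSpace C_UniformSpace (fun t => -1 * t + 0) f).
    - apply continuous_ex_derive. now auto_derive.
    - apply hf. revert ht. unfold Rmin, Rmax. repeat destruct Rle_dec; lra. }
  rewrite (RInt_scal (V := C_R_CompleteNormedModule)) by now apply ex_CInt.
  replace (RInt (V := C_R_CompleteNormedModule) (fun t => f (- t)) a b)
    with (CInt (fun t => f (-1 * t + 0)) a b).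
  - apply C_ext; simpl; unfold scal; simpl; unfold mult; simpl; unfold CInt; ring.
  - apply CInt_ext. intros t _. f_equal. ring.
Qed.

(** Stated on components, so that the real fundamental theorem of calculus applies to each. *)
Definition rder (f : R -> C) (t : R) (l : C) : Prop :=
  is_derive (fun u => Re (f u)) t (Re l) /\ is_derive (fun u => Im (f u)) t (Im l).

Lemma rder_ccont (f : R -> C) (t : R) (l : C) : rder f t l -> ccont f t.
Proof.
  intros [h1 h2]. apply ccont_pair; apply (ex_derive_continuous (K := R_AbsRing) (V := R_NormedModule));
    eexists; eassumption.
Qed.

Lemma CInt_rder (F f : R -> C) (a b : R) :
  (forall t, Rmin a b <= t <= Rmax a b -> rder F t (f t)) -> ccont_on f a b ->
  CInt f a b = (F b - F a)%C.
Proof.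
  intros hF hf. apply C_ext.
  - rewrite Re_CInt by assumption. apply is_RInt_unique.
    apply (is_RInt_derive (V := R_CompleteNormedModule) (fun t => Re (F t))).
    + intros t ht. now apply hF.
    + intros t ht. now apply ccont_Re, hf.
  - rewrite Im_CInt by assumption. apply is_RInt_unique.
    apply (is_RInt_derive (V := R_CompleteNormedModule) (fun t => Im (F t))).
    + intros t ht. now apply hF.
    + intros t ht. now apply ccont_Im, hf.
Qed.

Lemma rder_const (c : C) (t : R) : rder (fun _ => c) t 0.
Proof. split; apply (is_derive_const (V := R_NormedModule)). Qed.

Lemma rder_RtoC (f : R -> R) (t l : R) : is_derive f t l -> rder (fun u => RtoC (f u)) t (RtoC l).
Proof. intros h. split; [exact h | simpl; apply (is_derive_const (V := R_NormedModule) 0)]. Qed.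

Lemma rder_eq (f : R -> C) (t : R) (l l' : C) : l = l' -> rder f t l -> rder f t l'.
Proof. now intros <-. Qed.

Lemma rder_plus (f g : R -> C) (t : R) (l m : C) :
  rder f t l -> rder g t m -> rder (fun u => f u + g u)%C t (l + m).
Proof.
  intros [h1 h2] [h3 h4]; split.
  - now apply (is_derive_plus (V := R_NormedModule) (fun u => Re (f u)) (fun u => Re (g u))).
  - now apply (is_derive_plus (V := R_NormedModule) (fun u => Im (f u)) (fun u => Im (g u))).
Qed.

Lemma rder_opp (f : R -> C) (t : R) (l : C) : rder f t l -> rder (fun u => - f u)%C t (- l).
Proof.
  intros [h1 h2]; split.
  - now apply (is_derive_opp (V := R_NormedModule) (fun u => Re (f u))).
  - now apply (is_derive_opp (V := R_NormedModule) (fun u => Im (f u))).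
Qed.

Lemma rder_minus (f g : R -> C) (t : R) (l m : C) :
  rder f t l -> rder g t m -> rder (fun u => f u - g u)%C t (l - m).
Proof. intros hf hg. apply rder_plus; [exact hf | now apply rder_opp]. Qed.

Lemma rder_mult (f g : R -> C) (t : R) (l m : C) :
  rder f t l -> rder g t m -> rder (fun u => f u * g u)%C t (l * g t + f t * m).
Proof.
  intros [h1 h2] [h3 h4]; split.
  - replace (Re (l * g t + f t * m)) with
      (minus (Re l * Re (g t) + Re (f t) * Re m) (Im l * Im (g t) + Im (f t) * Im m))
      by (unfold minus, plus, opp; simpl; unfold Re, Im; ring).
    apply (is_derive_minus (V := R_NormedModule) (fun u => Re (f u) * Re (g u)) (fun u => Im (f u) * Im (g u)));
      apply (is_derive_mult (K := R_AbsRing)); auto; intros; apply Rmult_comm.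
  - replace (Im (l * g t + f t * m)) with
      (plus (Re l * Im (g t) + Re (f t) * Im m) (Im l * Re (g t) + Im (f t) * Re m))
      by (unfold plus; simpl; unfold Re, Im; ring).
    apply (is_derive_plus (V := R_NormedModule) (fun u => Re (f u) * Im (g u)) (fun u => Im (f u) * Re (g u)));
      apply (is_derive_mult (K := R_AbsRing)); auto; intros; apply Rmult_comm.
Qed.

Lemma rder_Cexp (f : R -> C) (t : R) (l : C) :
  rder f t l -> rder (fun u => Cexp (f u)) t (l * Cexp (f t)).
Proof.
  intros [h1 h2].
  assert (he : is_derive (fun u => exp (Re (f u))) t (Re l * exp (Re (f t)))).
  { apply (is_derive_comp exp (fun u => Re (f u))); [apply is_derive_exp | exact h1]. }
  split; simpl.
  - replace (fst l * (exp (Re (f t)) * cos (Im (f t))) - snd l * (exp (Re (f t)) * sin (Im (f t))))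
      with (Re l * exp (Re (f t)) * cos (Im (f t)) + exp (Re (f t)) * (Im l * - sin (Im (f t))))
      by (unfold Re, Im; ring).
    apply (is_derive_mult (K := R_AbsRing) (fun u => exp (Re (f u))) (fun u => cos (Im (f u))));
      [exact he | | intros; apply Rmult_comm].
    apply (is_derive_comp cos (fun u => Im (f u))); [apply is_derive_cos | exact h2].
  - replace (fst l * (exp (Re (f t)) * sin (Im (f t))) + snd l * (exp (Re (f t)) * cos (Im (f t))))
      with (Re l * exp (Re (f t)) * sin (Im (f t)) + exp (Re (f t)) * (Im l * cos (Im (f t))))
      by (unfold Re, Im; ring).
    apply (is_derive_mult (K := R_AbsRing) (fun u => exp (Re (f u))) (fun u => sin (Im (f u))));
      [exact he | | intros; apply Rmult_comm].
    apply (is_derive_comp sin (fun u => Im (f u))); [apply is_derive_sin | exact h2].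
Qed.

Lemma rder_id (t : R) : rder (fun u => RtoC u) t 1.
Proof. apply rder_RtoC, (is_derive_id (K := R_AbsRing)). Qed.

Lemma rder_linear (c : C) (t : R) : rder (fun u => c * RtoC u)%C t c.
Proof.
  eapply rder_eq; [| apply rder_mult; [apply rder_const | apply rder_id]].
  cbv beta. ring.
Qed.

(** Mean value inequality on the unit interval. A Taylor remainder of [Cexp] along the segment from
    0 to z has derivative z times the preceding remainder, so the bounds [Cmod_Cexp_minus_1] to
    [Cmod_Cexp_minus_3] follow one from another. *)
Lemma Cmod_increment_le (f df : R -> C) (B : R) :
  (forall t, 0 <= t <= 1 -> rder f t (df t)) -> (forall t, 0 <= t <= 1 -> ccont df t) ->
  (forall t, 0 <= t <= 1 -> Cmod (df t) <= B) -> Cmod (f 1 - f 0)%C <= B.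
Proof.
  intros h1 h2 h3.
  assert (hmin : Rmin 0 1 = 0) by (apply Rmin_left; lra).
  assert (hmax : Rmax 0 1 = 1) by (apply Rmax_right; lra).
  rewrite <- (CInt_rder f df 0 1).
  - replace B with (B * Rabs (1 - 0)) by (rewrite Rabs_pos_eq; lra).
    apply Cmod_CInt_le_const; unfold ccont_on; rewrite hmin, hmax; auto.
  - now rewrite hmin, hmax.
  - unfold ccont_on. now rewrite hmin, hmax.
Qed.

Lemma Cmod_Cexp_le (z : C) (t : R) : 0 <= t <= 1 -> Cmod (Cexp (z * RtoC t)) <= exp (Cmod z).
Proof.
  intros ht. rewrite Cmod_Cexp. apply exp_mono. simpl.
  replace (fst z * t - snd z * 0) with (Re z * t) by (unfold Re; ring).
  pose proof (re_le_Cmod z) as h. apply Rabs_le_between in h.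
  pose proof (Cmod_ge_0 z). nra.
Qed.

Lemma Cmod_Cexp_minus_1 (z : C) : Cmod (Cexp z - 1)%C <= Cmod z * exp (Cmod z).
Proof.
  replace (Cexp z - 1)%C with (Cexp (z * RtoC 1) - Cexp (z * RtoC 0))%C
    by (rewrite Cmult_1_r, Cmult_0_r, Cexp_0; reflexivity).
  apply (Cmod_increment_le (fun t => Cexp (z * RtoC t)) (fun t => z * Cexp (z * RtoC t))%C).
  - intros t _. apply rder_Cexp, rder_linear.
  - intros t _. apply ccont_mult; [apply ccont_const |].
    eapply rder_ccont, rder_Cexp, rder_linear.
  - intros t ht. rewrite Cmod_mult. apply Rmult_le_compat_l; [apply Cmod_ge_0 | now apply Cmod_Cexp_le].
Qed.

Lemma Cmod_scal_01 (z : C) (t : R) : 0 <= t <= 1 -> Cmod (z * RtoC t)%C <= Cmod z.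
Proof.
  intros ht. rewrite Cmod_mult, Cmod_RtoC_pos by lra. pose proof (Cmod_ge_0 z). nra.
Qed.

Lemma Cmod_Cexp_minus_2 (z : C) : Cmod (Cexp z - 1 - z)%C <= Cmod z ^ 2 * exp (Cmod z).
Proof.
  replace (Cexp z - 1 - z)%C
    with ((Cexp (z * RtoC 1) - z * RtoC 1) - (Cexp (z * RtoC 0) - z * RtoC 0))%C
    by (rewrite !Cmult_1_r, !Cmult_0_r, Cexp_0; ring).
  apply (Cmod_increment_le (fun t => Cexp (z * RtoC t) - z * RtoC t)%C
           (fun t => z * (Cexp (z * RtoC t) - 1))%C).
  - intros t _. eapply rder_eq; [| apply rder_minus; [apply rder_Cexp, rder_linear | apply rder_linear]].
    cbv beta. ring.
  - intros t _. apply ccont_mult; [apply ccont_const |].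
    apply ccont_minus; [| apply ccont_const]. eapply rder_ccont, rder_Cexp, rder_linear.
  - intros t ht. rewrite Cmod_mult. pose proof (Cmod_ge_0 z).
    replace (Cmod z ^ 2 * exp (Cmod z)) with (Cmod z * (Cmod z * exp (Cmod z))) by ring.
    apply Rmult_le_compat_l; auto.
    eapply Rle_trans; [apply Cmod_Cexp_minus_1 |].
    pose proof (Cmod_scal_01 z t ht). pose proof (Cmod_ge_0 (z * RtoC t)).
    apply Rmult_le_compat; auto using Rlt_le, exp_pos, exp_mono.
Qed.

Lemma Cmod_Cexp_minus_3 (z : C) :
  Cmod (Cexp z - 1 - z - z * z / 2)%C <= Cmod z ^ 3 * exp (Cmod z).
Proof.
  replace (Cexp z - 1 - z - z * z / 2)%C
    with ((Cexp (z * RtoC 1) - z * RtoC 1 - z * RtoC 1 * (z * RtoC 1) / 2)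
          - (Cexp (z * RtoC 0) - z * RtoC 0 - z * RtoC 0 * (z * RtoC 0) / 2))%C
    by (rewrite !Cmult_1_r, !Cmult_0_r, Cexp_0; field; exact C2_neq_0).
  apply (Cmod_increment_le (fun t => Cexp (z * RtoC t) - z * RtoC t - z * RtoC t * (z * RtoC t) / 2)%C
           (fun t => z * (Cexp (z * RtoC t) - 1 - z * RtoC t))%C).
  - intros t _. eapply rder_eq;
      [| apply rder_minus; [apply rder_minus; [apply rder_Cexp, rder_linear | apply rder_linear]
                           | apply rder_mult; [apply rder_mult; apply rder_linear | apply rder_const]]].
    cbv beta. field.
  - intros t _. apply ccont_mult; [apply ccont_const |].
    apply ccont_minus; [apply ccont_minus; [| apply ccont_const] |].
    + eapply rder_ccont, rder_Cexp, rder_linear.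
    + eapply rder_ccont, rder_linear.
  - intros t ht. rewrite Cmod_mult. pose proof (Cmod_ge_0 z).
    replace (Cmod z ^ 3 * exp (Cmod z)) with (Cmod z * (Cmod z ^ 2 * exp (Cmod z))) by ring.
    apply Rmult_le_compat_l; auto.
    eapply Rle_trans; [apply Cmod_Cexp_minus_2 |].
    pose proof (Cmod_scal_01 z t ht). pose proof (Cmod_ge_0 (z * RtoC t)).
    apply Rmult_le_compat; auto using Rlt_le, exp_pos, exp_mono, pow_le.
    now apply pow_incr.
Qed.

(** * Complex differentiability *)

(** Little-o form without a quotient: the point w = z needs no exception, and sums and compositions
    reduce to triangle inequalities. *)
Definition cder (f : C -> C) (z l : C) : Prop :=
  forall eps, 0 < eps -> exists delta, 0 < delta /\
    forall w, Cmod (w - z) < delta ->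
      Cmod (f w - f z - l * (w - z)) <= eps * Cmod (w - z).

Lemma ex_derive_cder (f : C -> C) (z : C) :
  ex_derive (K := C_AbsRing) (V := C_NormedModule) f z -> exists l, cder f z l.
Proof.
  intros [l [_ h]]. exists l. intros eps heps.
  specialize (h z (fun P hP => hP) (mkposreal eps heps)).
  destruct h as [delta h]. exists delta; split; [apply cond_pos |].
  intros w hw.
  assert (hb : ball (M := AbsRing_UniformSpace C_AbsRing) z delta w) by exact hw.
  specialize (h w hb). simpl in h.
  replace (f w - f z - l * (w - z))%C with ((f w - f z) - (w - z) * l)%C by ring.
  exact h.
Qed.

Lemma cder_ext (f g : C -> C) (z l : C) (r : R) :
  0 < r -> (forall w, Cmod (w - z) < r -> f w = g w) -> cder f z l -> cder g z l.
Proof.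
  intros hr he h eps heps. destruct (h eps heps) as (delta & hd & H).
  exists (Rmin delta r). split; [now apply Rmin_glb_lt |].
  intros w hw. rewrite <- !he.
  - apply H. eapply Rlt_le_trans; [exact hw | apply Rmin_l].
  - replace (z - z)%C with (RtoC 0) by ring. now rewrite Cmod_0.
  - eapply Rlt_le_trans; [exact hw | apply Rmin_r].
Qed.

Lemma cder_eq (f : C -> C) (z l l' : C) : l = l' -> cder f z l -> cder f z l'.
Proof. now intros <-. Qed.

Lemma cder_const (c z : C) : cder (fun _ => c) z 0.
Proof.
  intros eps heps. exists 1; split; [lra |]. intros w _.
  replace (c - c - 0 * (w - z))%C with (RtoC 0) by ring. rewrite Cmod_0.
  pose proof (Cmod_ge_0 (w - z)). nra.
Qed.

Lemma cder_id (z : C) : cder (fun w => w) z 1.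
Proof.
  intros eps heps. exists 1; split; [lra |]. intros w _.
  replace (w - z - 1 * (w - z))%C with (RtoC 0) by ring. rewrite Cmod_0.
  pose proof (Cmod_ge_0 (w - z)). nra.
Qed.

Lemma cder_plus (f g : C -> C) (z l m : C) :
  cder f z l -> cder g z m -> cder (fun w => f w + g w)%C z (l + m).
Proof.
  intros hf hg eps heps.
  destruct (hf (eps / 2)) as (d1 & hd1 & H1); [lra |].
  destruct (hg (eps / 2)) as (d2 & hd2 & H2); [lra |].
  exists (Rmin d1 d2). split; [now apply Rmin_glb_lt |]. intros w hw.
  specialize (H1 w (Rlt_le_trans _ _ _ hw (Rmin_l _ _))).
  specialize (H2 w (Rlt_le_trans _ _ _ hw (Rmin_r _ _))).
  replace (f w + g w - (f z + g z) - (l + m) * (w - z))%C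
    with ((f w - f z - l * (w - z)) + (g w - g z - m * (w - z)))%C by ring.
  eapply Rle_trans; [apply Cmod_triangle |]. lra.
Qed.

Lemma cder_bound (f : C -> C) (z l : C) :
  cder f z l -> exists delta, 0 < delta /\
    forall w, Cmod (w - z) < delta -> Cmod (f w - f z) <= (Cmod l + 1) * Cmod (w - z).
Proof.
  intros h. destruct (h 1 Rlt_0_1) as (d & hd & H). exists d; split; auto.
  intros w hw. specialize (H w hw).
  replace (f w - f z)%C with ((f w - f z - l * (w - z)) + l * (w - z))%C by ring.
  eapply Rle_trans; [apply Cmod_triangle |]. rewrite Cmod_mult. lra.
Qed.

Lemma cder_continuous (f : C -> C) (z l : C) :
  cder f z l -> forall eps, 0 < eps -> exists delta, 0 < delta /\
    forall w, Cmod (w - z) < delta -> Cmod (f w - f z) < eps.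
Proof.
  intros h eps heps. destruct (cder_bound _ _ _ h) as (d & hd & H).
  pose proof (Cmod_ge_0 l) as hl.
  exists (Rmin d (eps / (Cmod l + 1))). split.
  - apply Rmin_glb_lt; auto. apply Rdiv_lt_0_compat; lra.
  - intros w hw. eapply Rle_lt_trans.
    + apply H. eapply Rlt_le_trans; [exact hw | apply Rmin_l].
    + apply (Rlt_le_trans _ ((Cmod l + 1) * (eps / (Cmod l + 1)))); [| right; field; lra].
      apply Rmult_lt_compat_l; [lra |].
      eapply Rlt_le_trans; [exact hw | apply Rmin_r].
Qed.

Lemma cder_comp (f g : C -> C) (z l m : C) :
  cder g z m -> cder f (g z) l -> cder (fun w => f (g w)) z (l * m).
Proof.
  intros hg hf eps heps.
  pose proof (Cmod_ge_0 l) as hl. pose proof (Cmod_ge_0 m) as hm.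
  set (e1 := eps / (2 * (Cmod m + 1))). set (e2 := eps / (2 * (Cmod l + 1))).
  assert (he1 : 0 < e1) by (apply Rdiv_lt_0_compat; lra).
  assert (he2 : 0 < e2) by (apply Rdiv_lt_0_compat; lra).
  destruct (hf e1 he1) as (d1 & hd1 & H1).
  destruct (cder_continuous _ _ _ hg d1 hd1) as (d2 & hd2 & H2).
  destruct (cder_bound _ _ _ hg) as (d3 & hd3 & H3).
  destruct (hg e2 he2) as (d4 & hd4 & H4).
  exists (Rmin (Rmin d2 d3) d4). split; [repeat apply Rmin_glb_lt; auto |].
  intros w hw.
  assert (hw2 : Cmod (w - z) < d2).
  { eapply Rlt_le_trans; [exact hw |]. eapply Rle_trans; [apply Rmin_l | apply Rmin_l]. }
  assert (hw3 : Cmod (w - z) < d3).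
  { eapply Rlt_le_trans; [exact hw |]. eapply Rle_trans; [apply Rmin_l | apply Rmin_r]. }
  assert (hw4 : Cmod (w - z) < d4).
  { eapply Rlt_le_trans; [exact hw | apply Rmin_r]. }
  specialize (H1 (g w) (H2 w hw2)). specialize (H3 w hw3). specialize (H4 w hw4).
  replace (f (g w) - f (g z) - l * m * (w - z))%C
    with ((f (g w) - f (g z) - l * (g w - g z)) + l * (g w - g z - m * (w - z)))%C by ring.
  eapply Rle_trans; [apply Cmod_triangle |]. rewrite Cmod_mult.
  assert (h5 : e1 * Cmod (g w - g z) <= eps / 2 * Cmod (w - z)).
  { apply (Rle_trans _ (e1 * ((Cmod m + 1) * Cmod (w - z)))).
    - apply Rmult_le_compat_l; lra.
    - right. unfold e1. field. lra. }
  assert (h6 : Cmod l * Cmod (g w - g z - m * (w - z)) <= eps / 2 * Cmod (w - z)).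
  { apply (Rle_trans _ ((Cmod l + 1) * (e2 * Cmod (w - z)))).
    - apply Rmult_le_compat; try lra. apply Cmod_ge_0.
    - right. unfold e2. field. lra. }
  lra.
Qed.

Lemma cder_sqr (z : C) : cder (fun w => w * w)%C z (2 * z).
Proof.
  intros eps heps. exists eps; split; auto. intros w hw.
  replace (w * w - z * z - 2 * z * (w - z))%C with ((w - z) * (w - z))%C by ring.
  rewrite Cmod_mult. pose proof (Cmod_ge_0 (w - z)). nra.
Qed.

Lemma cder_scal (c : C) (f : C -> C) (z l : C) :
  cder f z l -> cder (fun w => c * f w)%C z (c * l).
Proof.
  intros h. apply (cder_comp (fun w => c * w)%C f z c l h).
  intros eps heps. exists 1; split; [lra |]. intros w _.
  replace (c * w - c * f z - c * (w - f z))%C with (RtoC 0) by ring. rewrite Cmod_0.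
  pose proof (Cmod_ge_0 (w - f z)). nra.
Qed.

Lemma cder_opp (f : C -> C) (z l : C) : cder f z l -> cder (fun w => - f w)%C z (- l).
Proof.
  intros h. apply (cder_eq _ _ (- (1) * l)%C); [ring |].
  apply (cder_ext (fun w => - (1) * f w)%C _ _ _ 1); [lra | intros; ring |].
  now apply cder_scal.
Qed.

Lemma cder_minus (f g : C -> C) (z l m : C) :
  cder f z l -> cder g z m -> cder (fun w => f w - g w)%C z (l - m).
Proof. intros hf hg. apply cder_plus; [exact hf | now apply cder_opp]. Qed.

(* Polarisation reduces products to squares. *)
Lemma cder_mult (f g : C -> C) (z l m : C) :
  cder f z l -> cder g z m -> cder (fun w => f w * g w)%C z (l * g z + f z * m).
Proof.
  intros hf hg.
  apply (cder_ext (fun w => / 4 * ((f w + g w) * (f w + g w) - (f w - g w) * (f w - g w)))%C _ _ _ 1);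
    [lra | intros; field; apply RtoC_neq_0; lra |].
  apply (cder_eq _ _ (/ 4 * (2 * (f z + g z) * (l + m) - 2 * (f z - g z) * (l - m)))%C);
    [field; apply RtoC_neq_0; lra |].
  apply cder_scal, cder_minus.
  - apply (cder_comp (fun w => w * w)%C (fun w => f w + g w)%C); [now apply cder_plus | apply cder_sqr].
  - apply (cder_comp (fun w => w * w)%C (fun w => f w - g w)%C); [now apply cder_minus | apply cder_sqr].
Qed.

Lemma cder_Cexp_id (z : C) : cder Cexp z (Cexp z).
Proof.
  intros eps heps. set (K := exp (Re z) * exp 1).
  assert (hK : 0 < K) by (apply Rmult_lt_0_compat; apply exp_pos).
  exists (Rmin 1 (eps / K)). split.
  - apply Rmin_glb_lt; [lra | now apply Rdiv_lt_0_compat].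
  - intros w hw.
    replace (Cexp w - Cexp z - Cexp z * (w - z))%C
      with (Cexp z * (Cexp (w - z) - 1 - (w - z)))%C.
    2:{ replace (Cexp w) with (Cexp (z + (w - z))) by (f_equal; ring).
        rewrite Cexp_plus. ring. }
    rewrite Cmod_mult, Cmod_Cexp.
    pose proof (Cmod_Cexp_minus_2 (w - z)) as h. pose proof (Cmod_ge_0 (w - z)) as h0.
    assert (h1 : Cmod (w - z) < 1) by (eapply Rlt_le_trans; [exact hw | apply Rmin_l]).
    assert (h2 : Cmod (w - z) < eps / K) by (eapply Rlt_le_trans; [exact hw | apply Rmin_r]).
    assert (h3 : exp (Cmod (w - z)) <= exp 1) by (apply exp_mono; lra).
    pose proof (exp_pos (Re z)) as h4.
    apply (Rle_trans _ (exp (Re z) * (Cmod (w - z) ^ 2 * exp 1))).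
    + apply Rmult_le_compat_l; [lra |]. eapply Rle_trans; [exact h |].
      apply Rmult_le_compat_l; [apply pow2_ge_0 | exact h3].
    + replace (exp (Re z) * (Cmod (w - z) ^ 2 * exp 1)) with ((K * Cmod (w - z)) * Cmod (w - z))
        by (unfold K; ring).
      apply Rmult_le_compat_r; auto.
      apply (Rle_trans _ (K * (eps / K))); [| right; field; lra].
      apply Rmult_le_compat_l; lra.
Qed.

Lemma cder_Cexp (f : C -> C) (z l : C) :
  cder f z l -> cder (fun w => Cexp (f w)) z (Cexp (f z) * l).
Proof. intros h. apply (cder_comp Cexp f); [exact h | apply cder_Cexp_id]. Qed.

Lemma cder_inv_id (z : C) : z <> RtoC 0 -> cder (fun w => / w)%C z (- (/ (z * z))).
Proof.
  intros hz eps heps. pose proof (proj1 (Cmod_gt_0 z) hz) as hm.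
  exists (Rmin (Cmod z / 2) (eps * Cmod z ^ 3 / 2)). split.
  - apply Rmin_glb_lt; [lra |]. apply Rdiv_lt_0_compat; [| lra].
    apply Rmult_lt_0_compat; auto. now apply pow_lt.
  - intros w hw.
    assert (h1 : Cmod (w - z) < Cmod z / 2) by (eapply Rlt_le_trans; [exact hw | apply Rmin_l]).
    assert (h2 : Cmod (w - z) < eps * Cmod z ^ 3 / 2) by (eapply Rlt_le_trans; [exact hw | apply Rmin_r]).
    assert (h3 : Cmod z / 2 < Cmod w).
    { pose proof (Cmod_triangle (z - w) w) as h. replace (z - w + w)%C with z in h by ring.
      replace (z - w)%C with (- (w - z))%C in h by ring. rewrite Cmod_opp in h. lra. }
    assert (hw0 : w <> RtoC 0) by (apply Cmod_gt_0; lra).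
    replace (/ w - / z - - / (z * z) * (w - z))%C with ((w - z) * (w - z) / (w * (z * z)))%C
      by (field; auto).
    rewrite Cmod_div, !Cmod_mult by (repeat apply Cmult_neq_0; auto).
    pose proof (Cmod_ge_0 (w - z)) as h0.
    apply (Rle_trans _ (Cmod (w - z) * Cmod (w - z) / (Cmod z / 2 * (Cmod z * Cmod z)))).
    + apply Rmult_le_compat_l; [nra |]. apply Rinv_le_contravar.
      * repeat apply Rmult_lt_0_compat; lra.
      * apply Rmult_le_compat_r; [nra | lra].
    + apply (Rle_trans _ (Cmod (w - z) * (eps * Cmod z ^ 3 / 2) / (Cmod z / 2 * (Cmod z * Cmod z)))).
      * apply Rmult_le_compat_r; [| apply Rmult_le_compat_l; lra].
        apply Rlt_le, Rinv_0_lt_compat. repeat apply Rmult_lt_0_compat; lra.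
      * right. field. lra.
Qed.

Lemma cder_inv (f : C -> C) (z l : C) :
  f z <> RtoC 0 -> cder f z l -> cder (fun w => / f w)%C z (- (/ (f z * f z)) * l).
Proof. intros h0 h. apply (cder_comp (fun w => / w)%C f); [exact h | now apply cder_inv_id]. Qed.

Lemma rder_of_eps (f : R -> C) (t : R) (l : C) :
  (forall eps, 0 < eps -> exists delta, 0 < delta /\ forall h, Rabs h < delta ->
     Cmod (f (t + h)%R - f t - l * RtoC h)%C <= eps * Rabs h) -> rder f t l.
Proof.
  intros H. split; apply is_derive_Reals; intros eps heps;
    destruct (H (eps / 2)) as (d & hd & Hd); try lra; exists (mkposreal d hd);
    intros h hh0 hh; specialize (Hd h hh);
    pose proof (Rmax_Cmod (f (t + h)%R - f t - l * RtoC h)%C) as hm.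
  - apply (Rmult_lt_reg_r (Rabs h)); [now apply Rabs_pos_lt |].
    rewrite <- Rabs_mult.
    replace (((Re (f (t + h)%R) - Re (f t)) / h - Re l) * h)
      with (fst (f (t + h)%R - f t - l * RtoC h)%C) by (simpl; unfold Re; field; auto).
    eapply Rle_lt_trans; [apply Rmax_l |]. eapply Rle_lt_trans; [exact hm |].
    eapply Rle_lt_trans; [exact Hd |]. apply Rmult_lt_compat_r; [now apply Rabs_pos_lt | lra].
  - apply (Rmult_lt_reg_r (Rabs h)); [now apply Rabs_pos_lt |].
    rewrite <- Rabs_mult.
    replace (((Im (f (t + h)%R) - Im (f t)) / h - Im l) * h)
      with (snd (f (t + h)%R - f t - l * RtoC h)%C) by (simpl; unfold Im; field; auto).
    eapply Rle_lt_trans; [apply Rmax_r |]. eapply Rle_lt_trans; [exact hm |].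
    eapply Rle_lt_trans; [exact Hd |]. apply Rmult_lt_compat_r; [now apply Rabs_pos_lt | lra].
Qed.

Lemma cder_rder_x (f : C -> C) (x y : R) (l : C) :
  cder f (x, y) l -> rder (fun t => f (t, y)) x l.
Proof.
  intros h. apply rder_of_eps. intros eps heps. destruct (h eps heps) as (d & hd & H).
  exists d; split; auto. intros k hk.
  assert (e : (((x + k)%R, y) - (x, y))%C = RtoC k) by (apply C_ext; simpl; ring).
  specialize (H ((x + k)%R, y)). rewrite e, Cmod_R in H. now apply H.
Qed.

Lemma cder_rder_y (f : C -> C) (x y : R) (l : C) :
  cder f (x, y) l -> rder (fun t => f (x, t)) y (Ci * l).
Proof.
  intros h. apply rder_of_eps. intros eps heps. destruct (h eps heps) as (d & hd & H).
  exists d; split; auto. intros k hk.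
  assert (e : ((x, (y + k)%R) - (x, y))%C = (Ci * RtoC k)%C) by (apply C_ext; simpl; ring).
  specialize (H (x, (y + k)%R)). rewrite e, Cmod_mult, Cmod_Ci, Cmod_R, Rmult_1_l in H.
  replace (Ci * l * RtoC k)%C with (l * (Ci * RtoC k))%C by ring. now apply H.
Qed.

(** * Goursat's theorem for rectangles *)

Lemma nested_intervals (a b : nat -> R) :
  (forall n, a n <= a (S n)) -> (forall n, b (S n) <= b n) -> (forall n, a n <= b n) ->
  exists X, forall n, a n <= X <= b n.
Proof.
  intros ha hb hab.
  assert (ham : forall n k, a n <= a (n + k)%nat).
  { intros n k. induction k as [|k IH]; [rewrite Nat.add_0_r; lra |].
    rewrite Nat.add_succ_r. specialize (ha (n + k)%nat). lra. }
  assert (hbm : forall n k, b (n + k)%nat <= b n).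
  { intros n k. induction k as [|k IH]; [rewrite Nat.add_0_r; lra |].
    rewrite Nat.add_succ_r. specialize (hb (n + k)%nat). lra. }
  assert (h : forall n m, a n <= b m).
  { intros n m. specialize (ham n m). specialize (hbm m n). specialize (hab (n + m)%nat).
    rewrite (Nat.add_comm m n) in hbm. lra. }
  destruct (completeness (fun r => exists n, r = a n)) as [X [h1 h2]].
  - exists (b 0%nat). intros r [n ->]. apply h.
  - now exists (a 0%nat), 0%nat.
  - exists X. intros n; split.
    + apply h1. now exists n.
    + apply h2. intros r [m ->]. apply h.
Qed.

(** The common core of Goursat's theorem and of the existence of maxima: a property inherited by one
    of the four quarters is followed down to a single point. The quarter is selected by choice, and
    the subtype [{s | ok s}] carries the invariant through the iteration. *)
Lemma bisection (Bad : R -> R -> R -> R -> Prop) (a b c d : R) :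
  a <= b -> c <= d -> Bad a b c d ->
  (forall a' b' c' d', a <= a' -> a' <= b' -> b' <= b -> c <= c' -> c' <= d' -> d' <= d ->
     Bad a' b' c' d' ->
     Bad a' ((a' + b') / 2) c' ((c' + d') / 2) \/ Bad ((a' + b') / 2) b' c' ((c' + d') / 2) \/
     Bad a' ((a' + b') / 2) ((c' + d') / 2) d' \/ Bad ((a' + b') / 2) b' ((c' + d') / 2) d') ->
  exists X Y, forall n : nat, exists a' b' c' d',
    a <= a' <= X /\ X <= b' <= b /\ c <= c' <= Y /\ Y <= d' <= d /\
    b' - a' = (b - a) / 2 ^ n /\ d' - c' = (d - c) / 2 ^ n /\ Bad a' b' c' d'.
Proof.
  intros hab hcd h0 hsplit.
  set (ok := fun s : R * R * R * R => let '(a', b', c', d') := s in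
         a <= a' /\ a' <= b' /\ b' <= b /\ c <= c' /\ c' <= d' /\ d' <= d /\ Bad a' b' c' d').
  set (child := fun s s' : R * R * R * R =>
         let '(a1, b1, c1, d1) := s in let '(a2, b2, c2, d2) := s' in
         a1 <= a2 /\ b2 <= b1 /\ c1 <= c2 /\ d2 <= d1 /\
         b2 - a2 = (b1 - a1) / 2 /\ d2 - c2 = (d1 - c1) / 2).
  assert (hstep : forall s : {s | ok s}, exists s' : {s | ok s}, child (proj1_sig s) (proj1_sig s')).
  { intros [[[[a1 b1] c1] d1] (h1 & h2 & h3 & h4 & h5 & h6 & h7)].
    destruct (hsplit a1 b1 c1 d1 h1 h2 h3 h4 h5 h6 h7) as [h|[h|[h|h]]].
    - assert (hk : ok (a1, (a1 + b1) / 2, c1, (c1 + d1) / 2)) by (repeat split; auto; lra).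
      exists (exist _ _ hk). simpl. repeat split; lra.
    - assert (hk : ok ((a1 + b1) / 2, b1, c1, (c1 + d1) / 2)) by (repeat split; auto; lra).
      exists (exist _ _ hk). simpl. repeat split; lra.
    - assert (hk : ok (a1, (a1 + b1) / 2, (c1 + d1) / 2, d1)) by (repeat split; auto; lra).
      exists (exist _ _ hk). simpl. repeat split; lra.
    - assert (hk : ok ((a1 + b1) / 2, b1, (c1 + d1) / 2, d1)) by (repeat split; auto; lra).
      exists (exist _ _ hk). simpl. repeat split; lra. }
  assert (hk0 : ok (a, b, c, d)) by (repeat split; auto; lra).
  set (next := fun s => proj1_sig (constructive_indefinite_description _ (hstep s))).
  assert (hnext : forall s, child (proj1_sig s) (proj1_sig (next s))).
  { intros s. unfold next. apply (proj2_sig (constructive_indefinite_description _ (hstep s))). }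
  set (sq := fun n => Nat.iter n next (exist _ _ hk0)).
  set (A := fun n => fst (fst (fst (proj1_sig (sq n))))).
  set (B := fun n => snd (fst (fst (proj1_sig (sq n))))).
  set (CC := fun n => snd (fst (proj1_sig (sq n)))).
  set (D := fun n => snd (proj1_sig (sq n))).
  assert (hok : forall n, ok (A n, B n, CC n, D n)).
  { intros n. unfold A, B, CC, D. destruct (sq n) as [[[[a1 b1] c1] d1] hs]. exact hs. }
  assert (hch : forall n, child (A n, B n, CC n, D n) (A (S n), B (S n), CC (S n), D (S n))).
  { intros n. pose proof (hnext (sq n)) as h. unfold A, B, CC, D.
    change (sq (S n)) with (next (sq n)).
    destruct (proj1_sig (sq n)) as [[[a1 b1] c1] d1].
    destruct (proj1_sig (next (sq n))) as [[[a2 b2] c2] d2]. exact h. }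
  destruct (nested_intervals A B) as [X hX].
  { intros n. destruct (hch n); tauto. }
  { intros n. destruct (hch n); tauto. }
  { intros n. destruct (hok n); tauto. }
  destruct (nested_intervals CC D) as [Y hY].
  { intros n. destruct (hch n); tauto. }
  { intros n. destruct (hch n); tauto. }
  { intros n. destruct (hok n); tauto. }
  exists X, Y. intros n. exists (A n), (B n), (CC n), (D n).
  assert (hsz : B n - A n = (b - a) / 2 ^ n /\ D n - CC n = (d - c) / 2 ^ n).
  { induction n as [|n IH].
    - unfold A, B, CC, D; simpl. split; field.
    - destruct (hch n) as (_ & _ & _ & _ & e1 & e2). rewrite e1, e2.
      destruct IH as [-> ->]. simpl. split; field; apply pow_nonzero; lra. }
  specialize (hX n); specialize (hY n). destruct (hok n) as (h1 & h2 & h3 & h4 & h5 & h6 & h7).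
  tauto.
Qed.

(** Counterclockwise contour integral along the boundary; the factor [Ci] is dz/dy on the vertical
    sides. *)
Definition rect_int (f : C -> C) (a b c d : R) : C :=
  (CInt (fun t => f (t, c)) a b + Ci * CInt (fun t => f (b, t)) c d
   - CInt (fun t => f (t, d)) a b - Ci * CInt (fun t => f (a, t)) c d)%C.

Lemma rect_int_ext (f g : C -> C) (a b c d : R) :
  (forall z, f z = g z) -> rect_int f a b c d = rect_int g a b c d.
Proof.
  intros h. unfold rect_int.
  rewrite (CInt_ext (fun t => f (t, c)) (fun t => g (t, c))) by auto.
  rewrite (CInt_ext (fun t => f (t, d)) (fun t => g (t, d))) by auto.
  rewrite (CInt_ext (fun t => f (a, t)) (fun t => g (a, t))) by auto.
  rewrite (CInt_ext (fun t => f (b, t)) (fun t => g (b, t))) by auto.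
  reflexivity.
Qed.

(** Separate continuity along horizontal and vertical lines is what the side integrals ask for. *)
Definition cont_rect (f : C -> C) (a b c d : R) : Prop :=
  forall x y, a <= x <= b -> c <= y <= d -> ccont (fun t => f (t, y)) x /\ ccont (fun t => f (x, t)) y.

Lemma cont_rect_x (f : C -> C) (a b c d a' b' y : R) :
  cont_rect f a b c d -> a <= a' -> a' <= b' -> b' <= b -> c <= y <= d ->
  ccont_on (fun t => f (t, y)) a' b'.
Proof.
  intros h h1 h2 h3 hy t. rewrite Rmin_left, Rmax_right by assumption. intros ht.
  apply (h t y); lra.
Qed.

Lemma cont_rect_y (f : C -> C) (a b c d c' d' x : R) :
  cont_rect f a b c d -> c <= c' -> c' <= d' -> d' <= d -> a <= x <= b ->
  ccont_on (fun t => f (x, t)) c' d'.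
Proof.
  intros h h1 h2 h3 hy t. rewrite Rmin_left, Rmax_right by assumption. intros ht.
  apply (h x t); lra.
Qed.

Lemma cder_cont_rect (f : C -> C) (a b c d : R) :
  (forall x y, a <= x <= b -> c <= y <= d -> exists l, cder f (x, y) l) -> cont_rect f a b c d.
Proof.
  intros h x y hx hy. destruct (h x y hx hy) as [l hl]. split.
  - eapply rder_ccont, cder_rder_x, hl.
  - eapply rder_ccont, cder_rder_y, hl.
Qed.

Lemma rect_int_split (f : C -> C) (a b c d m n : R) :
  cont_rect f a b c d -> a <= m <= b -> c <= n <= d ->
  rect_int f a b c d = (rect_int f a m c n + rect_int f m b c n
                        + rect_int f a m n d + rect_int f m b n d)%C.
Proof.
  intros h hm hn. unfold rect_int.
  assert (hx : forall y, c <= y <= d ->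
     CInt (fun t => f (t, y)) a b = (CInt (fun t => f (t, y)) a m + CInt (fun t => f (t, y)) m b)%C).
  { intros y hy. symmetry. apply CInt_Chasles; apply (cont_rect_x f a b c d); auto; lra. }
  assert (hy : forall x, a <= x <= b ->
     CInt (fun t => f (x, t)) c d = (CInt (fun t => f (x, t)) c n + CInt (fun t => f (x, t)) n d)%C).
  { intros x hx'. symmetry. apply CInt_Chasles; apply (cont_rect_y f a b c d); auto; lra. }
  rewrite (hx c), (hx d), (hy a), (hy b) by lra. ring.
Qed.

Lemma rect_int_plus (f g : C -> C) (a b c d : R) :
  a <= b -> c <= d -> cont_rect f a b c d -> cont_rect g a b c d ->
  rect_int (fun z => f z + g z)%C a b c d = (rect_int f a b c d + rect_int g a b c d)%C.
Proof.
  intros hab hcd hf hg. unfold rect_int.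
  rewrite !CInt_plus; try (apply (cont_rect_x _ a b c d); auto; lra);
    try (apply (cont_rect_y _ a b c d); auto; lra).
  ring.
Qed.

Lemma rect_int_primitive (F f : C -> C) (a b c d : R) :
  a <= b -> c <= d -> cont_rect f a b c d ->
  (forall x y, a <= x <= b -> c <= y <= d -> cder F (x, y) (f (x, y))) ->
  rect_int f a b c d = RtoC 0.
Proof.
  intros hab hcd hf hF.
  assert (hx : forall y, c <= y <= d -> CInt (fun t => f (t, y)) a b = (F (b, y) - F (a, y))%C).
  { intros y hy. apply (CInt_rder (fun t => F (t, y))).
    - intros t. rewrite Rmin_left, Rmax_right by assumption. intros ht.
      apply cder_rder_x. apply hF; lra.
    - apply (cont_rect_x f a b c d); auto; lra. }
  assert (hy : forall x, a <= x <= b -> (Ci * CInt (fun t => f (x, t)) c d)%C = (F (x, d) - F (x, c))%C).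
  { intros x hx'. rewrite <- CInt_mult_l by (apply (cont_rect_y f a b c d); auto; lra).
    apply (CInt_rder (fun t => F (x, t)) (fun t => Ci * f (x, t))%C).
    - intros t. rewrite Rmin_left, Rmax_right by assumption. intros ht.
      apply cder_rder_y. apply hF; lra.
    - intros t ht. apply ccont_mult; [apply ccont_const |].
      revert t ht. apply (cont_rect_y f a b c d); auto; lra. }
  unfold rect_int. rewrite (hx c), (hx d), (hy a), (hy b) by lra. ring.
Qed.

Lemma Cmod_rect_int_le (f : C -> C) (a b c d B : R) :
  a <= b -> c <= d -> cont_rect f a b c d ->
  (forall x y, a <= x <= b -> c <= y <= d -> Cmod (f (x, y)) <= B) ->
  Cmod (rect_int f a b c d) <= B * (2 * ((b - a) + (d - c))).
Proof.
  intros hab hcd hf hB.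
  assert (hx : forall y, c <= y <= d -> Cmod (CInt (fun t => f (t, y)) a b) <= B * (b - a)).
  { intros y hy. rewrite <- (Rabs_pos_eq (b - a)) by lra. apply Cmod_CInt_le_const.
    - apply (cont_rect_x f a b c d); auto; lra.
    - intros t. rewrite Rmin_left, Rmax_right by assumption. intros ht. apply hB; lra. }
  assert (hy : forall x, a <= x <= b -> Cmod (Ci * CInt (fun t => f (x, t)) c d) <= B * (d - c)).
  { intros x hx'. rewrite Cmod_mult, Cmod_Ci, Rmult_1_l.
    rewrite <- (Rabs_pos_eq (d - c)) by lra. apply Cmod_CInt_le_const.
    - apply (cont_rect_y f a b c d); auto; lra.
    - intros t. rewrite Rmin_left, Rmax_right by assumption. intros ht. apply hB; lra. }
  unfold rect_int, Cminus.
  repeat (eapply Rle_trans; [apply Cmod_triangle |]; rewrite ?Cmod_opp).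
  pose proof (hx c); pose proof (hx d); pose proof (hy a); pose proof (hy b).
  eapply Rle_trans; [apply Rplus_le_compat; [| apply H1; lra] |].
  - eapply Rle_trans; [apply Cmod_triangle |]. apply Rplus_le_compat.
    + eapply Rle_trans; [apply Cmod_triangle |]. apply Rplus_le_compat; [apply H; lra | apply H2; lra].
    + rewrite Cmod_opp. apply H0; lra.
  - lra.
Qed.

Lemma pow2_shrink (s eps : R) : 0 < eps -> exists n : nat, s / 2 ^ n < eps.
Proof.
  intros he. destruct (Rle_dec s 0) as [hs|hs].
  - exists 0%nat. simpl. lra.
  - destruct (pow_lt_1_zero (/ 2)) with (y := eps / s) as [n hn].
    + rewrite Rabs_pos_eq; lra.
    + apply Rdiv_lt_0_compat; lra.
    + exists n. specialize (hn n (le_n n)).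
      rewrite Rabs_pos_eq in hn by (apply pow_le; lra). rewrite pow_inv in hn.
      apply (Rmult_lt_compat_l s) in hn; [| lra].
      replace (s * (eps / s)) with eps in hn by (field; lra). exact hn.
Qed.

Lemma Cmod_pair_le (x y : R) : Cmod (x, y) <= Rabs x + Rabs y.
Proof.
  replace (x, y) with (RtoC x + Ci * RtoC y)%C by (apply C_ext; simpl; ring).
  eapply Rle_trans; [apply Cmod_triangle |].
  rewrite Cmod_mult, Cmod_Ci, !Cmod_R. lra.
Qed.

Theorem goursat (f : C -> C) (a b c d : R) :
  a <= b -> c <= d ->
  (forall x y, a <= x <= b -> c <= y <= d -> exists l, cder f (x, y) l) ->
  rect_int f a b c d = RtoC 0.
Proof.
  intros hab hcd hf.
  pose proof (cder_cont_rect f a b c d hf) as hcont.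
  destruct (Req_dec a b) as [e|hab'].
  { subst b. unfold rect_int. rewrite !CInt_point. ring. }
  destruct (Req_dec c d) as [e|hcd'].
  { subst d. unfold rect_int. rewrite !CInt_point. ring. }
  assert (hA : 0 < (b - a) * (d - c)) by (apply Rmult_lt_0_compat; lra).
  apply Cmod_eq_0. apply Rle_antisym; [| apply Cmod_ge_0].
  apply Rnot_lt_le. intros hpos.
  set (eps := Cmod (rect_int f a b c d) / (2 * ((b - a) * (d - c)))).
  assert (heps : 0 < eps) by (apply Rdiv_lt_0_compat; lra).
  (* A rectangle is bad if its integral exceeds [eps] times its area. The area is additive and the
     modulus of the integral subadditive over the quarters, so a bad rectangle has a bad quarter. *)
  destruct (bisection (fun a' b' c' d' => eps * ((b' - a') * (d' - c')) < Cmod (rect_int f a' b' c' d'))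
              a b c d hab hcd) as (X & Y & H).
  { unfold eps. apply (Rlt_le_trans _ (Cmod (rect_int f a b c d) * 1)); [| lra].
    replace (Cmod (rect_int f a b c d) / (2 * ((b - a) * (d - c))) * ((b - a) * (d - c)))
      with (Cmod (rect_int f a b c d) * / 2) by (field; lra).
    apply Rmult_lt_compat_l; lra. }
  { intros a1 b1 c1 d1 h1 h2 h3 h4 h5 h6 hbad.
    apply NNPP. intros hn.
    apply not_or_and in hn; destruct hn as [n1 hn]. apply not_or_and in hn; destruct hn as [n2 hn].
    apply not_or_and in hn; destruct hn as [n3 n4].
    apply Rnot_lt_le in n1, n2, n3, n4.
    rewrite (rect_int_split f a1 b1 c1 d1 ((a1 + b1) / 2) ((c1 + d1) / 2)) in hbad;
      [| intros x y hx hy; apply hcont; lra | lra | lra].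
    apply (Rlt_not_le _ _ hbad).
    eapply Rle_trans; [apply Cmod_triangle |].
    eapply Rle_trans; [apply Rplus_le_compat_r; eapply Rle_trans; [apply Cmod_triangle |];
                       apply Rplus_le_compat_r; apply Cmod_triangle |].
    nra. }
  assert (hXY : a <= X <= b /\ c <= Y <= d).
  { destruct (H 0%nat) as (a' & b' & c' & d' & h). lra. }
  destruct (hf X Y) as [l hl]; try tauto.
  set (s := (b - a) + (d - c)).
  assert (hs : 0 < s) by (unfold s; lra).
  (* Chosen so that [e1] times the size s / 2^n times the perimeter 2 s / 2^n equals [eps] times the
     area of the n-th rectangle. *)
  set (e1 := eps * ((b - a) * (d - c)) / (2 * s * s)).
  assert (he1 : 0 < e1).
  { apply Rdiv_lt_0_compat; [now apply Rmult_lt_0_compat |]. repeat apply Rmult_lt_0_compat; lra. }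
  destruct (hl e1 he1) as (delta & hd & Hd).
  destruct (pow2_shrink s delta hd) as [n hn].
  destruct (H n) as (a' & b' & c' & d' & h1 & h2 & h3 & h4 & h5 & h6 & hbad).
  assert (hp : 0 < 2 ^ n) by (apply pow_lt; lra).
  assert (hs' : (b' - a') + (d' - c') = s / 2 ^ n) by (rewrite h5, h6; unfold s; field; lra).
  apply (Rlt_not_le _ _ hbad).
  set (z0 := (X, Y) : C).
  (* The affine part has a primitive and integrates to 0; only the differentiability error
     contributes. *)
  set (aff := fun z : C => (f z0 + l * (z - z0))%C).
  set (err := fun z : C => (f z - aff z)%C).
  assert (haff : forall z, cder (fun z => (f z0 - l * z0) * z + l * (z * z * / 2))%C z (aff z)).
  { intros z. eapply cder_eq; [| apply cder_plus; [apply cder_scal, cder_id |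
      apply cder_scal; apply (cder_ext (fun z => / 2 * (z * z))%C _ _ _ 1);
        [lra | intros; ring | apply cder_scal, cder_sqr]]].
    unfold aff. field. }
  assert (caff : cont_rect aff a' b' c' d').
  { apply cder_cont_rect. intros x y _ _. exists (0 + l * (1 - 0))%C.
    apply cder_plus; [apply cder_const |]. apply cder_scal, cder_minus; [apply cder_id | apply cder_const]. }
  assert (cerr : cont_rect err a' b' c' d').
  { intros x y hx hy. destruct (hcont x y) as [k1 k2]; try lra.
    destruct (caff x y hx hy) as [k3 k4]. split; now apply ccont_minus. }
  replace (rect_int f a' b' c' d') with (rect_int (fun z => aff z + err z)%C a' b' c' d').
  2:{ apply rect_int_ext. intros z. unfold err. ring. }
  rewrite rect_int_plus by (auto; lra).
  rewrite (rect_int_primitive _ aff a' b' c' d') by (auto; lra). rewrite Cplus_0_l.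
  eapply Rle_trans.
  { apply (Cmod_rect_int_le err a' b' c' d' (e1 * (s / 2 ^ n))); auto; try lra.
    intros x y hx hy. unfold err, aff.
    replace (f (x, y) - (f z0 + l * ((x, y) - z0)))%C with (f (x, y) - f z0 - l * ((x, y) - z0))%C by ring.
    assert (hz : Cmod ((x, y) - z0) <= s / 2 ^ n).
    { replace ((x, y) - z0)%C with ((x - X, y - Y) : C) by (apply C_ext; simpl; ring).
      eapply Rle_trans; [apply Cmod_pair_le |]. rewrite <- hs'.
      apply Rplus_le_compat; apply Rabs_le; lra. }
    eapply Rle_trans; [apply Hd; now apply (Rle_lt_trans _ _ _ hz) |]. apply Rmult_le_compat_l; [now apply Rlt_le | exact hz]. }
  right. rewrite hs', h5, h6. unfold e1. field. split; lra.
Qed.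

(** * Unique continuation on half-planes *)

Lemma rect_int_swap_x (f : C -> C) (a b c d : R) :
  a <= b -> c <= d -> cont_rect f a b c d -> rect_int f b a c d = (- rect_int f a b c d)%C.
Proof.
  intros hab hcd hf. unfold rect_int.
  rewrite (CInt_swap (fun t => f (t, c)) a b), (CInt_swap (fun t => f (t, d)) a b)
    by (apply (cont_rect_x f a b c d); auto; lra). ring.
Qed.

Lemma rect_int_swap_y (f : C -> C) (a b c d : R) :
  (forall x, x = a \/ x = b -> ccont_on (fun t => f (x, t)) c d) ->
  rect_int f a b d c = (- rect_int f a b c d)%C.
Proof.
  intros hf. unfold rect_int.
  rewrite (CInt_swap (fun t => f (a, t)) c d), (CInt_swap (fun t => f (b, t)) c d) by auto. ring.
Qed.

(** Corners come in any order, because increments of a primitive involve rectangles on every side of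
    the base point. *)
Lemma goursat_half_plane (alpha : R) (f : C -> C) (a b c d : R) :
  (forall z, alpha < Re z -> exists l, cder f z l) -> alpha < a -> alpha < b ->
  rect_int f a b c d = RtoC 0.
Proof.
  intros hf ha hb.
  assert (hcy : forall x c d, alpha < x -> ccont_on (fun t => f (x, t)) c d).
  { intros x c' d' hx t _. destruct (hf (x, t)) as [l hl]; [exact hx |].
    eapply rder_ccont, cder_rder_y, hl. }
  assert (main : forall a b c d, alpha < a -> a <= b -> c <= d -> rect_int f a b c d = RtoC 0).
  { intros a' b' c' d' h1 h2 h3. apply goursat; auto. intros x y hx hy. apply hf. simpl. lra. }
  assert (main2 : forall c d, c <= d -> rect_int f a b c d = RtoC 0).
  { intros c' d' h. destruct (Rle_dec a b) as [h'|h'].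
    - now apply main.
    - rewrite rect_int_swap_x; [rewrite main by lra; ring | lra | lra |].
      apply cder_cont_rect. intros x y hx hy. apply hf. simpl. lra. }
  destruct (Rle_dec c d) as [h|h]; [now apply main2 |].
  rewrite rect_int_swap_y.
  - rewrite main2 by lra. ring.
  - intros x [-> | ->]; now apply hcy.
Qed.

(** Integral along the path that runs horizontally from (x0, 0) to abscissa Re z, then vertically to
    z. *)
Definition primitive (f : C -> C) (x0 : R) (z : C) : C :=
  (CInt (fun t => f (t, 0)) x0 (Re z) + Ci * CInt (fun t => f (Re z, t)) 0 (Im z))%C.

Lemma cder_primitive (alpha : R) (f : C -> C) (x0 : R) (z : C) :
  (forall z, alpha < Re z -> exists l, cder f z l) -> alpha < x0 -> alpha < Re z ->
  cder (primitive f x0) z (f z).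
Proof.
  intros hf hx0 hz.
  assert (hcx : forall y a b, alpha < a -> alpha < b -> ccont_on (fun t => f (t, y)) a b).
  { intros y a b ha hb t ht. destruct (hf (t, y)) as [l hl].
    - simpl. apply (Rlt_le_trans _ (Rmin a b)); [now apply Rmin_glb_lt | tauto].
    - eapply rder_ccont, cder_rder_x, hl. }
  assert (hcy : forall x c d, alpha < x -> ccont_on (fun t => f (x, t)) c d).
  { intros x c' d' hx t _. destruct (hf (x, t)) as [l hl]; [exact hx |].
    eapply rder_ccont, cder_rder_y, hl. }
  destruct z as [x y]. simpl in hz.
  (* The two broken paths differ by a closed rectangle, whose integral vanishes; what remains is the
     short path from (x, y) through (x', y) to (x', y'). *)
  assert (incr : forall x' y', alpha < x' ->
    (primitive f x0 (x', y') - primitive f x0 (x, y))%C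
    = (CInt (fun t => f (t, y)) x x' + Ci * CInt (fun t => f (x', t)) y y')%C).
  { intros x' y' hx'. unfold primitive; simpl.
    pose proof (goursat_half_plane alpha f x x' 0 y hf hz hx') as hg. unfold rect_int in hg.
    rewrite <- (CInt_Chasles (fun t => f (t, 0)) x0 x x') by auto.
    rewrite <- (CInt_Chasles (fun t => f (x', t)) 0 y y') by auto.
    match goal with |- ?L = ?R => replace L with (R + (L - R))%C by ring end.
    rewrite <- Cplus_0_r. f_equal. rewrite <- hg. ring. }
  destruct (hf (x, y) hz) as [l hl].
  intros eps heps.
  destruct (cder_continuous _ _ _ hl (eps / 2)) as (d1 & hd1 & H1); [lra |].
  (* The half pays for bounding the modulus by |dx| + |dy|; the second entry keeps the nearby point
     inside the half-plane. *)
  exists (Rmin (d1 / 2) (x - alpha)). split; [apply Rmin_glb_lt; lra |].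
  intros [x' y'] hw.
  assert (h1 : Cmod ((x', y') - (x, y)) < d1 / 2) by (eapply Rlt_le_trans; [exact hw | apply Rmin_l]).
  assert (h2 : Cmod ((x', y') - (x, y)) < x - alpha) by (eapply Rlt_le_trans; [exact hw | apply Rmin_r]).
  pose proof (Rmax_Cmod ((x', y') - (x, y))%C) as hm. simpl in hm.
  pose proof (Rle_trans _ _ _ (Rmax_l _ _) hm) as hmx.
  pose proof (Rle_trans _ _ _ (Rmax_r _ _) hm) as hmy.
  replace (x' + - x) with (x' - x) in hmx by ring.
  replace (y' + - y) with (y' - y) in hmy by ring.
  set (r := Cmod ((x', y') - (x, y))) in *.
  assert (hx' : alpha < x').
  { apply Rabs_le_between in hmx. lra. }
  rewrite incr by assumption.
  replace (CInt (fun t => f (t, y)) x x' + Ci * CInt (fun t => f (x', t)) y y'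
           - f (x, y) * ((x', y') - (x, y)))%C
    with (CInt (fun t => f (t, y) - f (x, y))%C x x'
          + Ci * CInt (fun t => f (x', t) - f (x, y))%C y y')%C.
  2:{ assert (hc : forall a b, CInt (fun _ => f (x, y)) a b = (f (x, y) * RtoC (b - a))%C).
      { intros a b. rewrite (CInt_rder (fun t => f (x, y) * RtoC t)%C).
        - rewrite RtoC_minus. ring.
        - intros t _. apply rder_linear.
        - intros t _. apply ccont_const. }
      rewrite !CInt_minus, !hc by (auto; intros t _; apply ccont_const).
      replace ((x', y') - (x, y))%C with (RtoC (x' - x) + Ci * RtoC (y' - y))%C
        by (apply C_ext; simpl; ring).
      ring. }
  assert (near : forall s t, Rabs (s - x) <= r -> Rabs (t - y) <= r -> Cmod (f (s, t) - f (x, y)) <= eps / 2).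
  { intros s t hs ht. apply Rlt_le, H1.
    replace ((s, t) - (x, y))%C with ((s - x, t - y) : C) by (apply C_ext; simpl; ring).
    eapply Rle_lt_trans; [apply Cmod_pair_le |]. lra. }
  assert (between : forall u v s, Rmin u v <= s <= Rmax u v -> Rabs (s - u) <= Rabs (v - u)).
  { intros u v s. unfold Rmin, Rmax. destruct Rle_dec; intros hs;
      [rewrite !Rabs_pos_eq by lra | rewrite !Rabs_left1 by lra]; lra. }
  assert (hr : 0 <= r) by apply Cmod_ge_0.
  eapply Rle_trans; [apply Cmod_triangle |]. rewrite Cmod_mult, Cmod_Ci, Rmult_1_l.
  apply (Rle_trans _ (eps / 2 * Rabs (x' - x) + eps / 2 * Rabs (y' - y))); [apply Rplus_le_compat | nra].
  - apply Cmod_CInt_le_const.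
    + intros t ht. apply ccont_minus; [now apply (hcx y x x') | apply ccont_const].
    + intros t ht. apply near.
      * apply between in ht. lra.
      * rewrite Rminus_diag, Rabs_R0. lra.
  - apply Cmod_CInt_le_const.
    + intros t ht. apply ccont_minus; [now apply (hcy x' y y') | apply ccont_const].
    + intros t ht. apply near.
      * lra.
      * apply between in ht. lra.
Qed.

(** Bisection in the role of compactness: a subrectangle is kept if every value on the whole
    rectangle is matched or exceeded somewhere in it. Upper semicontinuity at the limit point then
    makes its value maximal. *)
Lemma rect_max (u : R -> R -> R) (a b c d : R) :
  a <= b -> c <= d ->
  (forall x y, a <= x <= b -> c <= y <= d -> forall eps, 0 < eps -> exists delta, 0 < delta /\
     forall x' y', a <= x' <= b -> c <= y' <= d -> Rabs (x' - x) < delta -> Rabs (y' - y) < delta ->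
       u x' y' < u x y + eps) ->
  exists X Y, a <= X <= b /\ c <= Y <= d /\
    forall x y, a <= x <= b -> c <= y <= d -> u x y <= u X Y.
Proof.
  intros hab hcd hu.
  destruct (bisection (fun a' b' c' d' => forall x y, a <= x <= b -> c <= y <= d ->
              exists x' y', a' <= x' <= b' /\ c' <= y' <= d' /\ u x y <= u x' y') a b c d hab hcd)
    as (X & Y & H).
  { intros x y hx hy. exists x, y. repeat split; lra. }
  { intros a1 b1 c1 d1 h1 h2 h3 h4 h5 h6 hbad.
    assert (hneg : forall a' b' c' d',
      ~ (forall x y, a <= x <= b -> c <= y <= d ->
           exists x' y', a' <= x' <= b' /\ c' <= y' <= d' /\ u x y <= u x' y') ->
      exists x y, a <= x <= b /\ c <= y <= d /\
        forall x' y', a' <= x' <= b' -> c' <= y' <= d' -> u x' y' < u x y).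
    { intros a' b' c' d' hn. apply NNPP. intros hn'. apply hn. intros x y hx hy.
      apply NNPP. intros hn2. apply hn'. exists x, y. repeat split; try tauto.
      intros x' y' hx' hy'. apply Rnot_le_lt. intros hle. apply hn2. exists x', y'. tauto. }
    assert (hmax2 : forall p q : R * R, a <= fst p <= b /\ c <= snd p <= d ->
      a <= fst q <= b /\ c <= snd q <= d ->
      exists r : R * R, (a <= fst r <= b /\ c <= snd r <= d) /\
        u (fst p) (snd p) <= u (fst r) (snd r) /\ u (fst q) (snd q) <= u (fst r) (snd r)).
    { intros p q hp hq. destruct (Rle_dec (u (fst p) (snd p)) (u (fst q) (snd q))).
      - exists q. repeat split; try tauto; lra.
      - exists p. repeat split; try tauto; lra. }
    apply NNPP. intros hn.
    apply not_or_and in hn; destruct hn as [n1 hn]. apply not_or_and in hn; destruct hn as [n2 hn].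
    apply not_or_and in hn; destruct hn as [n3 n4].
    apply hneg in n1, n2, n3, n4.
    destruct n1 as (x1 & y1 & i1 & j1 & k1), n2 as (x2 & y2 & i2 & j2 & k2),
      n3 as (x3 & y3 & i3 & j3 & k3), n4 as (x4 & y4 & i4 & j4 & k4).
    destruct (hmax2 (x1, y1) (x2, y2)) as (p & hp & p1 & p2); [simpl; lra | simpl; lra |].
    destruct (hmax2 (x3, y3) (x4, y4)) as (q & hq & q1 & q2); [simpl; lra | simpl; lra |].
    destruct (hmax2 p q hp hq) as (r & hr & r1 & r2). simpl in p1, p2, q1, q2.
    destruct (hbad (fst r) (snd r)) as (x' & y' & hx' & hy' & hle); try tauto.
    destruct (Rle_dec x' ((a1 + b1) / 2)), (Rle_dec y' ((c1 + d1) / 2)).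
    - specialize (k1 x' y'). lra.
    - specialize (k3 x' y'). lra.
    - specialize (k2 x' y'). lra.
    - specialize (k4 x' y'). lra. }
  assert (hXY : a <= X <= b /\ c <= Y <= d).
  { destruct (H 0%nat) as (a' & b' & c' & d' & h). lra. }
  exists X, Y. repeat split; try tauto.
  intros x y hx hy. apply Rnot_lt_le. intros hlt.
  destruct (hu X Y) with (eps := u x y - u X Y) as (delta & hd & Hd); try tauto; try lra.
  destruct (pow2_shrink ((b - a) + (d - c)) delta hd) as [n hn].
  destruct (H n) as (a' & b' & c' & d' & h1 & h2 & h3 & h4 & h5 & h6 & hbad).
  destruct (hbad x y hx hy) as (x' & y' & hx' & hy' & hle).
  assert (hp : 0 < / 2 ^ n) by (apply Rinv_0_lt_compat, pow_lt; lra).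
  assert (hs1 : 0 <= (b - a) / 2 ^ n) by (unfold Rdiv; apply Rmult_le_pos; lra).
  assert (hs2 : 0 <= (d - c) / 2 ^ n) by (unfold Rdiv; apply Rmult_le_pos; lra).
  assert (hs : (b - a + (d - c)) / 2 ^ n = (b - a) / 2 ^ n + (d - c) / 2 ^ n) by (unfold Rdiv; ring).
  specialize (Hd x' y').
  apply (Rlt_irrefl (u x y)). apply (Rle_lt_trans _ _ _ hle).
  replace (u x y) with (u X Y + (u x y - u X Y)) at 1 by ring.
  apply Hd; try lra; apply Rabs_def1; lra.
Qed.

(** If k were positive, [g1] would increase through x with slope at least k/2, and g would rise
    above g x to the right when g1 x >= 0, to the left otherwise. *)
Lemma second_derivative_at_max (g g1 : R -> R) (x k r : R) :
  0 < r -> (forall t, Rabs (t - x) < r -> is_derive g t (g1 t)) -> is_derive g1 x k ->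
  (forall t, Rabs (t - x) < r -> g t <= g x) -> k <= 0.
Proof.
  intros hr hg hg1 hmax. apply Rnot_lt_le. intros hk.
  apply is_derive_Reals in hg1. destruct (hg1 (k / 2)) as [delta hd]; [lra |].
  set (s := Rmin r delta / 2).
  assert (hs : 0 < s /\ s < r /\ s < delta).
  { unfold s. pose proof (cond_pos delta). pose proof (Rmin_l r delta). pose proof (Rmin_r r delta).
    assert (0 < Rmin r delta) by (apply Rmin_glb_lt; auto). lra. }
  assert (slope : forall h, h <> 0 -> Rabs h <= s -> k / 2 < (g1 (x + h) - g1 x) / h).
  { intros h h0 hh. assert (hlt : Rabs h < delta) by lra. specialize (hd h h0 hlt).
    apply Rabs_lt_between in hd. lra. }
  destruct (Rle_dec 0 (g1 x)) as [h|h].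
  - destruct (MVT_cor2 g g1 x (x + s)) as (t & e & ht); [lra | |].
    + intros t ht. apply is_derive_Reals, hg. rewrite Rabs_pos_eq; lra.
    + specialize (slope (t - x)). rewrite Rabs_pos_eq in slope by lra.
      replace (x + (t - x)) with t in slope by ring.
      assert (hsl : k / 2 < (g1 t - g1 x) / (t - x)) by (apply slope; lra).
      apply (Rmult_lt_compat_r (t - x)) in hsl; [| lra].
      replace ((g1 t - g1 x) / (t - x) * (t - x)) with (g1 t - g1 x) in hsl by (field; lra).
      specialize (hmax (x + s)). rewrite Rabs_pos_eq in hmax by lra.
      assert (0 < k / 2 * (t - x)) by (apply Rmult_lt_0_compat; lra).
      assert (0 < g1 t * (x + s - x)) by (apply Rmult_lt_0_compat; lra). lra.
  - destruct (MVT_cor2 g g1 (x - s) x) as (t & e & ht); [lra | |].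
    + intros t ht. apply is_derive_Reals, hg. rewrite Rabs_left1; lra.
    + specialize (slope (t - x)). rewrite Rabs_left1 in slope by lra.
      replace (x + (t - x)) with t in slope by ring.
      assert (hsl : k / 2 < (g1 t - g1 x) / (t - x)) by (apply slope; lra).
      apply (Rmult_lt_compat_r (x - t)) in hsl; [| lra].
      replace ((g1 t - g1 x) / (t - x) * (x - t)) with (g1 x - g1 t) in hsl by (field; lra).
      specialize (hmax (x - s)). rewrite Rabs_left1 in hmax by lra.
      assert (0 < k / 2 * (x - t)) by (apply Rmult_lt_0_compat; lra).
      assert (0 < - g1 t * (x - (x - s))) by (apply Rmult_lt_0_compat; lra). lra.
Qed.

(* At an interior maximum of Re (zeta Phi) + eps x^2 the two second derivatives would have
   sum 2 eps > 0. *)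
Lemma maximum_principle (Phi Phi1 Phi2 : C -> C) (a b c d B : R) :
  a <= b -> c <= d ->
  (forall x y, a <= x <= b -> c <= y <= d -> cder Phi (x, y) (Phi1 (x, y))) ->
  (forall x y, a <= x <= b -> c <= y <= d -> cder Phi1 (x, y) (Phi2 (x, y))) ->
  (forall x y, a <= x <= b -> c <= y <= d -> x = a \/ x = b \/ y = c \/ y = d -> Cmod (Phi (x, y)) <= B) ->
  forall x y, a <= x <= b -> c <= y <= d -> Cmod (Phi (x, y)) <= B.
Proof.
  intros hab hcd h1 h2 hB x0 y0 hx0 hy0. apply Rnot_lt_le. intros hlt.
  set (p0 := Phi (x0, y0)) in *.
  assert (hp0 : 0 < Cmod p0).
  { apply Rle_lt_trans with (2 := hlt). apply Rle_trans with (Cmod (Phi (a, c))); [apply Cmod_ge_0 |].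
    apply hB; lra. }
  (* A unit complex number, unrelated to the zeta function, that rotates the large value [p0] onto
     the positive real axis. *)
  set (zeta := (Cconj p0 / RtoC (Cmod p0))%C).
  assert (hzm : Cmod zeta = 1).
  { unfold zeta. rewrite Cmod_div, Cmod_conj, Cmod_RtoC_pos by (try apply RtoC_neq_0; lra). field. lra. }
  assert (hz0 : Re (zeta * p0) = Cmod p0).
  { replace (zeta * p0)%C with (RtoC (Cmod p0)); [reflexivity |]. unfold zeta.
    replace (Cconj p0 / RtoC (Cmod p0) * p0)%C with ((p0 * Cconj p0) / RtoC (Cmod p0))%C
      by (field; apply RtoC_neq_0; lra).
    rewrite <- Cmod2_conj. rewrite <- RtoC_div by lra. f_equal. field. lra. }
  (* Small enough that eps x^2 stays within half of the excess of |p0| over B, so that the maximum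
     of [u] cannot lie on the boundary. *)
  set (eps := (Cmod p0 - B) / (2 * (a ^ 2 + b ^ 2 + 1))).
  assert (hab2 : 0 <= a ^ 2 + b ^ 2) by nra.
  assert (heps : 0 < eps) by (apply Rdiv_lt_0_compat; lra).
  set (u := fun x y => Re (zeta * Phi (x, y)) + eps * x ^ 2).
  destruct (rect_max u a b c d hab hcd) as (X & Y & hX & hY & hmax).
  { intros x y hx hy e he. destruct (cder_continuous _ _ _ (h1 x y hx hy) (e / 2)) as (d1 & hd1 & H1); [lra |].
    assert (hsq : exists d2, 0 < d2 /\ forall x', Rabs (x' - x) < d2 -> eps * x' ^ 2 < eps * x ^ 2 + e / 2).
    { assert (hc : continuity_pt (fun t => eps * t ^ 2) x) by reg.
      destruct (hc (e / 2)) as (d2 & hd2 & H2); [lra |]. exists d2; split; [exact hd2 |].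
      intros x' hx'. destruct (Req_dec x' x) as [->|hne]; [lra |].
      assert (hh : D_x no_cond x x' /\ Rdist x' x < d2) by (repeat split; auto).
      specialize (H2 x' hh). unfold dist in H2; simpl in H2. unfold Rdist in H2.
      apply Rabs_lt_between in H2. simpl. lra. }
    destruct hsq as (d2 & hd2 & H2).
    exists (Rmin (d1 / 2) d2). split; [apply Rmin_glb_lt; lra |].
    intros x' y' _ _ hx' hy'.
    specialize (H2 x' (Rlt_le_trans _ _ _ hx' (Rmin_r _ _))).
    pose proof (Rlt_le_trans _ _ _ hx' (Rmin_l _ _)) as hx1.
    pose proof (Rlt_le_trans _ _ _ hy' (Rmin_l _ _)) as hy1.
    assert (hc : Cmod (Phi (x', y') - Phi (x, y)) < e / 2).
    { apply H1. replace ((x', y') - (x, y))%C with ((x' - x, y' - y) : C) by (apply C_ext; simpl; ring).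
      eapply Rle_lt_trans; [apply Cmod_pair_le |]. lra. }
    assert (hr : Re (zeta * Phi (x', y')) - Re (zeta * Phi (x, y)) < e / 2).
    { replace (Re (zeta * Phi (x', y')) - Re (zeta * Phi (x, y)))
        with (Re (zeta * (Phi (x', y') - Phi (x, y)))) by (simpl; unfold Re, Im; ring).
      eapply Rle_lt_trans; [apply Rle_abs |]. eapply Rle_lt_trans; [apply re_le_Cmod |].
      rewrite Cmod_mult, hzm, Rmult_1_l. exact hc. }
    unfold u. lra. }
  assert (hux0 : Cmod p0 <= u X Y).
  { apply Rle_trans with (u x0 y0); [| now apply hmax]. unfold u. fold p0. rewrite hz0.
    pose proof (pow2_ge_0 x0). nra. }
  assert (hle : forall x y, a <= x <= b -> u x y <= Cmod (Phi (x, y)) + (Cmod p0 - B) / 2).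
  { intros x y hx. unfold u. apply Rplus_le_compat.
    - eapply Rle_trans; [apply Rle_abs |]. eapply Rle_trans; [apply re_le_Cmod |].
      rewrite Cmod_mult, hzm. lra.
    - apply Rle_trans with (eps * (a ^ 2 + b ^ 2 + 1)); [apply Rmult_le_compat_l; [lra |] |].
      + destruct (Rle_dec 0 x); nra.
      + right. unfold eps. field. lra. }
  assert (hint : a < X < b /\ c < Y < d).
  { assert (hno : ~ (X = a \/ X = b \/ Y = c \/ Y = d)).
    { intros h. specialize (hB X Y hX hY h). specialize (hle X Y hX). lra. }
    assert (X <> a /\ X <> b /\ Y <> c /\ Y <> d) by tauto. lra. }
  set (kx := Re (zeta * Phi2 (X, Y)) + 2 * eps).
  (* Differentiating twice in y brings the factor i^2 = -1, so [kx] and [ky] add up to 2 eps. *)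
  set (ky := - Re (zeta * Phi2 (X, Y))).
  assert (der_mul : forall (f : R -> C) t l, rder f t l ->
            is_derive (fun s => Re (zeta * f s)) t (Re (zeta * l))).
  { intros f t l hf. assert (hh := rder_mult (fun _ => zeta) f t _ _ (rder_const zeta t) hf).
    destruct hh as [hh _]. cbv beta in hh.
    replace (zeta * l)%C with (0 * f t + zeta * l)%C by ring. exact hh. }
  assert (hkx : kx <= 0).
  { apply (second_derivative_at_max (fun t => u t Y) (fun t => Re (zeta * Phi1 (t, Y)) + eps * (2 * t)) X kx
             (Rmin (X - a) (b - X))).
    - apply Rmin_glb_lt; lra.
    - intros t ht. apply Rabs_lt_between in ht.
      pose proof (Rmin_l (X - a) (b - X)). pose proof (Rmin_r (X - a) (b - X)).
      apply (is_derive_plus (V := R_NormedModule) (fun s => Re (zeta * Phi (s, Y))) (fun s => eps * s ^ 2)).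
      + apply (der_mul (fun s => Phi (s, Y))). apply cder_rder_x, h1; lra.
      + auto_derive; auto. ring.
    - apply (is_derive_plus (V := R_NormedModule) (fun s => Re (zeta * Phi1 (s, Y))) (fun s => eps * (2 * s))).
      + apply (der_mul (fun s => Phi1 (s, Y))). apply cder_rder_x, h2; lra.
      + auto_derive; auto. ring.
    - intros t ht. apply Rabs_lt_between in ht.
      pose proof (Rmin_l (X - a) (b - X)). pose proof (Rmin_r (X - a) (b - X)). apply hmax; lra. }
  assert (hky : ky <= 0).
  { apply (second_derivative_at_max (fun t => u X t) (fun t => Re (zeta * (Ci * Phi1 (X, t)))) Y ky
             (Rmin (Y - c) (d - Y))).
    - apply Rmin_glb_lt; lra.
    - intros t ht. apply Rabs_lt_between in ht.
      pose proof (Rmin_l (Y - c) (d - Y)). pose proof (Rmin_r (Y - c) (d - Y)).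
      replace (Re (zeta * (Ci * Phi1 (X, t)))) with (plus (Re (zeta * (Ci * Phi1 (X, t)))) (zero : R))
        by (unfold plus, zero; simpl; ring).
      apply (is_derive_plus (V := R_NormedModule) (fun s => Re (zeta * Phi (X, s))) (fun s => eps * X ^ 2)).
      + apply (der_mul (fun s => Phi (X, s))). apply cder_rder_y, h1; lra.
      + apply (is_derive_const (V := R_NormedModule)).
    - replace ky with (Re (zeta * (Ci * (Ci * Phi2 (X, Y))))).
      2:{ unfold ky. simpl. unfold Re, Im. ring. }
      apply (der_mul (fun s => Ci * Phi1 (X, s))%C).
      assert (hh := rder_mult (fun _ => Ci) (fun s => Phi1 (X, s)) Y _ _ (rder_const Ci Y)
                      (cder_rder_y _ _ _ _ (h2 X Y hX hY))).
      cbv beta in hh. eapply rder_eq; [| exact hh]. ring.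
    - intros t ht. apply Rabs_lt_between in ht.
      pose proof (Rmin_l (Y - c) (d - Y)). pose proof (Rmin_r (Y - c) (d - Y)). apply hmax; lra. }
  unfold kx, ky in *. lra.
Qed.

Lemma rect_bounded (H H1 : C -> C) (a b c d : R) :
  a <= b -> c <= d ->
  (forall x y, a <= x <= b -> c <= y <= d -> cder H (x, y) (H1 (x, y))) ->
  exists M, 0 <= M /\ forall x y, a <= x <= b -> c <= y <= d -> Cmod (H (x, y)) <= M.
Proof.
  intros hab hcd hH.
  destruct (rect_max (fun x y => Cmod (H (x, y))) a b c d hab hcd) as (X & Y & hX & hY & hm).
  - intros x y hx hy eps heps. destruct (cder_continuous _ _ _ (hH x y hx hy) eps heps) as (d1 & hd1 & Hd).
    exists (d1 / 2). split; [lra |]. intros x' y' _ _ hx' hy'.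
    assert (hc : Cmod (H (x', y') - H (x, y)) < eps).
    { apply Hd. replace ((x', y') - (x, y))%C with ((x' - x, y' - y) : C) by (apply C_ext; simpl; ring).
      eapply Rle_lt_trans; [apply Cmod_pair_le |]. lra. }
    pose proof (Cmod_triangle (H (x', y') - H (x, y)) (H (x, y))) as ht.
    replace (H (x', y') - H (x, y) + H (x, y))%C with (H (x', y')) in ht by ring. lra.
  - exists (Cmod (H (X, Y))). split; [apply Cmod_ge_0 | exact hm].
Qed.

(* The weight exp (lam psi) is 1 at s0 and exponentially small on the part of the boundary
   where H does not vanish. *)
Lemma weighted_vanishing (H H1 H2 : C -> C) (s0 : C) (sg kappa a b c d eta : R) :
  a <= Re s0 <= b -> c <= Im s0 <= d -> 0 < eta ->
  (forall x y, a <= x <= b -> c <= y <= d -> cder H (x, y) (H1 (x, y))) ->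
  (forall x y, a <= x <= b -> c <= y <= d -> cder H1 (x, y) (H2 (x, y))) ->
  (forall x y, a <= x <= b -> c <= y <= d -> x = a \/ x = b \/ y = c \/ y = d ->
     H (x, y) = RtoC 0 \/
     sg * (x - Re s0) + kappa * ((x - Re s0) ^ 2 - (y - Im s0) ^ 2) <= - eta) ->
  H s0 = RtoC 0.
Proof.
  intros hs1 hs2 heta h1 h2 hbd.
  destruct (rect_bounded H H1 a b c d) as (M & hM & hM'); auto; try lra.
  set (psi := fun z : C => (RtoC sg * (z - s0) + RtoC kappa * ((z - s0) * (z - s0)))%C).
  set (psi1 := fun z : C => (RtoC sg + RtoC kappa * (2 * (z - s0)))%C).
  assert (hpsi : forall z, cder psi z (psi1 z)).
  { intros z. unfold psi, psi1.
    eapply cder_eq; [| apply cder_plus; [apply cder_scal, cder_minus; [apply cder_id | apply cder_const] |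
      apply cder_scal; apply (cder_comp (fun w => w * w)%C (fun z => z - s0)%C);
        [apply cder_minus; [apply cder_id | apply cder_const] | apply cder_sqr]]]. ring. }
  assert (hpsi1 : forall z, cder psi1 z (RtoC kappa * 2)%C).
  { intros z. unfold psi1.
    eapply cder_eq; [| apply cder_plus; [apply cder_const | apply cder_scal, cder_scal, cder_minus;
      [apply cder_id | apply cder_const]]]. ring. }
  assert (hRe : forall x y, Re (psi (x, y)) = sg * (x - Re s0) + kappa * ((x - Re s0) ^ 2 - (y - Im s0) ^ 2)).
  { intros x y. unfold psi. simpl. unfold Re, Im. ring. }
  assert (key : forall lam, 0 < lam -> Cmod (H s0) <= M * exp (- (lam * eta))).
  { intros lam hlam.
    set (E := fun z => Cexp (RtoC lam * psi z)).
    set (L := RtoC lam).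
    assert (hE : forall z, cder E z (E z * (L * psi1 z))).
    { intros z. apply cder_Cexp, cder_scal, hpsi. }
    set (Phi := fun z => (E z * H z)%C).
    set (Phi1 := fun z => (E z * (L * psi1 z) * H z + E z * H1 z)%C).
    set (Phi2 := fun z => (((E z * (L * psi1 z)) * (L * psi1 z) + E z * (L * (RtoC kappa * 2))) * H z
                    + E z * (L * psi1 z) * H1 z + (E z * (L * psi1 z) * H1 z + E z * H2 z))%C).
    replace (H s0) with (Phi s0).
    2:{ unfold Phi, E, psi. replace (RtoC lam * (RtoC sg * (s0 - s0) + RtoC kappa * ((s0 - s0) * (s0 - s0))))%C
          with (RtoC 0) by ring. rewrite Cexp_0. ring. }
    replace s0 with ((Re s0, Im s0) : C) by (destruct s0; reflexivity).
    apply (maximum_principle Phi Phi1 Phi2 a b c d); auto; try lra.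
    - intros x y hx hy. apply cder_mult; [apply hE | now apply h1].
    - intros x y hx hy. apply cder_plus.
      + apply (cder_mult (fun z => E z * (L * psi1 z))%C H); [| now apply h1].
        apply (cder_mult E (fun z => L * psi1 z)%C); [apply hE |]. apply cder_scal, hpsi1.
      + apply (cder_mult E H1); [apply hE | now apply h2].
    - intros x y hx hy hb. unfold Phi. destruct (hbd x y hx hy hb) as [e|hle].
      + rewrite e, Cmult_0_r, Cmod_0. apply Rmult_le_pos; [lra | apply exp_ge_0].
      + rewrite Cmod_mult, Rmult_comm. apply Rmult_le_compat; try apply Cmod_ge_0; [now apply hM' |].
        unfold E. rewrite Cmod_Cexp. apply exp_mono.
        replace (Re (RtoC lam * psi (x, y))) with (lam * Re (psi (x, y))) by (simpl; unfold Re; ring).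
        rewrite hRe. nra. }
  apply Cmod_eq_0. apply Rle_antisym; [| apply Cmod_ge_0]. apply Rnot_lt_le. intros hpos.
  set (m := Cmod (H s0)) in *.
  (* With lam eta = M/m + 1 the bound M exp(-lam eta) is at most M / (2 + M/m), which is smaller
     than m. *)
  assert (hlam : 0 < (M / m + 1) / eta).
  { apply Rdiv_lt_0_compat; auto. assert (0 <= M / m) by (apply Rmult_le_pos; [lra | apply Rlt_le, Rinv_0_lt_compat; lra]). lra. }
  specialize (key _ hlam).
  replace ((M / m + 1) / eta * eta) with (M / m + 1) in key by (field; lra).
  rewrite exp_Ropp in key.
  pose proof (exp_ineq1_le (M / m + 1)) as hexp.
  pose proof (exp_pos (M / m + 1)) as hep.
  apply (Rmult_le_compat_r (exp (M / m + 1))) in key; [| lra].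
  replace (M * / exp (M / m + 1) * exp (M / m + 1)) with M in key by (field; lra).
  assert (m * (1 + (M / m + 1)) <= m * exp (M / m + 1)) by (apply Rmult_le_compat_l; lra).
  replace (m * (1 + (M / m + 1))) with (2 * m + M) in H0 by (field; lra). lra.
Qed.

(** The maximum principle uses two complex derivatives while f is only known to have one, so it is
    applied to a primitive [H], with derivatives f and [f1]. The base abscissa [x0] is the middle of
    the strip, hence H vanishes on the strip. From each s a rectangle reaches back to the line Re =
    x0, and the real part of the exponent of the weight is negative on its three other sides. Once H
    = 0, also f = H' = 0. *)
Theorem unique_continuation (alpha beta1 beta2 : R) (f : C -> C) :
  alpha <= beta1 -> beta1 < beta2 ->
  (forall z, alpha < Re z -> exists l, cder f z l) ->
  (forall z, beta1 < Re z < beta2 -> f z = RtoC 0) ->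
  forall z, alpha < Re z -> f z = RtoC 0.
Proof.
  intros hab hb hf hzero.
  destruct (choice (fun z l => alpha < Re z -> cder f z l)) as [f1 hf1].
  { intros z. destruct (Rlt_dec alpha (Re z)) as [h|h].
    - destruct (hf z h) as [l hl]. now exists l.
    - exists (RtoC 0). intros; contradiction. }
  set (x0 := (beta1 + beta2) / 2).
  set (H := primitive f x0).
  assert (hH : forall z, alpha < Re z -> cder H z (f z)).
  { intros z hz. apply (cder_primitive alpha); auto. unfold x0. lra. }
  assert (H0 : forall z, beta1 < Re z < beta2 -> H z = RtoC 0).
  { intros z hz. unfold H, primitive.
    assert (hc0 : forall a b, CInt (fun _ => RtoC 0) a b = RtoC 0).
    { intros a b. rewrite (CInt_rder (fun _ => RtoC 0)).
      - ring.
      - intros t _. apply rder_const.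
      - intros t _. apply ccont_const. }
    rewrite (CInt_ext (fun t => f (t, 0)) (fun _ => RtoC 0)), (CInt_ext (fun t => f (Re z, t)) (fun _ => RtoC 0)).
    - rewrite !hc0. ring.
    - intros t _. now apply hzero.
    - intros t. intros ht. apply hzero. simpl. revert ht. unfold x0, Rmin, Rmax. destruct Rle_dec; lra. }
  assert (HH : forall z, alpha < Re z -> H z = RtoC 0).
  { intros s hs. set (X := Re s) in *. set (Y := Im s).
    (* The abscissa X - r stays to the right of alpha. With kappa = 1 / (2r), the side at distance r
       has linear part -r and quadratic part at most r/2, which leaves at most -r/2. *)
    set (r := (X - alpha) / 2). assert (hr : 0 < r) by (unfold r; lra).
    set (kappa := / (2 * r)). assert (hk : 0 < kappa) by (apply Rinv_0_lt_compat; lra).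
    assert (hkr2 : kappa * r ^ 2 = r / 2) by (unfold kappa; field; lra).
    assert (hky : forall y, 0 <= kappa * (y - Y) ^ 2)
      by (intros y; apply Rmult_le_pos; [lra | apply pow2_ge_0]).
    set (B := Rabs (x0 - X) + r).
    assert (hB : r <= B) by (unfold B; pose proof (Rabs_pos (x0 - X)); lra).
    (* Height at which -kappa T^2 outweighs the linear and quadratic contributions of x along the
       horizontal sides. *)
    assert (hT : exists T, 0 < T /\ kappa * T ^ 2 >= B + kappa * B ^ 2 + r).
    { exists ((B + kappa * B ^ 2 + r) / kappa + 1).
      assert (hq : 0 < (B + kappa * B ^ 2 + r) / kappa) by (apply Rdiv_lt_0_compat; nra).
      split; [lra |].
      replace (B + kappa * B ^ 2 + r) with (kappa * ((B + kappa * B ^ 2 + r) / kappa)) at 2 by (field; lra).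
      apply Rle_ge, Rmult_le_compat_l; nra. }
    destruct hT as (T & hT & hT').
    assert (htop : forall sg x, sg = 1 \/ sg = -1 -> Rabs (x - X) <= B ->
               sg * (x - X) + kappa * ((x - X) ^ 2 - T ^ 2) <= - (r / 2)).
    { intros sg x hsg hx. apply Rabs_le_between in hx.
      assert (hsq : (x - X) ^ 2 <= B ^ 2) by nra.
      assert (hsx : sg * (x - X) <= B) by (destruct hsg; subst; lra).
      nra. }
    destruct (Rle_dec X x0) as [hle|hgt].
    - apply (weighted_vanishing H f f1 s 1 kappa (X - r) x0 (Y - T) (Y + T) (r / 2)); fold X Y; try lra.
      + intros x y hx hy. apply hH. simpl. unfold r in hx. lra.
      + intros x y hx hy. apply hf1. simpl. unfold r in hx. lra.
      + intros x y hx hy [e|[e|[e|e]]].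
        * right. subst x. replace (X - r - X) with (- r) by ring.
          specialize (hky y). replace ((- r) ^ 2) with (r ^ 2) by ring. lra.
        * left. apply H0. simpl. subst x. unfold x0. lra.
        * right. subst y. replace (Y - T - Y) with (- T) by ring.
          replace ((- T) ^ 2) with (T ^ 2) by ring. apply htop; auto.
          apply Rabs_le. unfold B. rewrite Rabs_pos_eq by lra. lra.
        * right. subst y. replace (Y + T - Y) with T by ring. apply htop; auto.
          apply Rabs_le. unfold B. rewrite Rabs_pos_eq by lra. lra.
    - apply (weighted_vanishing H f f1 s (-1) kappa x0 (X + r) (Y - T) (Y + T) (r / 2)); fold X Y; try lra.
      + intros x y hx hy. apply hH. simpl. unfold x0 in hx. lra.
      + intros x y hx hy. apply hf1. simpl. unfold x0 in hx. lra.
      + intros x y hx hy [e|[e|[e|e]]].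
        * left. apply H0. simpl. subst x. unfold x0. lra.
        * right. subst x. replace (X + r - X) with r by ring. specialize (hky y). lra.
        * right. subst y. replace (Y - T - Y) with (- T) by ring.
          replace ((- T) ^ 2) with (T ^ 2) by ring. apply htop; auto.
          apply Rabs_le. unfold B. rewrite Rabs_left1 by lra. lra.
        * right. subst y. replace (Y + T - Y) with T by ring. apply htop; auto.
          apply Rabs_le. unfold B. rewrite Rabs_left1 by lra. lra. }
  intros [x y] hz. simpl in hz.
  assert (h := cder_rder_x _ _ _ _ (hH (x, y) hz)).
  assert (h' : rder (fun t => H (t, y)) x 0).
  { destruct (rder_const (RtoC 0) x) as [k1 k2].
    split; eapply is_derive_ext_loc; try eassumption;
      (exists (mkposreal (x - alpha) (Rlt_Rminus _ _ hz)); intros t ht;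
       rewrite HH; [reflexivity |]; simpl; change (Rabs (t - x) < x - alpha) in ht;
       apply Rabs_lt_between in ht; lra). }
  destruct h as [h1 h2], h' as [h3 h4].
  apply C_ext.
  - rewrite <- (is_derive_unique _ _ _ h1). exact (is_derive_unique _ _ _ h3).
  - rewrite <- (is_derive_unique _ _ _ h2). exact (is_derive_unique _ _ _ h4).
Qed.

(** * Limits and series of complex numbers *)

Definition climit (u : nat -> C) (l : C) : Prop :=
  forall eps, 0 < eps -> exists N : nat, forall n, (N <= n)%nat -> Cmod (u n - l) < eps.

Lemma climit_unique (u : nat -> C) (l l' : C) : climit u l -> climit u l' -> l = l'.
Proof.
  intros h h'. apply Ceq_minus. apply Cmod_eq_0. apply Rle_antisym; [| apply Cmod_ge_0].
  apply Rnot_lt_le. intros hp.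
  destruct (h (Cmod (l - l') / 2)) as [N hN]; [lra |].
  destruct (h' (Cmod (l - l') / 2)) as [N' hN']; [lra |].
  specialize (hN (N + N')%nat (Nat.le_add_r _ _)).
  specialize (hN' (N + N')%nat ltac:(lia)).
  pose proof (Cmod_triangle (l - u (N + N')%nat) (u (N + N')%nat - l')) as ht.
  replace (l - u (N + N')%nat + (u (N + N')%nat - l'))%C with (l - l')%C in ht by ring.
  replace (l - u (N + N')%nat)%C with (- (u (N + N')%nat - l))%C in ht by ring.
  rewrite Cmod_opp in ht. lra.
Qed.

Lemma climit_ext (u v : nat -> C) (l : C) : (forall n, u n = v n) -> climit u l -> climit v l.
Proof. intros e h eps he. destruct (h eps he) as [N hN]. exists N. intros n hn. rewrite <- e. auto. Qed.

Lemma climit_const (c : C) : climit (fun _ => c) c.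
Proof.
  intros eps he. exists 0%nat. intros n _. replace (c - c)%C with (RtoC 0) by ring. now rewrite Cmod_0.
Qed.

Lemma climit_plus (u v : nat -> C) (l m : C) :
  climit u l -> climit v m -> climit (fun n => u n + v n)%C (l + m).
Proof.
  intros hu hv eps he. destruct (hu (eps / 2)) as [N hN]; [lra |].
  destruct (hv (eps / 2)) as [N' hN']; [lra |].
  exists (N + N')%nat. intros n hn.
  specialize (hN n ltac:(lia)). specialize (hN' n ltac:(lia)).
  replace (u n + v n - (l + m))%C with ((u n - l) + (v n - m))%C by ring.
  eapply Rle_lt_trans; [apply Cmod_triangle |]. lra.
Qed.

Lemma climit_scal (c : C) (u : nat -> C) (l : C) : climit u l -> climit (fun n => c * u n)%C (c * l).
Proof.
  intros hu eps he. pose proof (Cmod_ge_0 c) as hc.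
  destruct (hu (eps / (Cmod c + 1))) as [N hN]; [apply Rdiv_lt_0_compat; lra |].
  exists N. intros n hn. specialize (hN n hn).
  replace (c * u n - c * l)%C with (c * (u n - l))%C by ring. rewrite Cmod_mult.
  apply Rle_lt_trans with (Cmod c * (eps / (Cmod c + 1))); [apply Rmult_le_compat_l; lra |].
  apply Rlt_le_trans with ((Cmod c + 1) * (eps / (Cmod c + 1))).
  - apply Rmult_lt_compat_r; [apply Rdiv_lt_0_compat |]; lra.
  - right. field. lra.
Qed.

Lemma climit_RtoC (u : nat -> R) (l : R) : is_lim_seq u l -> climit (fun n => RtoC (u n)) (RtoC l).
Proof.
  intros h eps he. apply is_lim_seq_spec in h. destruct (h (mkposreal eps he)) as [N hN].
  exists N. intros n hn. rewrite <- RtoC_minus, Cmod_R. now apply hN.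
Qed.

Lemma climit_Cmod_le (u : nat -> C) (l : C) (B : R) (N : nat) :
  climit u l -> (forall n, (N <= n)%nat -> Cmod (u n) <= B) -> Cmod l <= B.
Proof.
  intros h hB. apply Rnot_lt_le. intros hlt.
  destruct (h (Cmod l - B)) as [M hM]; [lra |].
  specialize (hM (N + M)%nat ltac:(lia)). specialize (hB (N + M)%nat ltac:(lia)).
  pose proof (Cmod_triangle (l - u (N + M)%nat) (u (N + M)%nat)) as ht.
  replace (l - u (N + M)%nat + u (N + M)%nat)%C with l in ht by ring.
  replace (l - u (N + M)%nat)%C with (- (u (N + M)%nat - l))%C in ht by ring.
  rewrite Cmod_opp in ht. lra.
Qed.

Lemma climit_cauchy (u : nat -> C) :
  (forall eps, 0 < eps -> exists N : nat, forall n m, (N <= n)%nat -> (N <= m)%nat -> Cmod (u n - u m) < eps) ->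
  exists l, climit u l.
Proof.
  intros h.
  assert (hre : ex_finite_lim_seq (fun n => Re (u n))).
  { apply ex_lim_seq_cauchy_corr. intros eps. destruct (h eps (cond_pos eps)) as [N hN].
    exists N. intros n m hn hm. eapply Rle_lt_trans; [| apply (hN n m hn hm)].
    exact (re_le_Cmod (u n - u m)). }
  assert (him : ex_finite_lim_seq (fun n => Im (u n))).
  { apply ex_lim_seq_cauchy_corr. intros eps. destruct (h eps (cond_pos eps)) as [N hN].
    exists N. intros n m hn hm. eapply Rle_lt_trans; [| apply (hN n m hn hm)].
    eapply Rle_trans; [| apply (Rmax_Cmod (u n - u m)%C)]. apply Rmax_r. }
  destruct hre as [a ha], him as [b hb]. exists (a, b).
  apply climit_RtoC in ha, hb.
  assert (H := climit_plus _ _ _ _ ha (climit_scal Ci _ _ hb)).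
  replace ((a, b) : C) with (RtoC a + Ci * RtoC b)%C by (apply C_ext; simpl; ring).
  eapply climit_ext; [| exact H]. intros n. apply C_ext; simpl; unfold Re, Im; ring.
Qed.

Fixpoint psum (a : nat -> C) (n : nat) : C :=
  match n with O => RtoC 0 | S m => (psum a m + a m)%C end.

Fixpoint rpsum (b : nat -> R) (n : nat) : R :=
  match n with O => 0 | S m => rpsum b m + b m end.

Lemma psum_ext (a b : nat -> C) (n : nat) :
  (forall k, (k < n)%nat -> a k = b k) -> psum a n = psum b n.
Proof. induction n as [|n IH]; intros h; simpl; auto. rewrite IH, h; auto. Qed.

Lemma psum_plus (a b : nat -> C) (n : nat) :
  psum (fun k => a k + b k)%C n = (psum a n + psum b n)%C.
Proof. induction n as [|n IH]; simpl; [ring |]. rewrite IH. ring. Qed.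

Lemma psum_scal (c : C) (a : nat -> C) (n : nat) : psum (fun k => c * a k)%C n = (c * psum a n)%C.
Proof. induction n as [|n IH]; simpl; [ring |]. rewrite IH. ring. Qed.

Lemma psum_RtoC (b : nat -> R) (n : nat) : psum (fun k => RtoC (b k)) n = RtoC (rpsum b n).
Proof. induction n as [|n IH]; simpl; auto. now rewrite IH, RtoC_plus. Qed.

Lemma psum_add (a : nat -> C) (n m : nat) :
  psum a (n + m) = (psum a n + psum (fun k => a (n + k)%nat) m)%C.
Proof.
  induction m as [|m IH]; simpl; [rewrite Nat.add_0_r; ring |].
  rewrite Nat.add_succ_r. simpl. rewrite IH. ring.
Qed.

Lemma Cmod_psum_le (a : nat -> C) (b : nat -> R) (n : nat) :
  (forall k, Cmod (a k) <= b k) -> Cmod (psum a n) <= rpsum b n.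
Proof.
  intros h. induction n as [|n IH]; simpl; [rewrite Cmod_0; lra |].
  eapply Rle_trans; [apply Cmod_triangle |]. specialize (h n). lra.
Qed.

Lemma Cmod_psum_diff (a : nat -> C) (b : nat -> R) (n m : nat) :
  (forall k, Cmod (a k) <= b k) -> (n <= m)%nat -> Cmod (psum a m - psum a n) <= rpsum b m - rpsum b n.
Proof.
  intros h hnm. induction hnm as [|m hnm IH].
  - replace (psum a n - psum a n)%C with (RtoC 0) by ring. rewrite Cmod_0. lra.
  - simpl. replace (psum a m + a m - psum a n)%C with ((psum a m - psum a n) + a m)%C by ring.
    eapply Rle_trans; [apply Cmod_triangle |]. specialize (h m). lra.
Qed.

Definition Cser (a : nat -> C) (l : C) : Prop := climit (psum a) l.

Lemma sum_n_psum (a : nat -> C) (n : nat) :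
  sum_n (G := C_AbelianMonoid) a n = psum a (S n).
Proof.
  induction n as [|n IH].
  - rewrite sum_O. simpl. ring.
  - rewrite sum_Sn, IH. reflexivity.
Qed.

(** [sum_n] includes its upper index while [psum] stops before it, hence the shifts by one. *)
Lemma is_series_Cser (a : nat -> C) (l : C) :
  is_series (K := C_AbsRing) (V := C_NormedModule) a l <-> Cser a l.
Proof.
  unfold is_series. split.
  - intros h eps he.
    pose proof (proj1 (@filterlim_locally_ball_norm C_AbsRing nat C_NormedModule eventually _ _ _) h) as h'.
    destruct (h' (mkposreal eps he)) as [N hN].
    exists (S N). intros n hn. destruct n as [|n]; [lia |].
    specialize (hN n ltac:(lia)). unfold ball_norm in hN. rewrite <- sum_n_psum. exact hN.
  - intros h. apply (@filterlim_locally_ball_norm C_AbsRing nat C_NormedModule eventually _).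
    intros [eps he]. destruct (h eps he) as [N hN].
    exists N. intros n hn. unfold ball_norm. specialize (hN (S n) ltac:(lia)).
    rewrite <- sum_n_psum in hN. exact hN.
Qed.

Lemma Cser_unique (a : nat -> C) (l l' : C) : Cser a l -> Cser a l' -> l = l'.
Proof. apply climit_unique. Qed.

Lemma Cser_ext (a b : nat -> C) (l : C) : (forall n, a n = b n) -> Cser a l -> Cser b l.
Proof. intros h. apply climit_ext. intros n. apply psum_ext; auto. Qed.

Lemma Cser_plus (a b : nat -> C) (l m : C) :
  Cser a l -> Cser b m -> Cser (fun n => a n + b n)%C (l + m).
Proof.
  intros ha hb. eapply climit_ext; [| apply climit_plus; [exact ha | exact hb]].
  intros n. symmetry. apply psum_plus.
Qed.

Lemma Cser_scal (c : C) (a : nat -> C) (l : C) : Cser a l -> Cser (fun n => c * a n)%C (c * l).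
Proof.
  intros ha. eapply climit_ext; [| apply climit_scal; exact ha].
  intros n. symmetry. apply psum_scal.
Qed.

Lemma Cser_minus (a b : nat -> C) (l m : C) :
  Cser a l -> Cser b m -> Cser (fun n => a n - b n)%C (l - m).
Proof.
  intros ha hb. replace (l - m)%C with (l + (- (1)) * m)%C by ring.
  eapply Cser_ext; [| apply Cser_plus; [exact ha | apply (Cser_scal (- (1)) b m hb)]].
  intros n. cbv beta. ring.
Qed.

Lemma Cser_finite (a : nat -> C) (n : nat) :
  (forall k, (n <= k)%nat -> a k = RtoC 0) -> Cser a (psum a n).
Proof.
  intros h eps he. exists n. intros m hm.
  replace (psum a m) with (psum a n).
  - replace (psum a n - psum a n)%C with (RtoC 0) by ring. now rewrite Cmod_0.
  - induction hm as [|m hm IH]; auto. simpl. rewrite <- IH, h by assumption. ring.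
Qed.

Lemma Cser_psum (a : nat -> nat -> C) (l : nat -> C) (n : nat) :
  (forall j, (j < n)%nat -> Cser (a j) (l j)) -> Cser (fun k => psum (fun j => a j k) n) (psum l n).
Proof.
  induction n as [|n IH]; intros h; simpl.
  - apply (Cser_finite (fun _ => RtoC 0) 0). auto.
  - apply Cser_plus; auto.
Qed.

(** Convergence of a nonnegative series expressed by the supremum of its partial sums; it is the
    form in which dominating series are supplied below. *)
Definition rsum (b : nat -> R) (S : R) : Prop :=
  (forall n, 0 <= b n) /\ (forall n, rpsum b n <= S) /\
  forall eps, 0 < eps -> exists N, S - eps < rpsum b N.

Lemma rpsum_mono (b : nat -> R) (n m : nat) :
  (forall n, 0 <= b n) -> (n <= m)%nat -> rpsum b n <= rpsum b m.
Proof. intros h hnm. induction hnm as [|m hnm IH]; simpl; [lra |]. specialize (h m). lra. Qed.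

Lemma rpsum_scal (k : R) (b : nat -> R) (n : nat) : rpsum (fun i => k * b i) n = k * rpsum b n.
Proof. induction n as [|n IH]; simpl; [ring |]. rewrite IH. ring. Qed.

Lemma rsum_nonneg (b : nat -> R) (S : R) : rsum b S -> 0 <= S.
Proof. intros (_ & h & _). apply (h 0%nat). Qed.

Lemma rsum_bounded (b : nat -> R) (B : R) :
  (forall n, 0 <= b n) -> (forall n, rpsum b n <= B) -> exists S, rsum b S.
Proof.
  intros h0 hB. destruct (completeness (fun r => exists n, r = rpsum b n)) as [S [h1 h2]].
  - exists B. intros r [n ->]. apply hB.
  - exists 0, 0%nat. reflexivity.
  - exists S. split; [exact h0 |]. split.
    + intros n. apply h1. now exists n.
    + intros eps he. apply NNPP. intros hn.
      assert (S <= S - eps); [| lra]. apply h2. intros r [n ->].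
      apply Rnot_lt_le. intros hlt. apply hn. now exists n.
Qed.

Lemma rsum_scal (k : R) (b : nat -> R) (S : R) :
  0 <= k -> rsum b S -> rsum (fun n => k * b n) (k * S).
Proof.
  intros hk (h1 & h2 & h3). split; [| split].
  - intros n. apply Rmult_le_pos; auto.
  - intros n. rewrite rpsum_scal. apply Rmult_le_compat_l; auto.
  - intros eps he. destruct (h3 (eps / (k + 1))) as [N hN]; [apply Rdiv_lt_0_compat; lra |].
    exists N. rewrite rpsum_scal.
    assert (hq : 0 < eps / (k + 1)) by (apply Rdiv_lt_0_compat; lra).
    assert (e : (k + 1) * (eps / (k + 1)) = eps) by (field; lra).
    nra.
Qed.

Lemma rpsum_ext (b c : nat -> R) (n : nat) : (forall k, b k = c k) -> rpsum b n = rpsum c n.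
Proof. intros h. induction n as [|n IH]; simpl; auto. now rewrite IH, h. Qed.

Lemma rsum_ext (b c : nat -> R) (S : R) : (forall n, b n = c n) -> rsum b S -> rsum c S.
Proof.
  intros e (h1 & h2 & h3). split; [| split].
  - intros n. rewrite <- e. auto.
  - intros n. rewrite <- (rpsum_ext b c) by auto. auto.
  - intros eps he. destruct (h3 eps he) as [N hN]. exists N. now rewrite <- (rpsum_ext b c).
Qed.

Lemma rpsum_scal_r (k : R) (b : nat -> R) (n : nat) : rpsum (fun i => b i * k) n = rpsum b n * k.
Proof. induction n as [|n IH]; simpl; [ring |]. rewrite IH. ring. Qed.

Lemma rsum_scal_r (k : R) (b : nat -> R) (S : R) :
  0 <= k -> rsum b S -> rsum (fun n => b n * k) (S * k).
Proof.
  intros hk h. rewrite Rmult_comm. apply (rsum_ext (fun n => k * b n)); [intros; ring |].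
  now apply rsum_scal.
Qed.

Lemma rsum_Cser (b : nat -> R) (S : R) : rsum b S -> Cser (fun n => RtoC (b n)) (RtoC S).
Proof.
  intros (h1 & h2 & h3) eps he. destruct (h3 eps he) as [N hN]. exists N. intros n hn.
  rewrite psum_RtoC, <- RtoC_minus, Cmod_R.
  pose proof (rpsum_mono b N n h1 hn). specialize (h2 n). rewrite Rabs_left1; lra.
Qed.

Lemma Cser_dominated (a : nat -> C) (b : nat -> R) (S : R) :
  (forall k, Cmod (a k) <= b k) -> rsum b S -> exists l, Cser a l.
Proof.
  intros hab (h1 & h2 & h3). apply climit_cauchy. intros eps he.
  destruct (h3 eps he) as [N hN]. exists N.
  assert (main : forall n m, (N <= n)%nat -> (n <= m)%nat -> Cmod (psum a m - psum a n) < eps).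
  { intros n m hn hnm. eapply Rle_lt_trans; [apply Cmod_psum_diff; eassumption |].
    pose proof (rpsum_mono b N n h1 hn). specialize (h2 m). lra. }
  intros n m hn hm. destruct (Nat.le_ge_cases n m) as [h|h].
  - replace (psum a n - psum a m)%C with (- (psum a m - psum a n))%C by ring.
    rewrite Cmod_opp. auto.
  - auto.
Qed.

Lemma Cser_tail (a : nat -> C) (b : nat -> R) (S : R) (l : C) (n : nat) :
  (forall k, Cmod (a k) <= b k) -> rsum b S -> Cser a l -> Cmod (l - psum a n) <= S - rpsum b n.
Proof.
  intros hab (h1 & h2 & h3) hl.
  apply (climit_Cmod_le (fun m => psum a m - psum a n)%C _ _ n).
  - apply (climit_plus (psum a) (fun _ => - psum a n)%C); [exact hl | apply climit_const].
  - intros m hm. eapply Rle_trans; [apply Cmod_psum_diff; eassumption |]. specialize (h2 m). lra.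
Qed.

Lemma Cser_Cmod_le (a : nat -> C) (b : nat -> R) (S : R) (l : C) :
  (forall k, Cmod (a k) <= b k) -> rsum b S -> Cser a l -> Cmod l <= S.
Proof.
  intros h1 h2 h3. pose proof (Cser_tail a b S l 0 h1 h2 h3) as h. simpl in h.
  replace (l - 0)%C with l in h by ring. lra.
Qed.

(** Dominated convergence for series. Cut at a J beyond which the tail of b is below eps/4: the head
    converges termwise, and the tails of both series are bounded by that of b. *)
Theorem tannery (a : nat -> nat -> C) (b : nat -> R) (S : R) (l s : nat -> C) :
  (forall n j, Cmod (a n j) <= b j) -> rsum b S ->
  (forall j, climit (fun n => a n j) (l j)) -> (forall n, Cser (a n) (s n)) ->
  exists L, Cser l L /\ climit s L.
Proof.
  intros hab hb hl hs.
  assert (hlb : forall j, Cmod (l j) <= b j).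
  { intros j. apply (climit_Cmod_le (fun n => a n j) _ _ 0); auto. }
  destruct (Cser_dominated l b S hlb hb) as [L hL]. exists L. split; [exact hL |].
  intros eps he. destruct hb as (h1 & h2 & h3) eqn:e. clear e.
  destruct (h3 (eps / 4)) as [J hJ]; [lra |].
  assert (hfin : climit (fun n => psum (a n) J) (psum l J)).
  { clear - hl. induction J as [|J IH]; simpl; [apply climit_const |]. now apply climit_plus. }
  destruct (hfin (eps / 4)) as [N hN]; [lra |]. exists N. intros n hn. specialize (hN n hn).
  pose proof (Cser_tail (a n) b S (s n) J (hab n) hb (hs n)) as t1.
  pose proof (Cser_tail l b S L J hlb hb hL) as t2.
  replace (s n - L)%C with ((s n - psum (a n) J) + (psum (a n) J - psum l J) + - (L - psum l J))%C by ring.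
  eapply Rle_lt_trans; [apply Cmod_triangle |].
  eapply Rle_lt_trans; [apply Rplus_le_compat_r; apply Cmod_triangle |].
  rewrite Cmod_opp. lra.
Qed.

Lemma INR_S_pos (n : nat) : 0 < INR (S n).
Proof. apply lt_0_INR. lia. Qed.

Lemma INR_S_ge_1 (n : nat) : 1 <= INR (S n).
Proof. apply (le_INR 1). lia. Qed.

Lemma Rpower_INR_S_neg2 (n : nat) : Rpower (INR (S n)) (- (2)) = / INR (S n) ^ 2.
Proof. rewrite Rpower_Ropp. f_equal. rewrite <- Rpower_pow by apply INR_S_pos. f_equal. Qed.

(** Integral comparison: by the mean value theorem each term is at most a difference of values of
    t^(1-p) / (p-1), and these differences telescope. *)
Lemma p_series (p : R) : 1 < p -> exists s, rsum (fun n => Rpower (INR (S n)) (- p)) s.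
Proof.
  intros hp. apply (rsum_bounded _ (1 + / (p - 1))).
  - intros n. apply exp_ge_0.
  - assert (step : forall n, Rpower (INR (S (S n))) (- p)
               <= / (p - 1) * (Rpower (INR (S n)) (1 - p) - Rpower (INR (S (S n))) (1 - p))).
    { intros n. assert (hn : 0 < INR (S n)) by (apply lt_0_INR; lia).
      rewrite (S_INR (S n)). set (x := INR (S n)) in *.
      destruct (MVT_cor2 (fun t => Rpower t (1 - p)) (fun t => (1 - p) * Rpower t (1 - p - 1)) x (x + 1))
        as (c & e & hc); [lra | |].
      - intros c hc. apply derivable_pt_lim_power. lra.
      - replace (Rpower x (1 - p) - Rpower (x + 1) (1 - p)) with ((p - 1) * Rpower c (1 - p - 1)) by lra.
        rewrite <- Rmult_assoc, Rinv_l, Rmult_1_l by lra.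
        replace (1 - p - 1) with (- p) by ring. unfold Rpower. apply exp_mono.
        assert (ln c <= ln (x + 1)) by (left; apply ln_increasing; lra). nra. }
    assert (bound : forall n, rpsum (fun n => Rpower (INR (S n)) (- p)) (S n)
               <= 1 + / (p - 1) * (1 - Rpower (INR (S n)) (1 - p))).
    { induction n as [|n IH].
      - simpl. unfold Rpower. rewrite ln_1, !Rmult_0_r, exp_0. lra.
      - change (rpsum (fun n => Rpower (INR (S n)) (- p)) (S (S n)))
          with (rpsum (fun n => Rpower (INR (S n)) (- p)) (S n) + Rpower (INR (S (S n))) (- p)).
        specialize (step n). lra. }
    assert (hi : 0 < / (p - 1)) by (apply Rinv_0_lt_compat; lra).
    intros [|n]; [simpl; lra |]. eapply Rle_trans; [apply bound |].
    pose proof (Rpower_pos (INR (S n)) (1 - p)). nra.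
Qed.

(** * Integrals over the real line of exponentially decaying functions *)

(** Constant and rate are parameters rather than existentials, because exchanging sum and integral
    needs one rate and summable constants. *)
Definition decay (f : R -> C) (K c : R) : Prop :=
  (forall t, ccont f t) /\ 0 < c /\ forall t, Cmod (f t) <= K * exp (- (c * Rabs t)).

(** The two ends go to infinity independently. *)
Definition is_IR (f : R -> C) (l : C) : Prop :=
  forall eps, 0 < eps -> exists A, forall a b, a <= - A -> A <= b -> Cmod (CInt f a b - l) < eps.

(** Made total by choice; the value is meaningful when a limit exists, which [IR_correct] derives
    from [decay]. *)
Definition IR (f : R -> C) : C := epsilon (inhabits (RtoC 0)) (is_IR f).

Lemma exp_small (B c eps : R) : 0 <= B -> 0 < c -> 0 < eps ->
  exists A, 0 <= A /\ forall A', A <= A' -> B * exp (- (c * A')) < eps.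
Proof.
  intros hB hc he. exists (B / (c * eps)).
  assert (h0 : 0 <= B / (c * eps)).
  { apply Rmult_le_pos; [lra |]. apply Rlt_le, Rinv_0_lt_compat. now apply Rmult_lt_0_compat. }
  split; [exact h0 |]. intros A hA.
  rewrite exp_Ropp. pose proof (exp_ineq1_le (c * A)) as h. pose proof (exp_pos (c * A)) as hp.
  assert (h1 : B / eps <= c * A).
  { replace (B / eps) with (c * (B / (c * eps))) by (field; lra). apply Rmult_le_compat_l; lra. }
  apply (Rmult_lt_reg_r (exp (c * A))); auto.
  replace (B * / exp (c * A) * exp (c * A)) with B by (field; lra).
  apply Rlt_le_trans with (eps * (1 + B / eps)).
  - replace (eps * (1 + B / eps)) with (eps + B) by (field; lra). lra.
  - apply Rmult_le_compat_l; lra.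
Qed.

Lemma decay_K_nonneg (f : R -> C) (K c : R) : decay f K c -> 0 <= K.
Proof.
  intros (_ & _ & h). specialize (h 0). rewrite Rabs_R0, Rmult_0_r, Ropp_0, exp_0, Rmult_1_r in h.
  eapply Rle_trans; [apply Cmod_ge_0 | exact h].
Qed.

Lemma ccont_comp (f : R -> C) (g : R -> R) (t : R) :
  continuous g t -> ccont f (g t) -> ccont (fun u => f (g u)) t.
Proof. intros hg hf. now apply (@continuous_comp R_UniformSpace R_UniformSpace C_UniformSpace g f). Qed.

Lemma decay_reflect (f : R -> C) (K c : R) : decay f K c -> decay (fun t => f (- t)) K c.
Proof.
  intros (h1 & h2 & h3). split; [| split]; auto.
  - intros t. apply (ccont_comp f (fun u => - u)); auto.
    apply continuous_ex_derive. now auto_derive.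
  - intros t. rewrite <- (Rabs_Ropp t). apply h3.
Qed.

Lemma Cmod_CInt_tail (f : R -> C) (K c A b b' : R) :
  decay f K c -> 0 <= A -> A <= b -> A <= b' -> Cmod (CInt f b b') <= K / c * exp (- (c * A)).
Proof.
  intros hd hA. pose proof (decay_K_nonneg f K c hd) as hK. destruct hd as (h1 & h2 & h3).
  assert (main : forall b b', A <= b -> b <= b' -> Cmod (CInt f b b') <= K / c * exp (- (c * A))).
  { clear b b'. intros b b' hb hbb.
    eapply Rle_trans.
    - apply (Cmod_CInt_le f (fun t => K * exp (- (c * t))) b b'
               (minus (- (K / c) * exp (- (c * b'))) (- (K / c) * exp (- (c * b))))); auto.
      + intros t _; apply h1.
      + intros t ht. specialize (h3 t). rewrite (Rabs_pos_eq t) in h3 by lra. exact h3.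
      + apply (is_RInt_derive (V := R_CompleteNormedModule) (fun t => - (K / c) * exp (- (c * t)))).
        * intros t _. auto_derive; auto. field. lra.
        * intros t _. apply continuous_ex_derive. now auto_derive.
    - unfold minus, plus, opp; simpl.
      assert (hKc : 0 <= K / c) by (apply Rmult_le_pos; [lra | apply Rlt_le, Rinv_0_lt_compat; lra]).
      assert (he : exp (- (c * b)) <= exp (- (c * A))) by (apply exp_mono; nra).
      pose proof (exp_pos (- (c * b'))). nra. }
  intros hb hb'. destruct (Rle_dec b b') as [h|h]; [now apply main |].
  rewrite CInt_swap by (intros t _; apply h1). rewrite Cmod_opp. apply main; lra.
Qed.

Lemma Cmod_CInt_tail_left (f : R -> C) (K c A a a' : R) :
  decay f K c -> 0 <= A -> a <= - A -> a' <= - A -> Cmod (CInt f a a') <= K / c * exp (- (c * A)).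
Proof.
  intros hd hA ha ha'.
  pose proof (CInt_reflect f (- a) (- a')) as h. rewrite !Ropp_involutive in h.
  rewrite <- (Cmod_opp (CInt f a a')). rewrite <- h by (intros t _; apply hd).
  apply Cmod_CInt_tail; try lra. now apply decay_reflect.
Qed.

Lemma Cmod_CInt_cauchy (f : R -> C) (K c A a a' b b' : R) :
  decay f K c -> 0 <= A -> a <= - A -> a' <= - A -> A <= b -> A <= b' ->
  Cmod (CInt f a b - CInt f a' b') <= 2 * (K / c) * exp (- (c * A)).
Proof.
  intros hd hA ha ha' hb hb'.
  assert (hc : forall u v, ccont_on f u v) by (intros u v t _; apply hd).
  replace (CInt f a b - CInt f a' b')%C with (CInt f a a' + CInt f b' b)%C.
  - eapply Rle_trans; [apply Cmod_triangle |].
    pose proof (Cmod_CInt_tail_left f K c A a a' hd hA ha ha').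
    pose proof (Cmod_CInt_tail f K c A b' b hd hA hb' hb). lra.
  - rewrite <- (CInt_Chasles f a a' b) by auto. rewrite <- (CInt_Chasles f a' b' b) by auto. ring.
Qed.

Lemma is_IR_unique (f : R -> C) (l l' : C) : is_IR f l -> is_IR f l' -> l = l'.
Proof.
  intros h h'. apply Ceq_minus. apply Cmod_eq_0. apply Rle_antisym; [| apply Cmod_ge_0].
  apply Rnot_lt_le. intros hp.
  destruct (h (Cmod (l - l') / 2)) as [A hA]; [lra |].
  destruct (h' (Cmod (l - l') / 2)) as [A' hA']; [lra |].
  set (M := Rmax A A'). pose proof (Rmax_l A A') as m1. pose proof (Rmax_r A A') as m2. fold M in m1, m2.
  specialize (hA (- M) M ltac:(lra) ltac:(lra)). specialize (hA' (- M) M ltac:(lra) ltac:(lra)).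
  pose proof (Cmod_triangle (l - CInt f (- M) M) (CInt f (- M) M - l')) as ht.
  replace (l - CInt f (- M) M + (CInt f (- M) M - l'))%C with (l - l')%C in ht by ring.
  replace (l - CInt f (- M) M)%C with (- (CInt f (- M) M - l))%C in ht by ring.
  rewrite Cmod_opp in ht. lra.
Qed.

Lemma IR_unique (f : R -> C) (l : C) : is_IR f l -> IR f = l.
Proof.
  intros h. apply (is_IR_unique f); [| exact h].
  unfold IR. apply epsilon_spec. now exists l.
Qed.

Lemma IR_correct (f : R -> C) (K c : R) : decay f K c -> is_IR f (IR f).
Proof.
  intros hd. unfold IR. apply epsilon_spec.
  assert (hc : 0 < c) by apply hd.
  pose proof (decay_K_nonneg f K c hd) as hK.
  assert (hB : 0 <= 2 * (K / c)).
  { assert (0 <= K / c) by (apply Rmult_le_pos; [lra | apply Rlt_le, Rinv_0_lt_compat; lra]). lra. }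
  destruct (climit_cauchy (fun n => CInt f (- INR n) (INR n))) as [l hl].
  { intros eps he. destruct (exp_small (2 * (K / c)) c eps hB hc he) as (A & hA & H).
    destruct (nfloor_ex A hA) as [N hN]. exists (S N). intros n m hn hm.
    assert (hn' : A <= INR n) by (apply le_INR in hn; rewrite S_INR in hn; lra).
    assert (hm' : A <= INR m) by (apply le_INR in hm; rewrite S_INR in hm; lra).
    eapply Rle_lt_trans; [apply (Cmod_CInt_cauchy f K c A); auto; lra |]. apply H. lra. }
  exists l. intros eps he.
  destruct (exp_small (2 * (K / c)) c (eps / 2) hB hc) as (A & hA & H); [lra |].
  destruct (hl (eps / 2)) as [N hN]; [lra |].
  exists A. intros a b ha hb.
  destruct (nfloor_ex A hA) as [N' hN'].
  set (n := (N + S N')%nat). specialize (hN n ltac:(unfold n; lia)).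
  assert (hn : A <= INR n).
  { unfold n. rewrite plus_INR, S_INR. pose proof (pos_INR N). lra. }
  pose proof (Cmod_CInt_cauchy f K c A a (- INR n) b (INR n) hd hA ha ltac:(lra) hb hn) as h1.
  specialize (H A (Rle_refl A)).
  replace (CInt f a b - l)%C with ((CInt f a b - CInt f (- INR n) (INR n)) + (CInt f (- INR n) (INR n) - l))%C by ring.
  eapply Rle_lt_trans; [apply Cmod_triangle |]. lra.
Qed.

(** The bound is the integral of K exp(-c|t|) over the line. *)
Lemma Cmod_is_IR_le (f : R -> C) (K c : R) (l : C) : decay f K c -> is_IR f l -> Cmod l <= 2 * K / c.
Proof.
  intros hd hl. apply Rnot_lt_le. intros hlt.
  destruct (hl (Cmod l - 2 * K / c)) as [A hA]; [lra |].
  set (M := Rmax 0 A). pose proof (Rmax_l 0 A) as m1. pose proof (Rmax_r 0 A) as m2. fold M in m1, m2.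
  specialize (hA (- M) M ltac:(lra) ltac:(lra)).
  assert (hb : Cmod (CInt f (- M) M) <= 2 * K / c).
  { rewrite <- (CInt_Chasles f (- M) 0 M) by (intros t _; apply hd).
    eapply Rle_trans; [apply Cmod_triangle |].
    pose proof (Cmod_CInt_tail f K c 0 0 M hd ltac:(lra) ltac:(lra) ltac:(lra)) as h1.
    pose proof (Cmod_CInt_tail_left f K c 0 (- M) 0 hd ltac:(lra) ltac:(lra) ltac:(lra)) as h2.
    rewrite Rmult_0_r, Ropp_0, exp_0, Rmult_1_r in h1, h2. lra. }
  pose proof (Cmod_triangle (l - CInt f (- M) M) (CInt f (- M) M)) as ht.
  replace (l - CInt f (- M) M + CInt f (- M) M)%C with l in ht by ring.
  replace (l - CInt f (- M) M)%C with (- (CInt f (- M) M - l))%C in ht by ring.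
  rewrite Cmod_opp in ht. lra.
Qed.

Lemma is_IR_ext (f g : R -> C) (l : C) : (forall t, f t = g t) -> is_IR f l -> is_IR g l.
Proof.
  intros e h eps he. destruct (h eps he) as [A hA]. exists A. intros a b ha hb.
  rewrite <- (CInt_ext f g) by auto. auto.
Qed.

Lemma is_IR_plus (f g : R -> C) (l m : C) :
  (forall t, ccont f t) -> (forall t, ccont g t) ->
  is_IR f l -> is_IR g m -> is_IR (fun t => f t + g t)%C (l + m).
Proof.
  intros cf cg hf hg eps he. destruct (hf (eps / 2)) as [A hA]; [lra |].
  destruct (hg (eps / 2)) as [A' hA']; [lra |].
  exists (Rmax A A'). intros a b ha hb.
  pose proof (Rmax_l A A'). pose proof (Rmax_r A A').
  specialize (hA a b ltac:(lra) ltac:(lra)). specialize (hA' a b ltac:(lra) ltac:(lra)).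
  rewrite CInt_plus by (apply ccont_on_all; auto).
  replace (CInt f a b + CInt g a b - (l + m))%C with ((CInt f a b - l) + (CInt g a b - m))%C by ring.
  eapply Rle_lt_trans; [apply Cmod_triangle |]. lra.
Qed.

Lemma is_IR_scal (k : C) (f : R -> C) (l : C) :
  (forall t, ccont f t) -> is_IR f l -> is_IR (fun t => k * f t)%C (k * l).
Proof.
  intros cf hf eps he. pose proof (Cmod_ge_0 k) as hk.
  destruct (hf (eps / (Cmod k + 1))) as [A hA]; [apply Rdiv_lt_0_compat; lra |].
  exists A. intros a b ha hb. specialize (hA a b ha hb).
  rewrite CInt_mult_l by (apply ccont_on_all; auto).
  replace (k * CInt f a b - k * l)%C with (k * (CInt f a b - l))%C by ring. rewrite Cmod_mult.
  assert (e : (Cmod k + 1) * (eps / (Cmod k + 1)) = eps) by (field; lra).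
  assert (0 < eps / (Cmod k + 1)) by (apply Rdiv_lt_0_compat; lra).
  apply Rle_lt_trans with (Cmod k * (eps / (Cmod k + 1))); [apply Rmult_le_compat_l; lra | lra].
Qed.

Lemma is_IR_minus (f g : R -> C) (l m : C) :
  (forall t, ccont f t) -> (forall t, ccont g t) ->
  is_IR f l -> is_IR g m -> is_IR (fun t => f t - g t)%C (l - m).
Proof.
  intros cf cg hf hg. replace (l - m)%C with (l + (- (1)) * m)%C by ring.
  apply (is_IR_ext (fun t => f t + (- (1)) * g t)%C); [intros; ring |].
  apply is_IR_plus; auto.
  - intros t. apply ccont_mult; [apply ccont_const | auto].
  - now apply is_IR_scal.
Qed.

Lemma is_IR_shift (f : R -> C) (v : R) (l : C) :
  (forall t, ccont f t) -> is_IR f l -> is_IR (fun t => f (t + v)) l.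
Proof.
  intros cf hf eps he. destruct (hf eps he) as [A hA]. exists (A + Rabs v). intros a b ha hb.
  rewrite CInt_shift by (apply ccont_on_all; auto).
  pose proof (Rle_abs v). pose proof (Rle_abs (- v)). rewrite Rabs_Ropp in *.
  apply hA; lra.
Qed.

Lemma decay_limits (F : R -> C) (K c : R) :
  decay F K c -> forall eps, 0 < eps -> exists A, forall t, A <= Rabs t -> Cmod (F t) < eps.
Proof.
  intros hd eps he. destruct (exp_small K c eps) as (A & hA & H); auto.
  - now apply (decay_K_nonneg F K c).
  - apply hd.
  - exists A. intros t ht. eapply Rle_lt_trans; [apply hd |]. now apply H.
Qed.

(** Integration by parts with vanishing boundary terms; it gives the recurrence of the Gamma
    function. *)
Lemma is_IR_derivative (F f : R -> C) (K c : R) :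
  (forall t, rder F t (f t)) -> (forall t, ccont f t) -> decay F K c -> is_IR f 0.
Proof.
  intros hF hf hd eps he. destruct (decay_limits F K c hd (eps / 2)) as [A hA]; [lra |].
  exists (Rmax 0 A). intros a b ha hb. pose proof (Rmax_l 0 A). pose proof (Rmax_r 0 A).
  rewrite (CInt_rder F f) by (auto; intros t _; apply hf).
  replace (F b - F a - 0)%C with (F b + - F a)%C by ring.
  eapply Rle_lt_trans; [apply Cmod_triangle |]. rewrite Cmod_opp.
  pose proof (hA b). pose proof (hA a). rewrite Rabs_pos_eq in H1 by lra. rewrite Rabs_left1 in H2 by lra.
  lra.
Qed.

Lemma decay_plus (f g : R -> C) (K L c : R) :
  decay f K c -> decay g L c -> decay (fun t => f t + g t)%C (K + L) c.
Proof.
  intros (h1 & h2 & h3) (k1 & _ & k3). split; [| split]; auto.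
  - intros t. now apply ccont_plus.
  - intros t. eapply Rle_trans; [apply Cmod_triangle |]. specialize (h3 t). specialize (k3 t). lra.
Qed.

Lemma decay_scal (k : C) (f : R -> C) (K c : R) :
  decay f K c -> decay (fun t => k * f t)%C (Cmod k * K) c.
Proof.
  intros (h1 & h2 & h3). split; [| split]; auto.
  - intros t. apply ccont_mult; [apply ccont_const | auto].
  - intros t. rewrite Cmod_mult, Rmult_assoc. apply Rmult_le_compat_l; [apply Cmod_ge_0 | auto].
Qed.

Lemma decay_psum (f : nat -> R -> C) (M : nat -> R) (c : R) (n : nat) :
  0 < c -> (forall k, decay (f k) (M k) c) -> decay (fun t => psum (fun k => f k t) n) (rpsum M n) c.
Proof.
  intros hc h. induction n as [|n IH]; simpl.
  - split; [intros t; apply ccont_const | split; auto]. intros t. rewrite Cmod_0. lra.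
  - now apply decay_plus.
Qed.

Lemma is_IR_psum (f : nat -> R -> C) (l : nat -> C) (M : nat -> R) (c : R) (n : nat) :
  0 < c -> (forall k, decay (f k) (M k) c) -> (forall k, is_IR (f k) (l k)) ->
  is_IR (fun t => psum (fun k => f k t) n) (psum l n).
Proof.
  intros hc h hl. induction n as [|n IH]; simpl.
  - apply (is_IR_derivative (fun _ => RtoC 0) _ 0 1).
    + intros t. apply rder_const.
    + intros t. apply ccont_const.
    + split; [intros t; apply ccont_const | split; [lra |]]. intros t. rewrite Cmod_0. lra.
  - apply is_IR_plus; auto.
    + apply (decay_psum f M c n hc h).
    + apply h.
Qed.

(** As all terms share the rate c, the remainder after n terms decays at the same rate with constant
    S minus the n-th partial sum of M, and its integral is at most 2/c times that constant. *)
Theorem is_IR_series (f : nat -> R -> C) (l : nat -> C) (M : nat -> R) (S c : R) (F : R -> C) :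
  (forall k, decay (f k) (M k) c) -> (forall k, is_IR (f k) (l k)) -> rsum M S ->
  (forall t, ccont F t) -> (forall t, Cser (fun k => f k t) (F t)) ->
  decay F S c /\ Cser l (IR F).
Proof.
  intros hd hl hM cF hF.
  assert (hc : 0 < c) by apply (hd 0%nat).
  assert (hMt : forall t, rsum (fun k => M k * exp (- (c * Rabs t))) (S * exp (- (c * Rabs t)))).
  { intros t. apply rsum_scal_r; [apply exp_ge_0 | exact hM]. }
  assert (hdF : decay F S c).
  { split; [| split]; auto. intros t.
    apply (Cser_Cmod_le (fun k => f k t) (fun k => M k * exp (- (c * Rabs t)))); auto.
    intros k. apply hd. }
  split; [exact hdF |].
  intros eps he. destruct hM as (m1 & m2 & m3) eqn:e; clear e.
  destruct (m3 (eps * c / 2)) as [N hN]; [nra |].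
  exists N. intros n hn.
  replace (psum l n - IR F)%C with (- (IR F - psum l n))%C by ring. rewrite Cmod_opp.
  eapply Rle_lt_trans.
  - apply (Cmod_is_IR_le (fun t => F t - psum (fun k => f k t) n)%C (S - rpsum M n) c).
    + split; [| split]; auto.
      * intros t. apply ccont_minus; auto. apply (decay_psum f M c n hc hd).
      * intros t.
        pose proof (Cser_tail (fun k => f k t) (fun k => M k * exp (- (c * Rabs t)))
                      (S * exp (- (c * Rabs t))) (F t) n (fun k => proj2 (proj2 (hd k)) t) (hMt t) (hF t)) as h.
        rewrite rpsum_scal_r in h. lra.
    + apply is_IR_minus; auto.
      * apply (decay_psum f M c n hc hd).
      * now apply (IR_correct F S c).
      * now apply (is_IR_psum f l M c n).
  - pose proof (rpsum_mono M N n m1 hn). 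
    apply (Rmult_lt_reg_r c); auto. replace (2 * (S - rpsum M n) / c * c) with (2 * (S - rpsum M n)) by (field; lra).
    lra.
Qed.

Lemma decay_two_sided (f : R -> C) (K c : R) :
  (forall t, ccont f t) -> 0 < c ->
  (forall t, 0 <= t -> Cmod (f t) <= K * exp (- (c * t))) ->
  (forall t, t <= 0 -> Cmod (f t) <= K * exp (c * t)) -> decay f K c.
Proof.
  intros h1 h2 h3 h4. split; [| split]; auto. intros t. destruct (Rle_dec 0 t) as [h|h].
  - rewrite Rabs_pos_eq by lra. auto.
  - rewrite Rabs_left by lra. replace (- (c * - t)) with (c * t) by ring. apply h4; lra.
Qed.

(** * Differentiation under the integral sign *)

Lemma sqr_le_exp (x : R) : 0 <= x -> x ^ 2 <= 4 * exp x.
Proof.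
  intros hx. replace (exp x) with (exp (x / 2) * exp (x / 2)) by (rewrite <- exp_plus; f_equal; field).
  pose proof (exp_ineq1_le (x / 2)). nra.
Qed.

Lemma ccont_Cexp_linear (s : C) (t : R) : ccont (fun t => Cexp (s * RtoC t)) t.
Proof. eapply rder_ccont, rder_Cexp, rder_linear. Qed.

(** The second-order remainder of exp(h t) is at most |h t|^2 exp(|h t|). For |h| < c/4 the factors
    t^2 and exp(|h t|) each cost a quarter of the rate, so the error integral is O(|h|^2). This
    yields the holomorphy of the Gamma, Mellin and two-Lorentzian integrals. *)
Theorem cder_IR_param (f : R -> C) (s : C) (K c : R) :
  (forall t, ccont f t) -> decay (fun t => f t * Cexp (s * RtoC t))%C K c ->
  exists l, cder (fun w => IR (fun t => f t * Cexp (w * RtoC t))%C) s l.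
Proof.
  intros cf hd. pose proof (decay_K_nonneg _ _ _ hd) as hK. destruct hd as (h1 & hc & h3).
  set (G := fun w => fun t => (f t * Cexp (w * RtoC t))%C).
  assert (cG : forall w t, ccont (G w) t).
  { intros w t. apply ccont_mult; [auto | apply ccont_Cexp_linear]. }
  set (D := fun t => (f t * Cexp (s * RtoC t) * RtoC t)%C).
  assert (cD : forall t, ccont D t).
  { intros t. apply ccont_mult; [apply (cG s) |]. apply (rder_ccont _ _ _ (rder_id t)). }
  assert (absorb : forall t, Rabs t ^ 2 <= 64 / c ^ 2 * exp (c / 4 * Rabs t)).
  { intros t. pose proof (sqr_le_exp (c / 4 * Rabs t)) as h.
    assert (0 <= c / 4 * Rabs t) by (apply Rmult_le_pos; [lra | apply Rabs_pos]). specialize (h H).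
    apply (Rmult_le_compat_l (16 / c ^ 2)) in h.
    - replace (16 / c ^ 2 * (c / 4 * Rabs t) ^ 2) with (Rabs t ^ 2) in h by (field; lra).
      eapply Rle_trans; [exact h |]. right. field. lra.
    - apply Rlt_le, Rdiv_lt_0_compat; [lra |]. now apply pow_lt. }
  assert (dD : decay D (K * (1 + 64 / c ^ 2)) (c / 2)).
  { split; [exact cD | split; [lra |]]. intros t. unfold D. rewrite Cmod_mult, Cmod_R.
    pose proof (Rabs_pos t) as ht.
    assert (h4 : Rabs t <= (1 + 64 / c ^ 2) * exp (c / 4 * Rabs t)).
    { specialize (absorb t). assert (h5 : Rabs t <= 1 + Rabs t ^ 2) by nra.
      assert (1 <= exp (c / 4 * Rabs t)) by (pose proof (exp_ineq1_le (c / 4 * Rabs t)); nra). lra. }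
    apply Rle_trans with (K * exp (- (c * Rabs t)) * ((1 + 64 / c ^ 2) * exp (c / 4 * Rabs t))).
    - apply Rmult_le_compat; auto. apply Cmod_ge_0.
    - replace (K * exp (- (c * Rabs t)) * ((1 + 64 / c ^ 2) * exp (c / 4 * Rabs t)))
        with (K * (1 + 64 / c ^ 2) * (exp (- (c * Rabs t)) * exp (c / 4 * Rabs t))) by ring.
      apply Rmult_le_compat_l.
      + assert (0 < 64 / c ^ 2) by (apply Rdiv_lt_0_compat; [lra | now apply pow_lt]). nra.
      + rewrite <- exp_plus. apply exp_mono. nra. }
  exists (IR D). intros eps he.
  (* Twice the constant 64 K / c^2 divided by the rate c/2 gives 256 K / c^3; the added 1 keeps [Q]
     positive. *)
  set (Q := 256 * K / c ^ 3 + 1).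
  assert (hQ : 0 < Q).
  { unfold Q. assert (0 <= 256 * K / c ^ 3); [| lra].
    apply Rmult_le_pos; [lra |]. apply Rlt_le, Rinv_0_lt_compat. now apply pow_lt. }
  exists (Rmin (c / 4) (eps / Q)). split; [apply Rmin_glb_lt; [lra | now apply Rdiv_lt_0_compat] |].
  intros w hw. set (h := (w - s)%C) in *.
  assert (hw1 : Cmod h < c / 4) by (eapply Rlt_le_trans; [exact hw | apply Rmin_l]).
  assert (hw2 : Cmod h < eps / Q) by (eapply Rlt_le_trans; [exact hw | apply Rmin_r]).
  pose proof (Cmod_ge_0 h) as hh0.
  assert (eG : forall t, G w t = (G s t * Cexp (h * RtoC t))%C).
  { intros t. unfold G. rewrite <- Cmult_assoc, <- Cexp_plus. do 2 f_equal. unfold h. ring. }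
  assert (hht : forall t, Cmod (h * RtoC t) <= c / 4 * Rabs t).
  { intros t. rewrite Cmod_mult, Cmod_R. apply Rmult_le_compat_r; [apply Rabs_pos | lra]. }
  assert (dGw : decay (G w) K (c / 2)).
  { split; [apply cG | split; [lra |]]. intros t. rewrite eG, Cmod_mult, Cmod_Cexp.
    apply Rle_trans with (K * exp (- (c * Rabs t)) * exp (c / 4 * Rabs t)).
    - apply Rmult_le_compat; [apply Cmod_ge_0 | apply exp_ge_0 | apply h3 |].
      apply exp_mono. eapply Rle_trans; [apply Rle_abs |]. eapply Rle_trans; [apply re_le_Cmod | apply hht].
    - rewrite Rmult_assoc, <- exp_plus. apply Rmult_le_compat_l; auto. apply exp_mono.
      pose proof (Rabs_pos t). nra. }
  assert (dGs : decay (G s) K c) by (split; [apply cG | split; auto]).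
  set (E := fun t => (G w t - G s t - h * D t)%C).
  assert (cE : forall t, ccont E t).
  { intros t. apply ccont_minus; [apply ccont_minus; apply cG |].
    apply ccont_mult; [apply ccont_const | apply cD]. }
  assert (dE : decay E (64 * K / c ^ 2 * Cmod h ^ 2) (c / 2)).
  { split; [exact cE | split; [lra |]]. intros t. unfold E.
    replace (G w t - G s t - h * D t)%C with (G s t * (Cexp (h * RtoC t) - 1 - h * RtoC t))%C
      by (rewrite eG; unfold D, G; ring).
    rewrite Cmod_mult.
    assert (h5 : Cmod (Cexp (h * RtoC t) - 1 - h * RtoC t)%C
                 <= Cmod h ^ 2 * (64 / c ^ 2 * exp (c / 4 * Rabs t)) * exp (c / 4 * Rabs t)).
    { eapply Rle_trans; [apply Cmod_Cexp_minus_2 |].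
      apply Rmult_le_compat; [apply pow2_ge_0 | apply exp_ge_0 | | apply exp_mono, hht].
      rewrite Cmod_mult, Cmod_R, Rpow_mult_distr. apply Rmult_le_compat_l; [apply pow2_ge_0 | apply absorb]. }
    eapply Rle_trans; [apply Rmult_le_compat; [apply Cmod_ge_0 | apply Cmod_ge_0 | apply h3 | exact h5] |].
    replace (K * exp (- (c * Rabs t)) * (Cmod h ^ 2 * (64 / c ^ 2 * exp (c / 4 * Rabs t)) * exp (c / 4 * Rabs t)))
      with (64 * K / c ^ 2 * Cmod h ^ 2 * (exp (- (c * Rabs t)) * exp (c / 4 * Rabs t) * exp (c / 4 * Rabs t)))
      by (field; lra).
    rewrite <- !exp_plus. right. do 2 f_equal. field. }
  assert (iE : is_IR E (IR (G w) - IR (G s) - h * IR D)%C).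
  { apply is_IR_minus.
    - intros t. apply ccont_minus; apply cG.
    - intros t. apply ccont_mult; [apply ccont_const | apply cD].
    - apply is_IR_minus; try apply cG; eapply IR_correct; eassumption.
    - apply is_IR_scal; [apply cD |]. eapply IR_correct; eassumption. }
  pose proof (Cmod_is_IR_le E _ _ _ dE iE) as hb.
  replace (IR D * h)%C with (h * IR D)%C by ring.
  eapply Rle_trans; [exact hb |].
  replace (2 * (64 * K / c ^ 2 * Cmod h ^ 2) / (c / 2)) with (256 * K / c ^ 3 * Cmod h * Cmod h) by (field; lra).
  apply Rmult_le_compat_r; auto.
  apply Rle_trans with (Q * (eps / Q)); [| right; field; lra].
  apply Rmult_le_compat; try lra. 
  apply Rmult_le_pos; [lra |]. apply Rlt_le, Rinv_0_lt_compat. now apply pow_lt.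
  unfold Q; lra.
Qed.

(** * The Gamma and Bessel integrals *)

(** The constant is (p/e)^p, the maximum of x^p exp(-x). *)
Lemma exp_neg_le (p : R) : 0 < p -> exists C, 0 < C /\ forall x, 0 < x -> exp (- x) <= C * Rpower x (- p).
Proof.
  intros hp. exists (exp (p * ln p - p)). split; [apply exp_pos |].
  intros x hx. unfold Rpower. rewrite <- exp_plus. apply exp_mono.
  assert (h : ln (x / p) <= x / p - 1).
  { pose proof (exp_ineq1_le (ln (x / p))) as h. rewrite exp_ln in h by (apply Rdiv_lt_0_compat; lra). lra. }
  unfold Rdiv in h at 1. rewrite ln_mult, ln_Rinv in h by (auto; apply Rinv_0_lt_compat; lra).
  apply (Rmult_le_compat_l p) in h; [| lra].
  replace (p * (x / p - 1)) with (x - p) in h by (field; lra). nra.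
Qed.

(** The double exponential falls at any chosen rate p to the right, and the power of a that comes
    with it later provides summability over a. *)
Lemma exp_neg_exp_le (p : R) : 0 < p -> exists C, 0 < C /\
  forall a t, 0 < a -> exp (- (a * exp t)) <= C * Rpower a (- p) * exp (- (p * t)).
Proof.
  intros hp. destruct (exp_neg_le p hp) as (C & hC & H). exists C. split; auto.
  intros a t ha. eapply Rle_trans; [apply H; apply Rmult_lt_0_compat; [auto | apply exp_pos] |].
  rewrite Rmult_assoc. apply Rmult_le_compat_l; [lra |]. right.
  rewrite <- Rpower_mult_distr by (auto; apply exp_pos). f_equal.
  unfold Rpower. rewrite ln_exp. f_equal. ring.
Qed.

Lemma ccont_exp_exp (a t : R) : ccont (fun t => RtoC (exp (- (a * exp t)))) t.
Proof.
  apply ccont_ex_derive. now auto_derive.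
Qed.

Lemma Cmod_Cexp_linear (s : C) (t : R) : Cmod (Cexp (s * RtoC t)) = exp (Re s * t).
Proof. rewrite Cmod_Cexp. f_equal. simpl. unfold Re. ring. Qed.

Lemma decay_gamma (s : C) : 0 < Re s -> exists K c, decay (fun t => RtoC (exp (- exp t)) * Cexp (s * RtoC t))%C K c.
Proof.
  intros hs. destruct (exp_neg_exp_le (Re s + 1)) as (C & hC & H); [lra |].
  exists (C + 1), (Rmin 1 (Re s)).
  assert (h1 : 0 < Rmin 1 (Re s)) by (apply Rmin_glb_lt; lra).
  pose proof (Rmin_l 1 (Re s)). pose proof (Rmin_r 1 (Re s)).
  apply decay_two_sided; auto.
  - intros t. apply ccont_mult; [| apply ccont_Cexp_linear].
    apply (@continuous_ext R_UniformSpace C_UniformSpace (fun t => RtoC (exp (- (1 * exp t))))).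
    + intros u. now rewrite Rmult_1_l.
    + apply ccont_exp_exp.
  - intros t ht. rewrite Cmod_mult, Cmod_Cexp_linear, Cmod_RtoC_pos by apply exp_ge_0.
    specialize (H 1 t Rlt_0_1). rewrite Rmult_1_l in H.
    replace (Rpower 1 (- (Re s + 1))) with 1 in H by (unfold Rpower; rewrite ln_1, Rmult_0_r, exp_0; auto).
    eapply Rle_trans; [apply Rmult_le_compat_r; [apply exp_ge_0 | exact H] |].
    rewrite Rmult_1_r, Rmult_assoc, <- exp_plus.
    apply Rmult_le_compat; try lra; [apply exp_ge_0 |]. apply exp_mono. nra.
  - intros t ht. rewrite Cmod_mult, Cmod_Cexp_linear, Cmod_RtoC_pos by apply exp_ge_0.
    apply Rmult_le_compat; try apply exp_ge_0.
    + apply Rle_trans with (exp 0); [apply exp_mono; pose proof (exp_pos t); lra | rewrite exp_0; lra].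
    + apply exp_mono. nra.
Qed.

(** Euler's integral after u = e^t; since du = u dt, the exponent is s and not s - 1. *)
Definition Gam (s : C) : C := IR (fun t => RtoC (exp (- exp t)) * Cexp (s * RtoC t))%C.

Lemma is_IR_Gam (s : C) : 0 < Re s -> is_IR (fun t => RtoC (exp (- exp t)) * Cexp (s * RtoC t))%C (Gam s).
Proof. intros hs. destruct (decay_gamma s hs) as (K & c & h). now apply (IR_correct _ K c). Qed.

Lemma ccont_exp_neg_exp (t : R) : ccont (fun t => RtoC (exp (- exp t))) t.
Proof.
  apply ccont_ex_derive. now auto_derive.
Qed.

Lemma cder_Gam (s : C) : 0 < Re s -> exists l, cder Gam s l.
Proof.
  intros hs. destruct (decay_gamma s hs) as (K & c & h).
  apply (cder_IR_param (fun t => RtoC (exp (- exp t))) s K c); auto. apply ccont_exp_neg_exp.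
Qed.

Lemma Gam_succ (s : C) : 0 < Re s -> Gam (s + 1) = (s * Gam s)%C.
Proof.
  intros hs. destruct (decay_gamma s hs) as (K & c & h).
  assert (hs1 : 0 < Re (s + 1)) by (simpl; unfold Re in hs; lra).
  set (F := fun t => (RtoC (exp (- exp t)) * Cexp (s * RtoC t))%C).
  assert (cF : forall t, ccont F t) by apply h.
  assert (cF1 : forall t, ccont (fun t => RtoC (exp (- exp t)) * Cexp ((s + 1) * RtoC t))%C t).
  { intros t. apply ccont_mult; [apply ccont_exp_neg_exp | apply ccont_Cexp_linear]. }
  set (G := fun t => (s * F t - RtoC (exp (- exp t)) * Cexp ((s + 1) * RtoC t))%C).
  assert (cG : forall t, ccont G t).
  { intros t. apply ccont_minus; auto. apply ccont_mult; [apply ccont_const | auto]. }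
  assert (h0 : is_IR G 0).
  { apply (is_IR_derivative F G K c); auto. intros t.
    eapply rder_eq; [| apply rder_mult; [apply (rder_RtoC (fun t => exp (- exp t)) t (- exp t * exp (- exp t))) |
      apply rder_Cexp, rder_linear]].
    - unfold G, F. replace ((s + 1) * RtoC t)%C with (s * RtoC t + RtoC t)%C by ring.
      rewrite Cexp_plus, Cexp_RtoC, RtoC_mult, RtoC_opp. ring.
    - auto_derive; auto. ring. }
  assert (h1 : is_IR G (s * Gam s - Gam (s + 1))%C).
  { apply is_IR_minus; auto.
    - intros t. apply ccont_mult; [apply ccont_const | auto].
    - apply is_IR_scal; auto. now apply is_IR_Gam.
    - now apply is_IR_Gam. }
  pose proof (is_IR_unique _ _ _ h0 h1) as e. symmetry in e.
  apply Ceq_minus in e. now symmetry.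
Qed.

Lemma is_IR_gamma_scaled (a : R) (s : C) :
  0 < a -> 0 < Re s -> is_IR (fun t => RtoC (exp (- (a * exp t))) * Cexp (s * RtoC t))%C (cpow a (- s) * Gam s).
Proof.
  intros ha hs.
  assert (cF : forall t, ccont (fun t => RtoC (exp (- exp t)) * Cexp (s * RtoC t))%C t).
  { intros t. apply ccont_mult; [apply ccont_exp_neg_exp | apply ccont_Cexp_linear]. }
  assert (h := is_IR_shift _ (ln a) _ cF (is_IR_Gam s hs)). cbv beta in h.
  apply (is_IR_scal (cpow a (- s))) in h.
  - eapply is_IR_ext; [| exact h]. intros t. cbv beta.
    rewrite exp_plus, exp_ln by assumption. rewrite RtoC_plus.
    replace (s * (RtoC t + RtoC (ln a)))%C with (s * RtoC t + s * RtoC (ln a))%C by ring.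
    rewrite Cexp_plus, cpow_opp. unfold cpow. rewrite (Rmult_comm (exp t)). field. apply Cexp_neq_0.
  - intros t. apply (ccont_comp (fun t => RtoC (exp (- exp t)) * Cexp (s * RtoC t))%C (fun t => t + ln a)); auto.
    apply continuous_ex_derive. now auto_derive.
Qed.

Lemma continuous_ln_pos (t : R) : 0 < t -> continuous ln t.
Proof.
  intros ht. apply continuous_ex_derive. auto_derive; auto.
Qed.

Lemma scal_RtoC (r : R) (z : C) : (scal (V := C_R_ModuleSpace) r z : C) = (RtoC r * z)%C.
Proof. destruct z. apply C_ext; simpl; unfold scal; simpl; unfold mult; simpl; ring. Qed.

(** Connects the improper integral over the half-line with the integral over the whole line, by
    substituting u = e^t on each compact interval. *)
Lemma GammaInt_Gam (s : C) : 0 < Re s -> GammaInt s = Gam s.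
Proof.
  intros hs. unfold GammaInt.
  set (f := fun t => (cpow t (s - 1) * RtoC (exp (- t)))%C).
  assert (cf : forall t, 0 < t -> ccont f t).
  { intros t ht. apply ccont_mult.
    - unfold cpow. apply ccont_Cexp, ccont_mult; [apply ccont_const |].
      now apply ccont_RtoC, continuous_ln_pos.
    - apply ccont_ex_derive. now auto_derive. }
  set (g := fun t => (RtoC (exp (- exp t)) * Cexp (s * RtoC t))%C).
  assert (sub : forall a b, 0 < a -> 0 < b -> is_RInt (V := C_R_NormedModule) f a b (CInt g (ln a) (ln b))).
  { intros a b ha hb.
    assert (hpos : forall t, Rmin a b <= t <= Rmax a b -> 0 < t).
    { intros t ht. apply Rlt_le_trans with (Rmin a b); [now apply Rmin_glb_lt | tauto]. }
    assert (h : is_RInt (V := C_R_NormedModule) (fun y => scal (exp y) (f (exp y))) (ln a) (ln b)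
                  (RInt (V := C_R_CompleteNormedModule) f (exp (ln a)) (exp (ln b)))).
    { apply (is_RInt_comp (V := C_R_CompleteNormedModule) f exp exp).
      - intros t _. apply cf, exp_pos.
      - intros t _. split; [apply is_derive_exp | apply continuous_exp]. }
    rewrite !exp_ln in h by assumption.
    replace (CInt g (ln a) (ln b)) with (CInt f a b).
    - apply is_CInt. intros t ht. apply cf. now apply hpos.
    - unfold CInt. rewrite <- (is_RInt_unique (V := C_R_CompleteNormedModule) _ _ _ _ h).
      apply (RInt_ext (V := C_R_CompleteNormedModule)). intros t _.
      unfold f, g. rewrite cpow_exp.
      etransitivity; [apply scal_RtoC |].
      match goal with |- ?u = ?v => change (@eq C u v) end.
      replace (s * RtoC t)%C with ((s - 1) * RtoC t + RtoC t)%C by ring.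
      rewrite Cexp_plus, Cexp_RtoC. ring. }
  apply (is_RInt_gen_unique (V := C_R_CompleteNormedModule)).
  intros P [eps hP].
  destruct (is_IR_Gam s hs eps (cond_pos eps)) as [A hA].
  (* In logarithms the two neighbourhoods read ln a <= -A and A <= ln b, as [is_IR] requires. *)
  apply (Filter_prod _ _ _ (fun a => 0 < a <= exp (- A)) (fun b => exp A <= b)).
  - exists (mkposreal (exp (- A)) (exp_pos _)). intros y hy h0. split; auto.
    change (Rabs (y - 0) < exp (- A)) in hy. rewrite Rminus_0_r, Rabs_pos_eq in hy; lra.
  - exists (exp A). intros y hy. lra.
  - intros a b [ha ha'] hb. simpl. pose proof (exp_pos A).
    exists (CInt g (ln a) (ln b)). split; [apply sub; lra |].
    apply hP. apply C_NormedModule_mixin_compat1. apply hA.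
    + rewrite <- (ln_exp (- A)). apply Rcomplements.ln_le; lra.
    + rewrite <- (ln_exp A). apply Rcomplements.ln_le; lra.
Qed.

Lemma decay_bessel (nu : C) (a b : R) :
  0 < a -> 0 < b ->
  exists K, decay (fun t => RtoC (exp (- (a * exp t) - b * exp (- t))) * Cexp (nu * RtoC t))%C K 1.
Proof.
  intros ha hb.
  set (p := Rabs (Re nu) + 1). assert (hp : 0 < p) by (unfold p; pose proof (Rabs_pos (Re nu)); lra).
  destruct (exp_neg_exp_le p hp) as (C & hC & H).
  exists (C * (Rpower a (- p) + Rpower b (- p))).
  pose proof (exp_pos (- p * ln a)) as e1. pose proof (exp_pos (- p * ln b)) as e2.
  fold (Rpower a (- p)) in e1. fold (Rpower b (- p)) in e2.
  apply decay_two_sided; [| lra | |].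
  - intros t. apply ccont_mult; [| apply ccont_Cexp_linear].
    apply ccont_ex_derive. now auto_derive.
  - intros t ht. rewrite Cmod_mult, Cmod_Cexp_linear, Cmod_RtoC_pos by apply exp_ge_0.
    apply Rle_trans with (C * Rpower a (- p) * exp (- (p * t)) * exp (Re nu * t)).
    + apply Rmult_le_compat_r; [apply exp_ge_0 |].
      eapply Rle_trans; [| apply H; exact ha]. apply exp_mono. pose proof (exp_pos (- t)). nra.
    + rewrite Rmult_assoc, <- exp_plus. apply Rmult_le_compat; [nra | apply exp_ge_0 | nra |].
      apply exp_mono. unfold p. pose proof (Rle_abs (Re nu)). nra.
  - intros t ht. rewrite Cmod_mult, Cmod_Cexp_linear, Cmod_RtoC_pos by apply exp_ge_0.
    apply Rle_trans with (C * Rpower b (- p) * exp (- (p * - t)) * exp (Re nu * t)).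
    + apply Rmult_le_compat_r; [apply exp_ge_0 |].
      eapply Rle_trans; [| apply H; exact hb]. apply exp_mono. pose proof (exp_pos t). nra.
    + rewrite Rmult_assoc, <- exp_plus. apply Rmult_le_compat; [nra | apply exp_ge_0 | nra |].
      apply exp_mono. unfold p. pose proof (Rle_abs (- Re nu)). rewrite Rabs_Ropp in H0. nra.
Qed.

(** Since y cosh t = (y/2)(e^t + e^(-t)) is even in t, the hyperbolic cosine of nu t may be unfolded
    into exp(nu t) over the whole line, which doubles the integral. *)
Lemma BesselK_IR (nu : C) (y : R) : 0 < y ->
  is_IR (fun t => RtoC (exp (- (y / 2 * exp t) - y / 2 * exp (- t))) * Cexp (nu * RtoC t))%C
    (2 * BesselK nu y)%C.
Proof.
  intros hy. set (g := fun t => (RtoC (exp (- (y / 2 * exp t) - y / 2 * exp (- t))) * Cexp (nu * RtoC t))%C).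
  destruct (decay_bessel nu (y / 2) (y / 2)) as (K & hd); try lra. fold g in hd.
  set (f := fun t => (RtoC (exp (- y * cosh t)) * Ccosh (nu * RtoC t))%C).
  assert (hfg : forall t, f t = (/ 2 * (g t + g (- t)%R))%C).
  { intros t. unfold f, g, Ccosh. rewrite Ropp_involutive.
    replace (- (y / 2 * exp (- t)) - y / 2 * exp t) with (- (y / 2 * exp t) - y / 2 * exp (- t)) by ring.
    replace (- y * cosh t) with (- (y / 2 * exp t) - y / 2 * exp (- t)) by (unfold cosh; field).
    rewrite RtoC_opp. replace (nu * - RtoC t)%C with (- (nu * RtoC t))%C by ring.
    field. }
  assert (hdr := decay_reflect g K 1 hd).
  assert (cg : forall t, ccont g t) by apply hd.
  assert (cg' : forall t, ccont (fun t => g (- t)) t) by apply hdr.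
  assert (half : forall b, is_RInt (V := C_R_NormedModule) f 0 b (/ 2 * CInt g (- b) b)%C).
  { intros b.
    assert (cf : ccont_on f 0 b).
    { intros t _. apply (@continuous_ext R_UniformSpace C_UniformSpace (fun t => / 2 * (g t + g (- t)%R))%C).
      - intros u. symmetry. apply hfg.
      - apply ccont_mult; [apply ccont_const | apply ccont_plus; auto]. }
    replace (/ 2 * CInt g (- b) b)%C with (CInt f 0 b); [now apply is_CInt |].
    rewrite (CInt_ext f (fun t => / 2 * (g t + g (- t)%R))%C) by auto.
    rewrite CInt_mult_l by (intros t _; apply ccont_plus; auto).
    rewrite CInt_plus by (intros t _; auto).
    rewrite CInt_reflect by (intros t _; auto). rewrite Ropp_0.
    rewrite <- (CInt_Chasles g (- b) 0 b) by (intros t _; auto).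
    rewrite (CInt_swap g (- b) 0) by (intros t _; auto). ring. }
  assert (hg := IR_correct g K 1 hd).
  replace (2 * BesselK nu y)%C with (IR g); [exact hg |].
  replace (BesselK nu y) with (/ 2 * IR g)%C; [field; apply C2_neq_0 |].
  symmetry. unfold BesselK. fold f.
  apply (is_RInt_gen_unique (V := C_R_CompleteNormedModule)).
  intros P [eps hP].
  destruct (hg eps (cond_pos eps)) as [A hA].
  apply (Filter_prod _ _ _ (fun a => a = 0) (fun b => A <= b)).
  - reflexivity.
  - exists A. intros b hb. lra.
  - intros a b -> hb. simpl. exists (/ 2 * CInt g (- b) b)%C. split; [apply half |].
    apply hP. apply C_NormedModule_mixin_compat1.
    change (Cmod (/ 2 * CInt g (- b) b - / 2 * IR g) < eps).
    replace (/ 2 * CInt g (- b) b - / 2 * IR g)%C with (/ 2 * (CInt g (- b) b - IR g))%C by ring.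
    rewrite Cmod_mult, Cmod_inv, Cmod_RtoC_pos by (try apply C2_neq_0; lra).
    specialize (hA (- b) b ltac:(lra) hb). pose proof (Cmod_ge_0 (CInt g (- b) b - IR g)). lra.
Qed.

(** The shift by v with e^(2v) = a/b gives both exponentials the same coefficient sqrt(a b) and
    contributes the power (b/a)^(nu/2). *)
Lemma is_IR_bessel (nu : C) (a b : R) : 0 < a -> 0 < b ->
  is_IR (fun t => RtoC (exp (- (a * exp t) - b * exp (- t))) * Cexp (nu * RtoC t))%C
    (2 * cpow (b / a) (nu / 2) * BesselK nu (2 * sqrt (a * b)))%C.
Proof.
  intros ha hb. set (y := 2 * sqrt (a * b)).
  assert (hab : 0 < a * b) by now apply Rmult_lt_0_compat.
  assert (hsq : 0 < sqrt (a * b)) by now apply sqrt_lt_R0.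
  assert (hy : 0 < y) by (unfold y; lra).
  assert (hba : 0 < b / a) by now apply Rdiv_lt_0_compat.
  set (v := - (ln (b / a) / 2)).
  destruct (decay_bessel nu (y / 2) (y / 2)) as (K & hd); try lra.
  assert (cg : forall t, ccont (fun t => RtoC (exp (- (y / 2 * exp t) - y / 2 * exp (- t))) * Cexp (nu * RtoC t))%C t)
    by apply hd.
  assert (h := is_IR_shift _ v _ cg (BesselK_IR nu y hy)). cbv beta in h.
  assert (hv : exp (2 * v) = a / b).
  { unfold v. replace (2 * - (ln (b / a) / 2)) with (- ln (b / a)) by field.
    rewrite exp_Ropp, exp_ln by assumption. field. lra. }
  assert (hv1 : exp v = sqrt (a / b)).
  { rewrite <- hv. replace (2 * v) with (v + v) by ring. rewrite exp_plus.
    rewrite sqrt_square; auto. apply exp_ge_0. }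
  assert (e1 : y / 2 * exp v = a).
  { rewrite hv1. unfold y. replace (2 * sqrt (a * b) / 2) with (sqrt (a * b)) by field.
    rewrite <- sqrt_mult_alt by lra. replace (a * b * (a / b)) with (a * a) by (field; lra).
    apply sqrt_square. lra. }
  assert (e2 : y / 2 * exp (- v) = b).
  { rewrite exp_Ropp. apply (Rmult_eq_reg_r (exp v)); [| apply Rgt_not_eq, exp_pos].
    rewrite Rmult_assoc, Rinv_l, Rmult_1_r by (apply Rgt_not_eq, exp_pos).
    rewrite hv1. unfold y. replace (2 * sqrt (a * b) / 2) with (sqrt (a * b)) by field.
    replace (a * b) with (a / b * (b * b)) by (field; lra).
    assert (0 < a / b) by now apply Rdiv_lt_0_compat.
    rewrite sqrt_mult_alt, sqrt_square by lra. ring. }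
  apply (is_IR_scal (cpow (b / a) (nu / 2))) in h.
  - replace (2 * cpow (b / a) (nu / 2) * BesselK nu y)%C with (cpow (b / a) (nu / 2) * (2 * BesselK nu y))%C by ring.
    eapply is_IR_ext; [| exact h]. intros t. cbv beta.
    rewrite exp_plus. replace (- (t + v)) with (- t + - v) by ring. rewrite exp_plus.
    replace (y / 2 * (exp t * exp v)) with (a * exp t) by (rewrite <- e1 at 1; ring).
    replace (y / 2 * (exp (- t) * exp (- v))) with (b * exp (- t)) by (rewrite <- e2 at 1; ring).
    rewrite RtoC_plus. replace (nu * (RtoC t + RtoC v))%C with (nu * RtoC t + nu * RtoC v)%C by ring.
    rewrite Cexp_plus. unfold cpow, v.
    replace (nu * RtoC (- (ln (b / a) / 2)))%C with (- (nu / 2 * RtoC (ln (b / a))))%C.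
    + rewrite Cexp_opp. field. apply Cexp_neq_0.
    + rewrite RtoC_opp, RtoC_div by lra. field; apply C2_neq_0.
  - intros t. apply (ccont_comp (fun t => RtoC (exp (- (y / 2 * exp t) - y / 2 * exp (- t))) * Cexp (nu * RtoC t))%C
                       (fun t => t + v)); auto.
    apply continuous_ex_derive. now auto_derive.
Qed.

(** * The reflection integral *)

(** The quotient (e^(cw) - 1) / w with its removable singularity at 0 filled in. *)
Definition expm1_div (c w : C) : C :=
  if excluded_middle_informative (w = RtoC 0) then c else ((Cexp (c * w) - 1) / w)%C.

Lemma expm1_div_0 (c : C) : expm1_div c 0 = c.
Proof. unfold expm1_div. destruct excluded_middle_informative as [h|h]; auto. now elim h. Qed.

Lemma expm1_div_neq (c w : C) : w <> RtoC 0 -> expm1_div c w = ((Cexp (c * w) - 1) / w)%C.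
Proof. intros hw. unfold expm1_div. destruct excluded_middle_informative as [h|h]; auto. now elim hw. Qed.

(** At 0 the third-order remainder of the exponential gives the derivative c^2 / 2; elsewhere the
    quotient rule applies. *)
Lemma cder_expm1_div (c w : C) : exists l, cder (expm1_div c) w l.
Proof.
  destruct (classic (w = RtoC 0)) as [-> | hw].
  - exists (c * c / 2)%C. intros eps he.
    pose proof (Cmod_ge_0 c) as hc.
    set (Q := Cmod c ^ 3 * exp (Cmod c)).
    assert (hQ : 0 <= Q) by (apply Rmult_le_pos; [now apply pow_le | apply exp_ge_0]).
    exists (Rmin 1 (eps / (Q + 1))). split; [apply Rmin_glb_lt; [lra | apply Rdiv_lt_0_compat; lra] |].
    intros w hw. rewrite expm1_div_0.
    replace (w - 0)%C with w in * by ring.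
    assert (h1 : Cmod w < 1) by (eapply Rlt_le_trans; [exact hw | apply Rmin_l]).
    assert (h2 : Cmod w < eps / (Q + 1)) by (eapply Rlt_le_trans; [exact hw | apply Rmin_r]).
    destruct (classic (w = RtoC 0)) as [-> | h0].
    + rewrite expm1_div_0. replace (c - c - c * c / 2 * 0)%C with (RtoC 0) by (field; auto using C2_neq_0).
      rewrite !Cmod_0. lra.
    + rewrite expm1_div_neq by assumption.
      assert (hw0 : 0 < Cmod w) by now apply Cmod_gt_0.
      replace ((Cexp (c * w) - 1) / w - c - c * c / 2 * w)%C
        with ((Cexp (c * w) - 1 - c * w - c * w * (c * w) / 2) / w)%C by (field; auto using C2_neq_0).
      rewrite Cmod_div by assumption.
      assert (h3 : Cmod (Cexp (c * w) - 1 - c * w - c * w * (c * w) / 2)%C <= Q * Cmod w ^ 3).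
      { eapply Rle_trans; [apply Cmod_Cexp_minus_3 |]. rewrite Cmod_mult, Rpow_mult_distr. unfold Q.
        replace (Cmod c ^ 3 * exp (Cmod c) * Cmod w ^ 3) with (Cmod c ^ 3 * Cmod w ^ 3 * exp (Cmod c)) by ring.
        apply Rmult_le_compat_l; [apply Rmult_le_pos; apply pow_le; lra |]. apply exp_mono. nra. }
      apply (Rmult_le_reg_r (Cmod w)); auto.
      replace (Cmod (Cexp (c * w) - 1 - c * w - c * w * (c * w) / 2)%C / Cmod w * Cmod w)
        with (Cmod (Cexp (c * w) - 1 - c * w - c * w * (c * w) / 2)%C) by (field; lra).
      eapply Rle_trans; [exact h3 |].
      assert (h4 : Q * Cmod w <= eps).
      { apply Rle_trans with ((Q + 1) * (eps / (Q + 1))); [| right; field; lra].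
        apply Rmult_le_compat; lra. }
      replace (Q * Cmod w ^ 3) with (Q * Cmod w * (Cmod w * Cmod w)) by ring.
      rewrite (Rmult_assoc eps). apply Rmult_le_compat_r; nra.
  - eexists. apply (cder_ext (fun w => (Cexp (c * w) - 1) * / w)%C _ _ _ (Cmod w)).
    + now apply Cmod_gt_0.
    + intros v hv. rewrite expm1_div_neq; [reflexivity |]. intros ->.
      replace (0 - w)%C with (- w)%C in hv by ring. rewrite Cmod_opp in hv. lra.
    + apply (cder_mult (fun w => Cexp (c * w) - 1)%C (fun w => / w)%C).
      * apply cder_minus; [apply cder_Cexp, cder_scal, cder_id | apply cder_const].
      * now apply cder_inv_id.
Qed.

Lemma cos_eq_1_small (th : R) : Rabs th <= PI -> cos th = 1 -> th = 0.
Proof.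
  intros h hc. apply NNPP. intros h0.
  assert (hpos : 0 < Rabs th) by now apply Rabs_pos_lt.
  assert (hc' : cos (Rabs th) = 1).
  { unfold Rabs. destruct Rcase_abs; [now rewrite cos_neg | exact hc]. }
  pose proof PI_RGT_0.
  assert (cos (Rabs th) < cos 0) by (apply cos_decreasing_1; lra). rewrite cos_0 in H0. lra.
Qed.

(** If e^(2w) = 1 then Re w = 0 and cos(Im 2w) = 1; as |Im 2w| <= pi this leaves w = 0, where the
    filled-in value is 2. *)
Lemma expm1_div_2_neq_0 (w : C) : Rabs (Im w) <= PI / 2 -> expm1_div 2 w <> RtoC 0.
Proof.
  intros hw. destruct (classic (w = RtoC 0)) as [-> | h0].
  - rewrite expm1_div_0. apply C2_neq_0.
  - rewrite expm1_div_neq by assumption. intros e.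
    assert (h1 : Cexp (2 * w) = RtoC 1).
    { apply Ceq_minus. replace (Cexp (2 * w) - 1)%C with ((Cexp (2 * w) - 1) / w * w)%C by (field; auto).
      rewrite e. ring. }
    assert (hm : Cmod (Cexp (2 * w)) = 1) by (rewrite h1; apply Cmod_1).
    rewrite Cmod_Cexp in hm.
    assert (hre : Re (2 * w) = 0) by (apply exp_inv; rewrite exp_0; exact hm).
    assert (hcos : cos (Im (2 * w)) = 1).
    { assert (hr : Re (Cexp (2 * w)) = 1) by (rewrite h1; reflexivity).
      unfold Cexp in hr. cbn [Re fst] in hr. rewrite hm, Rmult_1_l in hr. exact hr. }
    destruct w as [a b]. simpl in hre, hcos, hw.
    apply h0. apply cos_eq_1_small in hcos.
    + apply C_ext; simpl; lra.
    + replace (2 * b + 0 * a) with (2 * b) by ring. rewrite Rabs_mult, (Rabs_pos_eq 2) by lra. lra.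
Qed.

(** This is (e^(sw) - e^w) / (1 - e^(2w)). Subtracting e^w removes the pole at 0, the only zero of
    the denominator in the strip |Im w| <= pi/2. *)
Definition reflection_kernel (s w : C) : C :=
  (- (Cexp w * expm1_div (s - 1) w * / expm1_div 2 w))%C.

Lemma cder_reflection_kernel (s w : C) : Rabs (Im w) <= PI / 2 -> exists l, cder (reflection_kernel s) w l.
Proof.
  intros hw. destruct (cder_expm1_div (s - 1) w) as [l1 h1]. destruct (cder_expm1_div 2 w) as [l2 h2].
  eexists. unfold reflection_kernel. apply cder_opp.
  apply (cder_mult (fun w => Cexp w * expm1_div (s - 1) w)%C (fun w => / expm1_div 2 w)%C).
  - apply (cder_mult Cexp (expm1_div (s - 1))); [apply cder_Cexp_id | exact h1].
  - apply cder_inv; [now apply expm1_div_2_neq_0 | exact h2].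
Qed.

Lemma reflection_kernel_eq (s w : C) : Cexp (2 * w) <> RtoC 1 ->
  reflection_kernel s w = ((Cexp (s * w) - Cexp w) / (1 - Cexp (2 * w)))%C.
Proof.
  intros h. assert (h0 : w <> RtoC 0).
  { intros ->. apply h. rewrite Cmult_0_r. apply Cexp_0. }
  assert (h1 : (Cexp (2 * w) - 1)%C <> RtoC 0) by (intros e; apply h; now apply Ceq_minus).
  assert (h2 : (1 - Cexp (2 * w))%C <> RtoC 0) by (intros e; apply h; symmetry; now apply Ceq_minus).
  unfold reflection_kernel. rewrite !expm1_div_neq by assumption.
  replace (s * w)%C with (w + (s - 1) * w)%C by ring. rewrite Cexp_plus. field. auto.
Qed.

(** Integrand of the classical integral of u^(s-1) / (1 + u^2) over u > 0, at u = e^t. *)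
Definition refl_int (s : C) (t : R) : C := (Cexp (s * RtoC t) * RtoC (/ (1 + exp (2 * t))))%C.

Lemma ccont_refl_int (s : C) (t : R) : ccont (refl_int s) t.
Proof.
  apply ccont_mult; [apply ccont_Cexp_linear |].
  apply ccont_ex_derive.
  auto_derive; auto. pose proof (exp_pos (2 * t)). lra.
Qed.

Lemma decay_refl_int (s : C) : 0 < Re s < 2 -> decay (refl_int s) 1 (Rmin (Re s) (2 - Re s)).
Proof.
  intros hs. pose proof (Rmin_l (Re s) (2 - Re s)). pose proof (Rmin_r (Re s) (2 - Re s)).
  apply decay_two_sided.
  - intros t. apply ccont_refl_int.
  - apply Rmin_glb_lt; lra.
  - intros t ht. pose proof (exp_pos (2 * t)) as he. unfold refl_int.
    rewrite Cmod_mult, Cmod_Cexp_linear, Cmod_RtoC_pos by (apply Rlt_le, Rinv_0_lt_compat; lra).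
    apply Rle_trans with (exp (Re s * t) * / exp (2 * t)).
    + apply Rmult_le_compat_l; [apply exp_ge_0 |]. apply Rinv_le_contravar; lra.
    + rewrite <- exp_Ropp, <- exp_plus, Rmult_1_l. apply exp_mono. nra.
  - intros t ht. pose proof (exp_pos (2 * t)) as he. unfold refl_int.
    rewrite Cmod_mult, Cmod_Cexp_linear, Cmod_RtoC_pos by (apply Rlt_le, Rinv_0_lt_compat; lra).
    apply Rle_trans with (exp (Re s * t) * / 1).
    + apply Rmult_le_compat_l; [apply exp_ge_0 |]. apply Rinv_le_contravar; lra.
    + rewrite Rinv_1, Rmult_1_r, Rmult_1_l. apply exp_mono. nra.
Qed.

Lemma atan_le_id (y : R) : 0 <= y -> 0 <= atan y <= y.
Proof.
  intros [hy | <-]; [| rewrite atan_0; lra].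
  destruct (MVT_cor2 atan (fun x => / (1 + x ^ 2)) 0 y hy) as (c & e & hc).
  - intros c _. apply derivable_pt_lim_atan.
  - rewrite atan_0 in e.
    assert (h1 : 0 < / (1 + c ^ 2)) by (apply Rinv_0_lt_compat; nra).
    assert (h2 : / (1 + c ^ 2) <= / 1) by (apply Rinv_le_contravar; nra). rewrite Rinv_1 in h2. nra.
Qed.

Lemma is_IR_refl_int_1 : is_IR (refl_int 1) (RtoC (PI / 2)).
Proof.
  intros eps he. destruct (exp_small 1 1 (eps / 2)) as (A & hA & H); try lra.
  exists A. intros a b ha hb.
  rewrite (CInt_rder (fun t => RtoC (atan (exp t)))).
  - rewrite <- !RtoC_minus, Cmod_R.
    assert (h1 : atan (exp b) = PI / 2 - atan (exp (- b))).
    { rewrite exp_Ropp, atan_inv by apply exp_pos. lra. }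
    pose proof (atan_le_id (exp (- b)) (Rlt_le _ _ (exp_pos _))).
    pose proof (atan_le_id (exp a) (Rlt_le _ _ (exp_pos _))).
    assert (k1 : exp (- b) < eps / 2).
    { specialize (H b ltac:(lra)). rewrite !Rmult_1_l in H. exact H. }
    assert (k2 : exp a < eps / 2).
    { specialize (H (- a) ltac:(lra)). rewrite !Rmult_1_l, Ropp_involutive in H. exact H. }
    rewrite h1. apply Rabs_def1; lra.
  - intros t _. unfold refl_int. rewrite Cmult_1_l, Cexp_RtoC, <- RtoC_mult.
    apply rder_RtoC. auto_derive; auto.
    replace (2 * t) with (t + t) by ring. rewrite exp_plus. field.
    pose proof (exp_pos t). nra.
  - intros t _. apply ccont_refl_int.
Qed.

Lemma Cexp_iPI2 : Cexp (Ci * RtoC (PI / 2)) = Ci.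
Proof.
  unfold Cexp. simpl. replace (0 * (PI / 2) - 1 * 0) with 0 by ring.
  replace (0 * 0 + 1 * (PI / 2)) with (PI / 2) by ring.
  rewrite exp_0, cos_PI2, sin_PI2. apply C_ext; simpl; ring.
Qed.

Lemma Ci_neq_0 : Ci <> RtoC 0.
Proof. intros h. injection h. lra. Qed.

Lemma Ci_sqr : (Ci * Ci)%C = (- (1))%C.
Proof. apply C_ext; simpl; ring. Qed.

Lemma refl_int_neq (t : R) : (1 + RtoC (exp (2 * t)))%C <> RtoC 0.
Proof. rewrite <- RtoC_plus. apply RtoC_neq_0. pose proof (exp_pos (2 * t)). lra. Qed.

(** On the lines Im w = pi/2 and Im w = -pi/2 one has e^(2w) = -e^(2t), so the denominator becomes 1
    + e^(2t). *)
Lemma reflection_kernel_side (s : C) (e t : R) : e = 1 \/ e = -1 ->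
  reflection_kernel s (t, e * (PI / 2))
  = (Cexp (RtoC e * (Ci * (RtoC PI * s / 2))) * refl_int s t - RtoC e * Ci * refl_int 1 t)%C.
Proof.
  intros he. set (w := (t, e * (PI / 2)) : C).
  assert (hw : w = (RtoC t + RtoC e * (Ci * RtoC (PI / 2)))%C) by (apply C_ext; simpl; ring).
  assert (h1 : Cexp (RtoC e * (Ci * RtoC (PI / 2))) = (RtoC e * Ci)%C).
  { destruct he as [-> | ->].
    - now rewrite !Cmult_1_l, Cexp_iPI2.
    - replace (-1 * (Ci * RtoC (PI / 2)))%C with (- (Ci * RtoC (PI / 2)))%C by ring.
      rewrite Cexp_opp, Cexp_iPI2. apply C_ext; simpl; field. }
  assert (hee : (RtoC e * RtoC e)%C = RtoC 1) by (rewrite <- RtoC_mult; destruct he as [-> | ->]; f_equal; ring).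
  assert (h2 : Cexp (2 * w) = (- RtoC (exp (2 * t)))%C).
  { rewrite hw. replace (2 * (RtoC t + RtoC e * (Ci * RtoC (PI / 2))))%C
      with (RtoC (2 * t) + (RtoC e * (Ci * RtoC (PI / 2)) + RtoC e * (Ci * RtoC (PI / 2))))%C
      by (rewrite RtoC_mult; ring).
    rewrite !Cexp_plus, h1, Cexp_RtoC.
    replace (RtoC e * Ci * (RtoC e * Ci))%C with ((RtoC e * RtoC e) * (Ci * Ci))%C by ring.
    rewrite hee, Ci_sqr. ring. }
  rewrite reflection_kernel_eq.
  2:{ rewrite h2. intros h. apply (f_equal fst) in h. simpl in h. pose proof (exp_pos (2 * t)). lra. }
  rewrite h2. unfold refl_int.
  replace (s * w)%C with (s * RtoC t + RtoC e * (Ci * (RtoC PI * s / 2)))%C.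
  2:{ rewrite hw, RtoC_div by lra. field. }
  replace (Cexp w) with (Cexp (RtoC t) * (RtoC e * Ci))%C by (rewrite <- h1, <- Cexp_plus; now rewrite <- hw).
  rewrite Cexp_plus, Cmult_1_l.
  pose proof (refl_int_neq t) as hn.
  rewrite RtoC_inv, RtoC_plus by (pose proof (exp_pos (2 * t)); lra). field.
  exact hn.
Qed.

(** Makes the vertical sides of the contour negligible: for |x| >= 1 the denominator has modulus at
    least half of max(1, e^(2x)). *)
Lemma reflection_kernel_far (s : C) (x y : R) : 0 < Re s < 2 -> 1 <= Rabs x -> Rabs y <= PI / 2 ->
  Cmod (reflection_kernel s (x, y))
  <= 2 * (exp (Rabs (Im s) * (PI / 2)) + 1) * exp (- (Rmin 1 (Rmin (Re s) (2 - Re s)) * Rabs x)).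
Proof.
  intros hs hx hy. set (d := Rmin 1 (Rmin (Re s) (2 - Re s))).
  assert (hd : 0 < d /\ d <= 1 /\ d <= Re s /\ d <= 2 - Re s).
  { unfold d. pose proof (Rmin_l 1 (Rmin (Re s) (2 - Re s))). pose proof (Rmin_r 1 (Rmin (Re s) (2 - Re s))).
    pose proof (Rmin_l (Re s) (2 - Re s)). pose proof (Rmin_r (Re s) (2 - Re s)).
    repeat split; try lra. repeat apply Rmin_glb_lt; lra. }
  set (w := (x, y) : C).
  assert (hm2 : Cmod (Cexp (2 * w)) = exp (2 * x)).
  { rewrite Cmod_Cexp. f_equal. simpl. ring. }
  assert (hms : Cmod (Cexp (s * w)) <= exp (Rabs (Im s) * (PI / 2)) * exp (Re s * x)).
  { rewrite Cmod_Cexp, <- exp_plus. apply exp_mono. simpl. unfold Re, Im.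
    assert (Rabs (snd s * y) <= Rabs (snd s) * (PI / 2)).
    { rewrite Rabs_mult. apply Rmult_le_compat_l; [apply Rabs_pos | exact hy]. }
    apply Rabs_le_between in H. lra. }
  assert (hm1 : Cmod (Cexp w) = exp x) by (rewrite Cmod_Cexp; reflexivity).
  assert (hE : 0 <= exp (Rabs (Im s) * (PI / 2))) by apply exp_ge_0.
  assert (hnum : Cmod (Cexp (s * w) - Cexp w)%C
                 <= exp (Rabs (Im s) * (PI / 2)) * exp (Re s * x) + exp x).
  { unfold Cminus. eapply Rle_trans; [apply Cmod_triangle |]. rewrite Cmod_opp. lra. }
  assert (hexp2 : 2 <= exp 2) by (pose proof (exp_ineq1_le 2); lra).
  assert (hden : Rmax 1 (exp (2 * x)) / 2 <= Cmod (1 - Cexp (2 * w))%C).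
  { unfold Rabs in hx. destruct (Rcase_abs x) as [hx0|hx0].
    - assert (he : exp (2 * x) <= / 2).
      { apply Rle_trans with (/ exp 2); [rewrite <- exp_Ropp; apply exp_mono; lra |].
        apply Rinv_le_contravar; lra. }
      rewrite Rmax_left by lra.
      pose proof (Cmod_triangle (1 - Cexp (2 * w)) (Cexp (2 * w))) as ht.
      replace (1 - Cexp (2 * w) + Cexp (2 * w))%C with (RtoC 1) in ht by ring.
      rewrite Cmod_1, hm2 in ht. lra.
    - assert (he : 2 <= exp (2 * x)).
      { apply Rle_trans with (exp 2); [lra | apply exp_mono; lra]. }
      rewrite Rmax_right by lra.
      pose proof (Cmod_triangle (- (1 - Cexp (2 * w))) 1) as ht.
      replace (- (1 - Cexp (2 * w)) + 1)%C with (Cexp (2 * w)) in ht by ring.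
      rewrite Cmod_1, hm2, Cmod_opp in ht. lra. }
  assert (hmax : 1 <= Rmax 1 (exp (2 * x))) by apply Rmax_l.
  assert (hw1 : Cexp (2 * w) <> RtoC 1).
  { intros e. rewrite e in hden. replace (1 - 1)%C with (RtoC 0) in hden by ring. rewrite Cmod_0 in hden. lra. }
  rewrite reflection_kernel_eq by exact hw1.
  assert (hd0 : (1 - Cexp (2 * w))%C <> RtoC 0) by (apply Cmod_gt_0; lra).
  rewrite Cmod_div by exact hd0.
  apply Rle_trans with ((exp (Rabs (Im s) * (PI / 2)) * exp (Re s * x) + exp x) * (2 * / Rmax 1 (exp (2 * x)))).
  - apply Rmult_le_compat; [apply Cmod_ge_0 | apply Rlt_le, Rinv_0_lt_compat; lra | exact hnum |].
    replace (2 * / Rmax 1 (exp (2 * x))) with (/ (Rmax 1 (exp (2 * x)) / 2)) by (field; lra).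
    apply Rinv_le_contravar; lra.
  - assert (hb : forall p, d <= p -> d <= 2 - p -> exp (p * x) * / Rmax 1 (exp (2 * x)) <= exp (- (d * Rabs x))).
    { intros p hp1 hp2. unfold Rabs in *. destruct (Rcase_abs x) as [hx0|hx0].
      - apply Rle_trans with (exp (p * x) * / 1).
        + apply Rmult_le_compat_l; [apply exp_ge_0 |]. apply Rinv_le_contravar; lra.
        + rewrite Rinv_1, Rmult_1_r. apply exp_mono. nra.
      - apply Rle_trans with (exp (p * x) * / exp (2 * x)).
        + apply Rmult_le_compat_l; [apply exp_ge_0 |]. apply Rinv_le_contravar; [apply exp_pos | apply Rmax_r].
        + rewrite <- exp_Ropp, <- exp_plus. apply exp_mono. nra. }
    pose proof (hb (Re s) ltac:(lra) ltac:(lra)) as b1.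
    pose proof (hb 1 ltac:(lra) ltac:(lra)) as b2. rewrite Rmult_1_l in b2.
    set (m := / Rmax 1 (exp (2 * x))) in *.
    replace ((exp (Rabs (Im s) * (PI / 2)) * exp (Re s * x) + exp x) * (2 * m))
      with (2 * (exp (Rabs (Im s) * (PI / 2)) * (exp (Re s * x) * m) + exp x * m)) by ring.
    rewrite Rmult_assoc. apply Rmult_le_compat_l; [lra |]. rewrite Rmult_plus_distr_r, Rmult_1_l.
    apply Rplus_le_compat; auto. apply Rmult_le_compat_l; auto.
Qed.

Lemma Csin_alt (z : C) : (Cexp (Ci * z) - Cexp (- (Ci * z)))%C = (2 * Ci * Csin z)%C.
Proof. unfold Csin. change Defs.Ci with Ci. field; auto using Ci_neq_0, C2_neq_0. Qed.

(** Goursat's theorem for [reflection_kernel] on [-R, R] x [-pi/2, pi/2]. Write I(s) for the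
    integral of [refl_int s]: the bottom side minus the top side tends to 2i (I(1) - sin(pi s/2)
    I(s)), the vertical sides vanish in the limit, and I(1) = pi/2 is an arctangent. *)
Theorem reflection_integral (s : C) : 0 < Re s < 2 ->
  (Csin (RtoC PI * s / 2) * IR (refl_int s))%C = RtoC (PI / 2).
Proof.
  intros hs. pose proof PI_RGT_0 as hpi.
  set (S := Csin (RtoC PI * s / 2)).
  set (h := fun t => (2 * Ci * refl_int 1 t - 2 * Ci * S * refl_int s t)%C).
  assert (ch : forall t, ccont h t).
  { intros t. apply ccont_minus; (apply ccont_mult; [apply ccont_const | apply ccont_refl_int]). }
  assert (hsum : is_IR h (2 * Ci * RtoC (PI / 2) - 2 * Ci * S * IR (refl_int s))%C).
  { apply is_IR_minus.
    - intros t. apply ccont_mult; [apply ccont_const | apply ccont_refl_int].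
    - intros t. apply ccont_mult; [apply ccont_const | apply ccont_refl_int].
    - apply is_IR_scal; [apply ccont_refl_int | apply is_IR_refl_int_1].
    - apply is_IR_scal; [apply ccont_refl_int |]. eapply IR_correct. now apply decay_refl_int. }
  assert (hbound : forall R0, 1 <= R0 -> Cmod (CInt h (- R0) R0)
     <= 2 * (2 * (exp (Rabs (Im s) * (PI / 2)) + 1)) * PI
        * exp (- (Rmin 1 (Rmin (Re s) (2 - Re s)) * R0))).
  { intros R0 hR.
    assert (hg : rect_int (reflection_kernel s) (- R0) R0 (-1 * (PI / 2)) (1 * (PI / 2)) = RtoC 0).
    { apply goursat; try lra. intros x y hx hy. apply cder_reflection_kernel. simpl. apply Rabs_le. lra. }
    assert (cy : forall x c d, Rabs c <= PI / 2 -> Rabs d <= PI / 2 ->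
               ccont_on (fun t => reflection_kernel s (x, t)) c d).
    { intros x c d hc hd t ht. destruct (cder_reflection_kernel s (x, t)) as [l hl].
      - simpl. apply Rabs_le_between in hc, hd. apply Rabs_le. revert ht. unfold Rmin, Rmax.
        destruct Rle_dec; lra.
      - eapply rder_ccont, cder_rder_y, hl. }
    unfold rect_int in hg.
    rewrite (CInt_ext (fun t => reflection_kernel s (t, -1 * (PI / 2)))
      (fun t => Cexp (RtoC (-1) * (Ci * (RtoC PI * s / 2))) * refl_int s t - RtoC (-1) * Ci * refl_int 1 t)%C) in hg
      by (intros t _; apply reflection_kernel_side; auto).
    rewrite (CInt_ext (fun t => reflection_kernel s (t, 1 * (PI / 2)))
      (fun t => Cexp (RtoC 1 * (Ci * (RtoC PI * s / 2))) * refl_int s t - RtoC 1 * Ci * refl_int 1 t)%C) in hg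
      by (intros t _; apply reflection_kernel_side; auto).
    replace (CInt h (- R0) R0) with
      (Ci * CInt (fun t => reflection_kernel s ((- R0)%R, t)) (-1 * (PI / 2)) (1 * (PI / 2))
       - Ci * CInt (fun t => reflection_kernel s (R0, t)) (-1 * (PI / 2)) (1 * (PI / 2)))%C.
    - assert (side : forall x, Rabs x = R0 ->
        Cmod (Ci * CInt (fun t => reflection_kernel s (x, t)) (-1 * (PI / 2)) (1 * (PI / 2))) <=
        2 * (exp (Rabs (Im s) * (PI / 2)) + 1) * exp (- (Rmin 1 (Rmin (Re s) (2 - Re s)) * R0)) * PI).
      { intros x hx. rewrite Cmod_mult, Cmod_Ci, Rmult_1_l.
        replace PI with (Rabs (1 * (PI / 2) - -1 * (PI / 2))) at 4 by (rewrite Rabs_pos_eq; lra).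
        apply Cmod_CInt_le_const.
        - apply cy; [rewrite Rabs_left | rewrite Rabs_pos_eq]; lra.
        - intros t. rewrite Rmin_left, Rmax_right by lra. intros ht. rewrite <- hx.
          apply reflection_kernel_far; auto; [lra |]. apply Rabs_le. lra. }
      pose proof (side (- R0) ltac:(rewrite Rabs_left; lra)) as k1.
      pose proof (side R0 ltac:(rewrite Rabs_pos_eq; lra)) as k2.
      unfold Cminus. eapply Rle_trans; [apply Cmod_triangle |]. rewrite Cmod_opp. lra.
    - unfold h. rewrite CInt_minus, !CInt_mult_l;
        try (intros t _; try (apply ccont_mult; [apply ccont_const |]); apply ccont_refl_int).
      rewrite !CInt_minus, !CInt_mult_l in hg;
        try (intros t _; try (apply ccont_mult; [apply ccont_const |]); apply ccont_refl_int).
      replace (RtoC (-1) * (Ci * (RtoC PI * s / 2)))%C with (- (Ci * (RtoC PI * s / 2)))%C in hg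
        by (rewrite RtoC_opp || idtac; replace (RtoC (-1)) with (- (1))%C by (apply C_ext; simpl; ring); ring).
      rewrite Cmult_1_l in hg.
      replace (2 * Ci * S)%C with (Cexp (Ci * (RtoC PI * s / 2)) - Cexp (- (Ci * (RtoC PI * s / 2))))%C
        by apply Csin_alt.
      replace (RtoC (-1)) with (- (1))%C in hg by (apply C_ext; simpl; ring).
      match type of hg with ?L = _ => match goal with |- ?U = ?V => replace V with (U + L)%C by ring end end.
      rewrite hg. ring. }
  assert (hz : is_IR h 0).
  { assert (hl := IR_unique _ _ hsum).
    replace (RtoC 0) with (2 * Ci * RtoC (PI / 2) - 2 * Ci * S * IR (refl_int s))%C; [exact hsum |].
    apply Cmod_eq_0. apply Rle_antisym; [| apply Cmod_ge_0]. apply Rnot_lt_le. intros hp.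
    set (l := (2 * Ci * RtoC (PI / 2) - 2 * Ci * S * IR (refl_int s))%C) in *.
    destruct (hsum (Cmod l / 2)) as [A hA]; [lra |].
    assert (hdd : 0 < Rmin 1 (Rmin (Re s) (2 - Re s))) by (repeat apply Rmin_glb_lt; lra).
    destruct (exp_small (2 * (2 * (exp (Rabs (Im s) * (PI / 2)) + 1)) * PI)
                (Rmin 1 (Rmin (Re s) (2 - Re s))) (Cmod l / 2)) as (A' & hA' & H'); try lra.
    { pose proof (exp_pos (Rabs (Im s) * (PI / 2))). nra. }
    set (M := Rmax 1 (Rmax A A')).
    assert (hM : 1 <= M /\ A <= M /\ A' <= M).
    { unfold M. pose proof (Rmax_l 1 (Rmax A A')). pose proof (Rmax_r 1 (Rmax A A')).
      pose proof (Rmax_l A A'). pose proof (Rmax_r A A'). lra. }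
    specialize (hA (- M) M ltac:(lra) ltac:(lra)). specialize (H' M ltac:(lra)).
    specialize (hbound M ltac:(lra)).
    pose proof (Cmod_triangle (l - CInt h (- M) M) (CInt h (- M) M)) as ht.
    replace (l - CInt h (- M) M + CInt h (- M) M)%C with l in ht by ring.
    replace (l - CInt h (- M) M)%C with (- (CInt h (- M) M - l))%C in ht by ring.
    rewrite Cmod_opp in ht. lra. }
  pose proof (is_IR_unique _ _ _ hz hsum) as e.
  apply Ceq_minus. 
  replace (S * IR (refl_int s) - RtoC (PI / 2))%C
    with (- (2 * Ci * RtoC (PI / 2) - 2 * Ci * S * IR (refl_int s)) / (2 * Ci))%C
    by (field; auto using Ci_neq_0, C2_neq_0).
  rewrite <- e. field; auto using Ci_neq_0, C2_neq_0.
Qed.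

(** * Lorentzian kernels and their Mellin integrals *)

Lemma exp_2 (t : R) : exp (2 * t) = exp t * exp t.
Proof. rewrite <- exp_plus. f_equal. ring. Qed.

(** The function u^s / (u^2 + A^2) at u = e^t. *)
Definition lor (s : C) (A t : R) : C := (Cexp (s * RtoC t) * RtoC (/ (exp (2 * t) + A ^ 2)))%C.

Lemma ccont_lor (s : C) (A t : R) : ccont (lor s A) t.
Proof.
  apply ccont_mult; [apply ccont_Cexp_linear |].
  apply ccont_ex_derive.
  auto_derive; auto. pose proof (exp_pos (2 * t)). nra.
Qed.

(** Scaling u by A, that is shifting t by ln A, reduces to width 1. *)
Lemma is_IR_lor (s : C) (A : R) : 0 < A -> 0 < Re s < 2 ->
  is_IR (lor s A) (cpow A (s - 2) * IR (refl_int s)).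
Proof.
  intros hA hs.
  assert (h := is_IR_shift _ (- ln A) _ (ccont_refl_int s) (IR_correct _ _ _ (decay_refl_int s hs))).
  apply (is_IR_scal (cpow A (s - 2))) in h.
  - eapply is_IR_ext; [| exact h]. intros t. unfold refl_int, lor.
    assert (e1 : exp (2 * (t + - ln A)) = exp (2 * t) / A ^ 2).
    { replace (2 * (t + - ln A)) with (2 * t + (- ln A + - ln A)) by ring.
      rewrite !exp_plus, exp_Ropp, exp_ln by assumption. field. lra. }
    rewrite e1. pose proof (exp_pos (2 * t)) as he. assert (hA2 : 0 < A ^ 2) by now apply pow_lt.
    replace (/ (1 + exp (2 * t) / A ^ 2)) with (A ^ 2 * / (exp (2 * t) + A ^ 2)) by (field; split; nra).
    rewrite cpow_minus. replace (cpow A 2) with (RtoC (A ^ 2)).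
    2:{ symmetry. exact (cpow_INR A 2 hA). }
    rewrite RtoC_plus, RtoC_opp.
    replace (s * (RtoC t + - RtoC (ln A)))%C with (s * RtoC t + - (s * RtoC (ln A)))%C by ring.
    rewrite Cexp_plus, Cexp_opp, RtoC_mult. unfold cpow. field.
    split; [apply Cexp_neq_0 | apply RtoC_neq_0; lra].
  - intros t. apply (ccont_comp (refl_int s) (fun t => t + - ln A)); [| apply ccont_refl_int].
    apply continuous_ex_derive. now auto_derive.
Qed.

(** The product of two Lorentzians u^2 / ((u^2 + A^2)(u^2 + B^2)) at u = e^t; times u^n it decays at
    both ends when |Re n| < 2. *)
Definition lor2_weight (A B t : R) : R := exp (2 * t) / ((exp (2 * t) + A ^ 2) * (exp (2 * t) + B ^ 2)).

Definition lor2 (A B : R) (n : C) (t : R) : C := (RtoC (lor2_weight A B t) * Cexp (n * RtoC t))%C.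

Lemma lor_den_pos (A t : R) : 0 < exp (2 * t) + A ^ 2.
Proof. pose proof (exp_pos (2 * t)). nra. Qed.

Lemma lor2_weight_pos (A B t : R) : 0 < lor2_weight A B t.
Proof.
  apply Rdiv_lt_0_compat; [apply exp_pos |]. apply Rmult_lt_0_compat; apply lor_den_pos.
Qed.

Lemma ccont_lor2_weight (A B t : R) : ccont (fun t => RtoC (lor2_weight A B t)) t.
Proof.
  apply ccont_ex_derive. unfold lor2_weight.
  auto_derive; auto. apply Rgt_not_eq, Rmult_lt_0_compat.
  - pose proof (lor_den_pos A t). lra.
  - pose proof (lor_den_pos B t). lra.
Qed.

Lemma ccont_lor2 (A B : R) (n : C) (t : R) : ccont (lor2 A B n) t.
Proof. apply ccont_mult; [apply ccont_lor2_weight | apply ccont_Cexp_linear]. Qed.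

Lemma decay_lor2 (A B : R) (n : C) : 0 < A -> 0 < B -> -2 < Re n < 2 ->
  exists K c, decay (lor2 A B n) K c.
Proof.
  intros hA hB hn. assert (hA2 : 0 < A ^ 2) by now apply pow_lt. assert (hB2 : 0 < B ^ 2) by now apply pow_lt.
  assert (hAB : 0 < / (A ^ 2 * B ^ 2)) by (apply Rinv_0_lt_compat, Rmult_lt_0_compat; auto).
  exists (1 + / (A ^ 2 * B ^ 2)), (Rmin (2 - Re n) (2 + Re n)).
  pose proof (Rmin_l (2 - Re n) (2 + Re n)). pose proof (Rmin_r (2 - Re n) (2 + Re n)).
  apply decay_two_sided.
  - intros t. apply ccont_lor2.
  - apply Rmin_glb_lt; lra.
  - intros t ht. unfold lor2. pose proof (lor2_weight_pos A B t).
    rewrite Cmod_mult, Cmod_Cexp_linear, Cmod_RtoC_pos by lra.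
    assert (hw : lor2_weight A B t <= exp (- (2 * t))).
    { unfold lor2_weight. rewrite exp_Ropp. pose proof (exp_pos (2 * t)) as he.
      replace (/ exp (2 * t)) with (exp (2 * t) / (exp (2 * t) * exp (2 * t))) by (field; lra).
      apply Rmult_le_compat_l; [lra |]. apply Rinv_le_contravar; nra. }
    eapply Rle_trans; [apply Rmult_le_compat_r; [apply exp_ge_0 | exact hw] |].
    rewrite <- exp_plus. apply Rle_trans with (1 * exp (- (Rmin (2 - Re n) (2 + Re n) * t))).
    + rewrite Rmult_1_l. apply exp_mono. nra.
    + apply Rmult_le_compat_r; [apply exp_ge_0 | lra].
  - intros t ht. unfold lor2. pose proof (lor2_weight_pos A B t).
    rewrite Cmod_mult, Cmod_Cexp_linear, Cmod_RtoC_pos by lra.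
    assert (hw : lor2_weight A B t <= / (A ^ 2 * B ^ 2) * exp (2 * t)).
    { unfold lor2_weight. pose proof (exp_pos (2 * t)) as he. unfold Rdiv. rewrite Rmult_comm.
      apply Rmult_le_compat_r; [lra |]. apply Rinv_le_contravar; [now apply Rmult_lt_0_compat |].
      apply Rmult_le_compat; lra. }
    eapply Rle_trans; [apply Rmult_le_compat_r; [apply exp_ge_0 | exact hw] |].
    rewrite Rmult_assoc, <- exp_plus. apply Rmult_le_compat; try lra; [apply exp_ge_0 |].
    apply exp_mono. nra.
Qed.

Lemma is_IR_lor2 (A B : R) (n : C) : 0 < A -> 0 < B -> -2 < Re n < 2 -> is_IR (lor2 A B n) (IR (lor2 A B n)).
Proof. intros hA hB hn. destruct (decay_lor2 A B n hA hB hn) as (K & c & h). eapply IR_correct, h. Qed.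

Lemma Csin_shift_PI (z : C) : Csin (z + RtoC PI) = (- Csin z)%C.
Proof.
  unfold Csin. change Defs.Ci with Ci.
  assert (h : Cexp (Ci * RtoC PI) = (- (1))%C).
  { replace (Ci * RtoC PI)%C with (Ci * RtoC (PI / 2) + Ci * RtoC (PI / 2))%C.
    - rewrite Cexp_plus, Cexp_iPI2. apply Ci_sqr.
    - rewrite RtoC_div by lra. field. }
  replace (- (Ci * (z + RtoC PI)))%C with (- (Ci * z) + - (Ci * RtoC PI))%C by ring.
  replace (Ci * (z + RtoC PI))%C with (Ci * z + Ci * RtoC PI)%C by ring.
  rewrite !Cexp_plus, (Cexp_opp (Ci * RtoC PI)), h. field. auto using Ci_neq_0, C2_neq_0.
Qed.

Lemma cder_Csin (s : C) : exists l, cder (fun s => Csin (RtoC PI * s / 2)) s l.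
Proof.
  eexists. unfold Csin. change Defs.Ci with Ci.
  apply (cder_ext (fun s => / (2 * Ci) * (Cexp (Ci * (RtoC PI * / 2) * s) - Cexp (- (Ci * (RtoC PI * / 2)) * s)))%C _ _ _ 1);
    [lra | |].
  - intros w _. unfold Cdiv. rewrite Cmult_comm. do 2 f_equal; try f_equal; ring.
  - apply cder_scal, cder_minus; apply cder_Cexp, cder_scal, cder_id.
Qed.

(* On Re n = 0 neither partial fraction decomposition converges termwise, so that line is
   reached by continuity in n. *)
Theorem two_lorentzian_integral (A B : R) (n : C) :
  0 < A -> 0 < B -> A ^ 2 <> B ^ 2 -> -2 < Re n < 2 ->
  (Csin (RtoC PI * n / 2) * IR (lor2 A B n))%C
  = (RtoC (PI / 2) * ((cpow A n - cpow B n) / RtoC (A ^ 2 - B ^ 2)))%C.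
Proof.
  intros hA hB hAB.
  assert (hd : RtoC (A ^ 2 - B ^ 2) <> RtoC 0) by (apply RtoC_neq_0; lra).
  assert (hpow : forall a z, 0 < a -> cpow a (z - 2) = (cpow a z / RtoC (a ^ 2))%C).
  { intros a z ha. rewrite cpow_minus. f_equal. exact (cpow_INR a 2 ha). }
  assert (hA2 : RtoC (A ^ 2) <> RtoC 0) by (apply RtoC_neq_0; apply pow_nonzero; lra).
  assert (hB2 : RtoC (B ^ 2) <> RtoC 0) by (apply RtoC_neq_0; apply pow_nonzero; lra).
  (* Here the difference of 1/(u^2 + B^2) and 1/(u^2 + A^2) is integrated termwise with exponent n +
     2, which moves the sine by pi and flips its sign. *)
  assert (neg : forall n, -2 < Re n < 0 -> (Csin (RtoC PI * n / 2) * IR (lor2 A B n))%C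
    = (RtoC (PI / 2) * ((cpow A n - cpow B n) / RtoC (A ^ 2 - B ^ 2)))%C).
  { clear n. intros n hn.
    assert (hs : 0 < Re (n + 2) < 2) by (simpl; unfold Re in *; lra).
    assert (h : is_IR (lor2 A B n) (/ RtoC (A ^ 2 - B ^ 2) *
       (cpow B (n + 2 - 2) * IR (refl_int (n + 2)) - cpow A (n + 2 - 2) * IR (refl_int (n + 2))))%C).
    { apply (is_IR_ext (fun t => / RtoC (A ^ 2 - B ^ 2) * (lor (n + 2) B t - lor (n + 2) A t))%C).
      - intros t. unfold lor, lor2, lor2_weight.
        replace ((n + 2) * RtoC t)%C with (n * RtoC t + RtoC (2 * t))%C by (rewrite RtoC_mult; ring).
        rewrite Cexp_plus, Cexp_RtoC.
        pose proof (lor_den_pos A t). pose proof (lor_den_pos B t).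
        replace (exp (2 * t) / ((exp (2 * t) + A ^ 2) * (exp (2 * t) + B ^ 2)))
          with (/ (A ^ 2 - B ^ 2) * exp (2 * t) * (/ (exp (2 * t) + B ^ 2) - / (exp (2 * t) + A ^ 2)))
          by (field; repeat split; lra).
        rewrite !RtoC_mult, (RtoC_minus (/ _) (/ _)), (RtoC_inv (A ^ 2 - B ^ 2)) by lra. ring.
      - apply is_IR_scal; [intros t; apply ccont_minus; apply ccont_lor |].
        apply is_IR_minus; try (intros t; apply ccont_lor); now apply is_IR_lor. }
    rewrite (IR_unique _ _ h).
    pose proof (reflection_integral (n + 2) hs) as hr.
    replace (RtoC PI * (n + 2) / 2)%C with (RtoC PI * n / 2 + RtoC PI)%C in hr by field.
    rewrite Csin_shift_PI in hr.
    replace (n + 2 - 2)%C with n by ring. rewrite <- hr. field. exact hd. }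
  (* Here A^2/(u^2 + A^2) minus B^2/(u^2 + B^2) is integrated termwise with exponent n. *)
  assert (pos : forall n, 0 < Re n < 2 -> (Csin (RtoC PI * n / 2) * IR (lor2 A B n))%C
    = (RtoC (PI / 2) * ((cpow A n - cpow B n) / RtoC (A ^ 2 - B ^ 2)))%C).
  { clear n. intros n hn.
    assert (h : is_IR (lor2 A B n) (/ RtoC (A ^ 2 - B ^ 2) *
       (RtoC (A ^ 2) * (cpow A (n - 2) * IR (refl_int n)) - RtoC (B ^ 2) * (cpow B (n - 2) * IR (refl_int n))))%C).
    { apply (is_IR_ext (fun t => / RtoC (A ^ 2 - B ^ 2) * (RtoC (A ^ 2) * lor n A t - RtoC (B ^ 2) * lor n B t))%C).
      - intros t. unfold lor, lor2, lor2_weight.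
        pose proof (lor_den_pos A t). pose proof (lor_den_pos B t).
        replace (exp (2 * t) / ((exp (2 * t) + A ^ 2) * (exp (2 * t) + B ^ 2)))
          with (/ (A ^ 2 - B ^ 2) * (A ^ 2 * / (exp (2 * t) + A ^ 2) - B ^ 2 * / (exp (2 * t) + B ^ 2)))
          by (field; repeat split; lra).
        rewrite RtoC_mult, (RtoC_minus (_ * _) (_ * _)), !RtoC_mult, (RtoC_inv (A ^ 2 - B ^ 2)) by lra. ring.
      - apply is_IR_scal.
        + intros t. apply ccont_minus; (apply ccont_mult; [apply ccont_const | apply ccont_lor]).
        + apply is_IR_minus; try (intros t; apply ccont_mult; [apply ccont_const | apply ccont_lor]);
            (apply is_IR_scal; [intros t; apply ccont_lor | now apply is_IR_lor]). }
    rewrite (IR_unique _ _ h). rewrite !hpow by assumption.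
    pose proof (reflection_integral n hn) as hr. rewrite <- hr. field. auto. }
  intros hn. destruct (Rtotal_order (Re n) 0) as [h|[h|h]]; [apply neg; lra | | apply pos; lra].
  set (W := fun n => (Csin (RtoC PI * n / 2) * IR (lor2 A B n)
                      - RtoC (PI / 2) * ((cpow A n - cpow B n) / RtoC (A ^ 2 - B ^ 2)))%C).
  assert (hW : exists l, cder W n l).
  { destruct (cder_Csin n) as [l1 h1].
    destruct (decay_lor2 A B n hA hB hn) as (K & c & hdec).
    destruct (cder_IR_param (fun t => RtoC (lor2_weight A B t)) n K c) as [l2 h2].
    { apply ccont_lor2_weight. }
    { exact hdec. }
    eexists. apply cder_minus.
    - apply (cder_mult (fun n => Csin (RtoC PI * n / 2)) (fun n => IR (lor2 A B n))); eassumption.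
    - apply (cder_ext (fun n => RtoC (PI / 2) * / RtoC (A ^ 2 - B ^ 2) *
               (Cexp (RtoC (ln A) * n) - Cexp (RtoC (ln B) * n)))%C _ _ _ 1); [lra | |].
      + intros w _. unfold cpow. rewrite (Cmult_comm w), (Cmult_comm w). field. exact hd.
      + apply cder_scal, cder_minus; apply cder_Cexp, cder_scal, cder_id. }
  destruct hW as [l hl].
  assert (hW0 : W n = RtoC 0).
  { apply Cmod_eq_0. apply Rle_antisym; [| apply Cmod_ge_0]. apply Rnot_lt_le. intros hp.
    destruct (cder_continuous _ _ _ hl (Cmod (W n)) hp) as (d & hd0 & H).
    set (e := Rmin (d / 2) 1).
    assert (he : 0 < e /\ e < d /\ e <= 1).
    { unfold e. pose proof (Rmin_l (d / 2) 1). pose proof (Rmin_r (d / 2) 1).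
      assert (0 < Rmin (d / 2) 1) by (apply Rmin_glb_lt; lra). lra. }
    specialize (H (n + RtoC e)%C).
    replace (n + RtoC e - n)%C with (RtoC e) in H by ring. rewrite Cmod_RtoC_pos in H by lra.
    specialize (H ltac:(lra)).
    replace (W (n + RtoC e)%C) with (RtoC 0) in H.
    - replace (0 - W n)%C with (- W n)%C in H by ring. rewrite Cmod_opp in H. lra.
    - unfold W. rewrite pos; [ring |]. simpl. unfold Re in *. lra. }
  unfold W in hW0. now apply Ceq_minus.
Qed.

(** * Dirichlet characters and Gauss sums *)

Lemma Csum_app (l1 l2 : list nat) (f : nat -> C) : Csum (l1 ++ l2) f = (Csum l1 f + Csum l2 f)%C.
Proof. induction l1 as [|a l1 IH]; simpl; [unfold Csum; simpl; ring |]. unfold Csum in *; simpl. rewrite IH. ring. Qed.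

Lemma Csum_seq (m n : nat) (f : nat -> C) : Csum (seq m n) f = psum (fun k => f (m + k)%nat) n.
Proof.
  induction n as [|n IH]; [reflexivity |]. rewrite seq_S, Csum_app, IH. unfold Csum; simpl. ring.
Qed.

Lemma Csum_perm (l l' : list nat) (f : nat -> C) : Permutation l l' -> Csum l f = Csum l' f.
Proof.
  intros h. induction h as [|x l l' h IH|x y l|l l' l'' h1 IH1 h2 IH2]; unfold Csum in *; simpl.
  - reflexivity.
  - now rewrite IH.
  - ring.
  - congruence.
Qed.

Lemma Csum_map (l : list nat) (g : nat -> nat) (f : nat -> C) : Csum (map g l) f = Csum l (fun k => f (g k)).
Proof. induction l as [|a l IH]; unfold Csum in *; simpl; auto. now rewrite IH. Qed.

(** Multiplication by n is injective on residues by Gauss's lemma, hence a permutation of the finite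
    set. *)
Lemma residue_permutation (n q : nat) : (0 < q)%nat -> Nat.gcd n q = 1%nat ->
  Permutation (map (fun r => (n * r) mod q) (seq 0 q)) (seq 0 q).
Proof.
  intros hq hg. apply NoDup_Permutation_bis.
  - apply NoDup_map_NoDup_ForallPairs; [| apply seq_NoDup].
    intros a b ha hb e. apply in_seq in ha, hb.
    assert (hinj : forall a b, (a <= b)%nat -> (b < q)%nat -> ((n * a) mod q = (n * b) mod q)%nat -> a = b).
    { clear a b ha hb e. intros a b hab hb e.
      assert (hd : Nat.divide q (n * (b - a))).
      { apply Nat.Lcm0.mod_divide. rewrite Nat.mul_sub_distr_l.
        pose proof (Nat.div_mod_eq (n * b) q) as e1. pose proof (Nat.div_mod_eq (n * a) q) as e2.
        assert (hle : (n * a <= n * b)%nat) by nia.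
        assert (hk : (n * b - n * a = (n * b / q - n * a / q) * q)%nat).
        { rewrite Nat.mul_sub_distr_r. lia. }
        rewrite hk. apply Nat.Div0.mod_mul. }
      apply Nat.gauss in hd; [| now rewrite Nat.gcd_comm].
      destruct (Nat.eq_dec (b - a) 0) as [h0|h0]; [lia |].
      apply Nat.divide_pos_le in hd; lia. }
    destruct (Nat.le_ge_cases a b) as [h|h]; [apply hinj; lia | symmetry; apply hinj; lia].
  - rewrite length_map. lia.
  - intros x hx. apply in_map_iff in hx. destruct hx as (r & <- & _). apply in_seq.
    split; [lia |]. apply Nat.mod_upper_bound. lia.
Qed.

Lemma Cmult_integral (z w : C) : (z * w)%C = RtoC 0 -> z = RtoC 0 \/ w = RtoC 0.
Proof.
  intros h. apply NNPP. intros hn. apply not_or_and in hn. destruct hn as [h1 h2].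
  now apply (Cmult_neq_0 z w h1 h2).
Qed.

Definition periodic (q : nat) (f : nat -> C) : Prop := forall n, f (n + q)%nat = f n.

Lemma periodic_mul (q : nat) (f : nat -> C) (n k : nat) : periodic q f -> f (n + k * q)%nat = f n.
Proof.
  intros h. induction k as [|k IH]; [now rewrite Nat.add_0_r |].
  replace (n + S k * q)%nat with (n + k * q + q)%nat by lia. now rewrite h.
Qed.

Lemma periodic_mod (q : nat) (f : nat -> C) (n : nat) : periodic q f -> f (n mod q) = f n.
Proof.
  intros h. rewrite (Nat.div_mod_eq n q) at 2. rewrite Nat.add_comm, Nat.mul_comm.
  symmetry. now apply periodic_mul.
Qed.

Lemma psum_residues (n q : nat) (f : nat -> C) :
  (0 < q)%nat -> Nat.gcd n q = 1%nat -> periodic q f -> psum (fun r => f (n * r)%nat) q = psum f q.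
Proof.
  intros hq hg hf.
  assert (e : forall g, psum g q = Csum (seq 0 q) g) by (intros g; now rewrite Csum_seq).
  rewrite !e. rewrite <- (Csum_perm _ _ f (residue_permutation n q hq hg)), Csum_map, !Csum_seq.
  apply psum_ext. intros k _. symmetry. now apply periodic_mod.
Qed.

Lemma psum_shift_periodic (q : nat) (f : nat -> C) : periodic q f -> psum (fun k => f (S k)) q = psum f q.
Proof.
  intros hf.
  assert (h : forall n, (psum (fun k => f (S k)) n + f 0%nat)%C = psum f (S n)).
  { induction n as [|n IH]; [simpl; ring |]. simpl in *. rewrite <- IH. ring. }
  specialize (h q). simpl in h. rewrite <- (hf 0%nat) in h. simpl in h.
  replace (psum (fun k => f (S k)) q) with (psum (fun k => f (S k)) q + f q - f q)%C by ring.
  rewrite h. ring.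
Qed.

Definition root_of_unity (q k : nat) : C := Cexp (Ci * RtoC (2 * PI * INR k / INR q)).

Section RootsOfUnity.

Variable q : nat.
Hypothesis hq0 : (0 < q)%nat.

Lemma root_of_unity_add (a b : nat) :
  root_of_unity q (a + b) = (root_of_unity q a * root_of_unity q b)%C.
Proof.
  unfold root_of_unity. rewrite <- Cexp_plus. f_equal. rewrite plus_INR.
  replace (2 * PI * (INR a + INR b) / INR q) with (2 * PI * INR a / INR q + 2 * PI * INR b / INR q)
    by (unfold Rdiv; ring).
  rewrite RtoC_plus. ring.
Qed.

Lemma root_of_unity_0 : root_of_unity q 0 = RtoC 1.
Proof. unfold root_of_unity. simpl. unfold Rdiv. rewrite Rmult_0_r, Rmult_0_l, Cmult_0_r. apply Cexp_0. Qed.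

Lemma root_of_unity_q : root_of_unity q q = RtoC 1.
Proof.
  unfold root_of_unity. assert (INR q <> 0) by (apply not_0_INR; lia).
  replace (2 * PI * INR q / INR q) with (2 * PI) by (field; auto).
  unfold Cexp. simpl. replace (0 * (2 * PI) - 1 * 0) with 0 by ring.
  replace (0 * 0 + 1 * (2 * PI)) with (2 * PI) by ring.
  rewrite exp_0, cos_2PI, sin_2PI. apply C_ext; simpl; ring.
Qed.

Lemma root_of_unity_periodic (m : nat) : periodic q (fun r => root_of_unity q (m * r)).
Proof.
  assert (hm : forall m, root_of_unity q (m * q) = RtoC 1).
  { induction m0 as [|k IH]; simpl; [apply root_of_unity_0 |].
    rewrite root_of_unity_add, root_of_unity_q, IH. ring. }
  intros r. rewrite Nat.mul_add_distr_l, root_of_unity_add, hm. ring.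
Qed.

Lemma root_of_unity_neq_1 (k : nat) : (0 < k < q)%nat -> root_of_unity q k <> RtoC 1.
Proof.
  intros hk e. apply (f_equal fst) in e. unfold root_of_unity, Cexp in e. simpl in e.
  replace (0 * (2 * PI * INR k / INR q) - 1 * 0) with 0 in e by ring.
  replace (0 * 0 + 1 * (2 * PI * INR k / INR q)) with (2 * PI * INR k / INR q) in e by ring.
  rewrite exp_0, Rmult_1_l in e.
  set (x := INR k / INR q).
  assert (hq : 0 < INR q) by (apply lt_0_INR; lia).
  assert (hx : 0 < x < 1).
  { unfold x. split; [apply Rdiv_lt_0_compat; auto; apply lt_0_INR; lia |].
    apply (Rmult_lt_reg_r (INR q)); auto. unfold Rdiv. rewrite Rmult_assoc, Rinv_l, Rmult_1_r, Rmult_1_l by lra.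
    apply lt_INR; lia. }
  replace (2 * PI * INR k / INR q) with (2 * PI * x) in e by (unfold x, Rdiv; ring).
  pose proof PI_RGT_0.
  destruct (Rle_dec x (/ 2)) as [h|h].
  - apply cos_eq_1_small in e; [nra |]. rewrite Rabs_pos_eq; nra.
  - assert (e' : cos (2 * PI * (1 - x)) = 1).
    { replace (2 * PI * (1 - x)) with (- (2 * PI * x) + 2 * PI) by ring.
      rewrite cos_plus, cos_2PI, sin_2PI, cos_neg. lra. }
    apply cos_eq_1_small in e'; [nra |]. rewrite Rabs_pos_eq; nra.
Qed.

(** Orthogonality: for a nonzero residue the sum times (root - 1) telescopes to 0, and the root is
    not 1. *)
Lemma psum_root_of_unity (m : nat) : psum (fun j => root_of_unity q (m * j)) q
  = if Nat.eqb (m mod q) 0 then RtoC (INR q) else RtoC 0.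
Proof.
  pose proof hq0 as hq.
  assert (hsym : forall j, root_of_unity q (m * j) = root_of_unity q ((m mod q) * j)).
  { intros j. rewrite (Nat.mul_comm m), (Nat.mul_comm (m mod q)).
    symmetry. apply (periodic_mod q (fun r => root_of_unity q (j * r))). apply root_of_unity_periodic. }
  rewrite (psum_ext _ (fun j => root_of_unity q ((m mod q) * j))) by auto.
  pose proof (Nat.mod_upper_bound m q ltac:(lia)) as hlt.
  set (r := (m mod q)%nat) in *. clearbody r. destruct (Nat.eqb_spec r 0) as [-> | h0].
  - simpl. rewrite (psum_ext _ (fun _ => RtoC 1)) by (intros; apply root_of_unity_0).
    clear. induction q as [|n IH]; [reflexivity |].
    change (psum (fun _ => RtoC 1) (S n)) with (psum (fun _ => RtoC 1) n + 1)%C.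
    rewrite IH, S_INR, RtoC_plus. reflexivity.
  - assert (geo : forall n, ((root_of_unity q r - 1) * psum (fun j => root_of_unity q (r * j)) n)%C
                        = (root_of_unity q (r * n) - 1)%C).
    { induction n as [|n IH].
      - simpl. rewrite Nat.mul_0_r, root_of_unity_0. ring.
      - change (psum (fun j => root_of_unity q (r * j)) (S n))
          with (psum (fun j => root_of_unity q (r * j)) n + root_of_unity q (r * n))%C.
        rewrite Cmult_plus_distr_l, IH, Nat.mul_succ_r, root_of_unity_add. ring. }
    specialize (geo q). pose proof (root_of_unity_periodic r 0%nat) as e. cbv beta in e. simpl in e.
    rewrite e, Nat.mul_0_r, root_of_unity_0 in geo. replace (1 - 1)%C with (RtoC 0) in geo by ring.
    apply Cmult_integral in geo. destruct geo as [geo|geo]; auto.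
    elim (root_of_unity_neq_1 r ltac:(lia)). now apply Ceq_minus.
Qed.

End RootsOfUnity.

Section Characters.

Variables (q : nat) (chi : nat -> C).
Hypothesis hchi : is_dirichlet_char q chi.

Lemma char_q_pos : (0 < q)%nat.
Proof. destruct hchi; lia. Qed.

Lemma char_mul (m n : nat) : chi (m * n)%nat = (chi m * chi n)%C.
Proof. apply hchi. Qed.

Lemma char_periodic : periodic q chi.
Proof. intros n. apply hchi. Qed.

Lemma char_coprime (n : nat) : chi n <> RtoC 0 <-> Nat.gcd n q = 1%nat.
Proof. apply hchi. Qed.

Lemma char_1 : chi 1%nat = RtoC 1.
Proof.
  assert (h : chi 1%nat <> RtoC 0) by (apply char_coprime; reflexivity).
  pose proof (char_mul 1 1) as e. simpl in e.
  replace (chi 1%nat) with (chi 1%nat * chi 1%nat / chi 1%nat)%C by (field; exact h).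
  rewrite <- e. field. exact h.
Qed.

Lemma char_pow (n k : nat) : chi (n ^ k)%nat = (chi n ^ k)%C.
Proof.
  induction k as [|k IH]; simpl.
  - apply char_1.
  - now rewrite char_mul, IH.
Qed.

(* The powers of chi n are values of the bounded function chi. *)
Lemma Cmod_char_le (n : nat) : Cmod (chi n) <= 1.
Proof.
  assert (hb : exists B, forall m, Cmod (chi m) <= B).
  { exists (rpsum (fun m => Cmod (chi m)) q). intros m. rewrite <- (periodic_mod q) by apply char_periodic.
    pose proof (Nat.mod_upper_bound m q ltac:(pose proof char_q_pos; lia)) as h.
    set (r := (m mod q)%nat) in *. clearbody r.
    eapply Rle_trans; [| apply (rpsum_mono _ (S r) q); [intros; apply Cmod_ge_0 | lia]].
    simpl. pose proof (rpsum_mono (fun m => Cmod (chi m)) 0 r ltac:(intros; apply Cmod_ge_0) ltac:(lia)) as h0.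
    simpl in h0. lra. }
  destruct hb as [B hB]. apply Rnot_lt_le. intros hlt.
  destruct (Pow_x_infinity (Cmod (chi n)) ltac:(rewrite Rabs_pos_eq; [exact hlt | apply Cmod_ge_0]) (B + 1)) as [k hk].
  specialize (hk k (le_n k)). rewrite Rabs_pos_eq in hk by (apply pow_le, Cmod_ge_0).
  specialize (hB (n ^ k)%nat). rewrite char_pow, Cmod_pow in hB. lra.
Qed.

Lemma char_inverse (n : nat) : Nat.gcd n q = 1%nat -> exists m, ((n * m) mod q = 1 mod q)%nat.
Proof.
  intros hg. pose proof char_q_pos as hq.
  assert (h : In (1 mod q)%nat (seq 0 q)) by (apply in_seq; split; [lia | apply Nat.mod_upper_bound; lia]).
  apply (Permutation_in _ (Permutation_sym (residue_permutation n q hq hg))) in h.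
  apply in_map_iff in h. destruct h as (m & e & _). now exists m.
Qed.

(** With m inverse to n modulo q, |chi n| |chi m| = 1 while both factors are at most 1. *)
Lemma char_conj_mul (n : nat) : Nat.gcd n q = 1%nat -> (chi n * Cconj (chi n))%C = RtoC 1.
Proof.
  intros hg. rewrite <- Cmod2_conj. f_equal.
  destruct (char_inverse n hg) as [m hm].
  assert (e : (chi n * chi m)%C = RtoC 1).
  { rewrite <- char_mul, <- (periodic_mod q), hm, periodic_mod by apply char_periodic. apply char_1. }
  apply (f_equal Cmod) in e. rewrite Cmod_mult, Cmod_1 in e.
  pose proof (Cmod_char_le n). pose proof (Cmod_char_le m).
  pose proof (Cmod_ge_0 (chi n)). pose proof (Cmod_ge_0 (chi m)). nra.
Qed.

(** Multiplying the variable by an n with chi n <> 1 permutes the terms, yet multiplies the sum by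
    chi n. *)
Lemma psum_char_zero : ~ is_principal q chi -> psum chi q = RtoC 0.
Proof.
  intros hn. apply not_all_ex_not in hn. destruct hn as [n hn].
  apply imply_to_and in hn. destruct hn as [hg hne].
  pose proof (psum_residues n q chi char_q_pos hg char_periodic) as e.
  rewrite (psum_ext _ (fun r => chi n * chi r)%C) in e by (intros; apply char_mul).
  rewrite psum_scal in e.
  assert (h : ((chi n - 1) * psum chi q)%C = RtoC 0).
  { replace ((chi n - 1) * psum chi q)%C with (chi n * psum chi q - psum chi q)%C by ring. rewrite e. ring. }
  apply Cmult_integral in h. destruct h as [h|h]; auto. elim hne. now apply Ceq_minus.
Qed.

Lemma char_q_ge_2 : ~ is_principal q chi -> (2 <= q)%nat.
Proof.
  intros hn. pose proof char_q_pos. destruct (Nat.eq_dec q 1) as [e|]; [| lia].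
  elim hn. intros n _. rewrite <- char_1.
  rewrite <- (periodic_mod q chi n), <- (periodic_mod q chi 1) by apply char_periodic.
  now rewrite e, !Nat.mod_1_r.
Qed.

Lemma gcd_pred (h2 : (2 <= q)%nat) : Nat.gcd (q - 1) q = 1%nat.
Proof.
  assert (hd : Nat.divide (Nat.gcd (q - 1) q) 1).
  { replace 1%nat with (q - (q - 1))%nat at 2 by lia.
    apply Nat.divide_sub_r; [apply Nat.gcd_divide_r | apply Nat.gcd_divide_l]. }
  now apply Nat.divide_1_r.
Qed.

Lemma gauss_sum_psum : gauss_sum q chi = psum (fun r => chi r * root_of_unity q r)%C q.
Proof.
  unfold gauss_sum. rewrite Csum_seq. simpl.
  rewrite <- (psum_shift_periodic q (fun r => chi r * root_of_unity q r)%C); [reflexivity |].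
  intros n. pose proof (root_of_unity_periodic q char_q_pos 1 n) as e. cbv beta in e. rewrite !Nat.mul_1_l in e.
  now rewrite e, char_periodic.
Qed.

(** Gauss sum of the conjugate character at frequency j; at j = 1 it is tau(conj chi). *)
Definition twisted_sum (j : nat) : C := psum (fun r => Cconj (chi r) * root_of_unity q (j * r))%C q.

Lemma twisted_periodic (j : nat) : periodic q (fun r => Cconj (chi r) * root_of_unity q (j * r))%C.
Proof. intros r. pose proof (root_of_unity_periodic q char_q_pos j r) as e. cbv beta in e. now rewrite e, char_periodic. Qed.

Lemma twisted_sum_scale (n j : nat) : Nat.gcd n q = 1%nat ->
  (Cconj (chi n) * twisted_sum (j * n))%C = twisted_sum j.
Proof.
  intros hg. unfold twisted_sum.
  rewrite <- (psum_residues n q _ char_q_pos hg (twisted_periodic j)), <- psum_scal.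
  apply psum_ext. intros r _. rewrite char_mul, Cmult_conj, Nat.mul_assoc. ring.
Qed.

Lemma twisted_sum_mod (j k : nat) : (j mod q = k mod q)%nat -> twisted_sum j = twisted_sum k.
Proof.
  intros e. apply psum_ext. intros r _. f_equal.
  rewrite (Nat.mul_comm j), (Nat.mul_comm k).
  rewrite <- (periodic_mod q (fun s => root_of_unity q (r * s)) j) by apply root_of_unity_periodic, char_q_pos.
  rewrite <- (periodic_mod q (fun s => root_of_unity q (r * s)) k) by apply root_of_unity_periodic, char_q_pos.
  now rewrite e.
Qed.

(** Separability of Gauss sums. For j coprime to q this is a change of variable. Otherwise let g =
    gcd(j, q) and d = q/g: primitivity provides n = 1 mod d, coprime to q, with chi n <> 1. Then j n
    = j mod q, so the sum equals itself times a factor other than 1 and vanishes, as does chi j. *)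
Lemma twisted_sum_eq (j : nat) : is_primitive q chi -> twisted_sum j = (chi j * twisted_sum 1)%C.
Proof.
  intros hp. pose proof char_q_pos as hq.
  destruct (Nat.eq_dec (Nat.gcd j q) 1) as [hg|hg].
  - rewrite <- (twisted_sum_scale j 1 hg), Nat.mul_1_l, Cmult_assoc, char_conj_mul by exact hg. ring.
  - assert (h0 : chi j = RtoC 0).
    { apply NNPP. intros h. apply char_coprime in h. contradiction. }
    rewrite h0, Cmult_0_l.
    set (g := Nat.gcd j q) in *.
    destruct (Nat.gcd_divide_r j q) as [d hd]. fold g in hd.
    destruct (Nat.gcd_divide_l j q) as [j' hj]. fold g in hj.
    assert (hg0 : (g <> 0)%nat) by nia.
    specialize (hp d). 
    assert (hdq : Nat.divide d q) by (exists g; lia).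
    specialize (hp hdq ltac:(nia)).
    apply not_all_ex_not in hp. destruct hp as [n hn].
    apply imply_to_and in hn. destruct hn as [hgn hn]. apply imply_to_and in hn. destruct hn as [hmod hne].
    assert (hd0 : (d <> 0)%nat) by nia.
    assert (e : ((j * n) mod q = j mod q)%nat).
    { transitivity ((j' * n * g) mod (d * g))%nat; [f_equal; nia |].
      transitivity ((j' * g) mod (d * g))%nat; [| f_equal; lia].
      rewrite (Nat.Div0.mul_mod_distr_r (j' * n) d g), (Nat.Div0.mul_mod_distr_r j' d g).
      f_equal. rewrite Nat.Div0.mul_mod, hmod, <- Nat.Div0.mul_mod, Nat.mul_1_r. reflexivity. }
    pose proof (twisted_sum_scale n j hgn) as es. rewrite (twisted_sum_mod _ _ e) in es.
    assert (h : ((Cconj (chi n) - 1) * twisted_sum j)%C = RtoC 0).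
    { replace ((Cconj (chi n) - 1) * twisted_sum j)%C with (Cconj (chi n) * twisted_sum j - twisted_sum j)%C by ring.
      rewrite es. ring. }
    apply Cmult_integral in h. destruct h as [h|h]; auto.
    elim hne. apply Ceq_minus in h. rewrite <- (Cconj_conj (chi n)), h. apply C_ext; simpl; ring.
Qed.

Lemma char_even (r : nat) : is_even_char q chi -> chi ((q - 1) * r)%nat = chi r.
Proof. intros he. rewrite char_mul, he. ring. Qed.

(** The general value is chi(-1) q, and evenness makes the sign 1. The product is expanded as the
    sum over j of [twisted_sum j] times the root of unity of index -j, with -j represented by (q -
    1) j; orthogonality leaves the residue r = 1 alone. *)
Theorem twisted_sum_gauss_sum : is_primitive q chi -> is_even_char q chi -> ~ is_principal q chi ->
  (twisted_sum 1 * gauss_sum q chi)%C = RtoC (INR q).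
Proof.
  intros hp he hn. pose proof (char_q_ge_2 hn) as h2. pose proof char_q_pos as hq.
  transitivity (psum (fun j => twisted_sum j * root_of_unity q ((q - 1) * j))%C q).
  - rewrite gauss_sum_psum, <- (psum_residues (q - 1) q _ hq (gcd_pred h2)), <- psum_scal.
    + apply psum_ext. intros j _. rewrite (twisted_sum_eq j hp), (char_even j he). ring.
    + intros n. pose proof (root_of_unity_periodic q char_q_pos 1 n) as e. cbv beta in e. rewrite !Nat.mul_1_l in e.
      now rewrite e, char_periodic.
  - assert (swap : forall n m (f : nat -> nat -> C),
      psum (fun j => psum (fun r => f j r) n) m = psum (fun r => psum (fun j => f j r) m) n).
    { intros n m f. induction m as [|m IH]; simpl.
      - induction n as [|n IH]; simpl; auto. rewrite <- IH. ring.
      - rewrite IH, <- psum_plus. reflexivity. }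
    rewrite (psum_ext _ (fun j => psum (fun r => Cconj (chi r) * root_of_unity q ((r + (q - 1)) * j))%C q)).
    2:{ intros j _. unfold twisted_sum. rewrite Cmult_comm, <- psum_scal. apply psum_ext. intros r _.
        rewrite Nat.mul_add_distr_r, root_of_unity_add, (Nat.mul_comm r j). ring. }
    rewrite swap.
    rewrite (psum_ext _ (fun r => if Nat.eqb r 1 then RtoC (INR q) else RtoC 0)).
    + assert (hs : forall n, psum (fun r => if Nat.eqb r 1 then RtoC (INR q) else RtoC 0) (S (S n)) = RtoC (INR q)).
      { induction n as [|n IH]; [simpl; ring |].
        change (psum (fun r => if Nat.eqb r 1 then RtoC (INR q) else RtoC 0) (S (S (S n))))
          with (psum (fun r => if Nat.eqb r 1 then RtoC (INR q) else RtoC 0) (S (S n)) + 0)%C.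
        rewrite IH. ring. }
      replace q with (S (S (q - 2))) at 1 by lia. apply hs.
    + intros r hr. rewrite psum_scal, psum_root_of_unity by exact hq.
      destruct (Nat.eqb_spec r 1) as [-> | hr1].
      * replace (1 + (q - 1))%nat with q by lia. rewrite Nat.Div0.mod_same. simpl.
        rewrite char_1. apply C_ext; simpl; ring.
      * destruct (Nat.eq_dec r 0) as [-> | hr0].
        -- rewrite Nat.add_0_l, Nat.mod_small by lia.
           destruct (Nat.eqb_spec (q - 1) 0); [lia | ring].
        -- replace (r + (q - 1))%nat with ((r - 1) + 1 * q)%nat by lia.
           rewrite Nat.Div0.mod_add, Nat.mod_small by lia.
           destruct (Nat.eqb_spec (r - 1) 0); [lia | ring].
Qed.

(** A cosine is half the sum of a root of unity and its inverse, and by evenness both halves give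
    the same twisted sum. *)
Lemma twisted_cos_sum (j : nat) : is_primitive q chi -> is_even_char q chi -> ~ is_principal q chi ->
  psum (fun r => Cconj (chi r) * RtoC (cos (2 * PI * INR (j * r) / INR q)))%C q = (chi j * twisted_sum 1)%C.
Proof.
  intros hp he hn. pose proof (char_q_ge_2 hn) as h2. pose proof char_q_pos as hq.
  rewrite <- twisted_sum_eq by exact hp.
  assert (hconj : psum (fun r => Cconj (chi r) * root_of_unity q ((q - 1) * (j * r)))%C q = twisted_sum j).
  { unfold twisted_sum. rewrite <- (psum_residues (q - 1) q _ hq (gcd_pred h2) (twisted_periodic j)).
    apply psum_ext. intros r _. rewrite char_even by exact he. do 2 f_equal. lia. }
  assert (hinv : forall k, (root_of_unity q ((q - 1) * k) * root_of_unity q k)%C = RtoC 1).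
  { intros k. rewrite <- root_of_unity_add. replace ((q - 1) * k + k)%nat with (k * q)%nat by nia.
    pose proof (root_of_unity_periodic q char_q_pos k 0%nat) as e. cbv beta in e. simpl in e.
    now rewrite e, Nat.mul_0_r, root_of_unity_0. }
  assert (hcos : forall k, RtoC (cos (2 * PI * INR k / INR q))
                     = (/ 2 * (root_of_unity q k + root_of_unity q ((q - 1) * k)))%C).
  { intros k. assert (h0 : root_of_unity q k <> RtoC 0) by apply Cexp_neq_0.
    replace (root_of_unity q ((q - 1) * k)) with (Cexp (- (Ci * RtoC (2 * PI * INR k / INR q)))).
    - unfold root_of_unity, Cexp. apply C_ext; simpl.
      + replace (- (0 * (2 * PI * INR k / INR q) - 1 * 0)) with 0 by ring.
        replace (0 * (2 * PI * INR k / INR q) - 1 * 0) with 0 by ring.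
        rewrite exp_0. replace (- (0 * 0 + 1 * (2 * PI * INR k / INR q))) with (- (2 * PI * INR k / INR q)) by ring.
        rewrite cos_neg. replace (0 * 0 + 1 * (2 * PI * INR k / INR q)) with (2 * PI * INR k / INR q) by ring. field.
      + replace (- (0 * (2 * PI * INR k / INR q) - 1 * 0)) with 0 by ring.
        replace (0 * (2 * PI * INR k / INR q) - 1 * 0) with 0 by ring.
        rewrite exp_0. replace (- (0 * 0 + 1 * (2 * PI * INR k / INR q))) with (- (2 * PI * INR k / INR q)) by ring.
        rewrite sin_neg. replace (0 * 0 + 1 * (2 * PI * INR k / INR q)) with (2 * PI * INR k / INR q) by ring. field.
    - rewrite Cexp_opp. fold (root_of_unity q k).
      replace (root_of_unity q ((q - 1) * k)) with
        (root_of_unity q ((q - 1) * k) * root_of_unity q k / root_of_unity q k)%C by (field; exact h0).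
      rewrite hinv. field. exact h0. }
  rewrite (psum_ext _ (fun r => / 2 * (Cconj (chi r) * root_of_unity q (j * r))
                        + / 2 * (Cconj (chi r) * root_of_unity q ((q - 1) * (j * r))))%C).
  2:{ intros r _. rewrite hcos. ring. }
  rewrite psum_plus, !psum_scal, hconj. unfold twisted_sum. field.
Qed.

End Characters.

(** * Partial fractions from the discrete Poisson kernel *)

Definition poisson_kernel (w alpha : R) : R := (1 - w ^ 2) / (1 - 2 * w * cos alpha + w ^ 2).

(** The half-angle form shows positivity and gives the lower bound needed for domination. *)
Lemma poisson_den (w alpha : R) :
  1 - 2 * w * cos alpha + w ^ 2 = (1 - w) ^ 2 + 4 * w * (sin (alpha / 2)) ^ 2.
Proof.
  replace alpha with (2 * (alpha / 2)) at 1 by field. rewrite cos_2a_sin. ring.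
Qed.

Lemma poisson_den_pos (w alpha : R) : 0 < w < 1 -> 0 < 1 - 2 * w * cos alpha + w ^ 2.
Proof. intros hw. rewrite poisson_den. pose proof (pow2_ge_0 (sin (alpha / 2))). nra. Qed.

(** Real part of the geometric sum of the powers of w e^(i alpha). *)
Lemma geometric_cos_sum (w alpha : R) (n : nat) :
  (1 - 2 * w * cos alpha + w ^ 2) * rpsum (fun k => w ^ k * cos (INR k * alpha)) n
  = 1 - w * cos alpha - w ^ n * cos (INR n * alpha) + w ^ S n * cos (INR n * alpha - alpha).
Proof.
  induction n as [|n IH].
  - simpl. rewrite Rmult_0_l, Rminus_0_l, cos_0, cos_neg. ring.
  - cbn [rpsum]. rewrite Rmult_plus_distr_l, IH, S_INR.
    replace ((INR n + 1) * alpha) with (INR n * alpha + alpha) by ring.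
    replace (INR n * alpha + alpha - alpha) with (INR n * alpha) by ring.
    rewrite cos_plus, cos_minus. simpl. ring.
Qed.

(** At alpha = 2 pi j / n the geometric sum closes up, because cos(n alpha) = 1 and cos(n alpha -
    alpha) = cos alpha. *)
Lemma poisson_kernel_sum (w : R) (n j : nat) : (0 < n)%nat -> 0 < w < 1 ->
  (1 - w ^ n) * poisson_kernel w (2 * PI * INR j / INR n)
  = 2 * rpsum (fun k => w ^ k * cos (INR k * (2 * PI * INR j / INR n))) n - (1 - w ^ n).
Proof.
  intros hn hw. set (al := 2 * PI * INR j / INR n).
  assert (hn0 : INR n <> 0) by (apply not_0_INR; lia).
  pose proof (geometric_cos_sum w al n) as h.
  replace (INR n * al) with (0 + 2 * INR j * PI) in h by (unfold al; field; auto).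
  rewrite cos_period, cos_0 in h.
  replace (0 + 2 * INR j * PI - al) with (- al + 2 * INR j * PI) in h by ring.
  rewrite cos_period, cos_neg in h.
  pose proof (poisson_den_pos w al hw) as hd. unfold poisson_kernel.
  apply (Rmult_eq_reg_l (1 - 2 * w * cos al + w ^ 2)); [| lra].
  set (Sg := rpsum (fun k => w ^ k * cos (INR k * al)) n) in *.
  replace ((1 - 2 * w * cos al + w ^ 2) * (2 * Sg - (1 - w ^ n)))
    with (2 * ((1 - 2 * w * cos al + w ^ 2) * Sg) - (1 - 2 * w * cos al + w ^ 2) * (1 - w ^ n)) by ring.
  rewrite h. replace (w ^ S n) with (w * w ^ n) by (simpl; ring). field. lra.
Qed.

Lemma Re_psum (a : nat -> C) (n : nat) : Re (psum a n) = rpsum (fun k => Re (a k)) n.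
Proof. induction n as [|n IH]; simpl; [reflexivity |]. unfold Re in *. now rewrite IH. Qed.

Lemma rpsum_cos (n m : nat) : (0 < n)%nat ->
  rpsum (fun j => cos (2 * PI * INR (m * j) / INR n)) n = if Nat.eqb (m mod n) 0 then INR n else 0.
Proof.
  intros hn. pose proof (psum_root_of_unity n hn m) as h. apply (f_equal Re) in h. rewrite Re_psum in h.
  rewrite (rpsum_ext _ (fun j => Re (root_of_unity n (m * j)))).
  - rewrite h. now destruct Nat.eqb.
  - intros j. unfold root_of_unity, Cexp. simpl.
    replace (0 * (2 * PI * INR (m * j) / INR n) - 1 * 0) with 0 by ring.
    replace (0 * 0 + 1 * (2 * PI * INR (m * j) / INR n)) with (2 * PI * INR (m * j) / INR n) by ring.
    rewrite exp_0. ring.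
Qed.

Lemma rpsum_plus (a b : nat -> R) (n : nat) : rpsum (fun k => a k + b k) n = rpsum a n + rpsum b n.
Proof. induction n as [|n IH]; simpl; [ring |]. rewrite IH. ring. Qed.

Lemma rpsum_swap (f : nat -> nat -> R) (n m : nat) :
  rpsum (fun j => rpsum (fun k => f j k) n) m = rpsum (fun k => rpsum (fun j => f j k) m) n.
Proof.
  induction m as [|m IH]; simpl.
  - induction n as [|n IH]; simpl; auto. rewrite <- IH. ring.
  - rewrite IH, <- rpsum_plus. reflexivity.
Qed.

Lemma rpsum_ext_lt (b c : nat -> R) (n : nat) : (forall k, (k < n)%nat -> b k = c k) -> rpsum b n = rpsum c n.
Proof. induction n as [|n IH]; intros h; simpl; auto. rewrite IH, h; auto. Qed.

Lemma rpsum_pick (f : nat -> R) (m n : nat) :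
  rpsum (fun k => if Nat.eqb k m then f k else 0) n = if Nat.ltb m n then f m else 0.
Proof.
  induction n as [|n IH]; [reflexivity |]. cbn [rpsum]. rewrite IH.
  destruct (Nat.eqb_spec n m) as [-> | h].
  - rewrite Nat.ltb_irrefl. assert (e : Nat.ltb m (S m) = true) by (apply Nat.ltb_lt; lia). rewrite e. ring.
  - destruct (Nat.ltb_spec m n), (Nat.ltb_spec m (S n)); try lia; ring.
Qed.

(** Fourier coefficients of the Poisson kernel over the n-th roots of unity: orthogonality retains
    only the frequencies r and n - r. *)
Lemma discrete_poisson (w : R) (n r : nat) : (r < n)%nat -> 0 < w < 1 ->
  rpsum (fun j => cos (2 * PI * INR (r * j) / INR n) * poisson_kernel w (2 * PI * INR j / INR n)) n
  = INR n * (w ^ r + w ^ (n - r)) / (1 - w ^ n).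
Proof.
  intros hr hw. assert (hn : (0 < n)%nat) by lia.
  assert (hn0 : INR n <> 0) by (apply not_0_INR; lia).
  assert (hwn : 0 < 1 - w ^ n).
  { assert (w ^ n < 1); [| lra]. apply pow_lt_1_compat; [lra | lia]. }
  apply (Rmult_eq_reg_l (1 - w ^ n)); [| lra].
  replace ((1 - w ^ n) * (INR n * (w ^ r + w ^ (n - r)) / (1 - w ^ n))) with (INR n * (w ^ r + w ^ (n - r)))
    by (field; lra).
  rewrite <- rpsum_scal.
  (* Product-to-sum formula; max minus min is |k - r| in natural numbers. *)
  rewrite (rpsum_ext _ (fun j => rpsum (fun k => w ^ k * (cos (2 * PI * INR (Nat.max k r - Nat.min k r) * INR j / INR n)
            + cos (2 * PI * INR (k + r) * INR j / INR n))) n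
            + - (1 - w ^ n) * cos (2 * PI * INR (r * j) / INR n))).
  2:{ intros j.
      replace ((1 - w ^ n) * (cos (2 * PI * INR (r * j) / INR n) * poisson_kernel w (2 * PI * INR j / INR n)))
        with (cos (2 * PI * INR (r * j) / INR n) * ((1 - w ^ n) * poisson_kernel w (2 * PI * INR j / INR n))) by ring.
      rewrite poisson_kernel_sum by assumption.
      rewrite Rmult_minus_distr_l. unfold Rminus. f_equal; [| ring].
      rewrite <- Rmult_assoc, <- rpsum_scal. apply rpsum_ext. intros k.
      set (a := INR k * (2 * PI * INR j / INR n)). set (b := 2 * PI * INR (r * j) / INR n).
      replace (cos (2 * PI * INR (Nat.max k r - Nat.min k r) * INR j / INR n)) with (cos (a - b)).
      - replace (2 * PI * INR (k + r) * INR j / INR n) with (a + b)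
          by (unfold a, b; rewrite mult_INR, plus_INR; field; auto).
        rewrite cos_plus, cos_minus. ring.
      - destruct (Nat.le_ge_cases k r) as [h|h].
        + rewrite Nat.max_r, Nat.min_l, minus_INR by lia. rewrite <- cos_neg. f_equal.
          unfold a, b. rewrite mult_INR. field. auto.
        + rewrite Nat.max_l, Nat.min_r, minus_INR by lia. f_equal.
          unfold a, b. rewrite mult_INR. field. auto. }
  rewrite rpsum_plus, rpsum_scal, rpsum_swap, (rpsum_cos n r hn), Nat.mod_small by assumption.
  (* For r = 0 the index n - r falls outside the range of k, and the second surviving frequency is
     again 0. *)
  rewrite (rpsum_ext_lt _ (fun k => (if Nat.eqb k r then INR n * w ^ k else 0)
              + (if Nat.eqb k (if Nat.eqb r 0 then 0 else n - r) then INR n * w ^ k else 0))).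
  2:{ intros k hk. rewrite rpsum_scal, rpsum_plus.
      rewrite (rpsum_ext (fun j => cos (2 * PI * INR (Nat.max k r - Nat.min k r) * INR j / INR n))
                 (fun j => cos (2 * PI * INR ((Nat.max k r - Nat.min k r) * j) / INR n)))
        by (intros j; rewrite (mult_INR (_ - _)); do 2 f_equal; ring).
      rewrite (rpsum_ext (fun j => cos (2 * PI * INR (k + r) * INR j / INR n))
                 (fun j => cos (2 * PI * INR ((k + r) * j) / INR n)))
        by (intros j; rewrite (mult_INR (k + r)); do 2 f_equal; ring).
      rewrite !rpsum_cos by assumption. rewrite (Nat.mod_small (_ - _)) by lia.
      rewrite Rmult_plus_distr_l. f_equal.
      - destruct (Nat.eqb_spec (Nat.max k r - Nat.min k r) 0), (Nat.eqb_spec k r); try lia; ring.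
      - destruct (Nat.eqb_spec r 0) as [-> | hr0].
        + rewrite Nat.add_0_r, Nat.mod_small by assumption. destruct (Nat.eqb_spec k 0); ring.
        + destruct (Nat.eqb_spec k (n - r)) as [-> | hk'].
          * replace (n - r + r)%nat with n by lia. rewrite Nat.Div0.mod_same. simpl. ring.
          * destruct (Nat.lt_ge_cases (k + r) n) as [h|h].
            -- rewrite Nat.mod_small by assumption. destruct (Nat.eqb_spec (k + r) 0); [lia | ring].
            -- replace (k + r)%nat with ((k + r - n) + 1 * n)%nat by lia.
               rewrite Nat.Div0.mod_add, Nat.mod_small by lia.
               destruct (Nat.eqb_spec (k + r - n) 0); [lia | ring]. }
  rewrite rpsum_plus, (rpsum_pick (fun k => INR n * w ^ k)), (rpsum_pick (fun k => INR n * w ^ k)).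
  destruct (Nat.eqb_spec r 0) as [-> | hr0].
  - destruct (Nat.ltb_spec 0 n); [| lia]. rewrite Nat.sub_0_r. simpl. ring.
  - destruct (Nat.ltb_spec r n), (Nat.ltb_spec (n - r) n); try lia. ring.
Qed.

(** Up to pi/3 the derivative is at least 1/2; beyond, sin(pi/3) already exceeds x/3. As pi >= 3,
    the constant 1/3 yields sin(pi t) >= t for 0 <= t <= 1/2. *)
Lemma sin_lower (x : R) : 0 <= x <= PI / 2 -> x / 3 <= sin x.
Proof.
  intros hx. pose proof PI_RGT_0. pose proof PI_4.
  destruct (Rle_dec x (PI / 3)) as [h|h].
  - destruct (Req_dec x 0) as [-> | h0]; [rewrite sin_0; lra |].
    destruct (MVT_cor2 sin cos 0 x) as (c & e & hc); [lra | intros; apply derivable_pt_lim_sin |].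
    rewrite sin_0 in e.
    assert (cos (PI / 3) <= cos c) by (apply cos_decr_1; lra). rewrite cos_PI3 in H1. nra.
  - assert (sin (PI / 3) <= sin x) by (apply sin_incr_1; lra). rewrite sin_PI3 in H1.
    assert (4 / 3 <= sqrt 3); [| lra].
    replace (4 / 3) with (sqrt ((4 / 3) * (4 / 3))) by (apply sqrt_square; lra). apply sqrt_le_1_alt. lra.
Qed.

(** * The Lorentzian series as a limit of discrete sums *)

Lemma lim_difference_quotient (f : R -> R) (l : R) (h : nat -> R) :
  is_derive f 0 l -> f 0 = 0 -> (forall n, h n <> 0) -> is_lim_seq h 0 ->
  is_lim_seq (fun n => f (h n) / h n) l.
Proof.
  intros hf h0 hn hh. apply is_derive_Reals in hf. apply is_lim_seq_spec. intros eps.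
  destruct (hf eps (cond_pos eps)) as [d hd].
  apply is_lim_seq_spec in hh. destruct (hh d) as [N hN]. exists N. intros n hnn.
  specialize (hN n hnn). rewrite Rminus_0_r in hN. specialize (hd (h n) (hn n) hN).
  rewrite Rplus_0_l, h0, Rminus_0_r in hd. exact hd.
Qed.

Section Lorentzian_series.

Variables (q rho : nat) (y : R).
Hypothesis hq : (0 < q)%nat.
Hypothesis hrho : (rho < q)%nat.
Hypothesis hy : 0 < y.

(** A multiple of 2q: the frequency rho/q becomes the integer frequency 2(k+1) rho over N, and a
    period splits into two equal halves. *)
Let N (k : nat) : nat := (2 * (q * S k))%nat.
(** Makes W^N = e^(-2 pi y) independent of k, while the Poisson kernel at 2 pi j/N divided by N
    tends to a Lorentzian in j. *)
Let W (k : nat) : R := exp (- (2 * PI * y / INR (N k))).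
Let term (k j : nat) : R :=
  cos (2 * PI * INR (rho * j) / INR q) * (poisson_kernel (W k) (2 * PI * INR j / INR (N k)) / INR (N k)).
Let A (j : nat) : R := cos (2 * PI * INR (rho * j) / INR q) * (y / (PI * (y ^ 2 + INR j ^ 2))).
Let V : R := (exp (- (2 * PI * y * (INR rho / INR q))) + exp (- (2 * PI * y * (1 - INR rho / INR q))))
             / (1 - exp (- (2 * PI * y))).

Lemma lorentz_N_pos (k : nat) : 0 < INR (N k).
Proof. apply lt_0_INR. unfold N. nia. Qed.

Lemma lorentz_W_bounds (k : nat) : exp (- (2 * PI * y)) <= W k < 1.
Proof.
  pose proof PI_RGT_0. pose proof (lorentz_N_pos k) as hN.
  assert (h1 : 1 <= INR (N k)) by (apply (le_INR 1); unfold N; nia).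
  assert (h2 : 0 < 2 * PI * y / INR (N k)) by (apply Rdiv_lt_0_compat; nra).
  assert (h3 : 2 * PI * y / INR (N k) <= 2 * PI * y).
  { unfold Rdiv. rewrite <- (Rmult_1_r (2 * PI * y)) at 2. apply Rmult_le_compat_l; [nra |].
    rewrite <- Rinv_1. apply Rinv_le_contravar; lra. }
  split; unfold W.
  - apply exp_mono. lra.
  - rewrite <- exp_0. apply exp_increasing. lra.
Qed.

Lemma lorentz_sum (k : nat) : rpsum (term k) (N k) = V.
Proof.
  pose proof (lorentz_W_bounds k) as hW. pose proof (lorentz_N_pos k) as hN.
  assert (hWp : 0 < W k) by apply exp_pos.
  assert (hq0 : INR q <> 0) by (apply not_0_INR; lia).
  assert (hNq : INR (N k) = 2 * INR q * INR (S k)) by (unfold N; rewrite !mult_INR; simpl; ring).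
  assert (hSk : INR (S k) <> 0) by (apply not_0_INR; lia).
  assert (hr : (2 * S k * rho < N k)%nat) by (unfold N; nia).
  pose proof (discrete_poisson (W k) (N k) (2 * S k * rho) hr ltac:(lra)) as h.
  rewrite (rpsum_ext _ (fun j => / INR (N k) * (cos (2 * PI * INR (2 * S k * rho * j) / INR (N k))
             * poisson_kernel (W k) (2 * PI * INR j / INR (N k))))).
  - rewrite rpsum_scal, h. unfold V, W.
    assert (hpow : forall m, exp (- (2 * PI * y / INR (N k))) ^ m = exp (- (2 * PI * y * (INR m / INR (N k))))).
    { intros m. rewrite <- Rpower_pow by apply exp_pos. unfold Rpower. rewrite ln_exp. f_equal. field. lra. }
    rewrite !hpow.
    replace (INR (2 * S k * rho) / INR (N k)) with (INR rho / INR q).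
    2:{ rewrite hNq, !mult_INR. change (INR 2) with 2. field. auto. }
    replace (INR (N k - 2 * S k * rho) / INR (N k)) with (1 - INR rho / INR q).
    2:{ rewrite minus_INR by lia. rewrite hNq, !mult_INR. change (INR 2) with 2. field. auto. }
    replace (INR (N k) / INR (N k)) with 1 by (field; lra). rewrite Rmult_1_r.
    field. split; [| lra].
    assert (exp (- (2 * PI * y)) < 1); [| lra]. rewrite <- exp_0. apply exp_increasing. pose proof PI_RGT_0. nra.
  - intros j. unfold term.
    replace (2 * PI * INR (2 * S k * rho * j) / INR (N k)) with (2 * PI * INR (rho * j) / INR q).
    + field. lra.
    + rewrite hNq, !mult_INR. change (INR 2) with 2. field. auto.
Qed.

Lemma lorentz_reflect (k i : nat) : (i <= N k)%nat -> term k (N k - i) = term k i.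
Proof.
  intros hi. pose proof (lorentz_N_pos k) as hN.
  assert (hq0 : INR q <> 0) by (apply not_0_INR; lia).
  unfold term. f_equal.
  - rewrite mult_INR, minus_INR by assumption.
    replace (2 * PI * (INR rho * (INR (N k) - INR i)) / INR q)
      with (- (2 * PI * INR (rho * i) / INR q) + 2 * INR (rho * (2 * S k)) * PI).
    + rewrite cos_period, cos_neg. reflexivity.
    + unfold N. rewrite !mult_INR. field. auto.
  - f_equal. unfold poisson_kernel. do 2 f_equal.
    rewrite minus_INR by assumption.
    replace (2 * PI * (INR (N k) - INR i) / INR (N k)) with (- (2 * PI * INR i / INR (N k)) + 2 * INR 1 * PI)
      by (simpl; field; lra).
    now rewrite cos_period, cos_neg.
Qed.

(** The symmetry j -> N - j folds the period onto j <= N/2, in trapezoidal form. On that range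
    sin(pi j/N) is at least j/N, which the uniform bound requires. *)
Lemma lorentz_half_sum (k : nat) : rpsum (fun j => term k j + term k (S j)) (q * S k) = V.
Proof.
  rewrite <- (lorentz_sum k). set (H := (q * S k)%nat).
  assert (hrev : forall m (f : nat -> R), rpsum f m = rpsum (fun j => f (m - 1 - j)%nat) m).
  { clear. induction m as [|m IH]; intros f; [reflexivity |].
    assert (hfirst : forall (g : nat -> R) n, rpsum g (S n) = g 0%nat + rpsum (fun j => g (S j)) n).
    { intros g n. induction n as [|n IHn]; [simpl; ring |].
      change (rpsum g (S (S n))) with (rpsum g (S n) + g (S n)). rewrite IHn. simpl. ring. }
    rewrite (hfirst (fun j => f (S m - 1 - j)%nat)). cbn [rpsum]. rewrite IH, Rplus_comm.
    f_equal; [f_equal; lia |]. apply rpsum_ext. intros j. f_equal. lia. }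
  assert (hadd : forall n m (f : nat -> R), rpsum f (n + m) = rpsum f n + rpsum (fun j => f (n + j)%nat) m).
  { clear. intros n m f. induction m as [|m IH]; [simpl; rewrite Nat.add_0_r; ring |].
    rewrite Nat.add_succ_r. simpl. rewrite IH. ring. }
  replace (N k) with (H + H)%nat by (unfold N, H; lia).
  rewrite hadd, rpsum_plus. f_equal.
  rewrite (hrev H (fun j => term k (H + j)%nat)). apply rpsum_ext_lt. intros j hj.
  rewrite <- (lorentz_reflect k (S j)) by (unfold N; fold H; lia).
  f_equal. unfold N. fold H. lia.
Qed.

(** Domination for Tannery's theorem. [E] bounds 1/W for all k. The term j = 0 is at most E / (PI
    y); for j >= 1 the half-angle form gives PI y E / j^2, and j >= (j+1)/2 costs the factor 4. *)
Lemma lorentz_term_bound : exists B, 0 <= B /\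
  forall k j, (j <= q * S k)%nat -> Rabs (term k j) <= B * / INR (S j) ^ 2.
Proof.
  assert (hpi : 0 < PI) by apply PI_RGT_0.
  set (E := exp (2 * PI * y)). assert (hE : 0 < E) by apply exp_pos.
  exists (E / (PI * y) + 4 * (PI * y * E)).
  assert (hB1 : 0 < E / (PI * y)) by (apply Rdiv_lt_0_compat; nra).
  assert (hB2 : 0 < PI * y * E) by (apply Rmult_lt_0_compat; [now apply Rmult_lt_0_compat | auto]).
  split; [lra |]. intros k j hj.
  pose proof (lorentz_W_bounds k) as hW. pose proof (lorentz_N_pos k) as hN.
  set (n := INR (N k)) in *. set (w := W k) in *. set (x := 2 * PI * y / n).
  assert (hx : 0 < x) by (apply Rdiv_lt_0_compat; nra).
  assert (hw : w = exp (- x)) by reflexivity.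
  assert (hwE : / E <= w) by (unfold E; rewrite <- exp_Ropp; tauto).
  assert (hwp : 0 < w) by (rewrite hw; apply exp_pos).
  assert (h1w : 1 - w <= x) by (pose proof (exp_ineq1_le (- x)); lra).
  assert (h2w : x * w <= 1 - w).
  { pose proof (exp_ineq1_le x) as h. assert (e : w * exp x = 1).
    { rewrite hw, <- exp_plus. replace (- x + x) with 0 by ring. apply exp_0. } nra. }
  pose proof (poisson_den_pos w (2 * PI * INR j / n) ltac:(lra)) as hden.
  assert (hP : 0 <= poisson_kernel w (2 * PI * INR j / n)).
  { unfold poisson_kernel. apply Rmult_le_pos; [nra | apply Rlt_le, Rinv_0_lt_compat, hden]. }
  unfold term. fold w n. rewrite Rabs_mult.
  apply Rle_trans with (1 * (poisson_kernel w (2 * PI * INR j / n) / n)).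
  { apply Rmult_le_compat; try apply Rabs_pos.
    - apply Rabs_le. apply COS_bound.
    - rewrite Rabs_pos_eq; [lra |]. apply Rmult_le_pos; [exact hP | apply Rlt_le, Rinv_0_lt_compat, hN]. }
  rewrite Rmult_1_l.
  assert (hSj : 0 < INR (S j)) by (apply lt_0_INR; lia).
  destruct (Nat.eq_dec j 0) as [-> | hj0].
  - apply Rle_trans with (E / (PI * y)).
    2:{ simpl. replace (1 * (1 * 1)) with 1 by ring. rewrite Rinv_1. lra. }
    unfold poisson_kernel. simpl INR. replace (2 * PI * 0 / n) with 0 by (field; lra). rewrite cos_0.
    replace ((1 - w ^ 2) / (1 - 2 * w * 1 + w ^ 2) / n) with ((1 + w) * / (n * (1 - w))) by (field; repeat split; nra).
    apply Rle_trans with (2 * / (n * (x * / E))).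
    + apply Rmult_le_compat; [lra | apply Rlt_le, Rinv_0_lt_compat; nra | lra |].
      apply Rinv_le_contravar; [apply Rmult_lt_0_compat; auto; apply Rmult_lt_0_compat; auto; now apply Rinv_0_lt_compat |].
      apply Rmult_le_compat_l; [lra |]. apply Rle_trans with (x * w); auto. apply Rmult_le_compat_l; lra.
    + right. unfold x. field. repeat split; nra.
  - assert (hj1 : 1 <= INR j) by (apply (le_INR 1); lia).
    assert (hjn : INR j / n <= / 2).
    { apply (Rmult_le_reg_r n); auto. unfold Rdiv. rewrite Rmult_assoc, Rinv_l, Rmult_1_r by lra.
      apply le_INR in hj. unfold n, N. rewrite mult_INR. change (INR 2) with 2. lra. }
    assert (hjn0 : 0 < INR j / n) by (apply Rdiv_lt_0_compat; lra).
    assert (hsin : INR j / n <= sin (2 * PI * INR j / n / 2)).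
    { replace (2 * PI * INR j / n / 2) with (PI * (INR j / n)) by (field; lra).
      eapply Rle_trans; [| apply sin_lower; nra]. pose proof PI2_3_2. nra. }
    assert (hd : 4 * / E * (INR j / n) ^ 2 <= 1 - 2 * w * cos (2 * PI * INR j / n) + w ^ 2).
    { rewrite poisson_den.
      assert ((INR j / n) ^ 2 <= sin (2 * PI * INR j / n / 2) ^ 2) by (apply pow_incr; lra).
      assert (0 < / E) by now apply Rinv_0_lt_compat.
      pose proof (pow2_ge_0 (1 - w)). pose proof (pow2_ge_0 (INR j / n)).
      assert (4 * / E * (INR j / n) ^ 2 <= 4 * w * sin (2 * PI * INR j / n / 2) ^ 2); [| lra].
      apply Rmult_le_compat; lra. }
    assert (hd0 : 0 < 4 * / E * (INR j / n) ^ 2).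
    { apply Rmult_lt_0_compat; [| now apply pow_lt]. assert (0 < / E) by now apply Rinv_0_lt_compat. lra. }
    apply Rle_trans with (2 * x * / (4 * / E * (INR j / n) ^ 2) * / n).
    { unfold poisson_kernel, Rdiv. apply Rmult_le_compat_r; [apply Rlt_le, Rinv_0_lt_compat, hN |].
      apply Rmult_le_compat; [nra | apply Rlt_le, Rinv_0_lt_compat, hden | nra |].
      apply Rinv_le_contravar; auto. }
    replace (2 * x * / (4 * / E * (INR j / n) ^ 2) * / n) with (PI * y * E * / INR j ^ 2)
      by (unfold x; field; repeat split; lra).
    apply Rle_trans with (4 * (PI * y * E) * / INR (S j) ^ 2).
    + replace (4 * (PI * y * E) * / INR (S j) ^ 2) with (PI * y * E * / ((INR (S j) / 2) ^ 2)) by (field; lra).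
      apply Rmult_le_compat_l; [lra |]. apply Rinv_le_contravar.
      * apply pow_lt. lra.
      * apply pow_incr. rewrite S_INR in *. lra.
    + apply Rmult_le_compat_r; [apply Rlt_le, Rinv_0_lt_compat, pow_lt, hSj | lra].
Qed.

Lemma lorentz_N_inv_lim : is_lim_seq (fun k => / INR (N k)) 0.
Proof.
  apply is_lim_seq_spec. intros eps.
  destruct (archimed_cor1 eps (cond_pos eps)) as (M & hM & hM0).
  exists M. intros k hk. rewrite Rminus_0_r, Rabs_pos_eq.
  - eapply Rle_lt_trans; [| exact hM]. apply Rinv_le_contravar; [apply lt_0_INR; lia |].
    apply le_INR. unfold N. nia.
  - apply Rlt_le, Rinv_0_lt_compat, lorentz_N_pos.
Qed.

(** With h = 1/N, dividing numerator and denominator by h^2 leaves the difference quotients (1 -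
    W)/h, tending to 2 pi y, and sin(pi j h)/h, tending to pi j. *)
Lemma lorentz_term_lim (j : nat) : is_lim_seq (fun k => term k j) (A j).
Proof.
  assert (hpi : 0 < PI) by apply PI_RGT_0.
  set (h := fun k => / INR (N k)).
  assert (hh : is_lim_seq h 0) by apply lorentz_N_inv_lim.
  assert (hh0 : forall k, h k <> 0) by (intros k; apply Rgt_not_eq, Rinv_0_lt_compat, lorentz_N_pos).
  assert (l1 : is_lim_seq (fun k => (1 - exp (- (2 * PI * y * h k))) / h k) (2 * PI * y)).
  { apply (lim_difference_quotient (fun t => 1 - exp (- (2 * PI * y * t)))); auto.
    - auto_derive; auto. rewrite Rmult_0_r, Ropp_0, exp_0. ring.
    - rewrite Rmult_0_r, Ropp_0, exp_0. ring. }
  assert (l2 : is_lim_seq (fun k => sin (PI * INR j * h k) / h k) (PI * INR j)).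
  { apply (lim_difference_quotient (fun t => sin (PI * INR j * t))); auto.
    - auto_derive; auto. rewrite Rmult_0_r, cos_0. ring.
    - rewrite Rmult_0_r. apply sin_0. }
  assert (l3 : is_lim_seq (fun k => exp (- (2 * PI * y * h k))) 1).
  { assert (hc : is_lim_seq (fun k => exp (- (2 * PI * y * h k))) (exp (- (2 * PI * y * 0)))).
    { apply (is_lim_seq_continuous (fun t => exp (- (2 * PI * y * t)))); [| exact hh].
      reg. }
    rewrite Rmult_0_r, Ropp_0, exp_0 in hc. exact hc. }
  assert (hden : (2 * PI * y) ^ 2 + 4 * 1 * (PI * INR j) ^ 2 <> 0).
  { apply Rgt_not_eq. pose proof (pow2_ge_0 (PI * INR j)). assert (0 < (2 * PI * y) ^ 2); [| lra].
    apply pow_lt. nra. }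
  assert (lim : is_lim_seq (fun k => cos (2 * PI * INR (rho * j) / INR q) *
     ((1 - exp (- (2 * PI * y * h k))) / h k * (1 + exp (- (2 * PI * y * h k)))
      / (((1 - exp (- (2 * PI * y * h k))) / h k) ^ 2
         + 4 * exp (- (2 * PI * y * h k)) * (sin (PI * INR j * h k) / h k) ^ 2)))
     (cos (2 * PI * INR (rho * j) / INR q) * (2 * PI * y * (1 + 1) / ((2 * PI * y) ^ 2 + 4 * 1 * (PI * INR j) ^ 2)))).
  { apply is_lim_seq_mult'; [apply is_lim_seq_const |].
    apply is_lim_seq_div'; [| | exact hden].
    - apply is_lim_seq_mult'; [exact l1 |]. apply is_lim_seq_plus'; [apply is_lim_seq_const | exact l3].
    - simpl. apply is_lim_seq_plus'.
      + apply is_lim_seq_mult'; [exact l1 |]. apply is_lim_seq_mult'; [exact l1 | apply is_lim_seq_const].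
      + apply is_lim_seq_mult'; [apply is_lim_seq_mult'; [apply is_lim_seq_const | exact l3] |].
        apply is_lim_seq_mult'; [exact l2 |]. apply is_lim_seq_mult'; [exact l2 | apply is_lim_seq_const]. }
  replace (Finite (A j)) with (Finite (cos (2 * PI * INR (rho * j) / INR q) *
     (2 * PI * y * (1 + 1) / ((2 * PI * y) ^ 2 + 4 * 1 * (PI * INR j) ^ 2)))).
  - eapply is_lim_seq_ext; [| exact lim]. intros k. unfold term. f_equal.
    pose proof (lorentz_W_bounds k) as hW. pose proof (lorentz_N_pos k) as hN.
    assert (hw : exp (- (2 * PI * y * h k)) = W k) by reflexivity. rewrite hw.
    unfold poisson_kernel. rewrite poisson_den.
    replace (2 * PI * INR j / INR (N k) / 2) with (PI * INR j * h k) by (unfold h; field; lra).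
    assert (hd : 0 < (1 - W k) ^ 2 + 4 * W k * sin (PI * INR j * h k) ^ 2).
    { pose proof (pow2_ge_0 (sin (PI * INR j * h k))). assert (0 < W k) by apply exp_pos.
      assert (0 < (1 - W k) ^ 2) by (apply pow_lt; lra). nra. }
    set (sn := sin (PI * INR j * h k)) in *. unfold h. field.
    repeat split; try lra.
    intros e. assert (0 < INR (N k) ^ 2 * ((1 - W k) ^ 2 + 4 * W k * sn ^ 2)) by (apply Rmult_lt_0_compat; auto; now apply pow_lt).
    lra.
  - f_equal. unfold A. f_equal. field. pose proof (pow2_ge_0 (INR j)). split; [| split]; nra.
Qed.

(** Tannery's theorem in the folded discrete formula, whose value V is the same for all numbers of
    nodes. *)
Theorem lorentzian_series :
  Cser (fun j => RtoC (2 * (cos (2 * PI * INR (rho * S j) / INR q) * (y / (PI * (y ^ 2 + INR (S j) ^ 2))))))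
    (RtoC (V - / (PI * y))).
Proof.
  assert (hpi : 0 < PI) by apply PI_RGT_0.
  destruct lorentz_term_bound as (B & hB0 & hB).
  destruct (p_series 2 ltac:(lra)) as (S2 & hS2).
  assert (hsum : rsum (fun j => 2 * B * / INR (S j) ^ 2) (2 * B * S2)).
  { apply rsum_scal; [lra |]. eapply rsum_ext; [| exact hS2]. exact Rpower_INR_S_neg2. }
  (* The cut-off q (k + 1) = N/2 grows with k, so each fixed j is eventually included. *)
  destruct (tannery (fun k j => if Nat.ltb j (q * S k) then RtoC (term k j + term k (S j)) else RtoC 0)
              (fun j => 2 * B * / INR (S j) ^ 2) (2 * B * S2) (fun j => RtoC (A j + A (S j))) (fun _ => RtoC V))
    as (L & hL & hlim).
  - intros k j. assert (h0 : 0 < / INR (S j) ^ 2) by (apply Rinv_0_lt_compat, pow_lt, lt_0_INR; lia).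
    destruct (Nat.ltb_spec j (q * S k)) as [h|h].
    + rewrite Cmod_R. eapply Rle_trans; [apply Rabs_triang |].
      pose proof (hB k j ltac:(lia)) as b1. pose proof (hB k (S j) ltac:(lia)) as b2.
      assert (/ INR (S (S j)) ^ 2 <= / INR (S j) ^ 2).
      { apply Rinv_le_contravar; [apply pow_lt, lt_0_INR; lia |].
        apply pow_incr. split; [apply pos_INR | apply le_INR; lia]. }
      nra.
    + rewrite Cmod_0. nra.
  - exact hsum.
  - intros j. assert (hl : is_lim_seq (fun k => term k j + term k (S j)) (A j + A (S j)))
      by (apply is_lim_seq_plus'; apply lorentz_term_lim).
    apply climit_RtoC in hl. intros eps he. destruct (hl eps he) as [M hM]. exists (M + j)%nat. intros k hk.
    destruct (Nat.ltb_spec j (q * S k)) as [h|h]; [apply hM; lia | nia].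
  - intros k. rewrite <- (lorentz_half_sum k), <- psum_RtoC.
    rewrite (psum_ext _ (fun j => if Nat.ltb j (q * S k) then RtoC (term k j + term k (S j)) else RtoC 0)).
    + apply Cser_finite. intros j hj. destruct (Nat.ltb_spec j (q * S k)); [lia | reflexivity].
    + intros j hj. destruct (Nat.ltb_spec j (q * S k)); [reflexivity | lia].
  - assert (e : L = RtoC V) by (eapply climit_unique; [exact hlim | apply climit_const]). subst L.
    assert (hA0 : A 0%nat = / (PI * y)).
    { unfold A. rewrite Nat.mul_0_r. simpl. replace (2 * PI * 0 / INR q) with 0 by (unfold Rdiv; ring).
      rewrite cos_0. field. split; nra. }
    assert (hAN : is_lim_seq (fun j => A (S j)) 0).
    { assert (hi : is_lim_seq (fun j => y / PI * / INR (S j)) (y / PI * 0)).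
      { apply is_lim_seq_mult'; [apply is_lim_seq_const |].
        apply (is_lim_seq_incr_1 (fun n => / INR n)). apply (is_lim_seq_inv _ p_infty); [| discriminate].
        apply is_lim_seq_INR. }
      rewrite Rmult_0_r in hi.
      apply (is_lim_seq_le_le (fun j => - (y / PI * / INR (S j))) _ (fun j => y / PI * / INR (S j))); auto.
      - intros j. apply Rabs_le_between. unfold A. rewrite Rabs_mult.
        assert (hj : 1 <= INR (S j)) by (apply (le_INR 1); lia).
        assert (hd : 0 < PI * (y ^ 2 + INR (S j) ^ 2)) by (apply Rmult_lt_0_compat; nra).
        apply Rle_trans with (1 * (y / (PI * (y ^ 2 + INR (S j) ^ 2)))).
        { apply Rmult_le_compat; try apply Rabs_pos.
          - apply Rabs_le, COS_bound.
          - rewrite Rabs_pos_eq; [lra |]. apply Rlt_le, Rdiv_lt_0_compat; auto. }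
        rewrite Rmult_1_l. replace (y / PI * / INR (S j)) with (y * / (PI * INR (S j))) by (field; lra).
        apply Rmult_le_compat_l; [lra |]. apply Rinv_le_contravar; [nra |]. apply Rmult_le_compat_l; nra.
      - replace (Finite 0) with (Rbar_opp 0) by (simpl; f_equal; ring).
        now apply -> is_lim_seq_opp. }
    apply climit_RtoC in hAN.
    intros eps he.
    destruct (hL (eps / 2)) as [M hM]; [lra |]. destruct (hAN (eps / 2)) as [M' hM']; [lra |].
    exists (M + M' + 1)%nat. intros n hn. destruct n as [|n]; [lia |].
    specialize (hM (S n) ltac:(lia)). specialize (hM' n ltac:(lia)).
    rewrite psum_RtoC, <- RtoC_minus, Cmod_R in hM |- *. rewrite <- RtoC_minus, Cmod_R in hM'.
    (* From trapezoidal to plain sums: the correction is A 0 = 1 / (pi y) and a boundary term A m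
       that tends to 0. *)
    assert (ident : forall m, rpsum (fun j => 2 * (cos (2 * PI * INR (rho * S j) / INR q)
              * (y / (PI * (y ^ 2 + INR (S j) ^ 2))))) m = rpsum (fun j => A j + A (S j)) m - A 0%nat + A m).
    { induction m as [|m IH]; [simpl; ring |]. cbn [rpsum]. rewrite IH. fold (A (S m)). ring. }
    rewrite ident, hA0.
    replace (rpsum (fun j => A j + A (S j)) (S n) - / (PI * y) + A (S n) - (V - / (PI * y)))
      with ((rpsum (fun j => A j + A (S j)) (S n) - V) + A (S n)) by ring.
    eapply Rle_lt_trans; [apply Rabs_triang |]. rewrite Rminus_0_r in hM'. lra.
Qed.

End Lorentzian_series.

Lemma exp_neg_lt_1 (x : R) : 0 < x -> exp (- x) < 1.
Proof. intros hx. rewrite <- exp_0. apply exp_increasing. lra. Qed.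

(** The case q = 1, rho = 0: there V = (1 + e^(-2 pi y)) / (1 - e^(-2 pi y)), and V/2 = 1 / (e^(2 pi
    y) - 1) + 1/2. *)
Theorem planck_series (y : R) : 0 < y ->
  Cser (fun m => RtoC (y / (PI * (y ^ 2 + INR (S m) ^ 2))))
    (RtoC (/ (exp (2 * PI * y) - 1) + / 2 - / (2 * PI * y))).
Proof.
  intros hy. assert (hpi : 0 < PI) by apply PI_RGT_0.
  pose proof (lorentzian_series 1 0 y ltac:(lia) ltac:(lia) hy) as h.
  apply (Cser_scal (RtoC (/ 2))) in h.
  assert (he : exp (- (2 * PI * y)) < 1) by (apply exp_neg_lt_1; nra).
  replace (RtoC (/ (exp (2 * PI * y) - 1) + / 2 - / (2 * PI * y))) with
    (RtoC (/ 2) * RtoC ((exp (- (2 * PI * y * (INR 0 / INR 1))) + exp (- (2 * PI * y * (1 - INR 0 / INR 1))))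
             / (1 - exp (- (2 * PI * y))) - / (PI * y)))%C.
  - eapply Cser_ext; [| exact h]. intros m. cbv beta. rewrite <- RtoC_mult. f_equal.
    replace (2 * PI * INR (0 * S m) / INR 1) with 0 by (simpl; field). rewrite cos_0. field.
    assert (0 < INR (S m)) by (apply lt_0_INR; lia). split; nra.
  - rewrite <- RtoC_mult. f_equal. simpl INR. replace (0 / 1) with 0 by field.
    rewrite Rmult_0_r, Ropp_0, exp_0, Rminus_0_r, Rmult_1_r.
    rewrite exp_Ropp in he |- *. pose proof (exp_pos (2 * PI * y)) as hp.
    assert (h1 : 1 < exp (2 * PI * y)).
    { rewrite <- Rinv_1 in he. apply Rinv_lt_cancel in he; lra. }
    field. repeat split; nra.
Qed.

(** * The exponential series F of the character and its Lorentzian form *)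

Lemma psum_rev (f : nat -> C) (n : nat) : psum (fun k => f (n - 1 - k)%nat) n = psum f n.
Proof.
  revert f. induction n as [|n IH]; intros f; [reflexivity |].
  assert (hfirst : forall (g : nat -> C) m, psum g (S m) = (g 0%nat + psum (fun j => g (S j)) m)%C).
  { intros g m. induction m as [|m IHm]; [simpl; ring |].
    change (psum g (S (S m))) with (psum g (S m) + g (S m))%C. rewrite IHm. simpl. ring. }
  rewrite (hfirst (fun j => f (S n - 1 - j)%nat)). cbn [psum].
  rewrite <- (IH f), Cplus_comm. f_equal; [| f_equal; lia].
  apply psum_ext. intros j hj. f_equal. lia.
Qed.

Lemma psum_conj (a : nat -> C) (n : nat) : psum (fun k => Cconj (a k)) n = Cconj (psum a n).
Proof.
  induction n as [|n IH]; simpl; [apply C_ext; simpl; ring |]. now rewrite IH, Cplus_conj.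
Qed.

Lemma Cser_shift (a : nat -> C) (l : C) (n : nat) :
  Cser a l -> Cser (fun k => a (n + k)%nat) (l - psum a n).
Proof.
  intros h eps he. destruct (h eps he) as [N hN]. exists N. intros m hm.
  specialize (hN (n + m)%nat ltac:(lia)). rewrite psum_add in hN.
  replace (psum (fun k => a (n + k)%nat) m - (l - psum a n))%C
    with (psum a n + psum (fun k => a (n + k)%nat) m - l)%C by ring. exact hN.
Qed.

Section Theta.

Variables (q : nat) (chi : nat -> C).
Hypothesis hchi : is_dirichlet_char q chi.
Hypothesis hnonprinc : ~ is_principal q chi.
Hypothesis heven : is_even_char q chi.
Hypothesis hprim : is_primitive q chi.

(** Closed form of F, with the geometric series summed over each residue class; continuity is then
    immediate and needs no uniform convergence. *)
Definition theta (u : R) : C :=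
  (psum (fun r => Cconj (chi r) * RtoC (exp (- (2 * PI * u * INR r)))) q
   * RtoC (/ (1 - exp (- (2 * PI * u * INR q)))))%C.

Let tau : C := twisted_sum q chi 1.

Lemma theta_q_pos : 0 < INR q.
Proof. apply lt_0_INR. apply (char_q_pos q chi hchi). Qed.

Lemma char_0 : chi 0%nat = RtoC 0.
Proof.
  apply NNPP. intros h. apply (char_coprime q chi hchi) in h. rewrite Nat.gcd_0_l in h.
  pose proof (char_q_ge_2 q chi hchi hnonprinc). lia.
Qed.

Lemma char_reflect (r : nat) : (1 <= r <= q)%nat -> chi (q - r)%nat = chi r.
Proof.
  intros hr. rewrite <- (char_even q chi hchi r heven).
  replace ((q - 1) * r)%nat with (q - r + (r - 1) * q)%nat by nia.
  symmetry. apply periodic_mul, (char_periodic q chi hchi).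
Qed.

Lemma theta_den (u : R) : 0 < u -> 0 < 1 - exp (- (2 * PI * u * INR q)).
Proof.
  intros hu. assert (hpi : 0 < PI) by apply PI_RGT_0. pose proof theta_q_pos.
  assert (exp (- (2 * PI * u * INR q)) < 1); [| lra]. apply exp_neg_lt_1.
  assert (0 < 2 * PI * u) by nra. apply Rmult_lt_0_compat; lra.
Qed.

(** [lorentzian_series] summed over rho with weights conj chi(rho). The cosines turn into chi(k) tau
    by separability, the constant 1 / (pi y) is killed by the vanishing character sum, and by
    evenness r -> q - r makes both exponentials of V contribute equally. *)
Theorem theta_lorentzian (u : R) : 0 < u ->
  Cser (fun k => tau * (chi (S k) * RtoC (INR q * u / (PI * ((INR q * u) ^ 2 + INR (S k) ^ 2)))))%C (theta u).
Proof.
  intros hu. assert (hpi : 0 < PI) by apply PI_RGT_0. pose proof theta_q_pos as hq.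
  pose proof (char_q_pos q chi hchi) as hqn.
  set (y := INR q * u). assert (hy : 0 < y) by (apply Rmult_lt_0_compat; lra).
  set (V := fun rho : nat => (exp (- (2 * PI * y * (INR rho / INR q))) + exp (- (2 * PI * y * (1 - INR rho / INR q))))
             / (1 - exp (- (2 * PI * y)))).
  assert (h : Cser (fun k => psum (fun rho => Cconj (chi rho) *
       RtoC (2 * (cos (2 * PI * INR (rho * S k) / INR q) * (y / (PI * (y ^ 2 + INR (S k) ^ 2))))))%C q)
     (psum (fun rho => Cconj (chi rho) * RtoC (V rho - / (PI * y)))%C q)).
  { apply (Cser_psum (fun rho k => Cconj (chi rho) *
       RtoC (2 * (cos (2 * PI * INR (rho * S k) / INR q) * (y / (PI * (y ^ 2 + INR (S k) ^ 2))))))%C).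
    intros rho hrho. apply Cser_scal. now apply lorentzian_series. }
  apply (Cser_scal (/ 2)) in h.
  assert (h0 : psum (fun r => Cconj (chi r)) q = RtoC 0).
  { rewrite psum_conj, (psum_char_zero q chi hchi hnonprinc). apply C_ext; simpl; ring. }
  set (X := psum (fun r => Cconj (chi r) * RtoC (exp (- (2 * PI * u * INR r))))%C q).
  assert (hrev : psum (fun r => Cconj (chi r) * RtoC (exp (- (2 * PI * u * (INR q - INR r)))))%C q = X).
  { assert (split0 : forall f, psum f q = (f 0%nat + psum (fun k => f (1 + k)%nat) (q - 1))%C).
    { intros f. replace (psum f q) with (psum f (1 + (q - 1))) by (f_equal; lia). rewrite psum_add. simpl. ring. }
    unfold X. rewrite !split0, char_0.
    replace (Cconj 0) with (RtoC 0) by (apply C_ext; simpl; ring).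
    rewrite !Cmult_0_l. f_equal.
    rewrite <- (psum_rev (fun k => Cconj (chi (1 + k)%nat) * RtoC (exp (- (2 * PI * u * INR (1 + k)))))%C).
    apply psum_ext. intros k hk. cbv beta.
    replace (1 + (q - 1 - 1 - k))%nat with (q - (1 + k))%nat by lia.
    rewrite char_reflect by lia. rewrite (minus_INR q (1 + k)) by lia. reflexivity. }
  replace (theta u) with (/ 2 * psum (fun rho => Cconj (chi rho) * RtoC (V rho - / (PI * y)))%C q)%C.
  - eapply Cser_ext; [| exact h]. intros k. cbv beta.
    rewrite (psum_ext _ (fun rho => RtoC (2 * (y / (PI * (y ^ 2 + INR (S k) ^ 2)))) *
               (Cconj (chi rho) * RtoC (cos (2 * PI * INR (S k * rho) / INR q))))%C).
    + rewrite psum_scal, (twisted_cos_sum q chi hchi (S k) hprim heven hnonprinc).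
      fold tau. rewrite RtoC_mult. field.
    + intros rho _. rewrite (Nat.mul_comm rho), !RtoC_mult. ring.
  - pose proof (theta_den u hu) as hd.
    rewrite (psum_ext _ (fun r => RtoC (/ (1 - exp (- (2 * PI * u * INR q)))) *
         (Cconj (chi r) * RtoC (exp (- (2 * PI * u * INR r)))
          + Cconj (chi r) * RtoC (exp (- (2 * PI * u * (INR q - INR r)))))
       + - RtoC (/ (PI * y)) * Cconj (chi r))%C).
    + rewrite psum_plus, !psum_scal, psum_plus, hrev, h0. unfold theta. fold X. field.
    + intros r _. unfold V.
      replace (2 * PI * y * (INR r / INR q)) with (2 * PI * u * INR r) by (unfold y; field; lra).
      replace (2 * PI * y * (1 - INR r / INR q)) with (2 * PI * u * (INR q - INR r)) by (unfold y; field; lra).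
      replace (2 * PI * y) with (2 * PI * u * INR q) by (unfold y; ring).
      unfold Rdiv. rewrite RtoC_minus, RtoC_mult, RtoC_plus. ring.
Qed.

Lemma exp_mult_INR (x : R) (d : nat) : exp (- (x * INR d)) = exp (- x) ^ d.
Proof.
  rewrite <- Rpower_pow by apply exp_pos. unfold Rpower. rewrite ln_exp. f_equal. ring.
Qed.

Lemma Cmod_conj_char_le (n : nat) : Cmod (Cconj (chi n)) <= 1.
Proof. rewrite Cmod_conj. apply (Cmod_char_le q chi hchi). Qed.

Lemma geometric_rsum (r : R) : 0 <= r < 1 -> exists s, rsum (fun n => r ^ n) s.
Proof.
  intros hr. apply (rsum_bounded _ (/ (1 - r))).
  - intros n. apply pow_le. lra.
  - intros n. assert (e : (1 - r) * rpsum (fun n => r ^ n) n = 1 - r ^ n).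
    { induction n as [|n IH]; simpl; [ring |]. rewrite Rmult_plus_distr_l, IH. ring. }
    apply (Rmult_le_reg_l (1 - r)); [lra |]. rewrite e, Rinv_r by lra.
    assert (0 <= r ^ n) by (apply pow_le; lra). lra.
Qed.

(** By periodicity the tail from index q on is e^(-xq) times the whole series, so the finite sum
    over one period determines the series. *)
Theorem theta_exponential (u : R) : 0 < u ->
  Cser (fun d => Cconj (chi (S d)) * RtoC (exp (- (2 * PI * u * INR (S d)))))%C (theta u).
Proof.
  intros hu. assert (hpi : 0 < PI) by apply PI_RGT_0. pose proof theta_q_pos as hq.
  set (x := 2 * PI * u). assert (hx : 0 < x) by (unfold x; nra).
  set (a := fun d => (Cconj (chi d) * RtoC (exp (- (x * INR d))))%C).
  destruct (geometric_rsum (exp (- x))) as [s hs].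
  { split; [apply exp_ge_0 | now apply exp_neg_lt_1]. }
  destruct (Cser_dominated a (fun n => exp (- x) ^ n) s) as [L hL]; auto.
  { intros d. unfold a. rewrite Cmod_mult, Cmod_RtoC_pos by apply exp_ge_0.
    rewrite exp_mult_INR. pose proof (Cmod_conj_char_le d). pose proof (Cmod_ge_0 (Cconj (chi d))).
    assert (0 <= exp (- x) ^ d) by (apply pow_le, Rlt_le, exp_pos). nra. }
  assert (h1 := Cser_shift a L q hL).
  assert (h2 : Cser (fun k => a (q + k)%nat) (RtoC (exp (- (x * INR q))) * L)).
  { eapply Cser_ext; [| apply (Cser_scal (RtoC (exp (- (x * INR q)))) a L hL)].
    intros k. cbv beta. unfold a. rewrite (Nat.add_comm q k), (char_periodic q chi hchi k), plus_INR.
    replace (- (x * (INR k + INR q))) with (- (x * INR k) + - (x * INR q)) by ring.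
    rewrite exp_plus, RtoC_mult. ring. }
  pose proof (Cser_unique _ _ _ h1 h2) as e.
  pose proof (theta_den u hu) as hd. fold x in hd.
  assert (hd0 : RtoC (1 - exp (- (x * INR q))) <> RtoC 0) by (apply RtoC_neq_0; lra).
  (* The stated series starts at d = 1; the dropped term is 0 because chi 0 = 0. *)
  replace (theta u) with (L - psum a 1)%C.
  - exact (Cser_shift a L 1 hL).
  - assert (ha0 : psum a 1 = RtoC 0).
    { simpl. unfold a. rewrite char_0. apply C_ext; simpl; ring. }
    rewrite ha0. unfold theta. fold x. fold a. rewrite RtoC_inv by lra.
    replace (psum a q) with (L - RtoC (exp (- (x * INR q))) * L)%C by (rewrite <- e; ring).
    rewrite RtoC_minus in hd0 |- *. field. exact hd0.
Qed.

(** In the Lorentzian form each term is O(u / k^2). This behaviour at 0 is what carries the Mellin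
    transform down to Re s > -1. *)
Lemma theta_small : exists K, 0 <= K /\ forall u, 0 < u -> Cmod (theta u) <= K * u.
Proof.
  assert (hpi : 0 < PI) by apply PI_RGT_0. pose proof theta_q_pos as hq.
  destruct (p_series 2 ltac:(lra)) as (s & hs).
  pose proof (rsum_nonneg _ _ hs) as hs0.
  pose proof (Cmod_ge_0 tau) as ht.
  set (K0 := Cmod tau * INR q / PI).
  assert (hK0 : 0 <= K0).
  { unfold K0. apply Rmult_le_pos; [apply Rmult_le_pos; lra | apply Rlt_le, Rinv_0_lt_compat; lra]. }
  exists (K0 * s). split; [now apply Rmult_le_pos |]. intros u hu.
  assert (hku : 0 <= K0 * u) by (apply Rmult_le_pos; lra).
  apply Rle_trans with (K0 * u * s); [| right; ring].
  eapply (Cser_Cmod_le _ (fun k => K0 * u * Rpower (INR (S k)) (- (2)))); [| | apply theta_lorentzian; exact hu].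
  - intros k. rewrite Rpower_INR_S_neg2. assert (hk : 0 < INR (S k)) by (apply lt_0_INR; lia).
    assert (hden : 0 < PI * ((INR q * u) ^ 2 + INR (S k) ^ 2)) by (apply Rmult_lt_0_compat; nra).
    assert (hqu : 0 < INR q * u) by (apply Rmult_lt_0_compat; lra).
    rewrite !Cmod_mult, Cmod_RtoC_pos by (apply Rlt_le, Rdiv_lt_0_compat; auto).
    pose proof (Cmod_char_le q chi hchi (S k)) as hc. pose proof (Cmod_ge_0 (chi (S k))) as hc0.
    replace (K0 * u * / INR (S k) ^ 2) with (Cmod tau * (1 * (INR q * u * / (PI * INR (S k) ^ 2))))
      by (unfold K0; field; lra).
    apply Rmult_le_compat_l; auto. apply Rmult_le_compat; auto.
    + apply Rlt_le, Rdiv_lt_0_compat; auto.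
    + apply Rmult_le_compat_l; [lra |].
      apply Rinv_le_contravar; [apply Rmult_lt_0_compat; [lra | now apply pow_lt] |].
      pose proof (pow2_ge_0 (INR q * u)). apply Rmult_le_compat_l; lra.
  - now apply rsum_scal.
Qed.

(** In the exponential form each term is at most a constant times (d u)^(-p), and p > 1 makes the
    sum over d finite. *)
Lemma theta_large (p : R) : 1 < p -> exists K, 0 <= K /\ forall t, Cmod (theta (exp t)) <= K * exp (- (p * t)).
Proof.
  intros hp. assert (hpi : 0 < PI) by apply PI_RGT_0.
  destruct (exp_neg_exp_le p ltac:(lra)) as (C & hC & H).
  destruct (p_series p hp) as (s & hs).
  pose proof (rsum_nonneg _ _ hs) as hs0.
  set (K0 := C * Rpower (2 * PI) (- p)).
  assert (hK0 : 0 <= K0) by (apply Rmult_le_pos; [lra | apply exp_ge_0]).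
  exists (K0 * s). split; [now apply Rmult_le_pos |]. intros t.
  apply Rle_trans with (K0 * exp (- (p * t)) * s); [| right; ring].
  eapply (Cser_Cmod_le _ (fun k => K0 * exp (- (p * t)) * Rpower (INR (S k)) (- p)));
    [| | apply theta_exponential, exp_pos].
  - intros k. assert (hk : 0 < INR (S k)) by (apply lt_0_INR; lia).
    cbv beta. rewrite Cmod_mult, Cmod_RtoC_pos by apply exp_ge_0.
    pose proof (Cmod_conj_char_le (S k)) as hc. pose proof (Cmod_ge_0 (Cconj (chi (S k)))) as hc0.
    apply Rle_trans with (1 * exp (- (2 * PI * exp t * INR (S k)))).
    { apply Rmult_le_compat_r; [apply exp_ge_0 | exact hc]. }
    rewrite Rmult_1_l. replace (2 * PI * exp t * INR (S k)) with (2 * PI * INR (S k) * exp t) by ring.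
    eapply Rle_trans; [apply H; nra |].
    rewrite <- Rpower_mult_distr by lra. right. unfold K0. ring.
  - apply rsum_scal; [| exact hs]. apply Rmult_le_pos; [exact hK0 | apply exp_ge_0].
Qed.

Lemma ccont_psum (f : nat -> R -> C) (n : nat) (t : R) :
  (forall k, ccont (f k) t) -> ccont (fun t => psum (fun k => f k t) n) t.
Proof.
  intros h. induction n as [|n IH]; simpl; [apply ccont_const | now apply ccont_plus].
Qed.

Lemma ccont_theta (t : R) : ccont (fun t => theta (exp t)) t.
Proof.
  unfold theta. apply ccont_mult.
  - apply (ccont_psum (fun r t => Cconj (chi r) * RtoC (exp (- (2 * PI * exp t * INR r))))%C).
    intros r. apply ccont_mult; [apply ccont_const |].
    apply ccont_ex_derive. now auto_derive.
  - apply ccont_ex_derive.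
    pose proof (theta_den (exp t) (exp_pos t)). auto_derive. lra.
Qed.

Lemma decay_theta (s : C) : -1 < Re s -> exists K c, decay (fun t => theta (exp t) * Cexp (s * RtoC t))%C K c.
Proof.
  intros hs. destruct theta_small as (K1 & hK1 & H1).
  set (p := Rabs (Re s) + 2). assert (hp : 1 < p) by (unfold p; pose proof (Rabs_pos (Re s)); lra).
  destruct (theta_large p hp) as (K2 & hK2 & H2).
  exists (K1 + K2), (Rmin 1 (Re s + 1)).
  pose proof (Rmin_l 1 (Re s + 1)). pose proof (Rmin_r 1 (Re s + 1)).
  apply decay_two_sided.
  - intros t. apply ccont_mult; [apply ccont_theta | apply ccont_Cexp_linear].
  - apply Rmin_glb_lt; lra.
  - intros t ht. rewrite Cmod_mult, Cmod_Cexp_linear.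
    eapply Rle_trans; [apply Rmult_le_compat_r; [apply exp_ge_0 | apply H2] |].
    rewrite Rmult_assoc, <- exp_plus. apply Rmult_le_compat; try lra; [apply exp_ge_0 |].
    apply exp_mono. unfold p. pose proof (Rle_abs (Re s)). nra.
  - intros t ht. rewrite Cmod_mult, Cmod_Cexp_linear.
    eapply Rle_trans; [apply Rmult_le_compat_r; [apply exp_ge_0 | apply H1, exp_pos] |].
    rewrite Rmult_assoc, <- exp_plus. apply Rmult_le_compat; try lra; [apply exp_ge_0 |].
    apply exp_mono. nra.
Qed.

Definition mellin (s : C) : C := IR (fun t => theta (exp t) * Cexp (s * RtoC t))%C.

Lemma is_IR_mellin (s : C) : -1 < Re s -> is_IR (fun t => theta (exp t) * Cexp (s * RtoC t))%C (mellin s).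
Proof. intros hs. destruct (decay_theta s hs) as (K & c & h). eapply IR_correct, h. Qed.

Lemma cder_mellin (s : C) : -1 < Re s -> exists l, cder mellin s l.
Proof.
  intros hs. destruct (decay_theta s hs) as (K & c & h).
  apply (cder_IR_param (fun t => theta (exp t)) s K c); auto. apply ccont_theta.
Qed.

End Theta.

(** * The Mellin transform of theta *)

Lemma Rpower_le_exponent (x p p' : R) : 1 <= x -> p <= p' -> Rpower x p <= Rpower x p'.
Proof.
  intros hx hp. apply exp_mono. apply Rmult_le_compat_r; [| exact hp].
  rewrite <- ln_1. apply Rcomplements.ln_le; lra.
Qed.

Lemma Rpower_quotient_neg (a b e : R) : 0 < a -> 0 < b -> Rpower (a / b) (- e) = Rpower b e * Rpower a (- e).
Proof.
  intros ha hb. unfold Rdiv. rewrite <- Rpower_mult_distr by (auto; now apply Rinv_0_lt_compat).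
  rewrite Rmult_comm. f_equal. unfold Rpower. rewrite ln_Rinv by assumption. f_equal. ring.
Qed.

(** At u = e^t: u^2 + A^2 >= max(u, A)^2 >= A^al u^(2 - al). The parameter al shares the decay
    between A, for summability, and t, for integrability. *)
Lemma lor_bound (A al t : R) : 0 < A -> 0 <= al <= 2 ->
  / (exp (2 * t) + A ^ 2) <= Rpower A (- al) * exp (- ((2 - al) * t)).
Proof.
  intros hA hal. unfold Rpower. rewrite <- exp_plus.
  replace (- al * ln A + - ((2 - al) * t)) with (- (al * ln A + (2 - al) * t)) by ring.
  rewrite exp_Ropp. apply Rinv_le_contravar; [apply exp_pos |].
  assert (e : A ^ 2 = exp (2 * ln A)).
  { rewrite exp_2, exp_ln by assumption. ring. }
  rewrite e. pose proof (exp_pos (2 * t)). pose proof (exp_pos (2 * ln A)).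
  destruct (Rle_dec t (ln A)) as [h|h].
  - apply Rle_trans with (exp (2 * ln A)); [apply exp_mono; nra | lra].
  - apply Rle_trans with (exp (2 * t)); [apply exp_mono; nra | lra].
Qed.

Section MellinFormulas.

Variables (q : nat) (chi : nat -> C) (L Lbar : C -> C).
Hypothesis hchi : is_dirichlet_char q chi.
Hypothesis hnonprinc : ~ is_principal q chi.
Hypothesis heven : is_even_char q chi.
Hypothesis hprim : is_primitive q chi.
Hypothesis hL : is_L_function chi L.
Hypothesis hLbar : is_L_function (conj_char chi) Lbar.

Let tau : C := twisted_sum q chi 1.

Lemma is_L_function_cder (f : nat -> C) (L0 : C -> C) (s : C) :
  is_L_function f L0 -> exists l, cder L0 s l.
Proof. intros [h _]. apply ex_derive_cder, h. Qed.

(** Termwise integration of the exponential series. For t <= 0 the exponent p, between 1 and Re s,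
    gives a summable series and still leaves decay; for t >= 0 the exponent p2 = Re s + 1 beats the
    growth of e^(s t). *)
Lemma mellin_dirichlet (s : C) : 1 < Re s ->
  mellin q chi s = (cpow (2 * PI) (- s) * Gam s * Lbar s)%C.
Proof.
  intros hs. assert (hpi : 0 < PI) by apply PI_RGT_0.
  set (sg := Re s) in *. set (p := (1 + sg) / 2). set (p2 := sg + 1).
  destruct (exp_neg_exp_le p ltac:(unfold p; lra)) as (C1 & hC1 & H1).
  destruct (exp_neg_exp_le p2 ltac:(unfold p2; lra)) as (C2 & hC2 & H2).
  set (c := Rmin 1 ((sg - 1) / 2)).
  assert (hc : 0 < c /\ c <= 1 /\ c <= (sg - 1) / 2).
  { unfold c. pose proof (Rmin_l 1 ((sg - 1) / 2)). pose proof (Rmin_r 1 ((sg - 1) / 2)).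
    repeat split; auto. apply Rmin_glb_lt; lra. }
  set (Cst := C1 * Rpower (2 * PI) (- p) + C2 * Rpower (2 * PI) (- p2)).
  pose proof (Rpower_pos (2 * PI) (- p)) as e1.
  pose proof (Rpower_pos (2 * PI) (- p2)) as e2.
  assert (hCst : 0 <= Cst) by (unfold Cst; nra).
  destruct (p_series p ltac:(unfold p; lra)) as (S0 & hS0).
  set (g := fun k t => (RtoC (exp (- (2 * PI * INR (S k) * exp t))) * Cexp (s * RtoC t))%C).
  assert (cg : forall k t, ccont (g k) t).
  { intros k t. apply ccont_mult; [apply ccont_exp_exp | apply ccont_Cexp_linear]. }
  destruct (is_IR_series (fun k t => Cconj (chi (S k)) * g k t)%C
              (fun k => Cconj (chi (S k)) * (cpow (2 * PI * INR (S k)) (- s) * Gam s))%C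
              (fun k => Cst * Rpower (INR (S k)) (- p)) (Cst * S0) c
              (fun t => theta q chi (exp t) * Cexp (s * RtoC t))%C) as [_ hser].
  - intros k. pose proof (INR_S_pos k) as hk. pose proof (INR_S_ge_1 k) as hk1.
    pose proof (Cmod_conj_char_le q chi hchi (S k)) as hcc.
    pose proof (Rpower_pos (INR (S k)) (- p)) as ek.
    assert (hpp : Rpower (INR (S k)) (- p2) <= Rpower (INR (S k)) (- p)).
    { apply Rpower_le_exponent; auto. unfold p, p2. lra. }
    pose proof (Rpower_pos (INR (S k)) (- p2)) as ek2.
    apply decay_two_sided; [| tauto | |].
    + intros t. apply ccont_mult; [apply ccont_const | apply cg].
    + intros t ht. unfold g. rewrite !Cmod_mult, Cmod_Cexp_linear, Cmod_RtoC_pos by apply exp_ge_0.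
      apply Rle_trans with (1 * (C2 * Rpower (2 * PI * INR (S k)) (- p2) * exp (- (p2 * t)) * exp (sg * t))).
      * apply Rmult_le_compat; auto; [apply Cmod_ge_0 | apply Rmult_le_pos; apply exp_ge_0 |].
        apply Rmult_le_compat_r; [apply exp_ge_0 |]. apply H2. nra.
      * rewrite Rmult_1_l, Rmult_assoc, <- exp_plus, <- Rpower_mult_distr by nra.
        apply Rmult_le_compat; [| apply exp_ge_0 | |].
        -- apply Rmult_le_pos; [lra |]. apply Rmult_le_pos; lra.
        -- unfold Cst. assert (C2 * (Rpower (2 * PI) (- p2) * Rpower (INR (S k)) (- p2))
             <= C2 * Rpower (2 * PI) (- p2) * Rpower (INR (S k)) (- p)).
           { rewrite <- Rmult_assoc. apply Rmult_le_compat_l; [nra | exact hpp]. }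
           assert (0 <= C1 * Rpower (2 * PI) (- p) * Rpower (INR (S k)) (- p)) by (repeat apply Rmult_le_pos; lra).
           lra.
        -- apply exp_mono. unfold p2. nra.
    + intros t ht. unfold g. rewrite !Cmod_mult, Cmod_Cexp_linear, Cmod_RtoC_pos by apply exp_ge_0.
      apply Rle_trans with (1 * (C1 * Rpower (2 * PI * INR (S k)) (- p) * exp (- (p * t)) * exp (sg * t))).
      * apply Rmult_le_compat; auto; [apply Cmod_ge_0 | apply Rmult_le_pos; apply exp_ge_0 |].
        apply Rmult_le_compat_r; [apply exp_ge_0 |]. apply H1. nra.
      * rewrite Rmult_1_l, Rmult_assoc, <- exp_plus, <- Rpower_mult_distr by nra.
        apply Rmult_le_compat; [| apply exp_ge_0 | |].
        -- apply Rmult_le_pos; [lra |]. apply Rmult_le_pos; lra.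
        -- unfold Cst.
           assert (0 <= C2 * Rpower (2 * PI) (- p2) * Rpower (INR (S k)) (- p)) by (repeat apply Rmult_le_pos; lra).
           lra.
        -- apply exp_mono. unfold p. nra.
  - intros k. pose proof (INR_S_pos k) as hk. apply is_IR_scal; [apply cg |].
    apply is_IR_gamma_scaled; [nra | fold sg; lra].
  - now apply rsum_scal.
  - intros t. apply ccont_mult; [apply ccont_theta; auto | apply ccont_Cexp_linear].
  - intros t. apply (Cser_ext (fun d => Cexp (s * RtoC t) *
        (Cconj (chi (S d)) * RtoC (exp (- (2 * PI * exp t * INR (S d))))))%C).
    + intros k. unfold g. replace (2 * PI * exp t * INR (S k)) with (2 * PI * INR (S k) * exp t) by ring. ring.
    + rewrite (Cmult_comm (theta _ _ _)). apply Cser_scal, theta_exponential; auto. apply exp_pos.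
  - destruct hLbar as [_ hser2]. specialize (hser2 s hs). apply is_series_Cser in hser2.
    apply (Cser_scal (cpow (2 * PI) (- s) * Gam s)%C) in hser2.
    apply (Cser_unique _ _ _ hser). eapply Cser_ext; [| exact hser2].
    intros k. cbv beta. unfold conj_char. rewrite (cpow_mult_base (2 * PI)) by (try apply INR_S_pos; nra). ring.
Qed.

(** On Re s > 1 this is [mellin_dirichlet] with Gamma(s + 1) = s Gamma(s). Written with the factor
    s, both sides are holomorphic on Re s > -1, so the pole of Gamma at 0 does not obstruct the
    continuation. *)
Theorem mellin_gamma (s : C) : -1 < Re s ->
  (s * mellin q chi s)%C = (Gam (s + 1) * cpow (2 * PI) (- s) * Lbar s)%C.
Proof.
  intros hs. apply Ceq_minus.
  apply (unique_continuation (-1) 1 2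
           (fun s => s * mellin q chi s - Gam (s + 1) * cpow (2 * PI) (- s) * Lbar s)%C); try lra.
  - intros z hz.
    destruct (cder_mellin q chi hchi hnonprinc heven hprim z hz) as [l1 h1].
    destruct (cder_Gam (z + 1)) as [l2 h2]; [simpl; unfold Re in hz; lra |].
    destruct (is_L_function_cder _ _ z hLbar) as [l3 h3].
    eexists. apply cder_minus.
    + apply (cder_mult (fun s => s) (mellin q chi)); [apply cder_id | exact h1].
    + apply (cder_mult (fun s => Gam (s + 1) * cpow (2 * PI) (- s))%C Lbar); [| exact h3].
      apply (cder_mult (fun s => Gam (s + 1)) (fun s => cpow (2 * PI) (- s))).
      * apply (cder_comp Gam (fun s => s + 1)%C); [apply cder_plus; [apply cder_id | apply cder_const] | exact h2].
      * apply (cder_ext (fun s => Cexp (- RtoC (ln (2 * PI)) * s))%C _ _ _ 1); [lra | |].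
        -- intros w _. unfold cpow. f_equal. ring.
        -- apply cder_Cexp, cder_scal, cder_id.
  - intros z hz. rewrite mellin_dirichlet, Gam_succ by (unfold Re in *; lra). ring.
Qed.

(** Termwise integration of the Lorentzian series with widths k/q. The choice al = 1 - sg/2 exceeds
    1, for summation over k, and leaves e^(sg t / 2) to the right; to the left the bound with
    exponent 2 leaves e^((sg + 1) t). *)
Lemma mellin_lorentzian (s : C) : -1 < Re s < 0 ->
  mellin q chi s = (tau / (RtoC PI * RtoC (INR q)) * cpow (INR q) (1 - s) * IR (refl_int (s + 1)) * L (1 - s))%C.
Proof.
  intros hs. assert (hpi : 0 < PI) by apply PI_RGT_0. pose proof (theta_q_pos q chi hchi) as hq.
  set (sg := Re s) in *. set (al := 1 - sg / 2).
  set (c := Rmin (- sg / 2) (sg + 1)).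
  assert (hc : 0 < c /\ c <= - sg / 2 /\ c <= sg + 1).
  { unfold c. pose proof (Rmin_l (- sg / 2) (sg + 1)). pose proof (Rmin_r (- sg / 2) (sg + 1)).
    repeat split; auto. apply Rmin_glb_lt; lra. }
  set (k0 := (tau / (RtoC PI * RtoC (INR q)))%C).
  set (Cst := Cmod k0 * (Rpower (INR q) al + Rpower (INR q) 2)).
  pose proof (Rpower_pos (INR q) al) as e1.
  pose proof (Rpower_pos (INR q) 2) as e2.
  pose proof (Cmod_ge_0 k0) as hk0.
  assert (hCst : 0 <= Cst) by (unfold Cst; apply Rmult_le_pos; lra).
  destruct (p_series al ltac:(unfold al; lra)) as (S0 & hS0).
  set (Ak := fun k => INR (S k) / INR q).
  assert (hAk : forall k, 0 < Ak k) by (intros k; apply Rdiv_lt_0_compat; [apply INR_S_pos | exact hq]).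
  assert (hApow : forall k e, Rpower (Ak k) (- e) = Rpower (INR q) e * Rpower (INR (S k)) (- e))
    by (intros k e; apply Rpower_quotient_neg; [apply INR_S_pos | exact hq]).
  assert (hs1 : 0 < Re (s + 1) < 2) by (simpl; fold (Re s); fold sg; lra).
  destruct (is_IR_series (fun k t => k0 * chi (S k) * lor (s + 1) (Ak k) t)%C
              (fun k => k0 * chi (S k) * (cpow (Ak k) (s + 1 - 2) * IR (refl_int (s + 1))))%C
              (fun k => Cst * Rpower (INR (S k)) (- al)) (Cst * S0) c
              (fun t => theta q chi (exp t) * Cexp (s * RtoC t))%C) as [_ hser].
  - intros k. pose proof (INR_S_pos k) as hk. pose proof (INR_S_ge_1 k) as hk1.
    pose proof (Cmod_char_le q chi hchi (S k)) as hcc. pose proof (Cmod_ge_0 (chi (S k))) as hcc0.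
    pose proof (Rpower_pos (INR (S k)) (- al)) as ek.
    assert (hpp : Rpower (INR (S k)) (- (2)) <= Rpower (INR (S k)) (- al)).
    { apply Rpower_le_exponent; auto. unfold al. lra. }
    assert (gen : forall t e, 0 <= e <= 2 ->
       Cmod (k0 * chi (S k) * lor (s + 1) (Ak k) t) <=
       Cmod k0 * (Rpower (INR q) e * Rpower (INR (S k)) (- e)) * exp ((sg - 1 + e) * t)).
    { intros t e he. unfold lor. pose proof (lor_den_pos (Ak k) t) as hd.
      rewrite !Cmod_mult, Cmod_Cexp_linear, Cmod_RtoC_pos by (apply Rlt_le, Rinv_0_lt_compat, hd).
      rewrite (Rmult_assoc (Cmod k0)), (Rmult_assoc (Cmod k0)). apply Rmult_le_compat_l; auto.
      apply Rle_trans with (1 * (exp (Re (s + 1) * t) * (Rpower (Ak k) (- e) * exp (- ((2 - e) * t))))).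
      - apply Rmult_le_compat; auto.
        + apply Rmult_le_pos; [apply exp_ge_0 | apply Rlt_le, Rinv_0_lt_compat, hd].
        + apply Rmult_le_compat_l; [apply exp_ge_0 |]. now apply lor_bound.
      - rewrite hApow. right.
        replace (1 * (exp (Re (s + 1) * t) * (Rpower (INR q) e * Rpower (INR (S k)) (- e) * exp (- ((2 - e) * t)))))
          with (Rpower (INR q) e * Rpower (INR (S k)) (- e) * (exp (Re (s + 1) * t) * exp (- ((2 - e) * t)))) by ring.
        rewrite <- exp_plus. do 2 f_equal. simpl. fold (Re s). fold sg. ring. }
    apply decay_two_sided; [| tauto | |].
    + intros t. apply ccont_mult; [apply ccont_const | apply ccont_lor].
    + intros t ht. eapply Rle_trans; [apply (gen t al); unfold al; lra |].
      apply Rmult_le_compat; [| apply exp_ge_0 | |].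
      * apply Rmult_le_pos; auto. apply Rmult_le_pos; lra.
      * unfold Cst. rewrite Rmult_assoc. apply Rmult_le_compat_l; auto. nra.
      * apply exp_mono. unfold al. nra.
    + intros t ht. eapply Rle_trans; [apply (gen t 2); lra |].
      pose proof (Rpower_pos (INR (S k)) (- (2))) as ek2.
      apply Rmult_le_compat; [| apply exp_ge_0 | |].
      * apply Rmult_le_pos; auto. apply Rmult_le_pos; lra.
      * unfold Cst. rewrite Rmult_assoc. apply Rmult_le_compat_l; auto.
        apply Rle_trans with (Rpower (INR q) 2 * Rpower (INR (S k)) (- al)); [apply Rmult_le_compat_l; lra | nra].
      * apply exp_mono. nra.
  - intros k. apply is_IR_scal; [intros t; apply ccont_lor |]. now apply is_IR_lor.
  - now apply rsum_scal.
  - intros t. apply ccont_mult; [apply ccont_theta; auto | apply ccont_Cexp_linear].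
  - intros t. eapply Cser_ext; [| rewrite (Cmult_comm (theta _ _ _)); apply Cser_scal, (theta_lorentzian q chi hchi hnonprinc heven hprim (exp t) (exp_pos t))].
    intros k. cbv beta. unfold lor, k0, Ak. fold tau.
    replace ((s + 1) * RtoC t)%C with (s * RtoC t + RtoC t)%C by ring. rewrite Cexp_plus, Cexp_RtoC.
    pose proof (exp_pos t) as het. pose proof (INR_S_pos k) as hk.
    replace (INR q * exp t / (PI * ((INR q * exp t) ^ 2 + INR (S k) ^ 2)))
      with (/ (PI * INR q) * (exp t * / (exp (2 * t) + (INR (S k) / INR q) ^ 2))).
    + rewrite RtoC_mult, RtoC_mult, RtoC_inv, (RtoC_mult PI) by nra. field.
      split; apply RtoC_neq_0; lra.
    + rewrite exp_2. field. repeat split; nra.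
  - destruct hL as [_ hser2]. specialize (hser2 (1 - s)%C ltac:(simpl; fold (Re s); fold sg; lra)).
    apply is_series_Cser in hser2.
    apply (Cser_scal (k0 * cpow (INR q) (1 - s) * IR (refl_int (s + 1)))%C) in hser2.
    apply (Cser_unique _ _ _ hser). eapply Cser_ext; [| exact hser2].
    intros k. cbv beta. unfold Ak, Rdiv. pose proof (INR_S_pos k).
    rewrite cpow_mult_base, cpow_inv_base by (auto; now apply Rinv_0_lt_compat).
    replace (- (1 - s))%C with (s + 1 - 2)%C by ring.
    replace (1 - s)%C with (- (s + 1 - 2))%C by ring. rewrite cpow_opp. ring.
Qed.

(** The functional equation of L in disguise: [mellin_lorentzian] with the reflection integral
    evaluated, continued from -1 < Re s < 0. With the sine kept on the left, both sides are
    holomorphic on Re s > -1. *)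
Theorem mellin_functional (s : C) : -1 < Re s ->
  (Csin (RtoC PI * (s + 1) / 2) * mellin q chi s)%C
  = (tau / (2 * RtoC (INR q)) * cpow (INR q) (1 - s) * L (1 - s))%C.
Proof.
  intros hs. assert (hpi : 0 < PI) by apply PI_RGT_0. pose proof (theta_q_pos q chi hchi) as hq.
  assert (hqC : RtoC (INR q) <> RtoC 0) by (apply RtoC_neq_0; lra).
  assert (hpC : RtoC PI <> RtoC 0) by (apply RtoC_neq_0; lra).
  apply Ceq_minus.
  apply (unique_continuation (-1) (-1) 0
           (fun s => Csin (RtoC PI * (s + 1) / 2) * mellin q chi s
                     - tau / (2 * RtoC (INR q)) * cpow (INR q) (1 - s) * L (1 - s))%C); try lra.
  - intros z hz.
    destruct (cder_mellin q chi hchi hnonprinc heven hprim z hz) as [l1 h1].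
    destruct (cder_Csin (z + 1)) as [l2 h2].
    destruct (is_L_function_cder _ _ (1 - z) hL) as [l3 h3].
    assert (hlin : cder (fun w => 1 - w)%C z (0 - 1)) by (apply cder_minus; [apply cder_const | apply cder_id]).
    eexists. apply cder_minus.
    + apply (cder_mult (fun s => Csin (RtoC PI * (s + 1) / 2)) (mellin q chi)); [| exact h1].
      apply (cder_comp (fun s => Csin (RtoC PI * s / 2)) (fun s => s + 1)%C);
        [apply cder_plus; [apply cder_id | apply cder_const] | exact h2].
    + apply (cder_mult (fun s => tau / (2 * RtoC (INR q)) * cpow (INR q) (1 - s))%C (fun s => L (1 - s))).
      * apply cder_scal. apply (cder_ext (fun s => Cexp (RtoC (ln (INR q)) * (1 - s)))%C _ _ _ 1); [lra | |].
        -- intros w _. unfold cpow. f_equal. ring.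
        -- apply cder_Cexp, cder_scal, hlin.
      * apply (cder_comp L (fun s => 1 - s)%C); [exact hlin | exact h3].
  - intros z hz. rewrite mellin_lorentzian by exact hz.
    pose proof (reflection_integral (z + 1) ltac:(simpl; unfold Re in hz; lra)) as hr.
    set (Sn := Csin (RtoC PI * (z + 1) / 2)) in *.
    replace (Sn * (tau / (RtoC PI * RtoC (INR q)) * cpow (INR q) (1 - z) * IR (refl_int (z + 1)) * L (1 - z)))%C
      with (tau / (RtoC PI * RtoC (INR q)) * cpow (INR q) (1 - z) * (Sn * IR (refl_int (z + 1))) * L (1 - z))%C by ring.
    rewrite hr, RtoC_div by lra. field. auto.
Qed.

(** The Lorentzian series of F integrated termwise against a second Lorentzian. For -1 <= Re n < 1
    the exponent al = (3 - Re n)/2 lies in (1, 2]: above 1 for the sum over k, at most 2 for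
    [lor_bound]. *)
Lemma theta_two_lorentzian (n : C) (B : R) : -1 <= Re n < 1 -> 0 < B ->
  (forall k, (INR (S k) / INR q) ^ 2 <> B ^ 2) ->
  exists K c, decay (fun t => theta q chi (exp t) * lor (n + 1) B t)%C K c /\
  Cser (fun k => tau / (RtoC PI * RtoC (INR q)) * chi (S k) * IR (lor2 (INR (S k) / INR q) B n))%C
    (IR (fun t => theta q chi (exp t) * lor (n + 1) B t)%C).
Proof.
  intros hn hB hne. assert (hpi : 0 < PI) by apply PI_RGT_0. pose proof (theta_q_pos q chi hchi) as hq.
  set (sg := Re n) in *. set (al := (3 - sg) / 2).
  set (c := Rmin ((1 - sg) / 2) ((sg + 3) / 2)).
  assert (hc : 0 < c /\ c <= (1 - sg) / 2 /\ c <= (sg + 3) / 2).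
  { unfold c. pose proof (Rmin_l ((1 - sg) / 2) ((sg + 3) / 2)). pose proof (Rmin_r ((1 - sg) / 2) ((sg + 3) / 2)).
    repeat split; auto. apply Rmin_glb_lt; lra. }
  set (k0 := (tau / (RtoC PI * RtoC (INR q)))%C).
  pose proof (Rpower_pos (INR q) al) as e1.
  assert (hBi : 0 < / B ^ 2) by (apply Rinv_0_lt_compat, pow_lt, hB).
  set (Cst := Cmod k0 * Rpower (INR q) al * (1 + / B ^ 2)).
  pose proof (Cmod_ge_0 k0) as hk0.
  assert (hCst : 0 <= Cst) by (unfold Cst; repeat apply Rmult_le_pos; lra).
  destruct (p_series al ltac:(unfold al; lra)) as (S0 & hS0).
  set (Ak := fun k => INR (S k) / INR q).
  assert (hAk : forall k, 0 < Ak k) by (intros k; apply Rdiv_lt_0_compat; [apply INR_S_pos | exact hq]).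
  assert (hApow : forall k e, Rpower (Ak k) (- e) = Rpower (INR q) e * Rpower (INR (S k)) (- e))
    by (intros k e; apply Rpower_quotient_neg; [apply INR_S_pos | exact hq]).
  destruct (is_IR_series (fun k t => k0 * chi (S k) * lor2 (Ak k) B n t)%C
              (fun k => k0 * chi (S k) * IR (lor2 (Ak k) B n))%C
              (fun k => Cst * Rpower (INR (S k)) (- al)) (Cst * S0) c
              (fun t => theta q chi (exp t) * lor (n + 1) B t)%C) as [hdec hser].
  - intros k. pose proof (INR_S_pos k) as hk.
    pose proof (Cmod_char_le q chi hchi (S k)) as hcc. pose proof (Cmod_ge_0 (chi (S k))) as hcc0.
    pose proof (Rpower_pos (INR (S k)) (- al)) as ek.
    assert (gen : forall t D, / (exp (2 * t) + B ^ 2) <= D ->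
       Cmod (k0 * chi (S k) * lor2 (Ak k) B n t) <=
       Cmod k0 * (Rpower (INR q) al * Rpower (INR (S k)) (- al)) * (D * exp ((sg + al) * t))).
    { intros t D hD. unfold lor2, lor2_weight. pose proof (lor_den_pos (Ak k) t) as hd. pose proof (lor_den_pos B t) as hd'.
      pose proof (lor2_weight_pos (Ak k) B t) as hwp. unfold lor2_weight in hwp.
      rewrite !Cmod_mult, Cmod_Cexp_linear, Cmod_RtoC_pos by lra.
      rewrite (Rmult_assoc (Cmod k0)), (Rmult_assoc (Cmod k0)). apply Rmult_le_compat_l; auto.
      apply Rle_trans with (1 * (exp (2 * t) * (Rpower (Ak k) (- al) * exp (- ((2 - al) * t)) * D) * exp (sg * t))).
      - apply Rmult_le_compat; auto.
        + apply Rmult_le_pos; [lra | apply exp_ge_0].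
        + apply Rmult_le_compat_r; [apply exp_ge_0 |]. unfold Rdiv. rewrite Rinv_mult.
          apply Rmult_le_compat_l; [apply exp_ge_0 |].
          apply Rmult_le_compat; auto; try (apply Rlt_le, Rinv_0_lt_compat; assumption).
          apply lor_bound; auto. unfold al. lra.
      - rewrite hApow. right.
        replace (1 * (exp (2 * t) * (Rpower (INR q) al * Rpower (INR (S k)) (- al) * exp (- ((2 - al) * t)) * D) * exp (sg * t)))
          with (Rpower (INR q) al * Rpower (INR (S k)) (- al) * (D * (exp (2 * t) * exp (- ((2 - al) * t)) * exp (sg * t)))) by ring.
        rewrite <- !exp_plus. do 3 f_equal. ring. }
    apply decay_two_sided; [| tauto | |].
    + intros t. apply ccont_mult; [apply ccont_const | apply ccont_lor2].
    + intros t ht. eapply Rle_trans; [apply (gen t (exp (- (2 * t)))) |].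
      { rewrite exp_Ropp. apply Rinv_le_contravar; [apply exp_pos |]. pose proof (pow2_ge_0 B). lra. }
      rewrite <- exp_plus. apply Rmult_le_compat; [| apply exp_ge_0 | |].
      * apply Rmult_le_pos; auto. apply Rmult_le_pos; lra.
      * unfold Cst. assert (0 <= Cmod k0 * Rpower (INR q) al * Rpower (INR (S k)) (- al)) by (repeat apply Rmult_le_pos; lra).
        nra.
      * apply exp_mono. unfold al. nra.
    + intros t ht. eapply Rle_trans; [apply (gen t (/ B ^ 2)) |].
      { apply Rinv_le_contravar; [now apply pow_lt |]. pose proof (exp_pos (2 * t)). lra. }
      rewrite <- Rmult_assoc. apply Rmult_le_compat; [| apply exp_ge_0 | |].
      * apply Rmult_le_pos; [| lra]. apply Rmult_le_pos; auto. apply Rmult_le_pos; lra.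
      * unfold Cst. assert (0 <= Cmod k0 * Rpower (INR q) al * Rpower (INR (S k)) (- al)) by (repeat apply Rmult_le_pos; lra).
        nra.
      * apply exp_mono. unfold al. nra.
  - intros k. apply is_IR_scal; [intros t; apply ccont_lor2 |]. apply is_IR_lor2; auto. fold sg. lra.
  - now apply rsum_scal.
  - intros t. apply ccont_mult; [apply ccont_theta; auto | apply ccont_lor].
  - intros t. eapply Cser_ext; [| rewrite (Cmult_comm (theta _ _ _)); apply Cser_scal, (theta_lorentzian q chi hchi hnonprinc heven hprim (exp t) (exp_pos t))].
    intros k. cbv beta. unfold lor, lor2, lor2_weight, k0, Ak. fold tau.
    replace ((n + 1) * RtoC t)%C with (n * RtoC t + RtoC t)%C by ring. rewrite Cexp_plus, Cexp_RtoC.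
    pose proof (exp_pos t) as het. pose proof (INR_S_pos k) as hk. pose proof (lor_den_pos B t) as hd.
    replace (INR q * exp t / (PI * ((INR q * exp t) ^ 2 + INR (S k) ^ 2)))
      with (/ (PI * INR q) * (exp t * / (exp (2 * t) + (INR (S k) / INR q) ^ 2))).
    + pose proof (lor_den_pos (INR (S k) / INR q) t).
      replace (exp (2 * t) / ((exp (2 * t) + (INR (S k) / INR q) ^ 2) * (exp (2 * t) + B ^ 2)))
        with (exp t * (exp t * / (exp (2 * t) + (INR (S k) / INR q) ^ 2)) * / (exp (2 * t) + B ^ 2)).
      * rewrite !RtoC_mult, (RtoC_inv (PI * INR q)), (RtoC_mult PI) by nra. field.
        split; apply RtoC_neq_0; lra.
      * rewrite exp_2 in *. field. repeat split; try lra.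
        intros e. assert (0 < (exp t * exp t + (INR (S k) / INR q) ^ 2) * INR q ^ 2) by (apply Rmult_lt_0_compat; auto; now apply pow_lt).
        replace ((exp t * exp t + (INR (S k) / INR q) ^ 2) * INR q ^ 2) with (exp t * exp t * INR q ^ 2 + INR (S k) ^ 2) in H0 by (field; lra).
        lra.
    + rewrite exp_2. field. repeat split; nra.
  - exists (Cst * S0), c. split; auto.
Qed.

End MellinFormulas.

(** * Rearrangement of divisor sums *)

Lemma divsum_psum (n : nat) (f : nat -> C) :
  divsum n f = psum (fun i => if Nat.eqb (n mod S i) 0 then f (S i) else RtoC 0) n.
Proof. unfold divsum. now rewrite Csum_seq. Qed.

Lemma divsum_ext (n : nat) (f g : nat -> C) :
  (forall d m, (1 <= d)%nat -> (n = d * m)%nat -> f d = g d) -> divsum n f = divsum n g.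
Proof.
  intros h. rewrite !divsum_psum. apply psum_ext. intros i _.
  destruct (Nat.eqb_spec (n mod S i) 0) as [e|e]; auto.
  apply (h (S i) (n / S i)%nat); [lia |].
  pose proof (Nat.div_mod_eq n (S i)). lia.
Qed.

Lemma divsum_scal (n : nat) (c : C) (f : nat -> C) :
  divsum n (fun d => c * f d)%C = (c * divsum n f)%C.
Proof.
  rewrite !divsum_psum, <- psum_scal. apply psum_ext. intros i _. destruct Nat.eqb; [reflexivity | ring].
Qed.

(** The integer quotient X / d jumps by one at S X precisely when d divides S X. *)
Lemma div_succ (X d : nat) : (0 < d)%nat ->
  (S X / d)%nat = if Nat.eqb (S X mod d) 0 then S (X / d) else (X / d)%nat.
Proof.
  intros hd. pose proof (Nat.div_mod_eq X d) as e. pose proof (Nat.mod_upper_bound X d ltac:(lia)) as hr.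
  destruct (Nat.eq_dec (S (X mod d)) d) as [h|h].
  - assert (e1 : S X = (S (X / d) * d + 0)%nat) by nia.
    assert (e2 : (S X / d = S (X / d))%nat) by (symmetry; apply (Nat.div_unique _ _ _ 0); lia).
    assert (e3 : (S X mod d = 0)%nat) by (rewrite e1, Nat.add_0_r; apply Nat.Div0.mod_mul).
    now rewrite e3, e2.
  - assert (e2 : (S X / d = X / d)%nat) by (symmetry; apply (Nat.div_unique _ _ _ (S (X mod d))); lia).
    assert (e3 : (S X mod d = S (X mod d))%nat) by (symmetry; apply (Nat.mod_unique _ _ (X / d)); lia).
    now rewrite e3, e2.
Qed.

(** Pairs (d, m) with d m <= X are counted by their product on the left and by d on the right, where
    m runs up to X / d. *)
Lemma psum_divsum (a : nat -> nat -> C) (X : nat) :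
  psum (fun n => divsum (S n) (fun d => a d (S n / d)%nat)) X
  = psum (fun i => psum (fun j => a (S i) (S j)) (X / S i)) X.
Proof.
  induction X as [|X IH]; [reflexivity |].
  change (psum (fun n => divsum (S n) (fun d => a d (S n / d)%nat)) (S X))
    with (psum (fun n => divsum (S n) (fun d => a d (S n / d)%nat)) X + divsum (S X) (fun d => a d (S X / d)%nat))%C.
  rewrite IH, divsum_psum.
  replace (psum (fun i => psum (fun j => a (S i) (S j)) (X / S i)) X)
    with (psum (fun i => psum (fun j => a (S i) (S j)) (X / S i)) (S X)).
  2:{ change (psum (fun i => psum (fun j => a (S i) (S j)) (X / S i)) (S X)) with
        (psum (fun i => psum (fun j => a (S i) (S j)) (X / S i)) X + psum (fun j => a (S X) (S j)) (X / S X))%C.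
      rewrite Nat.div_small by lia. simpl. ring. }
  rewrite <- psum_plus. apply psum_ext. intros i _.
  rewrite (div_succ X (S i)) by lia. destruct (Nat.eqb (S X mod S i) 0); simpl; [reflexivity | ring].
Qed.

(** Partial sums over n are sums over the region d m <= X. Tannery's theorem applies to their rows,
    the i-th row being dominated by b i Sc. *)
Theorem dirichlet_rearrangement (a : nat -> nat -> C) (b c : nat -> R) (Sb Sc : R) (A : nat -> C) :
  rsum b Sb -> rsum c Sc ->
  (forall i j, Cmod (a (S i) (S j)) <= b i * c j) ->
  (forall i, Cser (fun j => a (S i) (S j)) (A i)) ->
  exists T, Cser A T /\ Cser (fun n => divsum (S n) (fun d => a d (S n / d)%nat)) T.
Proof.
  intros hb hc hab hA.
  assert (hc0 : forall j, 0 <= c j) by apply hc. assert (hb0 : forall j, 0 <= b j) by apply hb.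
  pose proof (rsum_nonneg _ _ hc) as hSc.
  destruct (tannery (fun X i => psum (fun j => a (S i) (S j)) (X / S i)) (fun i => b i * Sc) (Sb * Sc) A
              (fun X => psum (fun i => psum (fun j => a (S i) (S j)) (X / S i)) X)) as (T & hT & hlim).
  - intros X i. eapply Rle_trans; [apply (Cmod_psum_le _ (fun j => b i * c j)); intros; apply hab |].
    rewrite rpsum_scal. apply Rmult_le_compat_l; [apply hb0 | apply hc].
  - now apply rsum_scal_r.
  - intros i eps he. destruct (hA i eps he) as [N hN]. exists (N * S i)%nat. intros X hX.
    apply hN. apply Nat.div_le_lower_bound; lia.
  - intros X. apply Cser_finite. intros i hi. rewrite Nat.div_small by lia. reflexivity.
  - exists T. split; auto. eapply climit_ext; [| exact hlim]. intros X. symmetry. apply psum_divsum.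
Qed.

(** * The Bessel series as an integral *)

Lemma planck_geometric (X : R) : 0 < X ->
  Cser (fun j => RtoC (exp (- (INR (S j) * X)))) (RtoC (/ (exp X - 1))).
Proof.
  intros hX. set (r := exp (- X)).
  assert (hr : 0 < r < 1) by (split; [apply exp_pos | now apply exp_neg_lt_1]).
  assert (hrX : r * exp X = 1).
  { unfold r. rewrite <- exp_plus. replace (- X + X) with 0 by ring. apply exp_0. }
  assert (hden : 0 < exp X - 1) by (pose proof (exp_ineq1 X ltac:(lra)); lra).
  assert (hsum : forall n, rpsum (fun j => exp (- (INR (S j) * X))) n = (1 - r ^ n) * / (exp X - 1)).
  { intros n. apply (Rmult_eq_reg_r (exp X - 1)); [| lra].
    rewrite Rmult_assoc, Rinv_l, Rmult_1_r by lra.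
    induction n as [|n IH]; [simpl; ring |]. cbn [rpsum]. rewrite Rmult_plus_distr_r, IH.
    replace (exp (- (INR (S n) * X))) with (r ^ S n).
    - simpl. replace (r * r ^ n * (exp X - 1)) with (r ^ n * (r * exp X) - r * r ^ n) by ring. rewrite hrX. ring.
    - unfold r. rewrite <- (exp_mult_INR X (S n)). f_equal. ring. }
  intros eps he.
  destruct (pow_lt_1_zero r ltac:(rewrite Rabs_pos_eq; lra) (eps * (exp X - 1)) ltac:(nra)) as [N hN].
  exists N. intros n hn. specialize (hN n hn).
  rewrite psum_RtoC, hsum, <- RtoC_minus, Cmod_R.
  replace ((1 - r ^ n) * / (exp X - 1) - / (exp X - 1)) with (- (r ^ n * / (exp X - 1))) by ring.
  rewrite Rabs_Ropp, Rabs_mult, (Rabs_pos_eq (/ _)) by (apply Rlt_le, Rinv_0_lt_compat; lra).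
  apply (Rmult_lt_reg_r (exp X - 1)); auto. rewrite Rmult_assoc, Rinv_l, Rmult_1_r by lra. exact hN.
Qed.

Section BesselSide.

Variables (q : nat) (chi : nat -> C) (nu : C) (x : R).
Hypothesis hchi : is_dirichlet_char q chi.
Hypothesis hnonprinc : ~ is_principal q chi.
Hypothesis hnu : 0 <= Re nu.
Hypothesis hx : 0 < x.

(** Integrand for the pair d = S i, m = S j in the divisor sum at n = d m. *)
Let bes (i j : nat) (t : R) : C :=
  (RtoC (exp (- (2 * PI * INR (S i) * exp t) - 2 * PI * INR (S j) * x * exp (- t))) * Cexp (nu * RtoC t))%C.

Let bes_val (i j : nat) : C :=
  (2 * cpow (2 * PI * INR (S j) * x / (2 * PI * INR (S i))) (nu / 2)
   * BesselK nu (2 * sqrt (2 * PI * INR (S i) * (2 * PI * INR (S j) * x))))%C.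

Let w2 (k : nat) : R := Rpower (INR (S k)) (- (2)).

(** The factor 1 / (exp(2 pi x / u) - 1) at u = e^t. *)
Definition planck_weight (t : R) : R := / (exp (2 * PI * x * exp (- t)) - 1).

Definition planck_integrand (t : R) : C :=
  (theta q chi (exp t) * (RtoC (planck_weight t) * Cexp (nu * RtoC t)))%C.

Lemma planck_den_pos (t : R) : 0 < exp (2 * PI * x * exp (- t)) - 1.
Proof.
  assert (hpi : 0 < PI) by apply PI_RGT_0.
  assert (h : 0 < 2 * PI * x * exp (- t)) by (pose proof (exp_pos (- t)); apply Rmult_lt_0_compat; nra).
  pose proof (exp_ineq1 (2 * PI * x * exp (- t)) ltac:(lra)). lra.
Qed.

Lemma ccont_planck_weight (t : R) : ccont (fun t => RtoC (planck_weight t)) t.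
Proof.
  apply ccont_ex_derive. unfold planck_weight.
  pose proof (planck_den_pos t). auto_derive. lra.
Qed.

(** The two exponentials are bounded with different powers at the two ends: Re nu + 3 and 2 for t >=
    0, 2 and 3 for t <= 0. All are at least 2, which gives the summable weights [w2], and what
    remains decays at rate at least 1. *)
Lemma decay_bes : exists K, 0 <= K /\ forall i j, decay (bes i j) (K * w2 i * w2 j) 1.
Proof.
  assert (hpi : 0 < PI) by apply PI_RGT_0. set (sg := Re nu) in *.
  destruct (exp_neg_exp_le (sg + 3) ltac:(lra)) as (C1 & hC1 & H1).
  destruct (exp_neg_exp_le 2 ltac:(lra)) as (C2 & hC2 & H2).
  destruct (exp_neg_exp_le 3 ltac:(lra)) as (C3 & hC3 & H3).
  assert (hpx : 0 < 2 * PI * x) by nra. assert (hp2 : 0 < 2 * PI) by lra.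
  assert (hpos : forall a p, 0 < Rpower a p) by (intros; apply exp_pos).
  set (K1 := C1 * Rpower (2 * PI) (- (sg + 3)) * (C2 * Rpower (2 * PI * x) (- (2)))).
  set (K2 := C2 * Rpower (2 * PI) (- (2)) * (C3 * Rpower (2 * PI * x) (- (3)))).
  assert (hK1 : 0 < K1) by (unfold K1; repeat apply Rmult_lt_0_compat; auto).
  assert (hK2 : 0 < K2) by (unfold K2; repeat apply Rmult_lt_0_compat; auto).
  exists (K1 + K2). split; [lra |]. intros i j.
  pose proof (INR_S_pos i) as hi. pose proof (INR_S_pos j) as hj.
  assert (ci : forall t, ccont (bes i j) t).
  { intros t. apply ccont_mult; [| apply ccont_Cexp_linear].
    apply ccont_ex_derive. now auto_derive. }
  assert (split_exp : forall t, exp (- (2 * PI * INR (S i) * exp t) - 2 * PI * INR (S j) * x * exp (- t))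
     = exp (- (2 * PI * INR (S i) * exp t)) * exp (- (2 * PI * x * INR (S j) * exp (- t)))).
  { intros t. rewrite <- exp_plus. f_equal. ring. }
  assert (gen : forall t Ca Cb pa pb Ka,
     exp (- (2 * PI * INR (S i) * exp t)) <= Ca * Rpower (2 * PI * INR (S i)) (- pa) * exp (- (pa * t)) ->
     exp (- (2 * PI * x * INR (S j) * exp (- t))) <= Cb * Rpower (2 * PI * x * INR (S j)) (- pb) * exp (- (pb * - t)) ->
     0 < Ca -> 0 < Cb -> 2 <= pa -> 2 <= pb ->
     Ka = Ca * Rpower (2 * PI) (- pa) * (Cb * Rpower (2 * PI * x) (- pb)) ->
     Cmod (bes i j t) <= Ka * w2 i * w2 j * exp ((sg - pa + pb) * t)).
  { intros t Ca Cb pa pb Ka h1 h2 hCa hCb hpa hpb ->. unfold bes.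
    rewrite Cmod_mult, Cmod_Cexp_linear, Cmod_RtoC_pos by apply exp_ge_0. rewrite split_exp. fold sg.
    rewrite <- Rpower_mult_distr in h1 by lra. rewrite <- Rpower_mult_distr in h2 by lra.
    assert (wi : Rpower (INR (S i)) (- pa) <= w2 i) by (apply Rpower_le_exponent; [apply INR_S_ge_1 | lra]).
    assert (wj : Rpower (INR (S j)) (- pb) <= w2 j) by (apply Rpower_le_exponent; [apply INR_S_ge_1 | lra]).
    pose proof (hpos (2 * PI) (- pa)) as q1. pose proof (hpos (2 * PI * x) (- pb)) as q2.
    apply Rle_trans with ((Ca * (Rpower (2 * PI) (- pa) * w2 i) * exp (- (pa * t)))
        * (Cb * (Rpower (2 * PI * x) (- pb) * w2 j) * exp (- (pb * - t))) * exp (sg * t)).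
    - apply Rmult_le_compat_r; [apply exp_ge_0 |].
      apply Rmult_le_compat; try (apply exp_ge_0).
      + eapply Rle_trans; [exact h1 |]. apply Rmult_le_compat_r; [apply exp_ge_0 |].
        apply Rmult_le_compat_l; [lra |]. apply Rmult_le_compat_l; lra.
      + eapply Rle_trans; [exact h2 |]. apply Rmult_le_compat_r; [apply exp_ge_0 |].
        apply Rmult_le_compat_l; [lra |]. apply Rmult_le_compat_l; lra.
    - right. replace ((sg - pa + pb) * t) with (- (pa * t) + - (pb * - t) + sg * t) by ring.
      rewrite !exp_plus. ring. }
  pose proof (hpos (INR (S i)) (- (2))) as vi. fold (w2 i) in vi.
  pose proof (hpos (INR (S j)) (- (2))) as vj. fold (w2 j) in vj.
  assert (vij : 0 < w2 i * w2 j) by now apply Rmult_lt_0_compat.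
  apply decay_two_sided; [exact ci | lra | |].
  - intros t ht. eapply Rle_trans.
    + apply (gen t C1 C2 (sg + 3) 2 K1); auto; try lra; [apply H1; nra | apply H2; nra].
    + replace ((sg - (sg + 3) + 2) * t) with (- (1 * t)) by ring.
      apply Rmult_le_compat_r; [apply exp_ge_0 |]. nra.
  - intros t ht. eapply Rle_trans.
    + apply (gen t C2 C3 2 3 K2); auto; try lra; [apply H2; nra | apply H3; nra].
    + apply Rmult_le_compat; [nra | apply exp_ge_0 | nra |]. apply exp_mono. nra.
Qed.

Lemma is_IR_bes (i j : nat) : is_IR (bes i j) (bes_val i j).
Proof.
  assert (hpi : 0 < PI) by apply PI_RGT_0.
  pose proof (INR_S_pos i) as hi. pose proof (INR_S_pos j) as hj.
  apply is_IR_bessel; [nra |]. apply Rmult_lt_0_compat; [nra | exact hx].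
Qed.

(** Summation over j is a geometric series and produces the Planck weight; summation over i then
    produces F. The product bound on [bes_val] is what the rearrangement into divisor sums needs. *)
Lemma planck_double_series : exists K, 0 <= K /\
  (forall i j, Cmod (bes_val i j) <= K * w2 i * w2 j) /\
  exists A, (forall i, Cser (fun j => bes_val i j) (A i)) /\
    Cser (fun i => Cconj (chi (S i)) * A i)%C (IR planck_integrand) /\
    exists K' c', decay planck_integrand K' c'.
Proof.
  assert (hpi : 0 < PI) by apply PI_RGT_0.
  destruct decay_bes as (K & hK & hd).
  destruct (p_series 2 ltac:(lra)) as (s & hs).
  pose proof (rsum_nonneg _ _ hs) as hs0.
  assert (hw : forall k, 0 < w2 k) by (intros; apply exp_pos).
  exists (2 * K). split; [lra |]. split.
  { intros i j. pose proof (Cmod_is_IR_le _ _ _ _ (hd i j) (is_IR_bes i j)) as h.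
    replace (2 * (K * w2 i * w2 j) / 1) with (2 * K * w2 i * w2 j) in h by field. exact h. }
  set (F := fun i t => (RtoC (exp (- (2 * PI * INR (S i) * exp t))) * (RtoC (planck_weight t) * Cexp (nu * RtoC t)))%C).
  assert (cF : forall i t, ccont (F i) t).
  { intros i t. apply ccont_mult; [apply ccont_exp_exp |].
    apply ccont_mult; [apply ccont_planck_weight | apply ccont_Cexp_linear]. }
  assert (inner : forall i, decay (F i) (K * w2 i * s) 1 /\ Cser (fun j => bes_val i j) (IR (F i))).
  { intros i. apply (is_IR_series (bes i) (bes_val i) (fun j => K * w2 i * w2 j) (K * w2 i * s) 1 (F i)).
    - intros j. apply hd.
    - intros j. apply is_IR_bes.
    - apply rsum_scal; [| exact hs]. apply Rmult_le_pos; [lra | apply Rlt_le, hw].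
    - apply cF.
    - intros t. assert (hX : 0 < 2 * PI * x * exp (- t)).
      { pose proof (exp_pos (- t)). apply Rmult_lt_0_compat; nra. }
      assert (h := Cser_scal (RtoC (exp (- (2 * PI * INR (S i) * exp t))) * Cexp (nu * RtoC t))%C _ _
                     (planck_geometric _ hX)).
      replace (F i t) with (RtoC (exp (- (2 * PI * INR (S i) * exp t))) * Cexp (nu * RtoC t) *
            RtoC (/ (exp (2 * PI * x * exp (- t)) - 1)))%C by (unfold F, planck_weight; ring).
      eapply Cser_ext; [| exact h]. intros j. cbv beta. unfold bes.
      replace (- (2 * PI * INR (S i) * exp t) - 2 * PI * INR (S j) * x * exp (- t))
        with (- (2 * PI * INR (S i) * exp t) + - (INR (S j) * (2 * PI * x * exp (- t)))) by ring.
      rewrite exp_plus, RtoC_mult. ring. }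
  exists (fun i => IR (F i)). split; [intros i; apply inner |].
  destruct (is_IR_series (fun i t => Cconj (chi (S i)) * F i t)%C (fun i => Cconj (chi (S i)) * IR (F i))%C
              (fun i => K * s * w2 i) (K * s * s) 1 planck_integrand) as [hdec hser].
  - intros i. destruct (inner i) as [hi _]. apply (decay_scal (Cconj (chi (S i)))) in hi.
    destruct hi as (h1 & h2 & h3). split; [exact h1 | split; [lra |]]. intros t.
    eapply Rle_trans; [apply h3 |]. apply Rmult_le_compat_r; [apply exp_ge_0 |].
    pose proof (Cmod_conj_char_le q chi hchi (S i)). pose proof (Cmod_ge_0 (Cconj (chi (S i)))).
    replace (K * s * w2 i) with (1 * (K * w2 i * s)) by ring. apply Rmult_le_compat_r; auto.
    apply Rmult_le_pos; auto. apply Rmult_le_pos; [lra | apply Rlt_le, hw].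
  - intros i. apply is_IR_scal; [apply cF |]. eapply IR_correct, inner.
  - apply rsum_scal; [now apply Rmult_le_pos | exact hs].
  - intros t. apply ccont_mult; [apply ccont_theta; auto |].
    apply ccont_mult; [apply ccont_planck_weight | apply ccont_Cexp_linear].
  - intros t. assert (h := Cser_scal (RtoC (planck_weight t) * Cexp (nu * RtoC t))%C _ _
                     (theta_exponential q chi hchi hnonprinc (exp t) (exp_pos t))).
    unfold planck_integrand. rewrite (Cmult_comm (theta _ _ _)).
    eapply Cser_ext; [| exact h]. intros i. cbv beta. unfold F.
    replace (2 * PI * exp t * INR (S i)) with (2 * PI * INR (S i) * exp t) by ring. ring.
  - split; eauto.
Qed.

(** For n = d m one has 4 pi sqrt(n x) = 2 sqrt(2 pi d . 2 pi m x) and d^(-nu) n^(nu/2) x^(nu/2) =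
    (m x / d)^(nu/2), so each term is [bes_val] up to the factor 2 x^(nu/2). *)
Theorem bessel_series_integral : exists S1,
  Cser (fun n => sigma_chi (- nu) (conj_char chi) (S n) * cpow (INR (S n)) (nu / 2)
                 * BesselK nu (4 * PI * sqrt (INR (S n) * x)))%C S1 /\
  (RtoC (8 * PI) * cpow x (nu / 2) * S1)%C = (RtoC (4 * PI) * IR planck_integrand)%C.
Proof.
  assert (hpi : 0 < PI) by apply PI_RGT_0.
  destruct planck_double_series as (K & hK & hb & A & hA & hAs & _).
  destruct (p_series 2 ltac:(lra)) as (s & hs).
  set (a := fun d m : nat => (cpow (INR d) (- nu) * Cconj (chi d) *
              (cpow (INR (d * m)) (nu / 2) * BesselK nu (4 * PI * sqrt (INR (d * m) * x))))%C).
  set (k0 := (/ 2 * / cpow x (nu / 2))%C).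
  assert (hx0 : cpow x (nu / 2) <> RtoC 0) by apply cpow_neq_0.
  assert (ha : forall i j, a (S i) (S j) = (k0 * (Cconj (chi (S i)) * bes_val i j))%C).
  { intros i j. pose proof (INR_S_pos i) as hi. pose proof (INR_S_pos j) as hj.
    unfold a, bes_val, k0. rewrite mult_INR.
    replace (2 * sqrt (2 * PI * INR (S i) * (2 * PI * INR (S j) * x))) with (4 * PI * sqrt (INR (S i) * INR (S j) * x)).
    2:{ replace (2 * PI * INR (S i) * (2 * PI * INR (S j) * x)) with ((2 * PI) * (2 * PI) * (INR (S i) * INR (S j) * x)) by ring.
        rewrite (sqrt_mult_alt (2 * PI * (2 * PI))), (sqrt_square (2 * PI)) by nra. ring. }
    replace (2 * PI * INR (S j) * x / (2 * PI * INR (S i))) with (INR (S j) * x * / INR (S i)) by (field; lra).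
    rewrite (cpow_mult_base (INR (S i)) (INR (S j))) by assumption.
    rewrite (cpow_mult_base (INR (S j) * x)), (cpow_mult_base (INR (S j)) x), cpow_inv_base
      by (auto; try (now apply Rinv_0_lt_compat); now apply Rmult_lt_0_compat).
    replace (- nu)%C with (- (nu / 2 + nu / 2))%C by field.
    rewrite cpow_opp, cpow_plus. field. repeat split; auto; apply cpow_neq_0. }
  destruct (dirichlet_rearrangement a (fun i => Cmod k0 * K * w2 i) w2 (Cmod k0 * K * s) s
              (fun i => k0 * (Cconj (chi (S i)) * A i))%C) as (T & hT & hT').
  - apply rsum_scal; [| exact hs]. apply Rmult_le_pos; [apply Cmod_ge_0 | lra].
  - exact hs.
  - intros i j. rewrite ha, !Cmod_mult, !Rmult_assoc. apply Rmult_le_compat_l; [apply Cmod_ge_0 |].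
    pose proof (Cmod_conj_char_le q chi hchi (S i)). pose proof (Cmod_ge_0 (Cconj (chi (S i)))).
    specialize (hb i j). pose proof (Cmod_ge_0 (bes_val i j)). nra.
  - intros i. eapply Cser_ext; [| apply Cser_scal, Cser_scal, hA]. intros j. cbv beta. now rewrite ha.
  - exists T. split.
    + eapply Cser_ext; [| exact hT']. intros n. cbv beta. unfold sigma_chi.
      rewrite <- Cmult_assoc, Cmult_comm, <- divsum_scal. apply divsum_ext. intros d m hd e.
      unfold a. assert (em : (S n / d)%nat = m) by (rewrite e, Nat.mul_comm; apply Nat.div_mul; lia).
      rewrite em, <- e. unfold conj_char. ring.
    + assert (hs2 := Cser_scal k0 _ _ hAs). pose proof (Cser_unique _ _ _ hT hs2) as ->.
      unfold k0. replace (RtoC (8 * PI)) with (2 * RtoC (4 * PI))%C.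
      * field. exact hx0.
      * rewrite <- RtoC_mult. f_equal. ring.
Qed.

End BesselSide.

(** * Partial fractions of the Planck weight, integrated against F *)

Section PlanckExpansion.

Variables (q : nat) (chi : nat -> C) (nu : C) (x : R).
Hypothesis hchi : is_dirichlet_char q chi.
Hypothesis hnonprinc : ~ is_principal q chi.
Hypothesis heven : is_even_char q chi.
Hypothesis hprim : is_primitive q chi.
Hypothesis hnu : 0 <= Re nu.
Hypothesis hx : 0 < x.

Let theta_lor (s : C) (B t : R) : C := (theta q chi (exp t) * lor s B t)%C.

Lemma ccont_theta_lor (s : C) (B t : R) : ccont (theta_lor s B) t.
Proof. apply ccont_mult; [apply ccont_theta; auto | apply ccont_lor]. Qed.

Lemma decay_theta_lor (s : C) (B : R) : -1 < Re s -> 0 < B -> exists K c, decay (theta_lor s B) K c.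
Proof.
  intros hs hB. destruct (decay_theta q chi hchi hnonprinc heven hprim s hs) as (K & c & hd).
  exists (K * / B ^ 2), c. pose proof (decay_K_nonneg _ _ _ hd) as hK. destruct hd as (h1 & h2 & h3).
  split; [intros t; apply ccont_theta_lor | split; auto]. intros t.
  unfold theta_lor, lor. rewrite Cmult_assoc, Cmod_mult.
  pose proof (lor_den_pos B t) as hd. assert (hB2 : 0 < B ^ 2) by now apply pow_lt.
  rewrite (Cmod_RtoC_pos (/ _)) by (apply Rlt_le, Rinv_0_lt_compat, hd).
  replace (K * / B ^ 2 * exp (- (c * Rabs t))) with (K * exp (- (c * Rabs t)) * / B ^ 2) by ring.
  apply Rmult_le_compat; [apply Cmod_ge_0 | apply Rlt_le, Rinv_0_lt_compat, hd | apply h3 |].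
  apply Rinv_le_contravar; auto. pose proof (exp_pos (2 * t)). lra.
Qed.

(** u^2 / (u^2 + B^2) = 1 - B^2 / (u^2 + B^2). *)
Lemma theta_lor_step (s : C) (B : R) : -1 < Re (s - 2) -> 0 < B ->
  IR (theta_lor s B) = (mellin q chi (s - 2) - RtoC (B ^ 2) * IR (theta_lor (s - 2) B))%C.
Proof.
  intros hs hB. apply IR_unique.
  apply (is_IR_ext (fun t => theta q chi (exp t) * Cexp ((s - 2) * RtoC t)
                             - RtoC (B ^ 2) * theta_lor (s - 2) B t)%C).
  - intros t. unfold theta_lor, lor. pose proof (lor_den_pos B t) as hd.
    replace (s * RtoC t)%C with ((s - 2) * RtoC t + RtoC (2 * t))%C by (rewrite RtoC_mult; ring).
    rewrite Cexp_plus, Cexp_RtoC, RtoC_inv by lra.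
    assert (hd0 : RtoC (exp (2 * t) + B ^ 2) <> RtoC 0) by (apply RtoC_neq_0; lra).
    rewrite RtoC_plus in *. field. exact hd0.
  - apply is_IR_minus.
    + intros t. apply ccont_mult; [apply ccont_theta; auto | apply ccont_Cexp_linear].
    + intros t. apply ccont_mult; [apply ccont_const | apply ccont_theta_lor].
    + apply is_IR_mellin; auto.
    + apply is_IR_scal; [intros t; apply ccont_theta_lor |].
      destruct (decay_theta_lor (s - 2) B hs hB) as (K & c & h). eapply IR_correct, h.
Qed.

(** Iteration of the step; the lowest Mellin argument is s - 2N, and the hypothesis on Re s keeps it
    right of -1. *)
Lemma theta_lor_expansion (N : nat) (s : C) (B : R) : -1 < Re s - 2 * INR N -> 0 < B ->
  IR (theta_lor s B)
  = (psum (fun j => RtoC ((-1) ^ j * B ^ (2 * j)) * mellin q chi (s - 2 - RtoC (2 * INR j))) N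
     + RtoC ((-1) ^ N * B ^ (2 * N)) * IR (theta_lor (s - RtoC (2 * INR N)) B))%C.
Proof.
  intros hs hB. induction N as [|N IH].
  - simpl. replace (s - RtoC (2 * 0))%C with s by (rewrite Rmult_0_r; ring).
    replace (1 * 1) with 1 by ring. ring.
  - rewrite S_INR in hs. rewrite IH by lra. cbn [psum].
    rewrite (theta_lor_step (s - RtoC (2 * INR N)) B) by (auto; simpl; unfold Re in *; lra).
    replace (s - RtoC (2 * INR N) - 2)%C with (s - 2 - RtoC (2 * INR N))%C by ring.
    replace (s - RtoC (2 * INR (S N)))%C with (s - 2 - RtoC (2 * INR N))%C
      by (rewrite S_INR, !RtoC_mult, RtoC_plus; ring).
    replace (RtoC ((-1) ^ S N * B ^ (2 * S N))) with (- (RtoC ((-1) ^ N * B ^ (2 * N)) * RtoC (B ^ 2)))%C.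
    + ring.
    + rewrite <- RtoC_mult, <- RtoC_opp. f_equal.
      replace (2 * S N)%nat with (2 * N + 2)%nat by lia. rewrite pow_add. simpl. ring.
Qed.

(** [planck_series] at y = x/u, times F(u) u^nu. Each term is y / (pi (y^2 + m^2)) = x / (pi m^2) .
    u / (u^2 + (x/m)^2), and the corrections 1/2 and 1 / (2 pi y) become Mellin transforms at nu and
    nu + 1. *)
Theorem planck_expansion :
  Cser (fun m => RtoC (x / (PI * INR (S m) ^ 2)) * IR (theta_lor (nu + 1) (x / INR (S m))))%C
    (IR (planck_integrand q chi nu x) + / 2 * mellin q chi nu
     - RtoC (/ (2 * PI * x)) * mellin q chi (nu + 1))%C.
Proof.
  assert (hpi : 0 < PI) by apply PI_RGT_0.
  set (sg := Re nu) in *.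
  destruct (theta_small q chi hchi hnonprinc heven hprim) as (K1 & hK1 & H1).
  destruct (theta_large q chi hchi hnonprinc (sg + 2) ltac:(lra)) as (K2 & hK2 & H2).
  set (F := fun t => (planck_integrand q chi nu x t + / 2 * (theta q chi (exp t) * Cexp (nu * RtoC t))
      - RtoC (/ (2 * PI * x)) * (theta q chi (exp t) * Cexp ((nu + 1) * RtoC t)))%C).
  assert (ct : forall s t, ccont (fun t => theta q chi (exp t) * Cexp (s * RtoC t))%C t).
  { intros s t. apply ccont_mult; [apply ccont_theta; auto | apply ccont_Cexp_linear]. }
  destruct (planck_double_series q chi nu x hchi hnonprinc hnu hx)
    as (_ & _ & _ & _ & _ & _ & K' & c' & hdP).
  assert (cP : forall t, ccont (planck_integrand q chi nu x) t) by apply hdP.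
  assert (cF : forall t, ccont F t).
  { intros t. apply ccont_minus; [apply ccont_plus; [apply cP |] |];
      (apply ccont_mult; [apply ccont_const | apply ct]). }
  assert (hIF : is_IR F (IR (planck_integrand q chi nu x) + / 2 * mellin q chi nu
                         - RtoC (/ (2 * PI * x)) * mellin q chi (nu + 1))%C).
  { apply is_IR_minus.
    - intros t. apply ccont_plus; [apply cP | apply ccont_mult; [apply ccont_const | apply ct]].
    - intros t. apply ccont_mult; [apply ccont_const | apply ct].
    - apply is_IR_plus; auto.
      + intros t. apply ccont_mult; [apply ccont_const | apply ct].
      + eapply IR_correct, hdP.
      + apply is_IR_scal; [apply ct |]. apply is_IR_mellin; auto. fold sg. lra.
    - apply is_IR_scal; [apply ct |]. apply is_IR_mellin; auto. simpl. fold (Re nu). fold sg. lra. }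
  rewrite <- (IR_unique _ _ hIF).
  (* For t <= 0, [lor_bound] with al = 1/2 turns 1/m^2 into m^(-3/2) and, since F(u) = O(u), leaves
     the rate Re nu + 1/2; hence 3/2 here and the common rate 1/2 below. *)
  set (w := fun m => Rpower (INR (S m)) (- (3 / 2))).
  destruct (p_series (3 / 2) ltac:(lra)) as (s & hs).
  pose proof (Rpower_pos x (- (/ 2))) as ex.
  set (K := x / PI * (K1 * Rpower x (- (/ 2)) + K2)).
  assert (hxp : 0 < x / PI) by now apply Rdiv_lt_0_compat.
  assert (hK : 0 <= K) by (unfold K; apply Rmult_le_pos; nra).
  apply (is_IR_series (fun m t => RtoC (x / (PI * INR (S m) ^ 2)) * theta_lor (nu + 1) (x / INR (S m)) t)%C _
           (fun m => K * w m) (K * s) (/ 2) F); auto.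
  - intros m. pose proof (INR_S_pos m) as hm. pose proof (INR_S_ge_1 m) as hm1.
    set (B := x / INR (S m)). assert (hB : 0 < B) by now apply Rdiv_lt_0_compat.
    assert (hcoef : 0 <= x / (PI * INR (S m) ^ 2)).
    { apply Rlt_le, Rdiv_lt_0_compat; auto. apply Rmult_lt_0_compat; [lra | now apply pow_lt]. }
    assert (hcw : x / (PI * INR (S m) ^ 2) = x / PI * Rpower (INR (S m)) (- (2))).
    { rewrite Rpower_INR_S_neg2. field. lra. }
    assert (hw0 : 0 < w m) by apply exp_pos.
    assert (hexp0 : forall a, 0 <= exp a) by (intros; apply exp_ge_0).
    assert (hre : Re (nu + 1) = sg + 1) by reflexivity.
    apply decay_two_sided; [| lra | |].
    + intros t. apply ccont_mult; [apply ccont_const | apply ccont_theta_lor].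
    + intros t ht. unfold theta_lor, lor. pose proof (lor_den_pos B t) as hd.
      rewrite !Cmod_mult, Cmod_Cexp_linear, !Cmod_RtoC_pos, hre
        by (try exact hcoef; apply Rlt_le, Rinv_0_lt_compat, hd).
      apply Rle_trans with (x / PI * w m * (K2 * exp (- ((sg + 2) * t)) * (exp ((sg + 1) * t) * 1))).
      * apply Rmult_le_compat; auto.
        -- apply Rmult_le_pos; [apply Cmod_ge_0 |]. apply Rmult_le_pos; auto. apply Rlt_le, Rinv_0_lt_compat, hd.
        -- rewrite hcw. apply Rmult_le_compat_l; [lra |]. apply Rpower_le_exponent; lra.
        -- apply Rmult_le_compat; [apply Cmod_ge_0 | | apply H2 |].
           ++ apply Rmult_le_pos; auto. apply Rlt_le, Rinv_0_lt_compat, hd.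
           ++ apply Rmult_le_compat_l; auto. rewrite <- Rinv_1. apply Rinv_le_contravar; [lra |].
              pose proof (pow2_ge_0 B). assert (1 <= exp (2 * t)) by (rewrite <- exp_0; apply exp_mono; lra). lra.
      * replace (x / PI * w m * (K2 * exp (- ((sg + 2) * t)) * (exp ((sg + 1) * t) * 1)))
          with (x / PI * K2 * w m * (exp (- ((sg + 2) * t)) * exp ((sg + 1) * t))) by ring.
        rewrite <- exp_plus. apply Rmult_le_compat; auto.
        -- apply Rmult_le_pos; [apply Rmult_le_pos; lra | lra].
        -- apply Rmult_le_compat_r; [lra |]. unfold K. apply Rmult_le_compat_l; [lra |]. nra.
        -- apply exp_mono. nra.
    + intros t ht. unfold theta_lor, lor. pose proof (lor_den_pos B t) as hd.
      rewrite !Cmod_mult, Cmod_Cexp_linear, !Cmod_RtoC_pos, hre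
        by (try exact hcoef; apply Rlt_le, Rinv_0_lt_compat, hd).
      assert (hBp : Rpower B (- (/ 2)) = Rpower x (- (/ 2)) * Rpower (INR (S m)) (/ 2)).
      { unfold B. rewrite Rpower_quotient_neg by assumption. apply Rmult_comm. }
      apply Rle_trans with (x / PI * Rpower (INR (S m)) (- (2)) * (K1 * exp t * (exp ((sg + 1) * t) *
          (Rpower B (- (/ 2)) * exp (- ((2 - / 2) * t)))))).
      * apply Rmult_le_compat; auto; [| rewrite hcw; lra |].
        -- apply Rmult_le_pos; [apply Cmod_ge_0 |]. apply Rmult_le_pos; auto. apply Rlt_le, Rinv_0_lt_compat, hd.
        -- apply Rmult_le_compat; [apply Cmod_ge_0 | | apply H1, exp_pos |].
           ++ apply Rmult_le_pos; auto. apply Rlt_le, Rinv_0_lt_compat, hd.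
           ++ apply Rmult_le_compat_l; auto. apply lor_bound; lra.
      * rewrite hBp.
        replace (x / PI * Rpower (INR (S m)) (- (2)) * (K1 * exp t * (exp ((sg + 1) * t) *
          (Rpower x (- (/ 2)) * Rpower (INR (S m)) (/ 2) * exp (- ((2 - / 2) * t))))))
          with (x / PI * (K1 * Rpower x (- (/ 2))) * (Rpower (INR (S m)) (- (2)) * Rpower (INR (S m)) (/ 2))
                * (exp t * exp ((sg + 1) * t) * exp (- ((2 - / 2) * t)))) by ring.
        rewrite <- !exp_plus, <- Rpower_plus.
        replace (- (2) + / 2) with (- (3 / 2)) by field. fold (w m).
        apply Rmult_le_compat; auto.
        -- apply Rmult_le_pos; [| lra]. apply Rmult_le_pos; [lra | nra].
        -- apply Rmult_le_compat_r; [lra |]. unfold K. apply Rmult_le_compat_l; lra.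
        -- apply exp_mono. nra.
  - intros m. apply is_IR_scal; [intros t; apply ccont_theta_lor |].
    destruct (decay_theta_lor (nu + 1) (x / INR (S m))) as (Kd & cd & hd).
    + simpl. fold (Re nu). fold sg. lra.
    + apply Rdiv_lt_0_compat; [exact hx | apply INR_S_pos].
    + eapply IR_correct, hd.
  - now apply rsum_scal.
  - intros t. set (y := x * exp (- t)).
    pose proof (exp_pos t) as het. pose proof (exp_pos (- t)) as het'.
    assert (hee : exp (- t) = / exp t) by apply exp_Ropp.
    assert (hy : 0 < y) by now apply Rmult_lt_0_compat.
    assert (h := Cser_scal (theta q chi (exp t) * Cexp (nu * RtoC t))%C _ _ (planck_series y hy)).
    replace (F t) with (theta q chi (exp t) * Cexp (nu * RtoC t) *
      RtoC (/ (exp (2 * PI * y) - 1) + / 2 - / (2 * PI * y)))%C.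
    + eapply Cser_ext; [| exact h]. intros m. cbv beta. unfold theta_lor, lor.
      pose proof (INR_S_pos m) as hm. pose proof (lor_den_pos (x / INR (S m)) t) as hd.
      replace ((nu + 1) * RtoC t)%C with (nu * RtoC t + RtoC t)%C by ring. rewrite Cexp_plus, Cexp_RtoC.
      replace (y / (PI * (y ^ 2 + INR (S m) ^ 2)))
        with (x / (PI * INR (S m) ^ 2) * (exp t * / (exp (2 * t) + (x / INR (S m)) ^ 2))).
      * rewrite !RtoC_mult. ring.
      * unfold y. rewrite hee, exp_2. field. repeat split; try lra; nra.
    + unfold F, planck_integrand, planck_weight.
      replace (2 * PI * x * exp (- t)) with (2 * PI * y) by (unfold y; ring).
      replace ((nu + 1) * RtoC t)%C with (nu * RtoC t + RtoC t)%C by ring. rewrite Cexp_plus, Cexp_RtoC.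
      replace (/ (2 * PI * y)) with (/ (2 * PI * x) * exp t).
      * rewrite RtoC_minus, RtoC_plus, RtoC_mult, (RtoC_inv 2) by lra. ring.
      * unfold y. rewrite hee. field. repeat split; lra.
Qed.

End PlanckExpansion.

(** * The twisted divisor series *)

Lemma pow_Rdiv (a b : R) (n : nat) : (a / b) ^ n = a ^ n / b ^ n.
Proof. unfold Rdiv. now rewrite Rpow_mult_distr, pow_inv. Qed.

Lemma rsum_Series (b : nat -> R) (S : R) : rsum b S -> Series b = S.
Proof.
  intros (h1 & h2 & h3). apply is_series_unique.
  assert (hs : forall n, sum_n b n = rpsum b (Datatypes.S n)).
  { induction n as [|n IH].
    - rewrite sum_O. simpl. ring.
    - rewrite sum_Sn, IH. reflexivity. }
  change (is_lim_seq (sum_n b) S). apply is_lim_seq_spec. intros eps.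
  destruct (h3 eps (cond_pos eps)) as [N hN]. exists N. intros n hn. rewrite hs.
  pose proof (rpsum_mono b N (Datatypes.S n) h1 ltac:(lia)). specialize (h2 (Datatypes.S n)).
  rewrite Rabs_left1; lra.
Qed.

Lemma zetaR_Cser (k : nat) : Cser (fun m => RtoC (/ INR (S m) ^ (2 * S k))) (RtoC (zetaR (2 * INR (S k)))).
Proof.
  pose proof (INR_S_ge_1 k) as hk.
  destruct (p_series (2 * INR (S k)) ltac:(lra)) as (s & hs).
  assert (hz : zetaR (2 * INR (S k)) = s).
  { unfold zetaR. rewrite (Series_ext _ (fun n => Rpower (INR (S n)) (- (2 * INR (S k))))).
    - now apply rsum_Series.
    - intros n. now rewrite Rpower_Ropp. }
  rewrite hz. eapply Cser_ext; [| apply rsum_Cser, hs]. intros m. cbv beta.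
  rewrite Rpower_Ropp. do 2 f_equal.
  rewrite <- Rpower_pow by apply INR_S_pos. f_equal. rewrite mult_INR. reflexivity.
Qed.

(** For l >= 2Q the ratio to l^2 is at least 1/2; each of the finitely many smaller l has a positive
    ratio because Q is not a positive integer. *)
Lemma square_gap (Q : R) : 0 < Q -> (forall m, (1 <= m)%nat -> Q <> INR m) ->
  exists c, 0 < c /\ forall l, c * INR (S l) ^ 2 <= Rabs (INR (S l) ^ 2 - Q ^ 2).
Proof.
  intros hQ hne.
  assert (hpos : forall l, 0 < Rabs (INR (S l) ^ 2 - Q ^ 2)).
  { intros l. apply Rabs_pos_lt. intros e. pose proof (INR_S_pos l).
    apply (hne (S l)); [lia |]. nra. }
  assert (hfin : forall M, exists c, 0 < c /\ forall l, (l < M)%nat -> c * INR (S l) ^ 2 <= Rabs (INR (S l) ^ 2 - Q ^ 2)).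
  { induction M as [|M (c & hc & H)].
    - exists 1. split; [lra |]. intros; lia.
    - pose proof (INR_S_pos M) as hM. assert (hM2 : 0 < INR (S M) ^ 2) by now apply pow_lt.
      exists (Rmin c (Rabs (INR (S M) ^ 2 - Q ^ 2) / INR (S M) ^ 2)). split.
      + apply Rmin_glb_lt; auto. apply Rdiv_lt_0_compat; auto.
      + intros l hl. destruct (Nat.eq_dec l M) as [-> | hlM].
        * apply Rle_trans with (Rabs (INR (S M) ^ 2 - Q ^ 2) / INR (S M) ^ 2 * INR (S M) ^ 2).
          -- apply Rmult_le_compat_r; [lra | apply Rmin_r].
          -- right. field. lra.
        * eapply Rle_trans; [| apply H; lia]. apply Rmult_le_compat_r; [apply pow2_ge_0 | apply Rmin_l]. }
  destruct (nfloor_ex (2 * Q) ltac:(lra)) as [M hM].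
  destruct (hfin (S M)) as (c & hc & H).
  exists (Rmin c (/ 2)). split; [apply Rmin_glb_lt; lra |]. intros l.
  destruct (Nat.lt_ge_cases l (S M)) as [h|h].
  - eapply Rle_trans; [| apply H; lia]. apply Rmult_le_compat_r; [apply pow2_ge_0 | apply Rmin_l].
  - assert (hl : 2 * Q <= INR (S l)).
    { apply le_INR in h. rewrite S_INR in *. lra. }
    rewrite Rabs_pos_eq by nra.
    apply Rle_trans with (/ 2 * INR (S l) ^ 2); [| nra].
    apply Rmult_le_compat_r; [apply pow2_ge_0 | apply Rmin_r].
Qed.

Section Final.

Variables (nu : C) (q : nat) (chi : nat -> C) (L : C -> C) (x : R).
Hypothesis hchi : is_dirichlet_char q chi.
Hypothesis hnonprinc : ~ is_principal q chi.
Hypothesis heven : is_even_char q chi.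
Hypothesis hprim : is_primitive q chi.
Hypothesis hL : is_L_function chi L.
Hypothesis hnu : 0 <= Re nu.
Hypothesis hx : 0 < x.
Hypothesis hqx : forall m, (1 <= m)%nat -> INR q * x <> INR m.

Let Q : R := INR q * x.
Let tau : C := twisted_sum q chi 1.

Definition diff_quotient (n : C) (l : nat) : C :=
  ((cpow (INR l) n - cpow Q n) / RtoC (INR l ^ 2 - Q ^ 2))%C.

Lemma final_Q_pos : 0 < Q.
Proof. apply Rmult_lt_0_compat; [apply (theta_q_pos q chi hchi) | exact hx]. Qed.

Lemma final_gap (l : nat) : INR (S l) ^ 2 - Q ^ 2 <> 0.
Proof.
  intros e. pose proof (INR_S_pos l). pose proof final_Q_pos. apply (hqx (S l)); [lia |]. fold Q. nra.
Qed.

(** The numerator is O(l^m) with m = max(Re n, 0) < 1 and the denominator is at least c l^2 in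
    modulus, so p = 2 - m > 1. *)
Lemma Cmod_diff_quotient (n : C) : Re n < 1 -> exists K p, 0 <= K /\ 1 < p /\
  forall l, Cmod (diff_quotient n (S l)) <= K * Rpower (INR (S l)) (- p).
Proof.
  intros hn. pose proof final_Q_pos as hQ.
  destruct (square_gap Q hQ hqx) as (c & hc & H).
  set (m := Rmax (Re n) 0).
  assert (hm : Re n <= m /\ 0 <= m /\ m < 1).
  { unfold m. pose proof (Rmax_l (Re n) 0). pose proof (Rmax_r (Re n) 0). repeat split; auto.
    apply Rmax_lub_lt; lra. }
  pose proof (Rpower_pos Q (Re n)) as hQn.
  exists ((1 + Rpower Q (Re n)) / c), (2 - m).
  split; [apply Rlt_le, Rdiv_lt_0_compat; lra |]. split; [lra |]. intros l.
  pose proof (INR_S_pos l) as hl. pose proof (INR_S_ge_1 l) as hl1.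
  assert (hd : RtoC (INR (S l) ^ 2 - Q ^ 2) <> RtoC 0) by (apply RtoC_neq_0, final_gap).
  unfold diff_quotient. rewrite Cmod_div by exact hd. rewrite Cmod_R.
  assert (hl2 : 0 < INR (S l) ^ 2) by now apply pow_lt.
  assert (hcl : 0 < c * INR (S l) ^ 2) by now apply Rmult_lt_0_compat.
  assert (hnum : Cmod (cpow (INR (S l)) n - cpow Q n)%C <= (1 + Rpower Q (Re n)) * Rpower (INR (S l)) m).
  { unfold Cminus. eapply Rle_trans; [apply Cmod_triangle |]. rewrite Cmod_opp, !Cmod_cpow by assumption.
    assert (h1 : Rpower (INR (S l)) (Re n) <= Rpower (INR (S l)) m) by (apply Rpower_le_exponent; lra).
    assert (h2 : 1 <= Rpower (INR (S l)) m).
    { rewrite <- (Rpower_O (INR (S l))) by assumption. apply Rpower_le_exponent; lra. }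
    nra. }
  apply Rle_trans with ((1 + Rpower Q (Re n)) * Rpower (INR (S l)) m * / (c * INR (S l) ^ 2)).
  - apply Rmult_le_compat; [apply Cmod_ge_0 | apply Rlt_le, Rinv_0_lt_compat, Rabs_pos_lt, final_gap | exact hnum |].
    apply Rinv_le_contravar; auto.
  - right. replace (- (2 - m)) with (m + - (2)) by ring. rewrite Rpower_plus, Rpower_INR_S_neg2.
    field. lra.
Qed.

Let bar_term (n : C) (d e : nat) : C := (cpow (INR d) (- nu) * chi e * diff_quotient n (d * e))%C.

Lemma Cmod_cpow_neg_le (d : nat) : Cmod (cpow (INR (S d)) (- nu)) <= 1.
Proof.
  rewrite Cmod_cpow by apply INR_S_pos. rewrite <- (Rpower_O (INR (S d))) by apply INR_S_pos.
  apply Rpower_le_exponent; [apply INR_S_ge_1 |]. simpl. fold (Re nu). lra.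
Qed.

(** The bound at d e is a product of a power of d and a power of e, so the double series is
    absolutely convergent and may be summed by rows or by divisors. *)
Lemma sigmabar_series (n : C) : Re n < 1 -> exists A S2,
  (forall i, Cser (fun j => bar_term n (S i) (S j)) (A i)) /\ Cser A S2 /\
  Cser (fun k => sigmabar_chi (- nu) chi (S k) * diff_quotient n (S k))%C S2.
Proof.
  intros hn. destruct (Cmod_diff_quotient n hn) as (K & p & hK & hp & H).
  destruct (p_series p hp) as (s & hs).
  assert (hb : forall i j, Cmod (bar_term n (S i) (S j))
             <= K * Rpower (INR (S i)) (- p) * Rpower (INR (S j)) (- p)).
  { intros i j. unfold bar_term. rewrite !Cmod_mult.
    pose proof (Cmod_cpow_neg_le i) as h1. pose proof (Cmod_char_le q chi hchi (S j)) as h2.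
    pose proof (Cmod_ge_0 (cpow (INR (S i)) (- nu))) as h3. pose proof (Cmod_ge_0 (chi (S j))) as h4.
    assert (e : S (j + i * S j) = (S i * S j)%nat) by lia.
    specialize (H (j + i * S j)%nat). rewrite e in H.
    rewrite mult_INR, <- Rpower_mult_distr in H by apply INR_S_pos.
    pose proof (Cmod_ge_0 (diff_quotient n (S i * S j))) as h5.
    apply Rle_trans with (1 * 1 * (K * (Rpower (INR (S i)) (- p) * Rpower (INR (S j)) (- p)))); [| right; ring].
    apply Rmult_le_compat; auto; [now apply Rmult_le_pos | now apply Rmult_le_compat]. }
  destruct (choice (fun i A => Cser (fun j => bar_term n (S i) (S j)) A)) as [A hA].
  { intros i. apply (Cser_dominated _ (fun j => K * Rpower (INR (S i)) (- p) * Rpower (INR (S j)) (- p))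
                       (K * Rpower (INR (S i)) (- p) * s)); [apply hb |].
    apply rsum_scal; [| exact hs]. apply Rmult_le_pos; [exact hK | apply exp_ge_0]. }
  destruct (dirichlet_rearrangement (bar_term n) (fun i => K * Rpower (INR (S i)) (- p))
              (fun j => Rpower (INR (S j)) (- p)) (K * s) s A) as (T & hT & hT'); auto.
  { now apply rsum_scal. }
  exists A, T. split; [exact hA | split; [exact hT |]].
  eapply Cser_ext; [| exact hT']. intros k. cbv beta. unfold sigmabar_chi.
  rewrite Cmult_comm, <- divsum_scal. apply divsum_ext. intros d m hd e.
  unfold bar_term. assert (em : (S k / d)%nat = m) by (rewrite e, Nat.mul_comm; apply Nat.div_mul; lia).
  rewrite em, <- e. ring.
Qed.

(** The Dirichlet series of the divisor function factors: at w = 2(N + 1) - nu it is zeta(w + nu)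
    L(w, chi), and the hypothesis says Re w > 1. *)
Lemma sigmabar_dirichlet (N : nat) : 1 < 2 * INR (S N) - Re nu ->
  Cser (fun k => sigmabar_chi (- nu) chi (S k) * cpow (INR (S k)) (nu - RtoC (2 * INR (S N))))%C
    (RtoC (zetaR (2 * INR (S N))) * L (RtoC (2 * INR (S N)) - nu))%C.
Proof.
  intros hN. pose proof (INR_S_ge_1 N) as hN1.
  set (z := (RtoC (2 * INR (S N)) - nu)%C). assert (hz : 1 < Re z) by exact hN.
  set (a := fun d e : nat => (cpow (INR d) (- nu) * chi e * cpow (INR (d * e)) (nu - RtoC (2 * INR (S N))))%C).
  assert (ha : forall i j, a (S i) (S j) =
     (RtoC (/ INR (S i) ^ (2 * S N)) * (chi (S j) * cpow (INR (S j)) (- z)))%C).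
  { intros i j. unfold a, z. pose proof (INR_S_pos i) as hi. pose proof (INR_S_pos j) as hj.
    rewrite mult_INR, cpow_mult_base by assumption.
    replace (RtoC (/ INR (S i) ^ (2 * S N))) with (cpow (INR (S i)) (- nu + (nu - RtoC (2 * INR (S N))))).
    - rewrite cpow_plus. replace (- (RtoC (2 * INR (S N)) - nu))%C with (nu - RtoC (2 * INR (S N)))%C by ring. ring.
    - rewrite <- cpow_Rinv_pow by assumption. f_equal. rewrite mult_INR. change (INR 2) with 2. ring. }
  destruct (p_series 2 ltac:(lra)) as (s & hs).
  destruct (p_series (Re z) hz) as (s' & hs').
  destruct (dirichlet_rearrangement a (fun i => Rpower (INR (S i)) (- (2))) (fun j => Rpower (INR (S j)) (- Re z)) s s'
              (fun i => RtoC (/ INR (S i) ^ (2 * S N)) * L z)%C) as (T & hT & hT'); auto.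
  - intros i j. rewrite ha, !Cmod_mult. pose proof (INR_S_pos i) as hi.
    assert (hip : 0 < / INR (S i) ^ (2 * S N)) by (apply Rinv_0_lt_compat, pow_lt, hi).
    rewrite Cmod_RtoC_pos, (Cmod_cpow (INR (S j))) by (try apply INR_S_pos; lra).
    assert (h1 : / INR (S i) ^ (2 * S N) <= Rpower (INR (S i)) (- (2))).
    { rewrite <- Rpower_pow, <- Rpower_Ropp by assumption. apply Rpower_le_exponent; [apply INR_S_ge_1 |].
      apply Ropp_le_contravar. apply (le_INR 2). lia. }
    pose proof (Cmod_char_le q chi hchi (S j)) as h2. pose proof (Cmod_ge_0 (chi (S j))) as h3.
    pose proof (Rpower_pos (INR (S j)) (Re (- z))) as h4.
    replace (- Re z) with (Re (- z)) by reflexivity.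
    apply Rmult_le_compat; auto; try lra; [apply Rmult_le_pos; lra | nra].
  - intros i. eapply Cser_ext; [| apply Cser_scal].
    + intros j. cbv beta. symmetry. apply ha.
    + apply is_series_Cser. now apply hL.
  - assert (hzz := Cser_scal (L z) _ _ (zetaR_Cser N)).
    assert (hT2 : Cser (fun i => RtoC (/ INR (S i) ^ (2 * S N)) * L z)%C (L z * RtoC (zetaR (2 * INR (S N))))%C).
    { eapply Cser_ext; [| exact hzz]. intros i. cbv beta. ring. }
    rewrite Cmult_comm. rewrite <- (Cser_unique _ _ _ hT hT2).
    eapply Cser_ext; [| exact hT']. intros k. cbv beta. unfold sigmabar_chi.
    rewrite (Cmult_comm (divsum _ _)), <- divsum_scal. apply divsum_ext. intros d m hd e.
    unfold a. assert (em : (S k / d)%nat = m) by (rewrite e, Nat.mul_comm; apply Nat.div_mul; lia).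
    rewrite em, <- e. ring.
Qed.

Let expo (N : nat) : C := (nu - RtoC (2 * INR N))%C.

(** The expression in braces of the identity; the index j here is one less than there. *)
Definition bracket (N : nat) (S2 : C) : C :=
  (psum (fun j => RtoC (zetaR (2 * INR (S j))) * L (RtoC (2 * INR (S j)) - nu) * RtoC (Q ^ (2 * j + 1))) N
   + RtoC (Q ^ (2 * N + 1)) * S2)%C.

(** With n = nu - 2N, the quotient for N minus Q^2 times the quotient for N + 1 is exactly k^(n -
    2). The two series thus differ by a Dirichlet series, which is the next zeta-L term. *)
Lemma bracket_succ (N : nat) (S2 S2' : C) : Re nu < 2 * INR N + 1 ->
  Cser (fun k => sigmabar_chi (- nu) chi (S k) * diff_quotient (expo N) (S k))%C S2 ->
  Cser (fun k => sigmabar_chi (- nu) chi (S k) * diff_quotient (expo (S N)) (S k))%C S2' ->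
  bracket N S2 = bracket (S N) S2'.
Proof.
  intros hN h h'. pose proof final_Q_pos as hQ.
  assert (hd := sigmabar_dirichlet N ltac:(rewrite S_INR; lra)).
  assert (hdiff := Cser_minus _ _ _ _ h (Cser_scal (RtoC (Q ^ 2)) _ _ h')).
  assert (e : (S2 - RtoC (Q ^ 2) * S2')%C = (RtoC (zetaR (2 * INR (S N))) * L (RtoC (2 * INR (S N)) - nu))%C).
  { apply (Cser_unique _ _ _ hdiff). eapply Cser_ext; [| exact hd]. intros k. cbv beta.
    unfold diff_quotient, expo. pose proof (INR_S_pos k) as hk.
    assert (hg : RtoC (INR (S k) ^ 2 - Q ^ 2) <> RtoC 0) by (apply RtoC_neq_0, final_gap).
    assert (shift : forall a, 0 < a -> cpow a (nu - RtoC (2 * INR N)) = (RtoC (a ^ 2) * cpow a (nu - RtoC (2 * INR (S N))))%C).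
    { intros a ha. rewrite <- (cpow_INR a 2 ha), <- cpow_plus. f_equal. change (INR 2) with 2.
      rewrite (S_INR N), !RtoC_mult, RtoC_plus. ring. }
    rewrite (shift (INR (S k))), (shift Q) by assumption.
    set (u := cpow (INR (S k)) (nu - RtoC (2 * INR (S N)))). set (v := cpow Q (nu - RtoC (2 * INR (S N)))).
    rewrite RtoC_minus in *. field. exact hg. }
  unfold bracket. cbn [psum].
  replace S2 with (RtoC (Q ^ 2) * S2' + (S2 - RtoC (Q ^ 2) * S2'))%C by ring. rewrite e.
  replace (RtoC (Q ^ (2 * S N + 1))) with (RtoC (Q ^ (2 * N + 1)) * RtoC (Q ^ 2))%C.
  - ring.
  - rewrite <- RtoC_mult, <- pow_add. do 2 f_equal. lia.
Qed.

(** * The identity for the Planck integral, multiplied by the sine *)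

Lemma Csin_shift_N (z : C) (N : nat) : Csin z = (RtoC ((-1) ^ N) * Csin (z - RtoC (INR N * PI)))%C.
Proof.
  induction N as [|N IH].
  - simpl. rewrite Rmult_0_l. replace (z - 0)%C with z by ring. ring.
  - rewrite IH, S_INR.
    replace (z - RtoC (INR N * PI))%C with (z - RtoC ((INR N + 1) * PI) + RtoC PI)%C
      by (rewrite !RtoC_mult, RtoC_plus; ring).
    rewrite Csin_shift_PI. simpl. rewrite (RtoC_mult (-1)). replace (RtoC (-1)) with (- (1))%C by (apply C_ext; simpl; ring). ring.
Qed.

Let sn : C := Csin (RtoC PI * nu / 2).

(** The contribution of m = S i. The N main terms come from [mellin_functional] at s = nu - 1 - 2j,
    the remainder from [two_lorentzian_integral] at n = nu - 2N. In each case the sine of the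
    formula is sin(pi nu / 2) up to a sign that cancels the sign of the expansion. *)
Lemma planck_term (N i : nat) (A : C) : 2 * INR N - 1 <= Re nu < 2 * INR N + 1 ->
  Cser (fun j => bar_term (expo N) (S i) (S j)) A ->
  (sn * (RtoC (x / (PI * INR (S i) ^ 2)) * IR (fun t => theta q chi (exp t) * lor (nu + 1) (x / INR (S i)) t)%C))%C
  = (tau / (2 * RtoC PI * RtoC (INR q)) * cpow (INR q) (1 - nu) *
     (psum (fun j => RtoC (Q ^ (2 * j + 1)) * L (RtoC (2 * INR (S j)) - nu) * RtoC (/ INR (S i) ^ (2 * S j))) N
      + RtoC (Q ^ (2 * N + 1)) * A))%C.
Proof.
  intros hN hA. assert (hpi : 0 < PI) by apply PI_RGT_0. pose proof (theta_q_pos q chi hchi) as hq.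
  pose proof (INR_S_pos i) as hm. set (m := INR (S i)) in *. set (B := x / m).
  assert (hB : 0 < B) by now apply Rdiv_lt_0_compat.
  set (n := expo N).
  assert (hn : -1 <= Re n < 1) by (unfold n, expo; simpl; fold (Re nu); lra).
  assert (hqC : RtoC (INR q) <> RtoC 0) by (apply RtoC_neq_0; lra).
  assert (hpC : RtoC PI <> RtoC 0) by (apply RtoC_neq_0; lra).
  assert (hmC : RtoC m <> RtoC 0) by (apply RtoC_neq_0; lra).
  (* k/q = x/m would make q x = m k a positive integer. *)
  assert (hne : forall k, (INR (S k) / INR q) ^ 2 <> B ^ 2).
  { intros k e. pose proof (INR_S_pos k) as hk.
    assert (e1 : INR (S k) / INR q = B).
    { apply (Rsqr_inj (INR (S k) / INR q) B).
      - apply Rlt_le, Rdiv_lt_0_compat; lra.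
      - lra.
      - rewrite !Rsqr_pow2. exact e. }
    apply (hqx (S i * S k)%nat); [lia |]. rewrite mult_INR. fold m.
    unfold B in e1. replace x with (x / m * m) by (field; lra). rewrite <- e1. field. lra. }
  assert (hre1 : -1 < Re (nu + 1) - 2 * INR N) by (change (-1 < Re nu + 1 - 2 * INR N); lra).
  rewrite (theta_lor_expansion q chi hchi hnonprinc heven hprim N (nu + 1) B hre1 hB).
  replace (nu + 1 - RtoC (2 * INR N))%C with (n + 1)%C by (unfold n, expo; ring).
  assert (hrem : (Csin (RtoC PI * n / 2) * IR (fun t => theta q chi (exp t) * lor (n + 1) B t))%C
     = (tau / (2 * RtoC (INR q)) * cpow (INR q) (2 - n) * RtoC (m ^ (2 * S N)) * A)%C).
  { destruct (theta_two_lorentzian q chi hchi hnonprinc heven hprim n B hn hB hne) as (_ & _ & _ & hser).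
    apply (Cser_scal (Csin (RtoC PI * n / 2))) in hser.
    apply (Cser_unique _ _ _ hser).
    eapply Cser_ext; [| apply Cser_scal, hA]. intros k. cbv beta. fold tau.
    pose proof (INR_S_pos k) as hk.
    assert (h2 := two_lorentzian_integral (INR (S k) / INR q) B n ltac:(now apply Rdiv_lt_0_compat) hB (hne k) ltac:(lra)).
    replace (Csin (RtoC PI * n / 2) * (tau / (RtoC PI * RtoC (INR q)) * chi (S k) * IR (lor2 (INR (S k) / INR q) B n)))%C
      with (tau / (RtoC PI * RtoC (INR q)) * chi (S k) * (Csin (RtoC PI * n / 2) * IR (lor2 (INR (S k) / INR q) B n)))%C by ring.
    rewrite h2. unfold bar_term, diff_quotient. fold n. fold m.
    pose proof final_Q_pos as hQ.
    assert (hg : RtoC ((m * INR (S k)) ^ 2 - Q ^ 2) <> RtoC 0).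
    { apply RtoC_neq_0. unfold m. rewrite <- mult_INR. replace (S i * S k)%nat with (S (k + i * S k)) by lia. apply final_gap. }
    rewrite mult_INR. fold m.
    (* Scaling by q m turns the widths k/q and x/m into m k and Q, the two entries of
       [diff_quotient]. *)
    assert (eA : cpow (INR (S k) / INR q) n = (cpow (m * INR (S k)) n / (cpow (INR q) n * cpow m n))%C).
    { unfold Rdiv. rewrite !cpow_mult_base, cpow_inv_base by (auto; now apply Rinv_0_lt_compat).
      field. split; apply cpow_neq_0. }
    assert (eB : cpow B n = (cpow Q n / (cpow (INR q) n * cpow m n))%C).
    { unfold B, Q, Rdiv. rewrite !cpow_mult_base, cpow_inv_base by (auto; now apply Rinv_0_lt_compat).
      field. split; apply cpow_neq_0. }
    rewrite eA, eB.
    replace ((INR (S k) / INR q) ^ 2 - B ^ 2) with (((m * INR (S k)) ^ 2 - Q ^ 2) * / (INR q ^ 2 * m ^ 2))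
      by (unfold B, Q; field; lra).
    rewrite RtoC_mult, RtoC_inv, (RtoC_mult (INR q ^ 2)) by (apply Rmult_integral_contrapositive_currified; apply pow_nonzero; lra).
    replace (2 - n)%C with (RtoC (INR 2) - n)%C by reflexivity. rewrite cpow_minus, cpow_INR by assumption.
    replace (cpow m (- nu)) with (/ (cpow m n * RtoC (m ^ (2 * N))))%C.
    2:{ rewrite <- cpow_INR, <- cpow_plus, <- cpow_opp by assumption. f_equal. unfold n, expo. rewrite mult_INR.
        change (INR 2) with 2. ring. }
    replace (m ^ (2 * S N)) with (m ^ (2 * N) * m ^ 2) by (rewrite <- pow_add; f_equal; lia).
    rewrite RtoC_mult, (RtoC_div PI) by lra.
    assert (hm2N : RtoC (m ^ (2 * N)) <> RtoC 0) by (apply RtoC_neq_0, pow_nonzero; lra).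
    assert (hm2 : RtoC (m ^ 2) <> RtoC 0) by (apply RtoC_neq_0, pow_nonzero; lra).
    assert (hq2 : RtoC (INR q ^ 2) <> RtoC 0) by (apply RtoC_neq_0, pow_nonzero; lra).
    field. repeat split; auto; apply cpow_neq_0. }
  assert (hsnN : sn = (RtoC ((-1) ^ N) * Csin (RtoC PI * n / 2))%C).
  { unfold sn. rewrite (Csin_shift_N _ N). do 2 f_equal. unfold n, expo. rewrite !RtoC_mult. field. }
  assert (hsq : forall j, (RtoC ((-1) ^ j) * RtoC ((-1) ^ j))%C = RtoC 1).
  { intros j. rewrite <- RtoC_mult, <- Rpow_mult_distr. replace (-1 * -1) with 1 by ring. now rewrite pow1. }
  rewrite !Cmult_plus_distr_l. f_equal.
  - rewrite <- !psum_scal. apply psum_ext. intros j hj.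
    set (s := (nu + 1 - 2 - RtoC (2 * INR j))%C).
    assert (hjN : INR j + 1 <= INR N) by (rewrite <- S_INR; apply le_INR; lia).
    assert (hf := mellin_functional q chi L hchi hnonprinc heven hprim hL s ltac:(unfold s; simpl; fold (Re nu); lra)).
    fold tau in hf.
    assert (hsnj : sn = (RtoC ((-1) ^ j) * Csin (RtoC PI * (s + 1) / 2))%C).
    { unfold sn. rewrite (Csin_shift_N _ j). do 2 f_equal. unfold s. rewrite !RtoC_mult. field. }
    rewrite hsnj, RtoC_mult.
    match goal with |- ?lhs = _ =>
      replace lhs with (RtoC (x / (PI * m ^ 2)) * RtoC (B ^ (2 * j)) * (RtoC ((-1) ^ j) * RtoC ((-1) ^ j))
          * (Csin (RtoC PI * (s + 1) / 2) * mellin q chi s))%C by ring end.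
    rewrite hsq, hf.
    replace (1 - s)%C with (RtoC (2 * INR (S j)) - nu)%C by (unfold s; rewrite S_INR, !RtoC_mult, RtoC_plus; ring).
    replace (cpow (INR q) (RtoC (2 * INR (S j)) - nu)) with (cpow (INR q) (1 - nu) * RtoC (INR q ^ (2 * j + 1)))%C.
    2:{ rewrite <- cpow_INR, <- cpow_plus by assumption. f_equal.
        rewrite plus_INR, mult_INR, (S_INR j). change (INR 2) with 2. change (INR 1) with 1.
        rewrite !RtoC_mult, !RtoC_plus, RtoC_mult. ring. }
    replace (RtoC (Q ^ (2 * j + 1))) with (RtoC (INR q ^ (2 * j + 1)) * RtoC (x ^ (2 * j + 1)))%C
      by (unfold Q; rewrite Rpow_mult_distr, RtoC_mult; reflexivity).
    replace (RtoC (x / (PI * m ^ 2)) * RtoC (B ^ (2 * j)))%C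
      with (RtoC (x ^ (2 * j + 1)) * RtoC (/ m ^ (2 * S j)) / RtoC PI)%C.
    + field. auto.
    + unfold Cdiv. rewrite <- RtoC_inv, <- !RtoC_mult by lra. f_equal. unfold B.
      replace (2 * S j)%nat with (2 * j + 2)%nat by lia. rewrite !pow_add, pow_Rdiv.
      field. repeat split; try lra; apply pow_nonzero; lra.
  - rewrite hsnN, (RtoC_mult ((-1) ^ N)).
    match goal with |- ?lhs = _ =>
      replace lhs with (RtoC (x / (PI * m ^ 2)) * RtoC (B ^ (2 * N)) * (RtoC ((-1) ^ N) * RtoC ((-1) ^ N))
          * (Csin (RtoC PI * n / 2) * IR (fun t => theta q chi (exp t) * lor (n + 1) B t)))%C by ring end.
    rewrite hsq, hrem.
    replace (cpow (INR q) (2 - n)) with (cpow (INR q) (1 - nu) * RtoC (INR q ^ (2 * N + 1)))%C.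
    2:{ rewrite <- cpow_INR, <- cpow_plus by assumption. f_equal. unfold n, expo.
        rewrite plus_INR, mult_INR. change (INR 2) with 2. change (INR 1) with 1.
        rewrite !RtoC_plus, !RtoC_mult. ring. }
    replace (RtoC (Q ^ (2 * N + 1))) with (RtoC (INR q ^ (2 * N + 1)) * RtoC (x ^ (2 * N + 1)))%C
      by (unfold Q; rewrite Rpow_mult_distr, RtoC_mult; reflexivity).
    replace (RtoC (x / (PI * m ^ 2)) * RtoC (B ^ (2 * N)))%C
      with (RtoC (x ^ (2 * N + 1)) * / RtoC (m ^ (2 * S N)) / RtoC PI)%C.
    + field. repeat split; auto. apply RtoC_neq_0, pow_nonzero; lra.
    + unfold Cdiv. rewrite <- !RtoC_inv, <- !RtoC_mult by (try apply pow_nonzero; lra). f_equal. unfold B.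
      replace (2 * S N)%nat with (2 * N + 2)%nat by lia. rewrite !pow_add, pow_Rdiv.
      field. repeat split; try lra; apply pow_nonzero; lra.
Qed.

(** Summation of [planck_term] over m: the factors 1 / m^(2j) add up to zeta(2j), and the rows of
    the double series to the divisor series. *)
Theorem planck_identity (N : nat) (S2 : C) : 2 * INR N - 1 <= Re nu < 2 * INR N + 1 ->
  Cser (fun k => sigmabar_chi (- nu) chi (S k) * diff_quotient (expo N) (S k))%C S2 ->
  (sn * (IR (planck_integrand q chi nu x) + / 2 * mellin q chi nu
         - RtoC (/ (2 * PI * x)) * mellin q chi (nu + 1)))%C
  = (tau / (2 * RtoC PI * RtoC (INR q)) * cpow (INR q) (1 - nu) * bracket N S2)%C.
Proof.
  intros hN hS2.
  destruct (sigmabar_series (expo N)) as (A & T & hA & hT & hT').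
  { unfold expo. simpl. fold (Re nu). lra. }
  pose proof (Cser_unique _ _ _ hT' hS2) as ->.
  assert (h := Cser_scal sn _ _ (planck_expansion q chi nu x hchi hnonprinc heven hprim hnu hx)).
  apply (Cser_unique _ _ _ h).
  eapply Cser_ext; [intros i; symmetry; exact (planck_term N i (A i) hN (hA i)) |].
  apply Cser_scal. unfold bracket. apply Cser_plus; [| now apply Cser_scal].
  apply (Cser_psum (fun j i => RtoC (Q ^ (2 * j + 1)) * L (RtoC (2 * INR (S j)) - nu) * RtoC (/ INR (S i) ^ (2 * S j)))%C).
  intros j _.
  replace (RtoC (zetaR (2 * INR (S j))) * L (RtoC (2 * INR (S j)) - nu) * RtoC (Q ^ (2 * j + 1)))%C
    with (RtoC (Q ^ (2 * j + 1)) * L (RtoC (2 * INR (S j)) - nu) * RtoC (zetaR (2 * INR (S j))))%C by ring.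
  apply Cser_scal, zetaR_Cser.
Qed.

(** The left-hand side does not involve N, and by [bracket_succ] the bracket keeps its value from
    the order [N0] upwards. *)
Lemma planck_identity_ge (N0 N : nat) (S2 : C) : 2 * INR N0 - 1 <= Re nu < 2 * INR N0 + 1 -> (N0 <= N)%nat ->
  Cser (fun k => sigmabar_chi (- nu) chi (S k) * diff_quotient (expo N) (S k))%C S2 ->
  (sn * (IR (planck_integrand q chi nu x) + / 2 * mellin q chi nu
         - RtoC (/ (2 * PI * x)) * mellin q chi (nu + 1)))%C
  = (tau / (2 * RtoC PI * RtoC (INR q)) * cpow (INR q) (1 - nu) * bracket N S2)%C.
Proof.
  intros hN0 hle. revert S2. induction hle as [|N hle IH]; intros S2 h; [now apply planck_identity |].
  assert (hN : INR N0 <= INR N) by now apply le_INR.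
  destruct (sigmabar_series (expo N)) as (A & T & _ & _ & hT).
  { unfold expo. simpl. fold (Re nu). lra. }
  rewrite (IH T hT). f_equal. apply bracket_succ; auto. lra.
Qed.

End Final.

(** * Nonvanishing of the sine and assembly of the identity *)

(** A zero would give e^(i pi nu) = 1: the modulus forces nu to be real, and the imaginary part
    gives sin(pi nu) = 0, so nu would be an integer. *)
Lemma Csin_neq_0 (nu : C) : (forall k : Z, nu <> RtoC (IZR k)) -> Csin (RtoC PI * nu / 2) <> RtoC 0.
Proof.
  intros hk e. assert (hpi : 0 < PI) by apply PI_RGT_0.
  pose proof (Csin_alt (RtoC PI * nu / 2)) as h. rewrite e, Cmult_0_r in h. apply Ceq_minus in h.
  set (w := (Ci * (RtoC PI * nu / 2))%C) in *.
  assert (h1 : Cexp (w + w) = RtoC 1).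
  { rewrite Cexp_plus. rewrite h at 1. rewrite Cexp_opp. field. apply Cexp_neq_0. }
  replace (w + w)%C with (Ci * (RtoC PI * nu))%C in h1 by (unfold w; field).
  assert (hm := f_equal Cmod h1). rewrite Cmod_Cexp, Cmod_1 in hm.
  assert (him : Re (Ci * (RtoC PI * nu)) = 0) by (apply exp_inv; rewrite exp_0; exact hm).
  assert (hs := f_equal snd h1). unfold Cexp in hs. cbn [snd RtoC] in hs. rewrite hm, Rmult_1_l in hs.
  destruct nu as [a b]. simpl in him, hs.
  replace (0 * (PI * b + 0 * a) + 1 * (PI * a - 0 * b)) with (PI * a) in hs by ring.
  apply sin_eq_0_0 in hs. destruct hs as [k hs].
  apply (hk k). apply C_ext; simpl.
  - apply (Rmult_eq_reg_l PI); [| lra]. lra.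
  - apply (Rmult_eq_reg_l PI); [| lra]. lra.
Qed.

Theorem theorem3p1
  (nu : C) (q : nat) (chi : nat -> C) (Lchi Lchibar : C -> C) (N : Z) (x : R)
  (hnu_nonint : forall k : Z, nu <> RtoC (IZR k))
  (hnu_re : 0 <= Re nu)
  (hchi : is_dirichlet_char q chi)
  (hnonprinc : ~ is_principal q chi)
  (heven : is_even_char q chi)
  (hprim : is_primitive q chi)
  (hL : is_L_function chi Lchi)
  (hLbar : is_L_function (conj_char chi) Lchibar)
  (hN : (Int_part ((Re nu + 1) / 2) <= N)%Z)
  (hx : 0 < x)
  (hqx : forall m : nat, (1 <= m)%nat -> INR q * x <> INR m) :
  let a := fun n : nat =>
    (sigma_chi (- nu) (conj_char chi) (S n) * cpow (INR (S n)) (nu / 2)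
       * BesselK nu (4 * PI * sqrt (INR (S n) * x)))%C in
  let b := fun n : nat =>
    (sigmabar_chi (- nu) chi (S n)
       * ((cpow (INR (S n)) (nu - RtoC (2 * IZR N))
           - cpow (INR q * x) (nu - RtoC (2 * IZR N)))
          / RtoC (INR (S n) ^ 2 - (INR q * x) ^ 2)))%C in
  ex_series (K := C_AbsRing) (V := C_NormedModule) a /\
  ex_series (K := C_AbsRing) (V := C_NormedModule) b /\
  forall S1 S2 : C,
    is_series (K := C_AbsRing) (V := C_NormedModule) a S1 ->
    is_series (K := C_AbsRing) (V := C_NormedModule) b S2 ->
    (RtoC (8 * PI) * cpow x (nu / 2) * S1
     = - (CGamma nu * Lchibar nu / cpow (2 * PI) (nu - 1))
       + RtoC 2 * CGamma (1 + nu) * Lchibar (1 + nu) / cpow (2 * PI) (nu + 1)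
           * RtoC (/ x)
       + RtoC 2 * cpow (INR q) (1 - nu) / (gauss_sum q chi * Csin (RtoC PI * nu / 2))
         * (Csum (seq 1 (Z.to_nat N))
              (fun j => RtoC (zetaR (2 * INR j)) * Lchi (RtoC (2 * INR j) - nu)
                        * RtoC ((INR q * x) ^ (2 * j - 1)))
            + RtoC ((INR q * x) ^ (2 * Z.to_nat N + 1)) * S2))%C.
Proof.
  intros a b. assert (hpi : 0 < PI) by apply PI_RGT_0.
  pose proof (base_Int_part ((Re nu + 1) / 2)) as [hI1 hI2].
  set (I := Int_part ((Re nu + 1) / 2)) in *.
  (* As Re nu >= 0, the floor is nonnegative; so is N, and [Z.to_nat] loses nothing. *)
  assert (hI0 : (0 <= I)%Z).
  { apply Z.lt_succ_r. apply lt_IZR. rewrite succ_IZR. lra. }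
  set (N0 := Z.to_nat I). set (k := Z.to_nat N).
  assert (hIN : IZR I = INR N0) by (unfold N0; rewrite INR_IZR_INZ, Z2Nat.id; auto).
  assert (hNk : IZR N = INR k) by (unfold k; rewrite INR_IZR_INZ, Z2Nat.id; auto; lia).
  assert (hN0k : (N0 <= k)%nat) by (unfold N0, k; lia).
  (* The floor of (Re nu + 1)/2 singles out exactly the order at which the integral argument
     applies. *)
  assert (hN0 : 2 * INR N0 - 1 <= Re nu < 2 * INR N0 + 1) by lra.
  assert (hkk : INR N0 <= INR k) by now apply le_INR.
  pose proof (theta_q_pos q chi hchi) as hq.
  destruct (bessel_series_integral q chi nu x hchi hnonprinc hnu_re hx) as (S1' & hS1' & e1).
  assert (hb : forall n, b n = (sigmabar_chi (- nu) chi (S n)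
                 * diff_quotient q x (nu - RtoC (2 * INR k)) (S n))%C).
  { intros n. unfold b, diff_quotient. now rewrite hNk. }
  split; [exists S1'; now apply is_series_Cser | split].
  - destruct (sigmabar_series nu q chi x hchi hnu_re hx hqx (nu - RtoC (2 * INR k))) as (_ & T & _ & _ & hT).
    { change (Re nu - 2 * INR k < 1). lra. }
    exists T. apply is_series_Cser. eapply Cser_ext; [| exact hT]. intros n. symmetry. apply hb.
  - intros S1 S2 h1 h2. apply is_series_Cser in h1, h2.
    rewrite (Cser_unique _ _ _ h1 hS1'), e1.
    assert (h2' := Cser_ext _ _ _ hb h2).
    pose proof (planck_identity_ge nu q chi Lchi x hchi hnonprinc heven hprim hL hnu_re hx hqx
                  N0 k S2 hN0 hN0k h2') as key.
    assert (hbr : bracket nu q Lchi x k S2 =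
      (Csum (seq 1 k) (fun j => RtoC (zetaR (2 * INR j)) * Lchi (RtoC (2 * INR j) - nu)
                        * RtoC ((INR q * x) ^ (2 * j - 1)))
       + RtoC ((INR q * x) ^ (2 * k + 1)) * S2)%C).
    { unfold bracket. f_equal. rewrite Csum_seq. apply psum_ext. intros j _.
      change (1 + j)%nat with (S j). do 3 f_equal. lia. }
    rewrite <- hbr. set (Br := bracket nu q Lchi x k S2) in *.
    pose proof (Csin_neq_0 nu hnu_nonint) as hsn. set (sn := Csin (RtoC PI * nu / 2)) in *.
    pose proof (twisted_sum_gauss_sum q chi hchi hprim heven hnonprinc) as htau.
    set (tau := twisted_sum q chi 1) in *. set (g := gauss_sum q chi) in *.
    assert (hqC : RtoC (INR q) <> RtoC 0) by (apply RtoC_neq_0; lra).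
    assert (hpC : RtoC PI <> RtoC 0) by (apply RtoC_neq_0; lra).
    assert (hxC : RtoC x <> RtoC 0) by (apply RtoC_neq_0; lra).
    assert (hg : g <> RtoC 0).
    { intros e. apply hqC. rewrite <- htau, e. ring. }
    assert (hnu0 : nu <> RtoC 0) by apply (hnu_nonint 0%Z).
    assert (hnu1 : (nu + 1)%C <> RtoC 0).
    { intros e. apply (f_equal Re) in e. change (Re nu + 1 = 0) in e. lra. }
    assert (m0 := mellin_gamma q chi Lchibar hchi hnonprinc heven hprim hLbar nu ltac:(lra)).
    assert (m1 := mellin_gamma q chi Lchibar hchi hnonprinc heven hprim hLbar (nu + 1)
                    ltac:(change (-1 < Re nu + 1); lra)).
    set (M0 := mellin q chi nu) in *. set (M1 := mellin q chi (nu + 1)) in *.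
    set (P := IR (planck_integrand q chi nu x)) in *.
    (* The identity is solved for the Bessel integral; here the sine is divided out. *)
    assert (hP : P = (tau / (2 * RtoC PI * RtoC (INR q)) * cpow (INR q) (1 - nu) * Br / sn
                      - / 2 * M0 + RtoC (/ (2 * PI * x)) * M1)%C).
    { rewrite <- key. field. exact hsn. }
    assert (hM0 : M0 = (Gam (nu + 1) * cpow (2 * PI) (- nu) * Lchibar nu / nu)%C)
      by (rewrite <- m0; field; exact hnu0).
    assert (hM1 : M1 = (Gam (nu + 1 + 1) * cpow (2 * PI) (- (nu + 1)) * Lchibar (nu + 1) / (nu + 1))%C)
      by (rewrite <- m1; field; exact hnu1).
    (* tau(chi) tau(conj chi) = q moves the Gauss sum of chi into the denominator and cancels the
       1/q. *)
    assert (htau' : tau = (RtoC (INR q) / g)%C) by (rewrite <- htau; field; exact hg).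
    rewrite hP, hM0, hM1, htau'.
    (* [CGamma] at nu and nu + 1 unfolds to Gamma integrals at nu + 1 and nu + 2 over nu and nu + 1,
       the same quotients that [mellin_gamma] produced. *)
    unfold CGamma. rewrite (Cplus_comm 1 nu).
    rewrite !GammaInt_Gam by
      (first [change (0 < Re nu + 1 + 1) | change (0 < Re nu + 1)]; lra).
    assert (h2p : 0 < 2 * PI) by lra.
    rewrite !cpow_opp, (cpow_minus (2 * PI)), (cpow_plus (2 * PI)), (cpow_1 (2 * PI)) by exact h2p.
    assert (hcp : cpow (2 * PI) nu <> RtoC 0) by apply cpow_neq_0.
    replace (RtoC (/ (2 * PI * x))) with (/ (2 * RtoC PI * RtoC x))%C.
    2:{ rewrite <- !RtoC_mult, <- RtoC_inv; [reflexivity |]. apply Rgt_not_eq. nra. }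
    rewrite (RtoC_inv x), (RtoC_mult 4), (RtoC_mult 2 PI) by lra.
    replace (RtoC 4) with (2 * 2)%C by (rewrite <- RtoC_mult; f_equal; ring).
    field. repeat split; auto.
Qed.
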